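(* Let $S=\{(\mathbf{a},\mathbf{b})\in\mathbb{R}^{p+q}:\mathbf{a}\ge0,\ \mu>0\}$, where $\mu=\mu(\mathbf{a},\mathbf{b})=\sum_{j=1}^qb_j-\sum_{k=1}^pa_k+\frac{p-q}{2}$. Suppose $\sum_{j=1}^qB_j-\sum_{k=1}^pA_k=0$ and let $(\mathbf{a}^*,\mathbf{b}^* )=(a_1^*,\dots,a_p^*,b_1^*,\dots,b_q^* )$ be a limit point of $S$ with $\mu^*=\sum_{j=1}^qb_j^*-\sum_{k=1}^pa_k^*+\frac{p-q}{2}=0$. Then the signed measures $$dv_{(\mathbf{a},\mathbf{b})}(x)=H_{q,p}^{p,0}\left(x \,\middle|\, \begin{array}{c}(\mathbf{B},\mathbf{b})\\(\mathbf{A},\mathbf{a})\end{array}\right)dx$$ converge weakly on every interval $[\eta,\rho]$, $0\le\eta<\rho$, to the signed measure $$dv_*(x)=\nu^*\rho\,\delta_\rho(x)+H_{q,p}^{p,0}\left(x \,\middle|\, \begin{array}{c}(\mathbf{B},\mathbf{b}^* )\\(\mathbf{A},\mathbf{a}^* )\end{array}\right)dx$$ as $S\ni(\mathbf{a},\mathbf{b})\to(\mathbf{a}^*,\mathbf{b}^* )$, where $\nu^*=(2\pi)^{(p-q)/2}\prod_{k=1}^pA_k^{a_k^*-1/2}\prod_{j=1}^qB_j^{1/2-b_j^*}$ and $\delta_\rho$ is the unit point mass at $\rho$.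
   Context: Let $p,q\in\mathbb{N}$ and fix $\mathbf{A}=(A_1,\dots,A_p)$, $\mathbf{B}=(B_1,\dots,B_q)$ with positive entries; $\mathbf{a}\ge0$ means all $a_k\ge0$. Let $\rho=\prod_{k=1}^pA_k^{A_k}\prod_{j=1}^qB_j^{-B_j}$. For real vectors $\mathbf{a}\in\mathbb{R}^p$, $\mathbf{b}\in\mathbb{R}^q$ and $0<x<\rho$, Fox's H function is $$H_{q,p}^{p,0}\left(x \,\middle|\, \begin{array}{c}(\mathbf{B},\mathbf{b})\\(\mathbf{A},\mathbf{a})\end{array}\right)=\frac{1}{2\pi i}\int_{\mathcal{L}_{-\infty}}\frac{\prod_{k=1}^p\Gamma(A_ks+a_k)}{\prod_{j=1}^q\Gamma(B_js+b_j)}x^{-s}\,ds,$$ where $\mathcal{L}_{-\infty}$ is a loop lying in a horizontal strip, starting at $-\infty+i\varphi_1$ and ending at $-\infty+i\varphi_2$ ($\varphi_1<\varphi_2$), leaving all poles of the integrand on its left. Weak convergence: signed measures $dv_{\mathbf{c}}$ on $[\alpha,\beta]$, indexed by $\mathbf{c}\in S$, converge weakly to $dv_0$ as $S\ni\mathbf{c}\to\mathbf{c}_0$ ($\mathbf{c}_0$ a limit point of $S$) if for every continuous $f$ on $[\alpha,\beta]$, $\lim_{S\ni\mathbf{c}\to\mathbf{c}_0}\int_\alpha^\beta f\,dv_{\mathbf{c}}=\int_\alpha^\beta f\,dv_0$, the limit being independent of the path. On $[\eta,\rho]$ the measures are restricted to that interval. *)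

(* Defs.v *)
From Stdlib Require Import Reals Factorial.
From Coquelicot Require Import Coquelicot.
Open Scope R_scope.

Fixpoint sumR (n : nat) (f : nat -> R) : R :=
  match n with O => 0 | S m => sumR m f + f m end.
Fixpoint prodR (n : nat) (f : nat -> R) : R :=
  match n with O => 1 | S m => prodR m f * f m end.
Fixpoint prodC (n : nat) (f : nat -> C) : C :=
  match n with O => RtoC 1 | S m => Cmult (prodC m f) (f m) end.
Fixpoint maxR (n : nat) (f : nat -> R) : R :=
  match n with O => 0 | S m => Rmax (maxR m f) (f m) end.

Definition cpowR (x : R) (s : C) : C :=
  (exp (Re s * ln x) * cos (Im s * ln x), exp (Re s * ln x) * sin (Im s * ln x)).

Fixpoint poch (s : C) (n : nat) : C :=
  match n with
  | O => s
  | S m => Cmult (poch s m) (Cplus s (RtoC (INR (S m))))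
  end.

(* Reciprocal Gamma function via Gauss' limit formula
   1/Gamma(s) = lim_n s(s+1)...(s+n) / (n! n^s)   (entire). *)
Definition rgamma (s : C) : C :=
  @lim C_CompleteNormedModule (filtermap (fun n : nat => Cdiv (poch s n) (Cmult (RtoC (INR (fact n))) (cpowR (INR n) s)))
                 eventually).

Definition Cgamma (s : C) : C := Cinv (rgamma s).

Definition hintegrand (p q : nat) (A a B b : nat -> R) (x : R) (s : C) : C :=
  Cmult (Cmult (prodC p (fun k => Cgamma (Cplus (Cmult (RtoC (A k)) s) (RtoC (a k)))))
               (prodC q (fun j => rgamma (Cplus (Cmult (RtoC (B j)) s) (RtoC (b j))))))
        (cpowR x (Copp s)).

(* Abscissa of the vertical part of the loop: strictly to the right of all
   poles -(a_k+n)/A_k of the integrand. *)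
Definition loop_c (p : nat) (A a : nat -> R) : R :=
  1 + maxR p (fun k => - a k / A k).

(* Fox's H function H^{p,0}_{q,p}(x | (B,b); (A,a)), defined by the loop integral over
   the specific loop L_{-oo}: from -oo - i along Im s = -1 to c - i, up to c + i,
   then along Im s = 1 back to -oo + i (phi1 = -1 < phi2 = 1). *)
Definition foxH (p q : nat) (A a B b : nat -> R) (x : R) : C :=
  let F := hintegrand p q A a B b x in
  let c := loop_c p A a in
  Cmult (Cinv (Cmult (RtoC (2 * PI)) Ci))
    (Cplus
      (Cminus
        (@RInt_gen C_R_CompleteNormedModule (fun t => F (t, -1)) (Rbar_locally m_infty) (at_point c))
        (@RInt_gen C_R_CompleteNormedModule (fun t => F (t, 1)) (Rbar_locally m_infty) (at_point c)))
      (Cmult Ci (@RInt C_R_CompleteNormedModule (fun y => F (c, y)) (-1) 1))).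

Definition rho (p q : nat) (A B : nat -> R) : R :=
  prodR p (fun k => Rpower (A k) (A k)) * prodR q (fun j => Rpower (B j) (- B j)).

Definition mu (p q : nat) (a b : nat -> R) : R :=
  sumR q b - sumR p a + (INR p - INR q) / 2.

Definition inS (p q : nat) (a b : nat -> R) : Prop :=
  (forall k, (k < p)%nat -> 0 <= a k) /\ 0 < mu p q a b.

Definition distpq (p q : nat) (a b a' b' : nat -> R) : R :=
  Rmax (maxR p (fun k => Rabs (a k - a' k))) (maxR q (fun j => Rabs (b j - b' j))).

Definition nu_star (p q : nat) (A B a b : nat -> R) : R :=
  Rpower (2 * PI) ((INR p - INR q) / 2)
  * prodR p (fun k => Rpower (A k) (a k - 1/2))
  * prodR q (fun j => Rpower (B j) (1/2 - b j)).

Definition int_fH (p q : nat) (A a B b : nat -> R) (eta : R) (f : R -> R) : C :=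
  @RInt_gen C_R_CompleteNormedModule
    (fun x => scal (f x) (foxH p q A a B b x))
    (at_right eta) (at_left (rho p q A B)).

(* Main.v *)
(** On the plane slit along the negative axis, Gauss' product together with
    Gudermann's series gives Stirling's formula
    [Gamma(z) = sqrt(2 pi) z^(z-1/2) e^(-z) e^(O(1/dist))], with an error that is also
    Lipschitz under real shifts of [z].  Since [sum A = sum B], the integrand of
    Fox's function becomes [e^(us) nu s^(-mu) e^theta(s)], [u = ln(rho/x)], where
    [theta(s) = O(1/dist)], [dist] being the distance to the negative axis.

    By Cauchy's theorem the loop may be replaced by the one of corner [(1 + i)/u].
    Rescaling by [u] the leading term yields [nu K(mu) u^(mu-1)] with
    [K(mu)] Hankel's integral for [1/Gamma(mu)], so [K(mu) ~ mu]; the remainder is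
    integrable near [rho], Lipschitz in the parameters, and away from [rho] the
    loop of corner [1/2 + i] gives a bound [O(x^(-1/2))].  Hence, with [v = 1 - x/rho],
    [H = H* + nu K(mu) v^(mu-1) + O(d (x^(-1/2) + (rho-x)^(-1/2)))] where [d] is the
    distance of the parameters, and [mu v^(mu-1) dx] tends to [rho] times the unit
    mass at [rho]. *)

Require Import Defs.
From Stdlib Require Import Reals Lra Lia Factorial.
From Coquelicot Require Import Coquelicot.
Open Scope R_scope.

(** * Complex exponential and increments of complex-valued functions *)

(** The obstacle is that mass escapes to [rho]: as [mu] tends to 0 the densities behave like
    [mu v^(mu-1)], and no single integrable function dominates them all. The integrals being
    improper Riemann integrals, the limit is reached quantitatively: the singular term is split off
    exactly, and the rest is bounded by [d] times one fixed integrable weight.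

    The split is exact by scaling: on the slit plane [log(Yz) = ln Y + log z], so on the loop
    enlarged by [Y = 1/u] the leading part of the integrand is a power of [Y] times [e^z z^(-mu)].
    The factor [mu] in Hankel's integral comes from an integration by parts, its normalization from
    the integral of [e^z / z].

    [1/Gamma] is given as a limit of Gauss' products. Cauchy's theorem is proved for these
    elementary products and carried to the limit by uniform convergence on rectangles. All data
    being real, the loop is symmetric under conjugation; each loop integral is therefore followed
    through one real number, the imaginary part of the integral over the upper half. *)

Definition Cexp (w : C) : C := (exp (Re w) * cos (Im w), exp (Re w) * sin (Im w)).

Lemma Cexp_plus (z w : C) : Cexp (z + w)%C = (Cexp z * Cexp w)%C.
Proof.
unfold Cexp, Cmult, Re, Im; simpl; rewrite exp_plus, cos_plus, sin_plus.
apply injective_projections; simpl; ring.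
Qed.

Lemma Cexp_0 : Cexp 0 = 1%C.
Proof.
unfold Cexp; simpl; rewrite exp_0, cos_0, sin_0.
apply injective_projections; simpl; ring.
Qed.

Lemma Cexp_RtoC (x : R) : Cexp (RtoC x) = RtoC (exp x).
Proof.
unfold Cexp; simpl; rewrite cos_0, sin_0.
apply injective_projections; simpl; ring.
Qed.

Lemma Cmod_sqr (z : C) : Cmod z * Cmod z = Re z * Re z + Im z * Im z.
Proof.
unfold Cmod; rewrite sqrt_sqrt; [unfold Re, Im; ring |].
nra.
Qed.

Lemma Cmod_Cexp (w : C) : Cmod (Cexp w) = exp (Re w).
Proof.
assert (H := sin2_cos2 (Im w)); unfold Rsqr in H.
assert (H0 := exp_pos (Re w)).
apply Rsqr_inj; [apply Cmod_ge_0 | lra |].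
unfold Rsqr; rewrite Cmod_sqr; unfold Cexp; simpl.
nra.
Qed.

Lemma Cexp_neq_0 (w : C) : Cexp w <> 0%C.
Proof.
apply Cmod_gt_0; rewrite Cmod_Cexp; apply exp_pos.
Qed.

Lemma Cexp_opp (w : C) : Cexp (- w)%C = (/ Cexp w)%C.
Proof.
assert (H : (Cexp (- w) * Cexp w = 1)%C).
{ rewrite <- Cexp_plus, <- Cexp_0; f_equal; ring. }
assert (H0 := Cexp_neq_0 w).
replace (Cexp (- w))%C with (Cexp (-w) * Cexp w * / Cexp w)%C by (field; assumption).
rewrite H; ring.
Qed.

Lemma Cexp_minus (z w : C) : Cexp (z - w)%C = (Cexp z / Cexp w)%C.
Proof.
unfold Cminus, Cdiv; rewrite Cexp_plus, Cexp_opp; reflexivity.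
Qed.

Lemma Cexp_conj (w : C) : Cexp (Cconj w) = Cconj (Cexp w).
Proof.
unfold Cexp, Cconj, Re, Im; simpl; rewrite cos_neg, sin_neg.
apply injective_projections; simpl; ring.
Qed.

Lemma cpowR_Cexp (x : R) (s : C) : cpowR x s = Cexp (RtoC (ln x) * s)%C.
Proof.
unfold cpowR, Cexp, Cmult; simpl.
replace (ln x * fst s - 0 * snd s) with (Re s * ln x) by (unfold Re; ring).
replace (ln x * snd s + 0 * fst s) with (Im s * ln x) by (unfold Im; ring).
reflexivity.
Qed.

Lemma Re_le_Cmod (z : C) : Re z <= Cmod z.
Proof. assert (H := re_le_Cmod z); apply Rabs_le_between in H; lra. Qed.

Lemma Rabs_Im_le_Cmod (z : C) : Rabs (Im z) <= Cmod z.
Proof.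
apply Rle_trans with (2 := Rmax_Cmod z); apply Rmax_r.
Qed.

Lemma Cmod_le_abs (z : C) : Cmod z <= Rabs (Re z) + Rabs (Im z).
Proof.
assert (H1 := Rabs_pos (Re z)); assert (H2 := Rabs_pos (Im z)).
apply Rsqr_incr_0; [| apply Cmod_ge_0 | lra].
unfold Rsqr; rewrite Cmod_sqr.
assert (H3 : Rabs (Re z) * Rabs (Re z) = Re z * Re z) by (symmetry; apply (Rsqr_abs (Re z))).
assert (H4 : Rabs (Im z) * Rabs (Im z) = Im z * Im z) by (symmetry; apply (Rsqr_abs (Im z))).
nra.
Qed.

Lemma Cmod_minus_le (z w : C) : Cmod (z - w)%C <= Cmod z + Cmod w.
Proof.
unfold Cminus; rewrite <- (Cmod_opp w); apply Cmod_triangle.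
Qed.

Lemma Cmod_minus_ge (z w : C) : Cmod z - Cmod w <= Cmod (z - w)%C.
Proof.
assert (H := Cmod_triangle (z - w) w).
replace (z - w + w)%C with z in H by ring; lra.
Qed.

Lemma Cmod_minus_sym (z w : C) : Cmod (z - w)%C = Cmod (w - z)%C.
Proof. rewrite <- Cmod_opp; f_equal; ring. Qed.

(** Curves in the plane are differentiated componentwise; holomorphy will be phrased through
    restrictions to horizontal and vertical lines. *)
Definition Cderiv (f : R -> C) (t : R) (l : C) : Prop :=
  is_derive (fun t => Re (f t)) t (Re l) /\ is_derive (fun t => Im (f t)) t (Im l).

Lemma Cderiv_ext (f g : R -> C) t l : (forall t, f t = g t) -> Cderiv f t l -> Cderiv g t l.
Proof.
intros H [H1 H2]; split.
- apply is_derive_ext with (2 := H1); intros; rewrite H; reflexivity.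
- apply is_derive_ext with (2 := H2); intros; rewrite H; reflexivity.
Qed.

Lemma Cderiv_eq f t l m : Cderiv f t l -> l = m -> Cderiv f t m.
Proof. intros H <-; exact H. Qed.

Lemma Cderiv_const (c : C) t : Cderiv (fun _ => c) t 0%C.
Proof. split; apply (is_derive_const (V := R_NormedModule)). Qed.

Lemma Cderiv_plus f g t l m : Cderiv f t l -> Cderiv g t m -> Cderiv (fun t => f t + g t)%C t (l + m)%C.
Proof.
intros [F1 F2] [G1 G2]; split.
- apply (is_derive_plus (fun t => Re (f t)) (fun t => Re (g t))); assumption.
- apply (is_derive_plus (fun t => Im (f t)) (fun t => Im (g t))); assumption.
Qed.

Lemma Cderiv_mult f g t l m : Cderiv f t l -> Cderiv g t m ->
  Cderiv (fun t => f t * g t)%C t (l * g t + f t * m)%C.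
Proof.
intros [F1 F2] [G1 G2].
assert (comm : forall n m : R_AbsRing, mult n m = mult m n) by (intros; apply Rmult_comm).
split; simpl.
- eapply is_derive_ext; [intros; reflexivity |].
  evar_last.
  apply (is_derive_minus (fun t => Re (f t) * Re (g t)) (fun t => Im (f t) * Im (g t))).
  + apply (is_derive_mult (fun t => Re (f t)) (fun t => Re (g t))); eassumption.
  + apply (is_derive_mult (fun t => Im (f t)) (fun t => Im (g t))); eassumption.
  + unfold minus, plus, opp, mult; simpl; unfold mult; simpl; unfold Re, Im; ring.
- evar_last.
  apply (is_derive_plus (fun t => Re (f t) * Im (g t)) (fun t => Im (f t) * Re (g t))).
  + apply (is_derive_mult (fun t => Re (f t)) (fun t => Im (g t))); eassumption.
  + apply (is_derive_mult (fun t => Im (f t)) (fun t => Re (g t))); eassumption.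
  + unfold minus, plus, opp, mult; simpl; unfold mult; simpl; unfold Re, Im; ring.
Qed.

Lemma Cderiv_scal c f t l : Cderiv f t l -> Cderiv (fun t => c * f t)%C t (c * l)%C.
Proof.
intros H; replace (c * l)%C with (0 * f t + c * l)%C by ring.
apply Cderiv_mult; [apply Cderiv_const | assumption].
Qed.

Lemma Cderiv_minus f g t l m : Cderiv f t l -> Cderiv g t m -> Cderiv (fun t => f t - g t)%C t (l - m)%C.
Proof.
intros [F1 F2] [G1 G2]; split.
- apply (is_derive_minus (fun t => Re (f t)) (fun t => Re (g t))); assumption.
- apply (is_derive_minus (fun t => Im (f t)) (fun t => Im (g t))); assumption.
Qed.

Lemma Cderiv_RtoC (f : R -> R) t l : is_derive f t l -> Cderiv (fun t => RtoC (f t)) t (RtoC l).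
Proof. intros H; split; simpl; [exact H | apply (is_derive_const (V := R_NormedModule))]. Qed.

Lemma Cderiv_id t : Cderiv RtoC t 1%C.
Proof. apply (Cderiv_RtoC (fun t => t)), (is_derive_id (K := R_AbsRing)). Qed.

Lemma Cderiv_pair (P Q : R -> R) t l : is_derive P t (Re l) -> is_derive Q t (Im l) ->
  Cderiv (fun t => (P t, Q t)) t l.
Proof. intros H1 H2; split; assumption. Qed.

Lemma Cderiv_Cexp f t l : Cderiv f t l -> Cderiv (fun t => Cexp (f t)) t (l * Cexp (f t))%C.
Proof.
intros [F1 F2]; unfold Cexp; simpl.
set (P := fun t => Re (f t)) in *; set (Q := fun t => Im (f t)) in *.
change (Cderiv (fun t => (exp (P t) * cos (Q t), exp (P t) * sin (Q t))) t
  (Cmult l (exp (P t) * cos (Q t), exp (P t) * sin (Q t)))).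
change (is_derive P t (Re l)) in F1; change (is_derive Q t (Im l)) in F2.
clearbody P Q.
assert (E1 := is_derive_unique _ _ _ F1 : Derive (fun x : R => P x) t = _).
assert (E2 := is_derive_unique _ _ _ F2 : Derive (fun x : R => Q x) t = _).
apply Cderiv_pair; (auto_derive; [repeat split; eexists; eassumption |]);
  rewrite E1, E2;
  unfold Re, Im; simpl; ring.
Qed.

Lemma Cnorm2_pos (z : C) : z <> 0%C -> 0 < Re z ^ 2 + Im z ^ 2.
Proof.
intros H; rewrite <- Cmod2_alt; apply pow_lt, Cmod_gt_0, H.
Qed.

Lemma Cderiv_inv (f : R -> C) t l : f t <> 0%C -> Cderiv f t l ->
  Cderiv (fun t => / f t)%C t (- (l / (f t * f t)))%C.
Proof.
intros Hf [F1 F2].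
assert (Hn := Cnorm2_pos _ Hf).
apply Cderiv_ext with (fun t => (Re (f t) / (Re (f t) ^ 2 + Im (f t) ^ 2), - Im (f t) / (Re (f t) ^ 2 + Im (f t) ^ 2))); [reflexivity |].
destruct l as [l1 l2].
replace (- ((l1, l2) / (f t * f t)))%C with
  (- ((l1, l2) / ((Re (f t), Im (f t)) * (Re (f t), Im (f t)))))%C by (unfold Re, Im; rewrite <- (surjective_pairing (f t)); reflexivity).
set (P := fun t => Re (f t)) in *; set (Q := fun t => Im (f t)) in *.
change (Re (f t)) with (P t) in *; change (Im (f t)) with (Q t) in *; 
change (is_derive P t l1) in F1; change (is_derive Q t l2) in F2.
change (Cderiv (fun t => (P t / (P t ^ 2 + Q t ^ 2), - Q t / (P t ^ 2 + Q t ^ 2))) t (- ((l1, l2) / ((P t, Q t) * (P t, Q t))))%C).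
clearbody P Q.
assert (E1 := is_derive_unique _ _ _ F1 : Derive (fun x : R => P x) t = _).
assert (E2 := is_derive_unique _ _ _ F2 : Derive (fun x : R => Q x) t = _).
assert (Hm : (P t * P t - Q t * Q t) * (P t * P t - Q t * Q t) +
   (P t * Q t + Q t * P t) * (P t * Q t + Q t * P t) = (P t ^ 2 + Q t ^ 2)^2) by ring.
apply Cderiv_pair; (auto_derive; [repeat split; try (eexists; eassumption); nra |]);
  rewrite E1, E2;
  unfold Re, Im; simpl;
  field; repeat split; nra.
Qed.

(** The mean value theorem holds for real functions only. It is applied to the component of [f] in
    the direction of the increment [D], and Cauchy-Schwarz brings back the modulus of the
    derivative. *)
Lemma Cmod_increment_le (f f' : R -> C) (a b M : R) : a <= b ->
  (forall t, a <= t <= b -> Cderiv f t (f' t)) ->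
  (forall t, a <= t <= b -> Cmod (f' t) <= M) ->
  Cmod (f b - f a)%C <= M * (b - a).
Proof.
intros Hab Hd HM.
set (D := (f b - f a)%C).
pose (phi := fun t => Re D * Re (f t) + Im D * Im (f t)).
destruct (MVT_gen phi a b (fun t => Re D * Re (f' t) + Im D * Im (f' t))) as [c [Hc Heq]].
- intros x; rewrite Rmin_left, Rmax_right by lra; intros Hx.
  destruct (Hd x) as [H1 H2]; [lra |].
  apply (is_derive_plus (fun t => Re D * Re (f t)) (fun t => Im D * Im (f t))).
  + apply (is_derive_scal (fun t => Re (f t))); assumption.
  + apply (is_derive_scal (fun t => Im (f t))); assumption.
- intros x; rewrite Rmin_left, Rmax_right by lra; intros Hx.
  destruct (Hd x) as [H1 H2]; [lra |].
  apply continuity_pt_filterlim, (ex_derive_continuous (K := R_AbsRing) (V := R_NormedModule)).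
  eexists; apply (is_derive_plus (fun t => Re D * Re (f t)) (fun t => Im D * Im (f t))).
  + apply (is_derive_scal (fun t => Re (f t))); eassumption.
  + apply (is_derive_scal (fun t => Im (f t))); eassumption.
- rewrite Rmin_left, Rmax_right in Hc by lra.
  assert (H1 : phi b - phi a = Cmod D * Cmod D).
  { rewrite Cmod_sqr; unfold phi, D; simpl; unfold Re, Im; ring. }
  assert (H2 : Re D * Re (f' c) + Im D * Im (f' c) <= Cmod D * Cmod (f' c)).
  { rewrite <- (Cmod_conj D), <- Cmod_mult.
    apply Rle_trans with (2 := Re_le_Cmod _).
    simpl; unfold Re, Im; lra. }
  assert (HMc := HM c Hc).
  assert (HD := Cmod_ge_0 D).
  assert (Hf' := Cmod_ge_0 (f' c)).
  rewrite H1 in Heq.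
  destruct (Req_dec (Cmod D) 0) as [H0|H0].
  + rewrite H0; apply Rmult_le_pos; lra.
  + apply Rmult_le_reg_l with (Cmod D); [lra |].
    rewrite Heq.
    apply Rle_trans with (Cmod D * Cmod (f' c) * (b - a)).
    * apply Rmult_le_compat_r; lra.
    * rewrite <- Rmult_assoc. apply Rmult_le_compat_r; [lra |].
      apply Rmult_le_compat_l; lra.
Qed.

Lemma exp_le (x y : R) : x <= y -> exp x <= exp y.
Proof.
intros [H | ->]; [left; apply exp_increasing, H | lra].
Qed.

(** The segment from [w'] to [w] stays in the half-plane where the real part is at most [M], and
    there the derivative of the exponential is at most [exp M] in modulus. *)
Lemma Cexp_minus_le (w w' : C) (M : R) : Re w <= M -> Re w' <= M ->
  Cmod (Cexp w - Cexp w')%C <= Cmod (w - w')%C * exp M.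
Proof.
intros H1 H2.
pose (g := fun t : R => (w' + RtoC t * (w - w'))%C).
assert (Hg : forall t, Cderiv g t (w - w')%C).
{ intros t; unfold g.
  apply Cderiv_eq with (0 + (1 * (w - w') + RtoC t * 0))%C; [| ring].
  apply Cderiv_plus; [apply Cderiv_const |].
  apply Cderiv_mult; [apply Cderiv_id | apply Cderiv_const]. }
assert (H := Cmod_increment_le (fun t => Cexp (g t)) (fun t => (w - w') * Cexp (g t))%C 0 1
  (Cmod (w - w') * exp M)).
unfold g in H.
replace (w' + RtoC 1 * (w - w'))%C with w in H by ring.
replace (w' + RtoC 0 * (w - w'))%C with w' in H by ring.
replace (Cmod (w - w') * exp M) with (Cmod (w - w') * exp M * (1 - 0)) by ring.
apply H; [lra | |].
- intros t _; apply (Cderiv_Cexp g), Hg.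
- intros t Ht; rewrite Cmod_mult, Cmod_Cexp.
  apply Rmult_le_compat_l; [apply Cmod_ge_0 |].
  assert (E : Re (w' + t * (w - w')) = (1 - t) * Re w' + t * Re w) by (simpl; unfold Re; ring).
  rewrite E. 
  apply exp_le; nra.
Qed.

(** * Gauss' product for the reciprocal Gamma function *)

Definition gauss (n : nat) (z : C) : C :=
  (poch z n / (RtoC (INR (fact n)) * cpowR (INR n) z))%C.

(** The quotient of consecutive Gauss products, [(1 + z/(n+1)) (1 + 1/n)^(-z)], which is
    [1 + O(1/n^2)]. *)
Definition gauss_ratio (n : nat) (z : C) : C :=
  ((1 + RtoC (/ (INR n + 1)) * z) * Cexp (RtoC (- ln (1 + / INR n)) * z))%C.

Lemma RtoC_neq_0 (x : R) : x <> 0 -> RtoC x <> 0%C.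
Proof. intros H E; apply H; injection E; auto. Qed.

Lemma INR_ge_1 (n : nat) : (1 <= n)%nat -> 1 <= INR n.
Proof. intros H; apply (le_INR 1); assumption. Qed.

Lemma gauss_S (n : nat) (z : C) : (1 <= n)%nat ->
  gauss (S n) z = (gauss n z * gauss_ratio n z)%C.
Proof.
intros Hn; assert (Hn' := INR_ge_1 n Hn).
unfold gauss, gauss_ratio.
change (poch z (S n)) with (poch z n * (z + RtoC (INR (S n))))%C.
change (fact (S n)) with ((S n) * fact n)%nat.
rewrite mult_INR, S_INR, !cpowR_Cexp.
replace (RtoC (ln (INR n + 1)) * z)%C
  with (RtoC (ln (INR n)) * z - RtoC (- ln (1 + / INR n)) * z)%C.
- rewrite Cexp_minus, RtoC_mult, RtoC_plus, (RtoC_inv (INR n + 1)) by lra.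
  rewrite RtoC_plus.
  assert (F := INR_fact_neq_0 n); apply RtoC_neq_0 in F.
  assert (E1 := Cexp_neq_0 (RtoC (ln (INR n)) * z)).
  assert (E2 := Cexp_neq_0 (RtoC (- ln (1 + / INR n)) * z)).
  assert (N : (RtoC (INR n) + 1)%C <> 0%C) by (rewrite <- RtoC_plus; apply RtoC_neq_0; lra).
  field; auto.
- replace (INR n + 1) with (INR n * (1 + / INR n)) by (field; lra).
  rewrite ln_mult by (assert (0 < / INR n) by (apply Rinv_0_lt_compat; lra); lra).
  rewrite RtoC_plus, RtoC_opp; ring.
Qed.

Lemma ln_1_plus_inv_bounds (x : R) : 1 <= x -> / (x + 1) <= ln (1 + / x) <= / x.
Proof.
intros Hx; assert (0 < / x) by (apply Rinv_0_lt_compat; lra).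
assert (0 < / (x + 1)) by (apply Rinv_0_lt_compat; lra).
split.
- assert (H1 : 1 + - / (x + 1) <= exp (- / (x + 1))) by apply exp_ineq1_le.
  replace (1 + / x) with (/ (1 + - / (x + 1))) by (field; lra).
  assert (0 < 1 + - / (x + 1)).
  { replace (1 + - / (x + 1)) with (x * / (x + 1)) by (field; lra); nra. }
  rewrite ln_Rinv by assumption.
  apply ln_le in H1; [| assumption]; rewrite ln_exp in H1; lra.
- assert (H1 := exp_ineq1_le (/ x)).
  apply ln_le in H1; [rewrite ln_exp in H1; lra | lra].
Qed.

(** With [l = ln (1 + 1/n)], the derivative in [z] is [e^(-lz) (1/(n+1) - l (1 + z/(n+1)))]. Since
    [l] lies between [1/(n+1)] and [1/n], this is a multiple of [1/n - 1/(n+1)], a bound that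
    telescopes in [n]. *)
Lemma gauss_ratio_lipschitz (n : nat) (M : R) (z z' : C) : (1 <= n)%nat ->
  Cmod z <= M -> Cmod z' <= M ->
  Cmod (gauss_ratio n z - gauss_ratio n z')%C <=
    (1 + M) * exp M * (/ INR n - / (INR n + 1)) * Cmod (z - z')%C.
Proof.
intros Hn Hz Hz'; assert (Hn' := INR_ge_1 n Hn).
assert (HM : 0 <= M) by (apply Rle_trans with (1 := Cmod_ge_0 z), Hz).
destruct (ln_1_plus_inv_bounds _ Hn') as [L1 L2].
set (l := ln (1 + / INR n)) in *.
set (x := INR n) in *.
assert (I1 : 0 < / (x + 1)) by (apply Rinv_0_lt_compat; lra).
assert (I2 : / x <= 1) by (rewrite <- Rinv_1; apply Rinv_le_contravar; lra).
assert (I3 : / x - / (x + 1) = / x * / (x + 1)) by (field; lra).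
pose (g := fun t : R => (z' + RtoC t * (z - z'))%C).
assert (Hg : forall t, Cderiv g t (z - z')%C).
{ intros t; unfold g.
  apply Cderiv_eq with (0 + (1 * (z - z') + RtoC t * 0))%C; [| ring].
  apply Cderiv_plus; [apply Cderiv_const |].
  apply Cderiv_mult; [apply Cderiv_id | apply Cderiv_const]. }
assert (Hgm : forall t, 0 <= t <= 1 -> Cmod (g t) <= M).
{ intros t Ht.
  replace (g t) with (RtoC (1 - t) * z' + RtoC t * z)%C by (unfold g; rewrite RtoC_minus; ring).
  apply Rle_trans with (1 := Cmod_triangle _ _).
  rewrite !Cmod_mult, !Cmod_R, !Rabs_pos_eq by lra; nra. }
assert (H := Cmod_increment_le
  (fun t => (1 + RtoC (/ (x + 1)) * g t) * Cexp (RtoC (- l) * g t))%C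
  (fun t => (z - z') * (Cexp (RtoC (- l) * g t) * (RtoC (/ (x + 1)) - RtoC l * (1 + RtoC (/ (x + 1)) * g t))))%C
  0 1 ((1 + M) * exp M * (/ x - / (x + 1)) * Cmod (z - z'))).
cbv beta in H; replace (g 1) with z in H by (unfold g; ring).
replace (g 0) with z' in H by (unfold g; ring).
rewrite Rminus_0_r, Rmult_1_r in H.
unfold gauss_ratio; fold x; fold l; apply H; clear H; [lra | |].
- intros t _.
  eapply Cderiv_eq.
  + apply Cderiv_mult.
    * apply Cderiv_plus; [apply Cderiv_const | apply Cderiv_scal, Hg].
    * apply Cderiv_Cexp, Cderiv_scal, Hg.
  + rewrite RtoC_opp; ring.
- intros t Ht; specialize (Hgm t Ht).
  rewrite !Cmod_mult, Cmod_Cexp.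
  rewrite (Rmult_comm _ (Cmod (z - z'))).
  apply Rmult_le_compat_l; [apply Cmod_ge_0 |].
  replace ((1 + M) * exp M * (/ x - / (x + 1))) with (exp M * ((1 + M) * (/ x - / (x + 1)))) by ring.
  apply Rmult_le_compat; [left; apply exp_pos | apply Cmod_ge_0 | |].
  + apply exp_le.
    apply Rle_trans with (1 := Re_le_Cmod _).
    rewrite Cmod_mult, Cmod_R, Rabs_Ropp, Rabs_pos_eq by lra.
    assert (0 <= Cmod (g t)) by apply Cmod_ge_0.
    nra.
  + replace (RtoC (/ (x + 1)) - RtoC l * (1 + RtoC (/ (x + 1)) * g t))%C
      with (RtoC (/ (x + 1) - l) - RtoC (l * / (x + 1)) * g t)%C
      by (rewrite RtoC_minus, RtoC_mult; ring).
    apply Rle_trans with (1 := Cmod_minus_le _ _).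
    rewrite Cmod_mult, !Cmod_R.
    rewrite Rabs_left1 by lra.
    rewrite (Rabs_pos_eq (l * _)) by nra.
    assert (0 <= Cmod (g t)) by apply Cmod_ge_0.
    assert (l * / (x + 1) * Cmod (g t) <= (/ x * / (x + 1)) * M).
    { apply Rmult_le_compat; [nra | assumption | nra | assumption]. }
    rewrite <- I3 in H0; lra.
Qed.

Lemma gauss_1 (z : C) : gauss 1 z = (z * (z + 1))%C.
Proof.
unfold gauss; rewrite cpowR_Cexp; simpl.
rewrite ln_1.
replace (RtoC 0 * z)%C with (RtoC 0) by ring; rewrite Cexp_0.
field.
Qed.

(** All three bounds accumulate the ratio estimate by induction on [n]. The sum of [1/k - 1/(k+1)]
    from 1 to [n - 1] is [1 - 1/n], which explains the exponents below. *)
Lemma gauss_bounds (M : R) : 0 <= M -> exists K, 0 < K /\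
  forall z, Cmod z <= M ->
  (forall n, (1 <= n)%nat -> Cmod (gauss n z) <= K) /\
  (forall n m, (1 <= n)%nat -> Cmod (gauss (n + m) z - gauss n z)%C <= K * / INR n) /\
  (forall z', Cmod z' <= M -> forall n, (1 <= n)%nat -> Cmod (gauss n z - gauss n z')%C <= K * Cmod (z - z')%C).
Proof.
intros HM.
set (D := (1 + M) * exp M).
assert (HD : 0 < D) by (unfold D; assert (H := exp_pos M); nra).
(* [M (M + 1)] bounds the first product [z (z + 1)], and [exp (D M)] the product of all later
   ratios. *)
set (B := M * (M + 1) * exp (D * M)).
assert (HB : 0 <= B) by (unfold B; assert (H := exp_pos (D * M)); nra).
set (L := (2 * M + 1 + B * D) * exp (D * M)).
(* The ratio equals 1 at [z = 0], so the Lipschitz bound based at 0 measures its distance to 1. *)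
assert (E1 : forall n z, (1 <= n)%nat -> Cmod z <= M ->
   Cmod (gauss_ratio n z - 1)%C <= D * M * (/ INR n - / (INR n + 1))).
{ intros n z Hn Hz.
  assert (R0 : gauss_ratio n 0 = 1%C).
  { unfold gauss_ratio.
    replace (RtoC (- ln (1 + / INR n)) * 0)%C with (RtoC 0) by ring.
    rewrite Cexp_0; ring. }
  rewrite <- R0.
  eapply Rle_trans; [apply (gauss_ratio_lipschitz n M z 0 Hn Hz); rewrite Cmod_0; assumption |].
  replace (z - 0)%C with z by ring.
  fold D.
  replace (D * M * (/ INR n - / (INR n + 1))) with (D * (/ INR n - / (INR n + 1)) * M) by ring.
  apply Rmult_le_compat_l; [| assumption].
  assert (Hn' := INR_ge_1 n Hn).
  apply Rmult_le_pos; [lra |].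
  assert (/ (INR n + 1) <= / INR n) by (apply Rinv_le_contravar; lra); lra. }
assert (E2 : forall n z, (1 <= n)%nat -> Cmod z <= M ->
   Cmod (gauss_ratio n z) <= exp (D * M * (/ INR n - / (INR n + 1)))).
{ intros n z Hn Hz.
  assert (H := E1 n z Hn Hz).
  assert (H1 := Cmod_minus_ge (gauss_ratio n z) 1); rewrite Cmod_1 in H1.
  assert (H2 := exp_ineq1_le (D * M * (/ INR n - / (INR n + 1)))); lra. }
assert (E3 : forall n z, (1 <= n)%nat -> Cmod z <= M ->
   Cmod (gauss n z) <= M * (M + 1) * exp (D * M * (1 - / INR n))).
{ intros n z Hn Hz; induction Hn as [| n Hn IH].
  - rewrite gauss_1, Cmod_mult; simpl (INR 1).
    replace (D * M * (1 - / 1)) with 0 by field; rewrite exp_0, Rmult_1_r.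
    assert (H1 := Cmod_triangle z 1); rewrite Cmod_1 in H1.
    assert (H2 := Cmod_ge_0 z); assert (H3 := Cmod_ge_0 (z + 1)); nra.
  - rewrite gauss_S, Cmod_mult, S_INR by assumption.
    replace (D * M * (1 - / (INR n + 1))) with
      (D * M * (1 - / INR n) + D * M * (/ INR n - / (INR n + 1))) by ring.
    rewrite exp_plus, <- Rmult_assoc.
    apply Rmult_le_compat; try apply Cmod_ge_0; [assumption | apply E2; assumption]. }
assert (E4 : forall n z, (1 <= n)%nat -> Cmod z <= M -> Cmod (gauss n z) <= B).
{ intros n z Hn Hz; apply Rle_trans with (1 := E3 n z Hn Hz); unfold B.
  apply Rmult_le_compat_l; [nra |]; apply exp_le.
  assert (Hn' := INR_ge_1 n Hn).
  assert (0 < / INR n) by (apply Rinv_0_lt_compat; lra). assert (0 <= D * M) by (apply Rmult_le_pos; lra); nra. }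
exists (B * D * M + B + L + 1).
assert (HL : 0 <= L).
{ unfold L; assert (H := exp_pos (D * M)); assert (0 <= B * D) by nra; nra. }
assert (HBD : 0 <= B * D * M) by (apply Rmult_le_pos; [nra | assumption]).
split; [lra |].
intros z Hz; split; [| split].
- intros n Hn; specialize (E4 n z Hn Hz); lra.
- intros n m Hn.
  assert (Hn' := INR_ge_1 n Hn).
  assert (P : Cmod (gauss (n + m) z - gauss n z)%C <= B * D * M * (/ INR n - / INR (n + m))).
  { induction m as [| m IH].
    - rewrite Nat.add_0_r; replace (gauss n z - gauss n z)%C with (RtoC 0) by ring.
      rewrite Cmod_0; lra.
    - rewrite Nat.add_succ_r, gauss_S, S_INR by lia.
      replace (gauss (n + m) z * gauss_ratio (n + m) z - gauss n z)%C with
        (gauss (n + m) z * (gauss_ratio (n + m) z - 1) + (gauss (n + m) z - gauss n z))%C by ring.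
      apply Rle_trans with (1 := Cmod_triangle _ _).
      rewrite Cmod_mult.
      assert (Q1 : Cmod (gauss (n + m) z) <= B) by (apply E4; [lia | assumption]).
      assert (Q2 := E1 (n + m)%nat z ltac:(lia) Hz).
      assert (Q3 := Cmod_ge_0 (gauss (n + m) z)).
      assert (Q4 := Cmod_ge_0 (gauss_ratio (n + m) z - 1)).
      assert (Cmod (gauss (n + m) z) * Cmod (gauss_ratio (n + m) z - 1) <=
         B * (D * M * (/ INR (n + m) - / (INR (n + m) + 1)))) by (apply Rmult_le_compat; assumption).
      nra. }
  apply Rle_trans with (1 := P).
  assert (1 <= INR (n + m)) by (apply INR_ge_1; lia).
  assert (0 < / INR (n + m)) by (apply Rinv_0_lt_compat; lra).
  assert (0 < / INR n) by (apply Rinv_0_lt_compat; lra).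
  nra.
- intros z' Hz' n Hn.
  (* The partial sum [1 - 1/n] is kept both in the linear factor and in the exponent, so that the
     induction closes; [2M + 1] is the Lipschitz constant of [z (z + 1)]. *)
  assert (P : Cmod (gauss n z - gauss n z')%C <=
     (2 * M + 1 + B * D * (1 - / INR n)) * exp (D * M * (1 - / INR n)) * Cmod (z - z')%C).
  { induction Hn as [| n Hn IH].
    - rewrite !gauss_1; simpl (INR 1).
      replace (D * M * (1 - / 1)) with 0 by field; rewrite exp_0.
      replace (z * (z + 1) - z' * (z' + 1))%C with ((z + z' + 1) * (z - z'))%C by ring.
      rewrite Cmod_mult; apply Rmult_le_compat_r; [apply Cmod_ge_0 |].
      assert (H1 := Cmod_triangle (z + z') 1); rewrite Cmod_1 in H1.
      assert (H2 := Cmod_triangle z z'); lra.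
    - assert (Hn' := INR_ge_1 n Hn).
      assert (0 < / INR n) by (apply Rinv_0_lt_compat; lra).
      assert (/ INR n <= 1) by (rewrite <- Rinv_1; apply Rinv_le_contravar; lra).
      assert (0 < / (INR n + 1)) by (apply Rinv_0_lt_compat; lra).
      assert (/ (INR n + 1) <= / INR n) by (apply Rinv_le_contravar; lra).
      rewrite !gauss_S, S_INR by assumption.
      replace (gauss n z * gauss_ratio n z - gauss n z' * gauss_ratio n z')%C with
        ((gauss n z - gauss n z') * gauss_ratio n z + gauss n z' * (gauss_ratio n z - gauss_ratio n z'))%C by ring.
      apply Rle_trans with (1 := Cmod_triangle _ _).
      rewrite !Cmod_mult.
      set (d := / INR n - / (INR n + 1)) in *.
      replace (1 - / (INR n + 1)) with (1 - / INR n + d) by (unfold d; ring).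
      set (W := Cmod (z - z')) in *.
      assert (HW : 0 <= W) by apply Cmod_ge_0.
      set (X := exp (D * M * (1 - / INR n))) in *.
      assert (HX : 0 < X) by apply exp_pos.
      replace (D * M * (1 - / INR n + d)) with (D * M * (1 - / INR n) + D * M * d) by ring; rewrite exp_plus.
      fold X; set (X' := exp (D * M * d)).
      assert (HX1 : 1 <= X * X').
      { unfold X, X'; rewrite <- exp_plus; apply Rle_trans with (exp 0); [rewrite exp_0; lra | apply exp_le].
        assert (0 <= D * M) by (apply Rmult_le_pos; lra); assert (0 <= d) by (unfold d; lra).
        apply Rplus_le_le_0_compat; apply Rmult_le_pos; lra. }
      assert (Q1 : Cmod (gauss n z - gauss n z') * Cmod (gauss_ratio n z) <=
        ((2 * M + 1 + B * D * (1 - / INR n)) * X * W) * X').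
      { apply Rmult_le_compat; try apply Cmod_ge_0; [assumption | apply E2; assumption]. }
      assert (Q2 : Cmod (gauss n z') * Cmod (gauss_ratio n z - gauss_ratio n z') <= B * (D * d * W)).
      { apply Rmult_le_compat; try apply Cmod_ge_0; [apply E4; assumption |].
        apply gauss_ratio_lipschitz; assumption. }
      assert (Q3 : B * (D * d * W) <= B * (D * d * W) * (X * X')).
      { rewrite <- (Rmult_1_r (B * _)) at 1. apply Rmult_le_compat_l; [| assumption].
        apply Rmult_le_pos; [assumption | apply Rmult_le_pos; [apply Rmult_le_pos |]; unfold d; lra]. }
      nra. }
  apply Rle_trans with (1 := P).
  apply Rmult_le_compat_r; [apply Cmod_ge_0 |].
  apply Rle_trans with L; [| lra].
  assert (Hn' := INR_ge_1 n Hn).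
  assert (0 < / INR n) by (apply Rinv_0_lt_compat; lra).
  assert (/ INR n <= 1) by (rewrite <- Rinv_1; apply Rinv_le_contravar; lra).
  assert (0 <= B * D) by nra.
  unfold L; apply Rmult_le_compat; [nra | left; apply exp_pos | nra |].
  apply exp_le; assert (0 <= D * M) by nra; nra.
Qed.

(** [lim] is specified on Cauchy filters only, so the rate is used twice: to show that the filter is
    Cauchy, then to estimate the distance to the limit. *)
Lemma C_lim_correct (u : nat -> C) (K : R) : 0 < K ->
  (forall n m, (1 <= n)%nat -> Cmod (u (n + m)%nat - u n)%C <= K * / INR n) ->
  forall n, (1 <= n)%nat ->
  Cmod (u n - @lim C_CompleteNormedModule (filtermap u eventually))%C <= K * / INR n.
Proof.
intros HK Hu n Hn.
set (l := @lim C_CompleteNormedModule (filtermap u eventually)).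
assert (Hc : forall eps : posreal, filtermap u eventually (@ball C_UniformSpace l eps)).
{ apply (@complete_cauchy C_CompleteNormedModule).
  - apply filtermap_proper_filter, eventually_filter.
  - intros eps.
    destruct (nfloor_ex (K / eps)) as [N HN].
    { apply Rdiv_le_0_compat; [lra | apply cond_pos]. }
    exists (u (S N)); exists (S N); intros m Hm.
    apply C_NormedModule_mixin_compat1.
    replace m with (S N + (m - S N))%nat by lia.
    change (Cmod (u (S N + (m - S N))%nat - u (S N))%C < eps).
    apply Rle_lt_trans with (1 := Hu (S N) (m - S N)%nat ltac:(lia)).
    rewrite S_INR.
    assert (He := cond_pos eps).
    assert (0 <= INR N) by apply pos_INR.
    apply Rmult_lt_reg_r with (INR N + 1); [lra |].
    rewrite Rmult_assoc, Rinv_l by lra.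
    replace (K * 1) with (K / eps * eps) by (field; lra); nra. }
apply le_epsilon; intros eps Heps.
assert (H2 : 0 < eps / 2) by lra.
destruct (Hc (mkposreal _ H2)) as [N HN].
specialize (HN (n + N)%nat ltac:(lia)).
apply C_NormedModule_mixin_compat2 in HN.
change (Cmod (u (n + N)%nat - l)%C < sqrt 2 * (eps / 2)) in HN.
(* Balls of the uniform structure on [C] are squares, which costs a factor [sqrt 2] when passing to
   the modulus. *)
assert (sqrt 2 <= 2).
{ rewrite <- (sqrt_Rsqr 2) at 2 by lra; apply sqrt_le_1; unfold Rsqr; lra. }
replace (u n - l)%C with ((u (n + N)%nat - l) - (u (n + N)%nat - u n))%C by ring.
apply Rle_trans with (1 := Cmod_minus_le _ _).
assert (H3 := Hu n N Hn); nra.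
Qed.

(** The bounds on Gauss' products are uniform in [n], hence survive in the limit. The rate makes the
    convergence uniform on bounded sets, which is what carries Cauchy's theorem to [rgamma]. *)
Lemma gauss_rgamma (M : R) : 0 <= M -> exists K, 0 < K /\
  forall z, Cmod z <= M ->
  Cmod (rgamma z) <= K /\
  (forall n, (1 <= n)%nat -> Cmod (gauss n z - rgamma z)%C <= K * / INR n) /\
  (forall z', Cmod z' <= M -> Cmod (rgamma z - rgamma z')%C <= K * Cmod (z - z')%C).
Proof.
intros HM; destruct (gauss_bounds M HM) as [K [HK HB]].
assert (Lim : forall z, Cmod z <= M -> forall n, (1 <= n)%nat -> Cmod (gauss n z - rgamma z)%C <= K * / INR n).
{ intros z Hz n Hn; apply (C_lim_correct (fun n => gauss n z) K HK); [| assumption].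
  intros; apply HB; assumption. }
assert (Small : forall eps, 0 < eps -> exists n, (1 <= n)%nat /\ K * / INR n < eps).
{ intros eps He.
  destruct (nfloor_ex (K / eps)) as [N HN].
  { apply Rdiv_le_0_compat; lra. }
  exists (S N); split; [lia |]; rewrite S_INR.
  assert (0 <= INR N) by apply pos_INR.
  apply Rmult_lt_reg_r with (INR N + 1); [lra |].
  rewrite Rmult_assoc, Rinv_l by lra.
  replace (K * 1) with (K / eps * eps) by (field; lra); nra. }
exists K; split; [assumption |]; intros z Hz; split; [| split].
- apply le_epsilon; intros eps He; destruct (Small eps He) as [n [Hn Hs]].
  assert (H1 := Lim z Hz n Hn).
  assert (H2 : Cmod (gauss n z) <= K) by (apply HB; assumption).
  replace (rgamma z) with (gauss n z - (gauss n z - rgamma z))%C by ring.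
  apply Rle_trans with (1 := Cmod_minus_le _ _); lra.
- apply Lim; assumption.
- intros z' Hz'; apply le_epsilon; intros eps He.
  destruct (Small (eps / 2)) as [n [Hn Hs]]; [lra |].
  assert (H1 := Lim z Hz n Hn); assert (H2 := Lim z' Hz' n Hn).
  destruct (HB z Hz) as [_ [_ H3]]; specialize (H3 z' Hz' n Hn).
  replace (rgamma z - rgamma z')%C with
    ((gauss n z - gauss n z') - ((gauss n z - rgamma z) - (gauss n z' - rgamma z')))%C by ring.
  apply Rle_trans with (1 := Cmod_minus_le _ _).
  assert (H4 := Cmod_minus_le (gauss n z - rgamma z) (gauss n z' - rgamma z')); lra.
Qed.

Lemma Cconj_RtoC (x : R) : Cconj (RtoC x) = RtoC x.
Proof. apply injective_projections; simpl; ring. Qed.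

Lemma Cconj_inv (z : C) : Cconj (/ z)%C = (/ Cconj z)%C.
Proof.
unfold Cinv, Cconj; simpl.
replace (- snd z * (- snd z * 1)) with (snd z * (snd z * 1)) by ring.
f_equal; unfold Rdiv; ring.
Qed.

Lemma gauss_conj (n : nat) (z : C) : gauss n (Cconj z) = Cconj (gauss n z).
Proof.
unfold gauss, Cdiv; rewrite Cmult_conj, Cconj_inv, Cmult_conj, Cconj_RtoC, !cpowR_Cexp, <- Cexp_conj, Cmult_conj, Cconj_RtoC.
f_equal.
induction n as [| n IH]; [reflexivity |].
simpl poch; rewrite IH, Cmult_conj, Cplus_conj, Cconj_RtoC; reflexivity.
Qed.

(** Schwarz reflection, inherited from the real coefficients of Gauss' products. *)
Lemma rgamma_conj (z : C) : rgamma (Cconj z) = Cconj (rgamma z).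
Proof.
destruct (gauss_rgamma (Cmod z) (Cmod_ge_0 z)) as [K [HK HB]].
assert (H : (rgamma (Cconj z) - Cconj (rgamma z))%C = 0%C).
{ apply Cmod_eq_0; apply Rle_antisym; [| apply Cmod_ge_0].
  apply le_epsilon; intros eps He; rewrite Rplus_0_l.
  destruct (nfloor_ex (2 * K / eps)) as [N HN].
  { apply Rdiv_le_0_compat; lra. }
  assert (Hs : 2 * (K * / INR (S N)) <= eps).
  { rewrite S_INR; assert (0 <= INR N) by apply pos_INR.
    apply Rmult_le_reg_r with (INR N + 1); [lra |].
    replace (2 * (K * / (INR N + 1)) * (INR N + 1)) with (2 * K / eps * eps) by (field; lra); nra. }
  destruct (HB z) as [_ [H1 _]]; [lra |].
  destruct (HB (Cconj z)) as [_ [H2 _]]; [rewrite Cmod_conj; lra |].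
  specialize (H1 (S N) ltac:(lia)); specialize (H2 (S N) ltac:(lia)).
  rewrite <- Cmod_conj in H1.
  replace (rgamma (Cconj z) - Cconj (rgamma z))%C with
    (Cconj (gauss (S N) z - rgamma z) - (gauss (S N) (Cconj z) - rgamma (Cconj z)))%C.
  - apply Rle_trans with (1 := Cmod_minus_le _ _); lra.
  - rewrite gauss_conj; apply injective_projections; simpl; ring. }
replace (rgamma (Cconj z)) with ((rgamma (Cconj z) - Cconj (rgamma z)) + Cconj (rgamma z))%C by ring.
rewrite H; ring.
Qed.

(** * Principal logarithm *)

(* The half-angle form of the argument is smooth on the whole plane slit along the
   negative real axis. *)
Definition Clog (z : C) : C := (ln (Cmod z), 2 * atan (Im z / (Cmod z + Re z))).

Definition slit (z : C) : Prop := 0 < Cmod z + Re z.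

Lemma slit_neq_0 (z : C) : slit z -> z <> 0%C.
Proof.
intros H E; unfold slit in H; rewrite E, Cmod_0 in H; simpl in H; lra.
Qed.

Lemma slit_Cmod_pos (z : C) : slit z -> 0 < Cmod z.
Proof. intros H; apply Cmod_gt_0, slit_neq_0, H. Qed.

Lemma slit_Re_pos (z : C) : 0 < Re z -> slit z.
Proof. intros H; unfold slit; assert (H0 := Cmod_ge_0 z); lra. Qed.

Lemma slit_Im_pos (z : C) : 0 < Im z -> slit z.
Proof.
intros H; unfold slit; assert (H0 := Cmod_ge_0 z); assert (H1 := Cmod_sqr z).
assert (- Re z < Cmod z); [| lra].
destruct (Rle_or_lt (Cmod z) (- Re z)); [nra | assumption].
Qed.

Lemma Cexp_Clog (z : C) : slit z -> Cexp (Clog z) = z.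
Proof.
intros H; assert (Hr := slit_Cmod_pos z H); assert (Hs := Cmod_sqr z).
unfold slit in H; unfold Cexp, Clog; simpl.
rewrite exp_ln by assumption.
set (r := Cmod z) in *; set (q := Im z / (r + Re z)).
rewrite cos_2a, sin_2a, cos_atan, sin_atan.
assert (Hq : 0 < 1 + q²) by (assert (H1 := Rle_0_sqr q); lra).
assert (Hq2 : sqrt (1 + q²) * sqrt (1 + q²) = 1 + q²) by (apply sqrt_sqrt; lra).
assert (Hq3 : 0 < sqrt (1 + q²)) by (apply sqrt_lt_R0; assumption).
(* Both identities come from [r^2 = x^2 + y^2]. They are the half-angle formulas:
   [1 + q^2 = 2r/(r+x)] and [1 - q^2 = 2x/(r+x)]. *)
assert (Hden : (r + Re z) * (r + Re z) + Im z * Im z = 2 * r * (r + Re z)) by nra.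
assert (Hden' : (r + Re z) * (r + Re z) - Im z * Im z = 2 * Re z * (r + Re z)) by nra.
assert (H1q : 1 + q² = 2 * r / (r + Re z)).
{ apply Rmult_eq_reg_r with ((r + Re z) * (r + Re z)); [| nra].
  unfold q, Rsqr; field_simplify; [nra | lra | lra]. }
apply injective_projections; simpl.
- replace (r * (1 / sqrt (1 + q²) * (1 / sqrt (1 + q²)) - q / sqrt (1 + q²) * (q / sqrt (1 + q²))))
    with (r * (1 - q * q) / (sqrt (1 + q²) * sqrt (1 + q²))) by (field; lra).
  rewrite Hq2, H1q.
  change (fst z) with (Re z).
  replace (1 - q * q) with (2 * Re z / (r + Re z)).
  + field; lra.
  + apply Rmult_eq_reg_r with ((r + Re z) * (r + Re z)); [| nra].
    unfold q; field_simplify; [nra | lra | lra].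
- replace (r * (2 * (q / sqrt (1 + q²)) * (1 / sqrt (1 + q²))))
    with (r * (2 * q) / (sqrt (1 + q²) * sqrt (1 + q²))) by (field; lra).
  rewrite Hq2, H1q; unfold q.
  change (snd z) with (Im z); field; lra.
Qed.

Lemma Cderiv_Clog (f : R -> C) t l : slit (f t) -> Cderiv f t l ->
  Cderiv (fun t => Clog (f t)) t (l / f t)%C.
Proof.
intros Hs [F1 F2].
assert (Hr := slit_Cmod_pos _ Hs); assert (H2 := Cmod_sqr (f t)); unfold slit in Hs.
destruct l as [l1 l2].
replace ((l1, l2) / f t)%C with ((l1, l2) / (Re (f t), Im (f t)))%C
  by (unfold Re, Im; rewrite <- (surjective_pairing (f t)); reflexivity).
unfold Clog, Cmod in *.
change (Cderiv (fun t => (ln (sqrt (Re (f t) ^ 2 + Im (f t) ^ 2)),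
  2 * atan (Im (f t) / (sqrt (Re (f t) ^ 2 + Im (f t) ^ 2) + Re (f t))))) t ((l1, l2) / (Re (f t), Im (f t)))%C).
change (fst (f t)) with (Re (f t)) in *; change (snd (f t)) with (Im (f t)) in *.
set (P := fun t => Re (f t)) in *; set (Q := fun t => Im (f t)) in *.
change (Re (f t)) with (P t) in *; change (Im (f t)) with (Q t) in *.
change (Cderiv (fun t => (ln (sqrt (P t ^ 2 + Q t ^ 2)),
  2 * atan (Q t / (sqrt (P t ^ 2 + Q t ^ 2) + P t)))) t ((l1, l2) / (P t, Q t))%C).
change (is_derive P t l1) in F1; change (is_derive Q t l2) in F2.
clearbody P Q.
assert (E1 := is_derive_unique _ _ _ F1 : Derive (fun x : R => P x) t = _).
assert (E2 := is_derive_unique _ _ _ F2 : Derive (fun x : R => Q x) t = _).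
assert (Hpos : 0 < P t ^ 2 + Q t ^ 2) by nra.
replace (P t ^ 2 + Q t ^ 2) with (P t * (P t * 1) + Q t * (Q t * 1)) in * by ring.
set (r := sqrt (P t * (P t * 1) + Q t * (Q t * 1))) in *.
assert (Hrr : P t ^ 2 + Q t ^ 2 = r * r) by nra.
apply Cderiv_pair; auto_derive.
- repeat split; try (eexists; eassumption); assumption.
- rewrite E1, E2; unfold Re; cbn -[pow]; fold r; rewrite Hrr; field; lra.
- repeat split; try (eexists; eassumption); try assumption.
  fold r; apply Rgt_not_eq; assumption.
- rewrite E1, E2; unfold Im; cbn -[pow]; fold r; rewrite Hrr.
  assert (HQ : Q t * Q t = r * r - P t * P t) by nra.
  assert (Hden : 1 + Q t * / (r + P t) * (Q t * / (r + P t) * 1) = 2 * r / (r + P t)).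
  { transitivity (1 + Q t * Q t / ((r + P t) * (r + P t))); [field; lra |].
    rewrite HQ; field; lra. }
  rewrite Hden.
  transitivity ((l2 * (r + P t) - l1 * Q t * (P t + r) / r - l2 * (Q t * Q t) / r) / (r * (r + P t))).
  + field; lra.
  + rewrite HQ; field; lra.
Qed.

Lemma slit_scal (A : R) (z : C) : 0 < A -> slit z -> slit (RtoC A * z)%C.
Proof.
intros HA H; unfold slit in *; rewrite Cmod_mult, Cmod_R, Rabs_pos_eq by lra.
replace (Re (RtoC A * z)) with (A * Re z) by (unfold Re; simpl; ring); nra.
Qed.

Lemma Clog_scal (A : R) (z : C) : 0 < A -> slit z ->
  Clog (RtoC A * z)%C = (RtoC (ln A) + Clog z)%C.
Proof.
intros HA Hz; assert (Hr := slit_Cmod_pos _ Hz); unfold slit in Hz.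
unfold Clog; rewrite Cmod_mult, Cmod_R, Rabs_pos_eq, ln_mult by lra.
replace (Re (RtoC A * z)) with (A * Re z) by (unfold Re; simpl; ring).
replace (Im (RtoC A * z)) with (A * Im z) by (unfold Im; simpl; ring).
replace (A * Im z / (A * Cmod z + A * Re z)) with (Im z / (Cmod z + Re z)).
2: { rewrite <- Rmult_plus_distr_l; field; split; lra. }
apply injective_projections; simpl; ring.
Qed.

Lemma Clog_RtoC (x : R) : 0 < x -> Clog (RtoC x) = RtoC (ln x).
Proof.
intros Hx; unfold Clog; rewrite Cmod_R, Rabs_pos_eq by lra; simpl.
unfold Rdiv; rewrite Rmult_0_l, atan_0, Rmult_0_r; reflexivity.
Qed.

Lemma Rabs_Im_Clog (z : C) : Rabs (Im (Clog z)) <= PI.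
Proof.
simpl; destruct (atan_bound (Im z / (Cmod z + Re z))) as [H1 H2].
apply Rabs_le; lra.
Qed.

Lemma Cmod_Clog_le (z : C) : Cmod (Clog z) <= Rabs (ln (Cmod z)) + PI.
Proof.
apply Rle_trans with (1 := Cmod_le_abs _).
apply Rplus_le_compat; [simpl; lra | apply Rabs_Im_Clog].
Qed.

(** For [m > 0], a part of the closed upper half-plane at distance at least [m] from the negative
    axis. It is stable under shifts to the right, so that one assumption on [z] controls every term
    of a series over [z + n]. *)
Definition far (m : R) (z : C) : Prop := m <= Im z \/ m <= Re z /\ 0 <= Im z.

Lemma far_plus (m t : R) (z : C) : 0 <= t -> far m z -> far m (z + RtoC t)%C.
Proof.
intros Ht; unfold far; simpl; unfold Re, Im.
intros [H | [H1 H2]]; [left | right]; lra.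
Qed.

Lemma far_slit (m : R) (z : C) : 0 < m -> far m z -> slit z.
Proof.
intros Hm [H | [H _]]; [apply slit_Im_pos | apply slit_Re_pos]; lra.
Qed.

Lemma far_Cmod (m : R) (z : C) : 0 < m -> far m z -> (m + Rabs (Re z)) / 2 <= Cmod z.
Proof.
intros Hm [H | [H _]]; assert (H1 := re_le_Cmod z); assert (H2 := Rabs_Im_le_Cmod z).
- rewrite Rabs_pos_eq in H2 by lra; lra.
- rewrite Rabs_pos_eq in * by lra; lra.
Qed.

Lemma far_Cmod_ge (m : R) (z : C) : 0 < m -> far m z -> m <= Cmod z.
Proof.
intros Hm [H | [H _]]; assert (H1 := re_le_Cmod z); assert (H2 := Rabs_Im_le_Cmod z).
- rewrite Rabs_pos_eq in H2 by lra; lra.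
- rewrite Rabs_pos_eq in H1 by lra; lra.
Qed.

(** * Gudermann's series *)

Definition Clim (u : nat -> C) (l : C) : Prop :=
  forall eps, 0 < eps -> exists N, forall n, (N <= n)%nat -> Cmod (u n - l)%C < eps.

Lemma Clim_ext (u v : nat -> C) l : (exists N, forall n, (N <= n)%nat -> u n = v n) -> Clim u l -> Clim v l.
Proof.
intros [N0 E] H eps He; destruct (H eps He) as [N HN].
exists (max N N0); intros n Hn; rewrite <- E by lia; apply HN; lia.
Qed.

Lemma Clim_unique (u : nat -> C) l m : Clim u l -> Clim u m -> l = m.
Proof.
intros H1 H2.
assert (E : (l - m)%C = 0%C).
{ apply Cmod_eq_0, Rle_antisym; [| apply Cmod_ge_0].
  apply le_epsilon; intros eps He; rewrite Rplus_0_l.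
  destruct (H1 (eps / 2)) as [N1 P1]; [lra |].
  destruct (H2 (eps / 2)) as [N2 P2]; [lra |].
  specialize (P1 (max N1 N2) ltac:(lia)); specialize (P2 (max N1 N2) ltac:(lia)).
  replace (l - m)%C with ((u (max N1 N2) - m) - (u (max N1 N2) - l))%C by ring.
  apply Rle_trans with (1 := Cmod_minus_le _ _); lra. }
replace l with ((l - m) + m)%C by ring; rewrite E; ring.
Qed.

Lemma Clim_components (u : nat -> C) l :
  is_lim_seq (fun n => Re (u n)) (Re l) -> is_lim_seq (fun n => Im (u n)) (Im l) -> Clim u l.
Proof.
intros H1 H2 eps He; apply is_lim_seq_spec in H1; apply is_lim_seq_spec in H2.
assert (He2 : 0 < eps / 2) by lra.
destruct (H1 (mkposreal _ He2)) as [N1 P1]; destruct (H2 (mkposreal _ He2)) as [N2 P2].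
exists (max N1 N2); intros n Hn.
specialize (P1 n ltac:(lia)); specialize (P2 n ltac:(lia)); simpl in P1, P2.
apply Rle_lt_trans with (1 := Cmod_le_abs _).
unfold Cminus, Cplus, Copp; simpl; unfold Re, Im, Rminus in *; lra.
Qed.

Lemma Clim_plus (u v : nat -> C) l m : Clim u l -> Clim v m -> Clim (fun n => u n + v n)%C (l + m)%C.
Proof.
intros H1 H2 eps He.
destruct (H1 (eps / 2)) as [N1 P1]; [lra |].
destruct (H2 (eps / 2)) as [N2 P2]; [lra |].
exists (max N1 N2); intros n Hn; specialize (P1 n ltac:(lia)); specialize (P2 n ltac:(lia)).
replace (u n + v n - (l + m))%C with ((u n - l) + (v n - m))%C by ring.
apply Rle_lt_trans with (1 := Cmod_triangle _ _); lra.
Qed.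

Lemma Clim_opp (u : nat -> C) l : Clim u l -> Clim (fun n => - u n)%C (- l)%C.
Proof.
intros H eps He; destruct (H eps He) as [N P]; exists N; intros n Hn.
replace (- u n - - l)%C with (- (u n - l))%C by ring; rewrite Cmod_opp; auto.
Qed.

Lemma Clim_const (l : C) : Clim (fun _ => l) l.
Proof.
intros eps He; exists 0%nat; intros n _; replace (l - l)%C with (RtoC 0) by ring; rewrite Cmod_0; lra.
Qed.

Lemma Clim_RtoC (u : nat -> R) (l : R) : is_lim_seq u l -> Clim (fun n => RtoC (u n)) (RtoC l).
Proof. intros H; apply Clim_components; simpl; [exact H | apply is_lim_seq_const]. Qed.

Lemma Clim_Cexp (u : nat -> C) l : Clim u l -> Clim (fun n => Cexp (u n)) (Cexp l).
Proof.
intros H eps He.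
assert (Hp := exp_pos (Re l + 1)).
destruct (H (Rmin 1 (eps / exp (Re l + 1)))) as [N P].
{ apply Rmin_pos; [lra |]; apply Rdiv_lt_0_compat; assumption. }
exists N; intros n Hn; specialize (P n Hn).
assert (P1 := Rmin_l 1 (eps / exp (Re l + 1))); assert (P2 := Rmin_r 1 (eps / exp (Re l + 1))).
assert (P3 := Re_le_Cmod (u n - l)).
assert (P4 : Re (u n - l) = Re (u n) - Re l) by (simpl; unfold Re; ring).
apply Rle_lt_trans with (Cmod (u n - l) * exp (Re l + 1)).
- apply Cexp_minus_le; lra.
- apply Rmult_lt_reg_r with (/ exp (Re l + 1)); [apply Rinv_0_lt_compat; assumption |].
  rewrite Rmult_assoc, Rinv_r, Rmult_1_r by lra; unfold Rdiv in *; lra.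
Qed.

Lemma Clim_le (u : nat -> C) l M : Clim u l -> (forall n, Cmod (u n) <= M) -> Cmod l <= M.
Proof.
intros H HM; apply le_epsilon; intros eps He; destruct (H eps He) as [N P].
specialize (P N (le_n N)); specialize (HM N).
replace l with (u N - (u N - l))%C by ring.
apply Rle_trans with (1 := Cmod_minus_le _ _); lra.
Qed.

Lemma Clim_by_bound (u : nat -> C) l (K : R) N0 :
  (forall n, (N0 <= n)%nat -> Cmod (u n - l)%C <= K * / INR n) -> Clim u l.
Proof.
intros H eps He.
destruct (nfloor_ex (Rmax K 0 / eps)) as [N HN].
{ apply Rdiv_le_0_compat; [apply Rmax_r | lra]. }
exists (max N0 (S N)); intros n Hn; apply Rle_lt_trans with (1 := H n ltac:(lia)).
assert (L : INR (S N) <= INR n) by (apply le_INR; lia); rewrite S_INR in L.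
assert (0 <= INR N) by apply pos_INR.
assert (HK := Rmax_l K 0).
apply Rmult_lt_reg_r with (INR n); [lra |].
rewrite Rmult_assoc, Rinv_l by lra.
assert (Rmax K 0 = Rmax K 0 / eps * eps) by (field; lra); nra.
Qed.

Fixpoint sumC (n : nat) (f : nat -> C) : C :=
  match n with O => 0%C | S m => (sumC m f + f m)%C end.

Lemma sumC_sum_n (w : nat -> C) n :
  sumC (S n) w = (sum_n (fun k => Re (w k)) n, sum_n (fun k => Im (w k)) n).
Proof.
induction n as [| n IH].
- rewrite !sum_O; simpl; apply injective_projections; simpl; unfold Re, Im; ring.
- rewrite !sum_Sn; change (sumC (S (S n)) w) with (sumC (S n) w + w (S n))%C; rewrite IH.
  reflexivity.
Qed.

Lemma sumC_minus n (f g : nat -> C) : (sumC n f - sumC n g)%C = sumC n (fun k => f k - g k)%C.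
Proof.
induction n as [| n IH]; simpl; [ring |]; rewrite <- IH; ring.
Qed.

(** Majorants are kept as increments of a bounded sequence: convergence and the bound on the sum are
    then read off from its values. *)
Lemma sumC_telescope_le (w : nat -> C) (b : nat -> R) n :
  (forall k, Cmod (w k) <= b (S k) - b k) -> Cmod (sumC n w) <= b n - b O.
Proof.
intros H; induction n as [| n IH]; simpl; [rewrite Cmod_0; lra |].
apply Rle_trans with (1 := Cmod_triangle _ _); specialize (H n); lra.
Qed.

Definition SeriesC (w : nat -> C) : C := (Series (fun n => Re (w n)), Series (fun n => Im (w n))).

Lemma SeriesC_Clim (w : nat -> C) (b : nat -> R) (l : R) :
  (forall k, Cmod (w k) <= b (S k) - b k) -> is_lim_seq b l ->
  Clim (fun n => sumC n w) (SeriesC w).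
Proof.
intros H Hb.
assert (Hs : ex_series (fun k => b (S k) - b k)).
{ exists (l - b O).
  change (is_lim_seq (sum_n (fun k => b (S k) - b k)) (Finite (l - b O))).
  apply (is_lim_seq_ext (fun n => b (S n) - b O)).
  - intros n; induction n as [| n IH].
    + rewrite sum_O; reflexivity.
    + rewrite sum_Sn, <- IH; unfold plus; simpl; ring.
  - apply is_lim_seq_minus'; [| apply is_lim_seq_const].
    apply -> is_lim_seq_incr_1; assumption. }
assert (Hre : ex_series (fun n => Re (w n))).
{ apply (ex_series_le (K := R_AbsRing) (V := R_CompleteNormedModule)) with (2 := Hs); intros n.
  apply Rle_trans with (2 := H n), re_le_Cmod. }
assert (Him : ex_series (fun n => Im (w n))).
{ apply (ex_series_le (K := R_AbsRing) (V := R_CompleteNormedModule)) with (2 := Hs); intros n.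
  apply Rle_trans with (2 := H n), Rabs_Im_le_Cmod. }
apply Series_correct in Hre; apply Series_correct in Him.
apply Clim_components.
- apply is_lim_seq_incr_1.
  apply is_lim_seq_ext with (2 := Hre); intros n; rewrite sumC_sum_n; reflexivity.
- apply is_lim_seq_incr_1.
  apply is_lim_seq_ext with (2 := Him); intros n; rewrite sumC_sum_n; reflexivity.
Qed.

(** A bounded function whose unit increments dominate [m / ((m + |v|)(m + |v + 1|))]. It is the
    telescoping majorant for terms of quadratic decay, and works wherever the series starts, even
    far to the left. *)
Definition ramp (m v : R) : R := v / (m + Rabs v).

Lemma ramp_bounds m v : 0 < m -> -1 <= ramp m v <= 1.
Proof.
intros Hm; unfold ramp; assert (H := Rabs_pos v); assert (H1 := Rle_abs v).
assert (H2 := Rle_abs (- v)); rewrite Rabs_Ropp in H2.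
split.
- apply Rmult_le_reg_r with (m + Rabs v); [lra |].
  unfold Rdiv; rewrite Rmult_assoc, Rinv_l by lra; lra.
- apply Rmult_le_reg_r with (m + Rabs v); [lra |].
  unfold Rdiv; rewrite Rmult_assoc, Rinv_l by lra; lra.
Qed.

(** Equality holds when [v] and [v + 1] have the same sign; otherwise the difference of cross
    products gains [-2 v (v + 1) >= 0]. *)
Lemma ramp_step m v : 0 < m ->
  m / ((m + Rabs v) * (m + Rabs (v + 1))) <= ramp m (v + 1) - ramp m v.
Proof.
intros Hm; unfold ramp.
assert (H := Rabs_pos v); assert (H1 := Rabs_pos (v + 1)).
apply Rmult_le_reg_r with ((m + Rabs v) * (m + Rabs (v + 1))); [nra |].
replace (m / ((m + Rabs v) * (m + Rabs (v + 1))) * ((m + Rabs v) * (m + Rabs (v + 1)))) with m by (field; lra).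
replace (((v + 1) / (m + Rabs (v + 1)) - v / (m + Rabs v)) * ((m + Rabs v) * (m + Rabs (v + 1))))
  with ((v + 1) * (m + Rabs v) - v * (m + Rabs (v + 1))) by (field; lra).
unfold Rabs; destruct (Rcase_abs v); destruct (Rcase_abs (v + 1)); nra.
Qed.

Lemma ramp_lim m x : 0 < m -> is_lim_seq (fun n => ramp m (x + INR n)) 1.
Proof.
intros Hm.
destruct (nfloor_ex (Rabs x)) as [N HN]; [apply Rabs_pos |].
apply (is_lim_seq_ext_loc (fun n => 1 - m * / (m + (x + INR n)))).
- exists (S N); intros n Hn; apply le_INR in Hn; rewrite S_INR in Hn.
  assert (H2 := Rle_abs (- x)); rewrite Rabs_Ropp in H2.
  unfold ramp; rewrite Rabs_pos_eq by lra; field; lra.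
- replace (Finite 1) with (Finite (1 - m * 0)) by (f_equal; ring).
  apply is_lim_seq_minus'; [apply is_lim_seq_const |].
  apply (is_lim_seq_scal_l _ m 0).
  apply (is_lim_seq_ext (fun n => / ((m + x) + INR n))); [intros; f_equal; ring |].
  replace (Finite 0) with (Rbar_inv p_infty) by reflexivity.
  apply is_lim_seq_inv; [| discriminate].
  apply is_lim_seq_plus with (Finite (m + x)) p_infty; [apply is_lim_seq_const | apply is_lim_seq_INR | reflexivity].
Qed.

(** The general term [(z + 1/2) log(1 + 1/z) - 1] of Gudermann's series, with the logarithm of the
    quotient written as a difference of principal values. *)
Definition gudermann (z : C) : C := ((z + RtoC (/ 2)) * (Clog (z + 1) - Clog z) - 1)%C.

(** The polynomial [t/2 - t^2/2] vanishes at 0 and 1, so it does not change the increment over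
    [[0, 1]]; subtracting it turns the derivative from a quantity of order [1/|z|] into the product
    kernel below, of order [1/|z|^2]. *)
Definition gud_primitive (z : C) (t : R) : C :=
  ((z + RtoC (/ 2)) * Clog (z + RtoC t) - RtoC t - RtoC (t / 2 - t * t / 2) / (z + RtoC (/ 2)))%C.

Definition gud_kernel (z : C) (t : R) : C :=
  (RtoC ((/ 2 - t) * (/ 2 - t)) / ((z + RtoC t) * (z + RtoC (/ 2))))%C.

Lemma gud_primitive_increment (z : C) : (gud_primitive z 1 - gud_primitive z 0)%C = gudermann z.
Proof.
unfold gud_primitive, gudermann.
replace (1 / 2 - 1 * 1 / 2) with 0 by field.
replace (0 / 2 - 0 * 0 / 2) with 0 by field.
replace (z + RtoC 0)%C with z by ring.
unfold Cdiv; ring.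
Qed.

Lemma Cderiv_gud_primitive (z : C) (m t : R) : 0 < m -> far m z -> 0 <= t ->
  Cderiv (gud_primitive z) t (gud_kernel z t).
Proof.
intros Hm Hz Ht.
assert (S1 : slit (z + RtoC t)%C) by (apply far_slit with m, far_plus; assumption).
assert (S2 : slit (z + RtoC (/ 2))%C) by (apply far_slit with m, far_plus; [| lra |]; assumption).
apply slit_neq_0 in S2; assert (S3 := slit_neq_0 _ S1).
eapply Cderiv_eq.
- unfold gud_primitive; apply Cderiv_minus; [apply Cderiv_minus |].
  + apply Cderiv_scal, (Cderiv_Clog (fun t => z + RtoC t)%C); [exact S1 |].
    apply Cderiv_plus; [apply Cderiv_const | apply Cderiv_id].
  + apply Cderiv_id.
  + apply Cderiv_mult; [| apply Cderiv_const].
    apply (Cderiv_RtoC (fun t => t / 2 - t * t / 2) t (/ 2 - t)).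
    auto_derive; [trivial | field].
- unfold gud_kernel.
  rewrite RtoC_mult, RtoC_minus.
  field; auto.
Qed.

Lemma Rdiv_le_cross (a b c d : R) : 0 < b -> 0 < d -> a * d <= c * b -> a / b <= c / d.
Proof.
intros Hb Hd H; apply Rmult_le_reg_r with (b * d); [nra |].
replace (a / b * (b * d)) with (a * d) by (field; lra).
replace (c / d * (b * d)) with (c * b) by (field; lra); assumption.
Qed.

(** The factor depends on [delta] alone. Later [m] grows without bound while [delta] stays fixed,
    and the constants must not follow [m]. *)
Lemma near_comparable (delta m v t : R) : 0 < delta <= m -> Rabs t <= 2 ->
  m + Rabs v <= (1 + 2 / delta) * (m + Rabs (v + t)).
Proof.
intros Hd Ht.
assert (H := Rabs_triang (v + t) (- t)); rewrite Rabs_Ropp in H.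
replace (v + t + - t) with v in H by ring.
assert (H1 := Rabs_pos (v + t)).
assert (2 <= 2 / delta * (m + Rabs (v + t))).
{ replace 2 with (2 / delta * delta) at 1 by (field; lra).
  apply Rmult_le_compat_l; [| lra]. apply Rdiv_le_0_compat; lra. }
lra.
Qed.

Lemma far_shift_lower (delta m : R) (z : C) (v : R) : 0 < delta <= m -> far m z ->
  Rabs (Re z - v) <= 2 -> (m + Rabs v) / (2 * (1 + 2 / delta)) <= Cmod z.
Proof.
intros Hd Hz Hv.
apply Rle_trans with (2 := far_Cmod m z ltac:(lra) Hz).
assert (H := near_comparable delta m v (Re z - v) Hd Hv).
replace (v + (Re z - v)) with (Re z) in H by ring.
assert (0 < 2 / delta) by (apply Rdiv_lt_0_compat; lra).
apply Rdiv_le_cross; lra.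
Qed.

(** The term is the integral of [gud_kernel] over [[0, 1]]. Its numerator is at most 1/4, and its
    two denominators are at least [N0/(2c)] and [N1/(2c)], so the kernel is at most
    [c^2/(N0 N1)]. *)
Lemma gudermann_bound (delta m : R) (z : C) : 0 < delta <= m -> far m z ->
  Cmod (gudermann z) <= (1 + 2 / delta) ^ 2 / m * (ramp m (Re z + 1) - ramp m (Re z)).
Proof.
intros Hd Hz; set (c := 1 + 2 / delta).
assert (Hc : 0 < 2 / delta) by (apply Rdiv_lt_0_compat; lra).
assert (Hm : 0 < m) by lra.
set (N0 := m + Rabs (Re z)); set (N1 := m + Rabs (Re z + 1)).
assert (HN0 : 0 < N0) by (unfold N0; assert (H := Rabs_pos (Re z)); lra).
assert (HN1 : 0 < N1) by (unfold N1; assert (H := Rabs_pos (Re z + 1)); lra).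
assert (HR := ramp_step m (Re z) Hm); fold N0 N1 in HR.
apply Rle_trans with (c ^ 2 / m * (m / (N0 * N1))).
2: { apply Rmult_le_compat_l; [| assumption]. apply Rdiv_le_0_compat; [nra | lra]. }
replace (c ^ 2 / m * (m / (N0 * N1))) with (c ^ 2 / (N0 * N1) * (1 - 0)) by (field; lra).
rewrite <- gud_primitive_increment.
apply Cmod_increment_le with (gud_kernel z); [lra | |].
- intros t Ht; apply Cderiv_gud_primitive with m; lra || assumption.
- intros t Ht; unfold gud_kernel.
  assert (F1 : far m (z + RtoC t)%C) by (apply far_plus; [lra | assumption]).
  assert (F2 : far m (z + RtoC (/ 2))%C) by (apply far_plus; [lra | assumption]).
  (* One denominator is compared with [Re z] and the other with [Re z + 1], so that the product
     required by [ramp_step] appears. *)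
  assert (B1 := far_shift_lower delta m _ (Re z) Hd F1).
  assert (B2 := far_shift_lower delta m _ (Re z + 1) Hd F2).
  fold c in B1, B2; fold N0 in B1; fold N1 in B2.
  assert (Z1 : 0 < Cmod (z + RtoC t)) by (apply slit_Cmod_pos, far_slit with m; assumption).
  assert (Z2 : 0 < Cmod (z + RtoC (/ 2))) by (apply slit_Cmod_pos, far_slit with m; assumption).
  rewrite Cmod_div.
  2: { apply Cmod_gt_0; rewrite Cmod_mult; nra. }
  rewrite Cmod_mult, Cmod_R, Rabs_pos_eq by apply Rle_0_sqr.
  simpl (Re (z + _)) in B1, B2.
  assert (B1' : N0 / (2 * c) <= Cmod (z + RtoC t)).
  { apply B1; unfold Re; simpl; apply Rabs_le; lra. }
  assert (B2' : N1 / (2 * c) <= Cmod (z + RtoC (/ 2))).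
  { apply B2; unfold Re; simpl; apply Rabs_le; lra. }
  assert (Hc1 : 0 < c) by (unfold c; lra).
  assert (P : N0 / (2 * c) * (N1 / (2 * c)) <= Cmod (z + RtoC t) * Cmod (z + RtoC (/ 2))).
  { apply Rmult_le_compat; try assumption; apply Rlt_le, Rdiv_lt_0_compat; lra. }
  apply Rdiv_le_cross; [nra | nra |].
  replace (N0 * N1) with (4 * c ^ 2 * (N0 / (2 * c) * (N1 / (2 * c)))) by (field; lra).
  apply Rle_trans with (/ 4 * (4 * c ^ 2 * (N0 / (2 * c) * (N1 / (2 * c))))).
  + assert (0 < N0 / (2 * c) * (N1 / (2 * c))) by (apply Rmult_lt_0_compat; apply Rdiv_lt_0_compat; lra).
    apply Rmult_le_compat_r; nra.
  + replace (/ 4 * (4 * c ^ 2 * (N0 / (2 * c) * (N1 / (2 * c))))) with (c ^ 2 * (N0 / (2 * c) * (N1 / (2 * c)))) by (field; lra).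
    apply Rmult_le_compat_l; [nra | assumption].
Qed.

Lemma gudermann_lipschitz (delta m h : R) (z : C) : 0 < delta <= m -> far m z -> 0 <= h <= 1 ->
  Cmod (gudermann (z + RtoC h) - gudermann z)%C <=
    h * (4 / delta * (1 + 2 / delta) ^ 2 / m) * (ramp m (Re z + 1) - ramp m (Re z)).
Proof.
intros Hd Hz Hh; set (c := 1 + 2 / delta).
assert (Hc : 0 < 2 / delta) by (apply Rdiv_lt_0_compat; lra).
assert (Hc1 : 0 < c) by (unfold c; lra).
assert (Hm : 0 < m) by lra.
set (N0 := m + Rabs (Re z)); set (N1 := m + Rabs (Re z + 1)).
assert (HN0 : 0 < N0) by (unfold N0; assert (H := Rabs_pos (Re z)); lra).
assert (HN1 : 0 < N1) by (unfold N1; assert (H := Rabs_pos (Re z + 1)); lra).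
assert (HR := ramp_step m (Re z) Hm); fold N0 N1 in HR.
assert (Hz' : far m (z + RtoC h)%C) by (apply far_plus; [lra | assumption]).
apply Rle_trans with (h * (4 / delta * c ^ 2 / m) * (m / (N0 * N1))).
2: { apply Rmult_le_compat_l; [| assumption]. apply Rmult_le_pos; [lra |].
  apply Rdiv_le_0_compat; [| lra]; apply Rmult_le_pos; [apply Rdiv_le_0_compat; lra | nra]. }
replace (h * (4 / delta * c ^ 2 / m) * (m / (N0 * N1))) with (h * (4 / delta * c ^ 2) / (N0 * N1) * (1 - 0)) by (field; lra).
rewrite <- !gud_primitive_increment.
replace (gud_primitive (z + RtoC h) 1 - gud_primitive (z + RtoC h) 0 - (gud_primitive z 1 - gud_primitive z 0))%C
  with ((gud_primitive (z + RtoC h) 1 - gud_primitive z 1) - (gud_primitive (z + RtoC h) 0 - gud_primitive z 0))%C by ring.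
apply (Cmod_increment_le (fun t => gud_primitive (z + RtoC h) t - gud_primitive z t)%C
   (fun t => gud_kernel (z + RtoC h) t - gud_kernel z t)%C); [lra | |].
- intros t Ht; apply Cderiv_minus; apply Cderiv_gud_primitive with m; lra || assumption.
- intros t Ht; unfold gud_kernel.
  set (a' := (z + RtoC t)%C); set (b' := (z + RtoC (/ 2))%C).
  set (a := (z + RtoC h + RtoC t)%C); set (b := (z + RtoC h + RtoC (/ 2))%C).
  assert (Fa' : far m a') by (apply far_plus; [lra | assumption]).
  assert (Fb' : far m b') by (apply far_plus; [lra | assumption]).
  assert (Fa : far m a) by (apply far_plus; [lra | assumption]).
  assert (Fb : far m b) by (apply far_plus; [lra | assumption]).
  assert (Za' : a' <> 0%C) by (apply slit_neq_0, far_slit with m; assumption).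
  assert (Zb' : b' <> 0%C) by (apply slit_neq_0, far_slit with m; assumption).
  assert (Za : a <> 0%C) by (apply slit_neq_0, far_slit with m; assumption).
  assert (Zb : b <> 0%C) by (apply slit_neq_0, far_slit with m; assumption).
  assert (Ra := far_shift_lower delta m a (Re z) Hd Fa).
  assert (Rb' := far_shift_lower delta m b' (Re z + 1) Hd Fb').
  fold c N0 in Ra; fold c N1 in Rb'.
  assert (Ra0 : N0 / (2 * c) <= Cmod a).
  { apply Ra; unfold a, Re; simpl; apply Rabs_le; lra. }
  assert (Rb0 : N1 / (2 * c) <= Cmod b').
  { apply Rb'; unfold b', Re; simpl; apply Rabs_le; lra. }
  assert (Ma' := far_Cmod_ge m a' Hm Fa'). assert (Mb := far_Cmod_ge m b Hm Fb).
  set (k := (/ 2 - t) * (/ 2 - t)).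
  assert (Hk : 0 <= k <= / 4).
  { unfold k; split; [apply Rle_0_sqr |]; assert (- / 2 <= / 2 - t <= / 2) by lra; nra. }
  (* As [a = a' + h] and [b = b' + h], the difference is [-k h (1/b + 1/a') / (a b')]: the bracket
     is at most [2/delta], while [1/(a b')] retains the telescoping majorant. *)
  replace (RtoC k / (a * b) - RtoC k / (a' * b'))%C
    with (- (RtoC (k * h) * (/ b + / a') * (/ a * / b')))%C.
  2: { assert (Ea : a = (a' + RtoC h)%C) by (unfold a, a'; ring).
       assert (Eb : b = (b' + RtoC h)%C) by (unfold b, b'; ring).
       clearbody a b a' b'; rewrite Ea, Eb.
       rewrite RtoC_mult; field.
       rewrite <- Ea, <- Eb; auto. }
  rewrite Cmod_opp, !Cmod_mult, Cmod_R, (Rabs_pos_eq (k * h)) by nra.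
  rewrite (Cmod_inv a), (Cmod_inv b') by assumption.
  assert (I1 : Cmod (/ b + / a')%C <= 2 / delta).
  { apply Rle_trans with (1 := Cmod_triangle _ _).
    rewrite !Cmod_inv by assumption.
    assert (/ Cmod b <= / delta) by (apply Rinv_le_contravar; lra).
    assert (/ Cmod a' <= / delta) by (apply Rinv_le_contravar; lra).
    unfold Rdiv; lra. }
  assert (I2 : / Cmod a <= 2 * c / N0).
  { replace (2 * c / N0) with (/ (N0 / (2 * c))) by (field; lra).
    apply Rinv_le_contravar; [apply Rdiv_lt_0_compat; lra | assumption]. }
  assert (I3 : / Cmod b' <= 2 * c / N1).
  { replace (2 * c / N1) with (/ (N1 / (2 * c))) by (field; lra).
    apply Rinv_le_contravar; [apply Rdiv_lt_0_compat; lra | assumption]. }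
  apply Rle_trans with ((/ 4 * h) * (2 / delta) * (2 * c / N0 * (2 * c / N1))).
  + apply Rmult_le_compat.
    * apply Rmult_le_pos; [nra | apply Cmod_ge_0].
    * apply Rmult_le_pos; left; apply Rinv_0_lt_compat; apply Cmod_gt_0; assumption.
    * apply Rmult_le_compat; [nra | apply Cmod_ge_0 | nra | assumption].
    * apply Rmult_le_compat; try assumption; left; apply Rinv_0_lt_compat; apply Cmod_gt_0; assumption.
  + replace (/ 4 * h * (2 / delta) * (2 * c / N0 * (2 * c / N1))) with (h * (2 / delta * c ^ 2) / (N0 * N1)) by (field; lra).
    unfold Rdiv at 1 3; apply Rmult_le_compat_r; [left; apply Rinv_0_lt_compat; nra |].
    apply Rmult_le_compat_l; [lra |]; apply Rmult_le_compat_r; [nra |].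
    unfold Rdiv; apply Rmult_le_compat_r; [left; apply Rinv_0_lt_compat; lra | lra].
Qed.

Definition gud_sum (z : C) : C := SeriesC (fun n => gudermann (z + RtoC (INR n))).

Lemma gud_sum_Clim (m : R) (z : C) : 0 < m -> far m z ->
  Clim (fun n => sumC n (fun k => gudermann (z + RtoC (INR k)))) (gud_sum z).
Proof.
intros Hm Hz.
apply SeriesC_Clim with (fun n => (1 + 2 / m) ^ 2 / m * ramp m (Re z + INR n)) ((1 + 2 / m) ^ 2 / m * 1).
- intros k; rewrite <- Rmult_minus_distr_l, S_INR.
  replace (Re z + (INR k + 1)) with (Re (z + RtoC (INR k)) + 1) by (unfold Re; simpl; ring).
  replace (Re z + INR k) with (Re (z + RtoC (INR k))) by (unfold Re; simpl; ring).
  apply gudermann_bound; [lra |]; apply far_plus; [apply pos_INR | assumption].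
- apply (is_lim_seq_scal_l _ _ (Finite 1)), ramp_lim; assumption.
Qed.

(** The factor 2 bounds the total increment of [ramp], whose values lie between -1 and 1. *)
Lemma gud_sum_bound (delta m : R) (z : C) : 0 < delta <= m -> far m z ->
  Cmod (gud_sum z) <= 2 * (1 + 2 / delta) ^ 2 / m.
Proof.
intros Hd Hz; assert (Hm : 0 < m) by lra.
assert (HC : 0 <= (1 + 2 / delta) ^ 2 / m).
{ apply Rdiv_le_0_compat; [apply pow2_ge_0 | lra]. }
apply (Clim_le _ _ _ (gud_sum_Clim m z Hm Hz)); intros n.
eapply Rle_trans.
- apply sumC_telescope_le with (b := fun n => (1 + 2 / delta) ^ 2 / m * ramp m (Re z + INR n)).
  intros k; rewrite <- Rmult_minus_distr_l, S_INR.
  replace (Re z + (INR k + 1)) with (Re (z + RtoC (INR k)) + 1) by (unfold Re; simpl; ring).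
  replace (Re z + INR k) with (Re (z + RtoC (INR k))) by (unfold Re; simpl; ring).
  apply gudermann_bound; [lra |]; apply far_plus; [apply pos_INR | assumption].
- rewrite <- Rmult_minus_distr_l.
  destruct (ramp_bounds m (Re z + INR n) Hm); destruct (ramp_bounds m (Re z + INR 0) Hm).
  replace (2 * (1 + 2 / delta) ^ 2 / m) with ((1 + 2 / delta) ^ 2 / m * 2) by (unfold Rdiv; ring).
  apply Rmult_le_compat_l; lra.
Qed.

Lemma gud_sum_lipschitz (delta m h : R) (z : C) : 0 < delta <= m -> far m z -> 0 <= h <= 1 ->
  Cmod (gud_sum (z + RtoC h) - gud_sum z)%C <= h * (8 / delta * (1 + 2 / delta) ^ 2 / m).
Proof.
intros Hd Hz Hh; assert (Hm : 0 < m) by lra.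
set (C0 := h * (4 / delta * (1 + 2 / delta) ^ 2 / m)).
assert (HC : 0 <= C0).
{ apply Rmult_le_pos; [lra |]; apply Rdiv_le_0_compat; [| lra].
  apply Rmult_le_pos; [apply Rdiv_le_0_compat; lra | apply pow2_ge_0]. }
assert (Hz' : far m (z + RtoC h)%C) by (apply far_plus; [lra | assumption]).
apply (Clim_le (fun n => sumC n (fun k => gudermann (z + RtoC h + RtoC (INR k)))
   + - sumC n (fun k => gudermann (z + RtoC (INR k))))%C).
- apply Clim_plus; [| apply Clim_opp]; apply gud_sum_Clim with m; assumption.
- intros n; change (Cmod (sumC n (fun k => gudermann (z + RtoC h + RtoC (INR k)))
   - sumC n (fun k => gudermann (z + RtoC (INR k))))%C <= h * (8 / delta * (1 + 2 / delta) ^ 2 / m)).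
  rewrite sumC_minus.
  eapply Rle_trans.
  + apply sumC_telescope_le with (b := fun n => C0 * ramp m (Re z + INR n)).
    intros k; rewrite <- Rmult_minus_distr_l, S_INR.
    replace (Re z + (INR k + 1)) with (Re (z + RtoC (INR k)) + 1) by (unfold Re; simpl; ring).
    replace (Re z + INR k) with (Re (z + RtoC (INR k))) by (unfold Re; simpl; ring).
    replace (z + RtoC h + RtoC (INR k))%C with (z + RtoC (INR k) + RtoC h)%C by ring.
    apply gudermann_lipschitz; try assumption; apply far_plus; [apply pos_INR | assumption].
  + rewrite <- Rmult_minus_distr_l.
    destruct (ramp_bounds m (Re z + INR n) Hm); destruct (ramp_bounds m (Re z + INR 0) Hm).
    replace (h * (8 / delta * (1 + 2 / delta) ^ 2 / m)) with (C0 * 2) by (unfold C0, Rdiv; ring).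
    apply Rmult_le_compat_l; lra.
Qed.

(** * Stirling's formula *)

Definition stirling_main (z : C) : C := ((z - RtoC (/ 2)) * Clog z - z)%C.

(** Gudermann's term is the amount by which [stirling_main] fails the functional equation
    [log Gamma(z + 1) - log Gamma(z) = log z]. *)
Lemma gudermann_telescope (z : C) :
  gudermann z = (stirling_main (z + 1) - stirling_main z - Clog z)%C.
Proof.
unfold gudermann, stirling_main.
replace (z + RtoC (/ 2))%C with (z + 1 - RtoC (/ 2))%C; [ring |].
replace (RtoC (/ 2)) with (RtoC (1 - / 2)) at 2 by (f_equal; lra).
rewrite RtoC_minus; ring.
Qed.

Lemma sum_Clog_telescope (z : C) (n : nat) :
  sumC n (fun k => Clog (z + RtoC (INR k))) =
  (stirling_main (z + RtoC (INR n)) - stirling_main z - sumC n (fun k => gudermann (z + RtoC (INR k))))%C.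
Proof.
induction n as [| n IH].
- simpl; replace (z + RtoC 0)%C with z by ring; ring.
- change (sumC (S n) (fun k => Clog (z + RtoC (INR k)))) with
    (sumC n (fun k => Clog (z + RtoC (INR k))) + Clog (z + RtoC (INR n)))%C.
  change (sumC (S n) (fun k => gudermann (z + RtoC (INR k)))) with
    (sumC n (fun k => gudermann (z + RtoC (INR k))) + gudermann (z + RtoC (INR n)))%C.
  rewrite IH, gudermann_telescope, S_INR, RtoC_plus.
  replace (z + (RtoC (INR n) + 1))%C with (z + RtoC (INR n) + 1)%C by ring; ring.
Qed.

Lemma poch_Cexp (m : R) (z : C) (n : nat) : 0 < m -> far m z ->
  poch z n = Cexp (sumC (S n) (fun k => Clog (z + RtoC (INR k)))).
Proof.
intros Hm Hz; induction n as [| n IH].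
- simpl; replace (z + RtoC 0)%C with z by ring.
  replace (0 + Clog z)%C with (Clog z) by ring; symmetry; apply Cexp_Clog, far_slit with m; assumption.
- change (poch z (S n)) with (poch z n * (z + RtoC (INR (S n))))%C.
  change (sumC (S (S n)) (fun k => Clog (z + RtoC (INR k)))) with
    (sumC (S n) (fun k => Clog (z + RtoC (INR k))) + Clog (z + RtoC (INR (S n))))%C.
  rewrite Cexp_plus, <- IH, Cexp_Clog; [reflexivity |].
  apply far_slit with m; [assumption |]; apply far_plus; [apply pos_INR | assumption].
Qed.

(** The logarithm of [n! e^n / n^(n + 1/2)]. *)
Definition stirling_defect (n : nat) : R :=
  ln (INR (fact n)) - (INR n + / 2) * ln (INR n) + INR n.

Lemma gudermann_INR (n : nat) : (1 <= n)%nat ->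
  gudermann (RtoC (INR n)) = RtoC (stirling_defect n - stirling_defect (S n)).
Proof.
intros Hn; assert (Hn' := INR_ge_1 n Hn).
assert (E : Clog (RtoC (INR n) + 1)%C = RtoC (ln (INR n + 1))).
{ rewrite <- RtoC_plus; apply Clog_RtoC; lra. }
unfold gudermann, stirling_defect; rewrite E, Clog_RtoC by lra.
change (fact (S n)) with ((S n) * fact n)%nat; rewrite mult_INR, S_INR.
rewrite ln_mult; [| lra | apply INR_fact_lt_0].
apply injective_projections; simpl; field.
Qed.

(** Its decrements are Gudermann's terms at the positive integers, so it converges with the series
    at 1. The value of the limit will come from Wallis' integrals. *)
Lemma stirling_defect_converges : exists c : R, is_lim_seq stirling_defect c.
Proof.
assert (F : far 1 (RtoC 1)) by (right; simpl; lra).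
assert (H := gud_sum_Clim 1 (RtoC 1) ltac:(lra) F).
exists (stirling_defect 1 - Re (gud_sum (RtoC 1))).
apply is_lim_seq_incr_1.
assert (E : forall n, Re (sumC n (fun k => gudermann (RtoC 1 + RtoC (INR k)))) = stirling_defect 1 - stirling_defect (S n)).
{ induction n as [| n IH]; [simpl; unfold Re; simpl; ring |].
  change (sumC (S n) (fun k => gudermann (RtoC 1 + RtoC (INR k)))) with
    (sumC n (fun k => gudermann (RtoC 1 + RtoC (INR k))) + gudermann (RtoC 1 + RtoC (INR n)))%C.
  change (Re (sumC n (fun k => gudermann (RtoC 1 + RtoC (INR k))) + gudermann (RtoC 1 + RtoC (INR n)))%C)
    with (Re (sumC n (fun k => gudermann (RtoC 1 + RtoC (INR k)))) + Re (gudermann (RtoC 1 + RtoC (INR n)))).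
  rewrite IH, <- RtoC_plus, Rplus_comm.
  replace (1 + INR n) with (INR (S n)) by (rewrite S_INR; ring).
  rewrite gudermann_INR by lia; simpl; ring. }
apply is_lim_seq_spec; intros eps.
destruct (H eps (cond_pos eps)) as [N HN]; exists N; intros n Hn.
specialize (HN n Hn).
apply Rle_lt_trans with (2 := HN).
apply Rle_trans with (2 := re_le_Cmod _).
replace (Re (sumC n (fun k => gudermann (RtoC 1 + RtoC (INR k))) - gud_sum (RtoC 1))%C) with
  (Re (sumC n (fun k => gudermann (RtoC 1 + RtoC (INR k)))) - Re (gud_sum (RtoC 1))) by reflexivity.
rewrite E, <- (Rabs_Ropp (_ - stirling_defect (S n) - _)).
right; f_equal; ring.
Qed.

(** * Wallis' integrals and the constant in Stirling's formula *)

Definition wallis (n : nat) : R := RInt (fun x => sin x ^ n) 0 (PI / 2).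

Lemma ex_RInt_sin_pow n : ex_RInt (fun x => sin x ^ n) 0 (PI / 2).
Proof.
apply (ex_RInt_continuous (V := R_CompleteNormedModule)); intros x _.
apply (ex_derive_continuous (K := R_AbsRing) (V := R_NormedModule)); auto_derive; trivial.
Qed.

Lemma wallis_0 : wallis 0 = PI / 2.
Proof. unfold wallis; simpl; rewrite RInt_const; unfold scal; simpl; unfold mult; simpl; ring. Qed.

Lemma wallis_1 : wallis 1 = 1.
Proof.
unfold wallis; apply is_RInt_unique.
replace 1 with ((- cos (PI / 2)) - (- cos 0)) by (rewrite cos_0, cos_PI2; ring).
apply (is_RInt_derive (V := R_CompleteNormedModule) (fun x => - cos x)).
- intros x _; auto_derive; [trivial | ring].
- intros x _; apply (ex_derive_continuous (K := R_AbsRing) (V := R_NormedModule)); auto_derive; trivial.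
Qed.

(** The integrand is the derivative of [- cos x sin^(n+1) x], which vanishes at 0 and at
    [PI / 2]. *)
Lemma wallis_rec n : (INR n + 2) * wallis (S (S n)) = (INR n + 1) * wallis n.
Proof.
assert (H : is_RInt (fun x => (INR n + 2) * sin x ^ S (S n) - (INR n + 1) * sin x ^ n) 0 (PI / 2)
   ((fun x => - cos x * sin x ^ S n) (PI / 2) - (fun x => - cos x * sin x ^ S n) 0)).
{ apply (is_RInt_derive (V := R_CompleteNormedModule) (fun x => - cos x * sin x ^ S n)).
  - intros x _; auto_derive; [trivial |].
    assert (E := sin2_cos2 x); unfold Rsqr in E.
    change (match n with 0%nat => 1 | S _ => INR n + 1 end) with (INR (S n)); rewrite S_INR.
    simpl.
    transitivity (sin x * (sin x * sin x ^ n) - (INR n + 1) * (cos x * cos x) * sin x ^ n); [ring |].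
    replace (cos x * cos x) with (1 - sin x * sin x) by lra; ring.
  - intros x _; apply (ex_derive_continuous (K := R_AbsRing) (V := R_NormedModule)); auto_derive; trivial. }
cbv beta in H; rewrite cos_PI2, sin_0 in H; simpl (0 ^ S n) in H.
replace (- 0 * sin (PI / 2) ^ S n - - cos 0 * (0 * 0 ^ n)) with 0 in H by ring.
assert (H2 : is_RInt (fun x => (INR n + 2) * sin x ^ S (S n) - (INR n + 1) * sin x ^ n) 0 (PI / 2)
  ((INR n + 2) * wallis (S (S n)) - (INR n + 1) * wallis n)).
{ apply (is_RInt_minus (V := R_NormedModule) (fun x => (INR n + 2) * sin x ^ S (S n)) (fun x => (INR n + 1) * sin x ^ n)).
  - apply (is_RInt_scal (V := R_NormedModule) (fun x => sin x ^ S (S n))), (RInt_correct (V := R_CompleteNormedModule)), ex_RInt_sin_pow.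
  - apply (is_RInt_scal (V := R_NormedModule) (fun x => sin x ^ n)), (RInt_correct (V := R_CompleteNormedModule)), ex_RInt_sin_pow. }
apply (is_RInt_unique (V := R_CompleteNormedModule)) in H; apply (is_RInt_unique (V := R_CompleteNormedModule)) in H2; rewrite H in H2; lra.
Qed.

Lemma wallis_decr n : wallis (S n) <= wallis n.
Proof.
assert (P := PI_RGT_0).
unfold wallis; apply RInt_le; [lra | apply ex_RInt_sin_pow | apply ex_RInt_sin_pow |].
intros x Hx; simpl.
assert (0 <= sin x) by (apply sin_ge_0; lra).
assert (H1 := SIN_bound x).
assert (0 <= sin x ^ n) by (apply pow_le; assumption).
nra.
Qed.

Lemma wallis_closed n :
  wallis (2 * n) = PI / 2 * INR (fact (2 * n)) / (4 ^ n * INR (fact n) ^ 2) /\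
  wallis (2 * n + 1) = 4 ^ n * INR (fact n) ^ 2 / ((2 * INR n + 1) * INR (fact (2 * n))).
Proof.
induction n as [| n [IH1 IH2]].
- simpl; rewrite wallis_0, wallis_1; split; field.
- assert (R1 := wallis_rec (2 * n)); assert (R2 := wallis_rec (2 * n + 1)).
  replace (2 * S n)%nat with (S (S (2 * n))) by lia.
  replace (S (S (2 * n)) + 1)%nat with (S (S (2 * n + 1))) by lia.
  rewrite plus_INR, mult_INR in R2; rewrite mult_INR in R1; simpl (INR 2) in *; simpl (INR 1) in *.
  assert (0 <= INR n) by apply pos_INR.
  assert (F1 := INR_fact_lt_0 n); assert (F2 := INR_fact_lt_0 (2 * n)).
  assert (P4 : 0 < 4 ^ n) by (apply pow_lt; lra).
  change (fact (S (S (2 * n)))) with (S (S (2 * n)) * (S (2 * n) * fact (2 * n)))%nat.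
  change (fact (S n)) with (S n * fact n)%nat.
  rewrite !mult_INR, !S_INR, mult_INR; simpl (INR 2).
  change (4 ^ S n) with (4 * 4 ^ n).
  rewrite IH1 in R1; rewrite IH2 in R2.
  split.
  + apply Rmult_eq_reg_l with ((1 + 1) * INR n + 2); [| lra].
    rewrite R1; field; lra.
  + apply Rmult_eq_reg_l with ((1 + 1) * INR n + 1 + 2); [| lra].
    rewrite R2; field; lra.
Qed.

Lemma is_lim_seq_inv_INR_0 : is_lim_seq (fun n => / INR n) 0.
Proof.
replace (Finite 0) with (Rbar_inv p_infty) by reflexivity.
apply is_lim_seq_inv; [apply is_lim_seq_INR | discriminate].
Qed.

Lemma wallis_pos n : 0 < wallis (2 * n) /\ 0 < wallis (2 * n + 1).
Proof.
assert (P := PI_RGT_0).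
destruct (wallis_closed n) as [-> ->].
assert (0 <= INR n) by apply pos_INR.
assert (F1 := INR_fact_lt_0 n); assert (F2 := INR_fact_lt_0 (2 * n)).
assert (P4 : 0 < 4 ^ n) by (apply pow_lt; lra).
assert (0 < INR (fact n) ^ 2) by (apply pow_lt; assumption).
split; apply Rdiv_lt_0_compat.
- apply Rmult_lt_0_compat; lra.
- apply Rmult_lt_0_compat; assumption.
- apply Rmult_lt_0_compat; assumption.
- apply Rmult_lt_0_compat; lra.
Qed.

(** The ratio of the integrals of index [2n] and [2n + 1] tends to 1, by monotonicity and the
    recurrence. In closed form its logarithm is [ln PI + 2 s(2n) - 4 s(n) + ln(2 + 1/n)], with [s]
    the defect and [c] its limit; hence [ln(2 PI) - 2c = 0]. *)
Lemma stirling_defect_limit : is_lim_seq stirling_defect (ln (2 * PI) / 2).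
Proof.
destruct stirling_defect_converges as [c Hc].
assert (P := PI_RGT_0).
assert (L1 : is_lim_seq (fun n => ln (wallis (2 * n)) - ln (wallis (2 * n + 1))) 0).
{ apply is_lim_seq_le_le_loc with (fun _ => 0) (fun n => / INR n).
  - exists 1%nat; intros n Hn; assert (Hn' := INR_ge_1 n Hn).
    destruct (wallis_pos n) as [W1 W2].
    assert (D1 := wallis_decr (2 * n)); replace (S (2 * n)) with (2 * n + 1)%nat in D1 by lia.
    assert (D2 := wallis_decr (2 * n + 1)); replace (S (2 * n + 1)) with (S (S (2 * n))) in D2 by lia.
    assert (R1 := wallis_rec (2 * n)); rewrite mult_INR in R1; simpl (INR 2) in R1.
    split; [apply ln_le in D1; lra |].
    assert (D4 : wallis (2 * n) <= wallis (2 * n + 1) * exp (/ INR n)).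
    { assert (D5 : wallis (2 * n) * ((1 + 1) * INR n + 1) = wallis (S (S (2 * n))) * ((1 + 1) * INR n + 2)) by lra.
      assert (I := exp_ineq1_le (/ INR n)).
      assert (0 < / INR n) by (apply Rinv_0_lt_compat; lra).
      apply Rle_trans with (wallis (S (S (2 * n))) * (1 + / INR n)).
      - apply Rmult_le_reg_r with ((1 + 1) * INR n + 1); [lra |].
        rewrite D5.
        rewrite Rmult_assoc; apply Rmult_le_compat_l; [nra |].
        replace ((1 + / INR n) * ((1 + 1) * INR n + 1)) with (2 * INR n + 1 + 2 + / INR n) by (field; lra); lra.
      - apply Rmult_le_compat; nra. }
    apply ln_le in D4; [| assumption].
    rewrite ln_mult, ln_exp in D4; [lra | lra | apply exp_pos].
  - apply is_lim_seq_const.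
  - apply is_lim_seq_inv_INR_0. }
assert (L2 : is_lim_seq (fun n => ln (wallis (2 * n)) - ln (wallis (2 * n + 1)))
   (ln PI + (2 * c - 4 * c) + ln (2 + 0))).
{ apply (is_lim_seq_ext_loc (fun n => ln PI + (2 * stirling_defect (2 * n) - 4 * stirling_defect n) + ln (2 + / INR n))).
  - exists 1%nat; intros n Hn; assert (Hn' := INR_ge_1 n Hn).
    destruct (wallis_closed n) as [-> ->].
    assert (F1 := INR_fact_lt_0 n); assert (F2 := INR_fact_lt_0 (2 * n)).
    assert (P4 : 0 < 4 ^ n) by (apply pow_lt; lra).
    assert (0 < / INR n) by (apply Rinv_0_lt_compat; lra).
    assert (F3 : 0 < INR (fact n) ^ 2) by (apply pow_lt; assumption).
    assert (E4 : ln (4 ^ n) = 2 * INR n * ln 2).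
    { replace 4 with (2 * 2) by ring; rewrite Rpow_mult_distr, ln_mult by (apply pow_lt; lra).
      rewrite <- Rpower_pow by lra; unfold Rpower; rewrite ln_exp; ring. }
    assert (EF : ln (INR (fact n) ^ 2) = 2 * ln (INR (fact n))).
    { simpl; rewrite Rmult_1_r, ln_mult by assumption; ring. }
    rewrite (ln_div (PI / 2 * _)), (ln_div (4 ^ n * _)) by (apply Rmult_lt_0_compat; lra).
    rewrite (ln_mult (PI / 2)), (ln_mult (4 ^ n)), (ln_mult (2 * INR n + 1)), (ln_div PI) by lra.
    rewrite E4, EF.
    replace (2 + / INR n) with ((2 * INR n + 1) * / INR n) by (field; lra).
    rewrite ln_mult, ln_Rinv by lra.
    unfold stirling_defect; rewrite mult_INR; simpl (INR 2).
    replace (ln ((1 + 1) * INR n)) with (ln 2 + ln (INR n)).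
    2: { rewrite <- ln_mult by lra; f_equal; ring. }
    field.
  - apply is_lim_seq_plus'; [apply is_lim_seq_plus' |].
    + apply is_lim_seq_const.
    + apply is_lim_seq_minus'.
      * apply (is_lim_seq_scal_l _ 2 (Finite c)).
        apply (is_lim_seq_subseq stirling_defect c (fun n => (2 * n)%nat)); [| assumption].
        apply eventually_subseq; intros n; lia.
      * apply (is_lim_seq_scal_l _ 4 (Finite c)); assumption.
    + apply is_lim_seq_continuous.
      * apply continuity_pt_filterlim.
        apply (ex_derive_continuous (K := R_AbsRing) (V := R_NormedModule)).
        auto_derive; lra.
      * apply is_lim_seq_plus'; [apply is_lim_seq_const | apply is_lim_seq_inv_INR_0]. }
apply is_lim_seq_unique in L1; apply is_lim_seq_unique in L2; rewrite L1 in L2.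
injection L2; intros E; rewrite Rplus_0_r in E.
rewrite ln_mult by lra.
replace ((ln 2 + ln PI) / 2) with c by lra; assumption.
Qed.

Definition LogGamma (z : C) : C :=
  (stirling_main z + RtoC (ln (2 * PI) / 2) + gud_sum z)%C.

(** Taylor's formula of first order at [x]: the condition [2|w| <= x] keeps the segment from [x] to
    [w + x] in the half-plane where the real part is at least [x/2]. *)
Lemma Clog_large (w : C) (x : R) : 0 < x -> 2 * Cmod w <= x ->
  Cmod (Clog (w + RtoC x) - RtoC (ln x) - w * RtoC (/ x))%C <= 2 * Cmod w ^ 2 * (/ x * / x).
Proof.
intros Hx Hw; assert (Hw0 := Cmod_ge_0 w).
assert (S0 : forall t, 0 <= t <= 1 -> x / 2 <= Re (RtoC t * w + RtoC x)%C).
{ intros t Ht; unfold Re; simpl.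
  assert (H := re_le_Cmod w); apply Rabs_le_between in H; unfold Re in H; nra. }
assert (H := Cmod_increment_le (fun t => Clog (RtoC t * w + RtoC x) - RtoC t * (w * RtoC (/ x)))%C
  (fun t => w / (RtoC t * w + RtoC x) - w * RtoC (/ x))%C 0 1 (2 * Cmod w ^ 2 * (/ x * / x))).
cbv beta in H.
replace (RtoC 1 * w + RtoC x)%C with (w + RtoC x)%C in H by ring.
replace (RtoC 0 * w + RtoC x)%C with (RtoC x) in H by ring.
rewrite Clog_RtoC in H by assumption.
replace (Clog (w + RtoC x) - RtoC 1 * (w * RtoC (/ x)) - (RtoC (ln x) - RtoC 0 * (w * RtoC (/ x))))%C
  with (Clog (w + RtoC x) - RtoC (ln x) - w * RtoC (/ x))%C in H by ring.
rewrite Rminus_0_r, Rmult_1_r in H; apply H; [lra | |].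
- intros t Ht; eapply Cderiv_eq.
  + apply Cderiv_minus.
    * apply (Cderiv_Clog (fun t => RtoC t * w + RtoC x)%C).
      { apply slit_Re_pos; specialize (S0 t Ht); lra. }
      apply Cderiv_plus; [apply Cderiv_mult; [apply Cderiv_id | apply Cderiv_const] | apply Cderiv_const].
    * apply Cderiv_mult; [apply Cderiv_id | apply Cderiv_const].
  + unfold Cdiv; ring.
- intros t Ht; specialize (S0 t Ht).
  set (d := (RtoC t * w + RtoC x)%C) in *.
  assert (Hd : x / 2 <= Cmod d) by (apply Rle_trans with (1 := S0), Re_le_Cmod).
  assert (Hd0 : d <> 0%C) by (apply Cmod_gt_0; lra).
  assert (Hx0 : RtoC x <> 0%C) by (apply RtoC_neq_0; lra).
  replace (w / d - w * RtoC (/ x))%C with (- (RtoC t * (w * w) * (/ d * RtoC (/ x))))%C.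
  2: { rewrite RtoC_inv by lra. replace (RtoC t * (w * w))%C with (w * (d - RtoC x))%C by (unfold d; ring).
       field; auto. }
  rewrite Cmod_opp, !Cmod_mult, !Cmod_R, Cmod_inv by assumption.
  rewrite (Rabs_pos_eq t) by lra.
  assert (0 < / x) by (apply Rinv_0_lt_compat; lra).
  rewrite (Rabs_pos_eq (/ x)) by lra.
  assert (/ Cmod d <= 2 * / x).
  { replace (2 * / x) with (/ (x / 2)) by (field; lra); apply Rinv_le_contravar; lra. }
  replace (2 * Cmod w ^ 2 * (/ x * / x)) with ((1 * (Cmod w * Cmod w)) * ((2 * / x) * / x)) by ring.
  assert (0 < / Cmod d) by (apply Rinv_0_lt_compat; lra).
  apply Rmult_le_compat; [nra | nra | nra |].
  apply Rmult_le_compat_r; lra.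
Qed.

Lemma rgamma_Clim (z : C) : Clim (fun n => gauss n z) (rgamma z).
Proof.
destruct (gauss_rgamma (Cmod z) (Cmod_ge_0 z)) as [K [HK HB]].
apply Clim_by_bound with K 1%nat; intros n Hn.
destruct (HB z (Rle_refl _)) as [_ [H _]]; apply H; assumption.
Qed.

(** Expanding [log(z + 1 + n)] about [n] leaves a remainder [O(1/n^2)], multiplied by [z + n + 1/2],
    a term in [1/n], and minus [stirling_defect n], which supplies the constant. *)
Lemma stirling_main_large (z : C) :
  Clim (fun n => stirling_main (z + RtoC (INR (S n))) - RtoC (ln (INR (fact n))) - RtoC (ln (INR n)) * z)%C
    (RtoC (- (ln (2 * PI) / 2))).
Proof.
set (w := (z + 1)%C).
set (rem := fun n => (Clog (w + RtoC (INR n)) - RtoC (ln (INR n)) - w * RtoC (/ INR n))%C).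
apply (Clim_ext (fun n => ((z + RtoC (INR n) + RtoC (/ 2)) * rem n + (z + RtoC (/ 2)) * w * RtoC (/ INR n))
   + RtoC (- stirling_defect n))%C).
- exists 1%nat; intros n Hn; assert (Hn' := INR_ge_1 n Hn).
  assert (Hx0 : RtoC (INR n) <> 0%C) by (apply RtoC_neq_0; lra).
  unfold rem, stirling_main, stirling_defect; rewrite S_INR.
  replace (z + RtoC (INR n + 1))%C with (w + RtoC (INR n))%C by (unfold w; rewrite RtoC_plus; ring).
  set (LL := Clog (w + RtoC (INR n))).
  replace (- (ln (INR (fact n)) - (INR n + / 2) * ln (INR n) + INR n)) with
     ((INR n + / 2) * ln (INR n) - INR n - ln (INR (fact n))) by ring.
  rewrite !RtoC_minus, RtoC_mult, RtoC_plus, (RtoC_inv (INR n)) by lra.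
  replace (w + RtoC (INR n) - RtoC (/ 2))%C with (z + RtoC (INR n) + RtoC (/ 2))%C.
  2: { unfold w; replace (RtoC (/ 2)) with (RtoC (1 - / 2)) at 1 by (f_equal; lra). rewrite RtoC_minus; ring. }
  unfold w; field; assumption.
- replace (RtoC (- (ln (2 * PI) / 2))) with (0 + RtoC (- (ln (2 * PI) / 2)))%C by ring.
  apply Clim_plus.
  2: { apply Clim_RtoC; apply (is_lim_seq_opp _ (Finite (ln (2 * PI) / 2))); apply stirling_defect_limit. }
  destruct (nfloor_ex (2 * Cmod w + Cmod z + 1)) as [N0 HN0].
  { assert (H1 := Cmod_ge_0 w); assert (H2 := Cmod_ge_0 z); lra. }
  apply Clim_by_bound with (2 * (2 * Cmod w ^ 2) + Cmod ((z + RtoC (/ 2)) * w)) (S N0).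
  intros n Hn.
  apply le_INR in Hn; rewrite S_INR in Hn.
  assert (Hw0 := Cmod_ge_0 w); assert (Hz0 := Cmod_ge_0 z).
  assert (0 < / INR n) by (apply Rinv_0_lt_compat; lra).
  assert (HR := Clog_large w (INR n) ltac:(lra) ltac:(lra)); fold (rem n) in HR.
  match goal with |- Rle (Cmod (Cminus ?a ?b)) _ => replace (Cminus a b) with a by ring end.
  apply Rle_trans with (1 := Cmod_triangle _ _); rewrite Rmult_plus_distr_r.
  apply Rplus_le_compat.
  + rewrite Cmod_mult.
    assert (HZ : Cmod (z + RtoC (INR n) + RtoC (/ 2)) <= 2 * INR n).
    { assert (H1 := Cmod_triangle (z + RtoC (INR n)) (RtoC (/ 2))).
      assert (H2 := Cmod_triangle z (RtoC (INR n))).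
      rewrite Cmod_R, Rabs_pos_eq in H1 by lra; rewrite Cmod_R, Rabs_pos_eq in H2 by lra; lra. }
    apply Rle_trans with (2 * INR n * (2 * Cmod w ^ 2 * (/ INR n * / INR n))).
    * apply Rmult_le_compat; try apply Cmod_ge_0; assumption.
    * right; field; lra.
  + rewrite (Cmod_mult _ (RtoC (/ INR n))), Cmod_R, (Rabs_pos_eq (/ INR n)) by lra; lra.
Qed.

(** Gauss' product is the exponential of a sum of logarithms along [z, z + 1, ...]. Gudermann's
    terms telescope this sum to [stirling_main] at [z + n + 1], whose asymptotics are known. The
    comparison is made after exponentiation, which sidesteps branches. *)
Lemma rgamma_LogGamma (m : R) (z : C) : 0 < m -> far m z -> rgamma z = Cexp (- LogGamma z)%C.
Proof.
intros Hm Hz; apply (Clim_unique (fun n => gauss n z)); [apply rgamma_Clim |].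
apply (Clim_ext (fun n => Cexp ((stirling_main (z + RtoC (INR (S n))) - RtoC (ln (INR (fact n))) - RtoC (ln (INR n)) * z)
   + (- stirling_main z + - sumC (S n) (fun k => gudermann (z + RtoC (INR k))))))%C).
- exists 1%nat; intros n Hn; assert (Hn' := INR_ge_1 n Hn).
  unfold gauss; rewrite (poch_Cexp m) by assumption; rewrite sum_Clog_telescope, cpowR_Cexp.
  replace (RtoC (INR (fact n))) with (Cexp (RtoC (ln (INR (fact n))))).
  2: { rewrite Cexp_RtoC, exp_ln; [reflexivity | apply INR_fact_lt_0]. }
  rewrite <- Cexp_plus, <- Cexp_minus; f_equal; ring.
- replace (- LogGamma z)%C with (RtoC (- (ln (2 * PI) / 2)) + (- stirling_main z + - gud_sum z))%C
    by (unfold LogGamma; rewrite RtoC_opp; ring).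
  apply Clim_Cexp, Clim_plus; [apply stirling_main_large |].
  apply Clim_plus; [apply Clim_const |]; apply Clim_opp.
  intros eps He; destruct (gud_sum_Clim m z Hm Hz eps He) as [N HN].
  exists N; intros n Hn; apply HN; lia.
Qed.

Lemma Cgamma_LogGamma (m : R) (z : C) : 0 < m -> far m z -> Cgamma z = Cexp (LogGamma z).
Proof.
intros Hm Hz; unfold Cgamma; rewrite (rgamma_LogGamma m) by assumption.
rewrite <- Cexp_opp; f_equal; ring.
Qed.

Lemma Cmod_increment_abs (f f' : R -> C) (lo hi M a b : R) :
  lo <= a <= hi -> lo <= b <= hi ->
  (forall t, lo <= t <= hi -> Cderiv f t (f' t)) ->
  (forall t, lo <= t <= hi -> Cmod (f' t) <= M) ->
  Cmod (f b - f a)%C <= M * Rabs (b - a).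
Proof.
intros Ha Hb Hd HM; destruct (Rle_dec a b) as [H | H].
- rewrite Rabs_pos_eq by lra; apply Cmod_increment_le with f'; [lra | |]; intros; [apply Hd | apply HM]; lra.
- rewrite Cmod_minus_sym, Rabs_left by lra.
  replace (- (b - a)) with (a - b) by ring.
  apply Cmod_increment_le with f'; [lra | |]; intros; [apply Hd | apply HM]; lra.
Qed.

(** * Asymptotics of the kernel of Fox's function *)

(** The logarithm in Stirling's formula is taken at [A s] instead of [A s + a]. Then [log s] is
    common to all Gamma factors, and the remaining coefficients, affine in [a], can be summed over
    the factors. *)
Definition stirling_err (A a : R) (s : C) : C :=
  (LogGamma (RtoC A * s + RtoC a) -
   ((RtoC A * s + RtoC a - RtoC (/ 2)) * (Clog s + RtoC (ln A)) - RtoC A * s + RtoC (ln (2 * PI) / 2)))%C.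

Definition log_shift (w : C) (a : R) : C := (Clog (w + RtoC a) - Clog w)%C.

Definition log_shift_err (w : C) (a : R) : C :=
  ((w + RtoC a - RtoC (/ 2)) * log_shift w a - RtoC a)%C.

Lemma stirling_err_split (A a : R) (s : C) : 0 < A -> slit s ->
  stirling_err A a s = (log_shift_err (RtoC A * s) a + gud_sum (RtoC A * s + RtoC a))%C.
Proof.
intros HA Hs; unfold stirling_err, log_shift_err, log_shift, LogGamma, stirling_main.
rewrite (Clog_scal A s) by assumption; ring.
Qed.

Lemma far_interval (m M t : R) (w : C) : far m (w - RtoC M)%C -> - M <= t -> far m (w + RtoC t)%C.
Proof.
intros H Ht; replace (w + RtoC t)%C with (w - RtoC M + RtoC (t + M))%C by (rewrite RtoC_plus; ring).
apply far_plus; [lra | assumption].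
Qed.

Lemma log_shift_bound (m M a : R) (w : C) : 0 < m -> far m (w - RtoC M)%C -> Rabs a <= M ->
  Cmod (log_shift w a) <= M / m.
Proof.
intros Hm Hw Ha; assert (HM := Rabs_pos a); apply Rabs_le_between in Ha.
assert (H := Cmod_increment_abs (fun t => Clog (w + RtoC t)) (fun t => 1 / (w + RtoC t))%C
  (- M) M (/ m) 0 a).
cbv beta in H; replace (w + RtoC 0)%C with w in H by ring.
apply Rle_trans with (/ m * Rabs (a - 0)).
- apply H; try lra.
  + intros t Ht; apply (Cderiv_Clog (fun t => w + RtoC t)%C).
    * apply far_slit with m, far_interval with M; assumption || lra.
    * apply Cderiv_eq with (0 + 1)%C; [| ring]; apply Cderiv_plus; [apply Cderiv_const | apply Cderiv_id].
  + intros t Ht.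
    assert (F : far m (w + RtoC t)%C) by (apply far_interval with M; assumption || lra).
    assert (F0 := far_Cmod_ge m _ Hm F).
    rewrite Cmod_div, Cmod_1 by (apply Cmod_gt_0; lra).
    unfold Rdiv; rewrite Rmult_1_l; apply Rinv_le_contravar; lra.
- rewrite Rminus_0_r, Rmult_comm; unfold Rdiv; apply Rmult_le_compat_r.
  + left; apply Rinv_0_lt_compat; lra.
  + apply Rabs_le; lra.
Qed.

(** Subtracting [a] in [log_shift_err] cancels the main part of the derivative in [a]: what is left
    is [log(1 + a/w) - (1/2)/(w + a)], of order [1/m]. *)
Lemma log_shift_err_lipschitz (m M a a' : R) (w : C) : 0 < m -> far m (w - RtoC M)%C ->
  Rabs a <= M -> Rabs a' <= M ->
  Cmod (log_shift_err w a - log_shift_err w a')%C <= (M + / 2) / m * Rabs (a - a').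
Proof.
intros Hm Hw Ha Ha'.
apply Rabs_le_between in Ha; apply Rabs_le_between in Ha'.
apply (Cmod_increment_abs (log_shift_err w) (fun t => log_shift w t - RtoC (/ 2) / (w + RtoC t))%C (- M) M).
- lra.
- lra.
- intros t Ht.
  assert (F : far m (w + RtoC t)%C) by (apply far_interval with M; assumption || lra).
  assert (S0 := far_slit m _ Hm F); assert (Z := slit_neq_0 _ S0).
  eapply Cderiv_eq.
  + unfold log_shift_err, log_shift; apply Cderiv_minus; [| apply Cderiv_id].
    apply Cderiv_mult.
    * apply Cderiv_minus; [| apply Cderiv_const].
      apply Cderiv_plus; [apply Cderiv_const | apply Cderiv_id].
    * apply Cderiv_minus; [| apply Cderiv_const].
      apply (Cderiv_Clog (fun t => w + RtoC t)%C); [assumption |].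
      apply Cderiv_plus; [apply Cderiv_const | apply Cderiv_id].
  + unfold log_shift; cbv beta; field; assumption.
- intros t Ht.
  assert (F : far m (w + RtoC t)%C) by (apply far_interval with M; assumption || lra).
  assert (F0 := far_Cmod_ge m _ Hm F).
  apply Rle_trans with (1 := Cmod_minus_le _ _).
  unfold Rdiv; rewrite Rmult_plus_distr_r; apply Rplus_le_compat.
  + apply log_shift_bound; try assumption; apply Rabs_le; lra.
  + rewrite Cmod_div by (apply Cmod_gt_0; lra); rewrite Cmod_R, Rabs_pos_eq by lra.
    apply Rmult_le_compat_l; [lra | apply Rinv_le_contravar; lra].
Qed.

Lemma log_shift_err_0 (w : C) : log_shift_err w 0 = 0%C.
Proof.
unfold log_shift_err, log_shift; replace (w + RtoC 0)%C with w by ring; ring.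
Qed.

(** [T] depends on [delta] and [M] only. The decay in [m], for the size as well as for the Lipschitz
    constant in [a], is the error [O(1/dist)] of Stirling's formula. *)
Lemma stirling_err_estimates (delta M : R) : 0 < delta -> 0 <= M -> exists T, 0 < T /\
  forall A m s, 0 < A -> delta <= m -> slit s -> far m (RtoC A * s - RtoC M)%C ->
  (forall a, Rabs a <= M -> Cmod (stirling_err A a s) <= T / m) /\
  (forall a a', Rabs a <= M -> Rabs a' <= M -> Rabs (a - a') <= 1 ->
     Cmod (stirling_err A a s - stirling_err A a' s)%C <= T / m * Rabs (a - a')).
Proof.
intros Hd HM.
set (c := 1 + 2 / delta).
assert (Hc : 0 < 2 / delta) by (apply Rdiv_lt_0_compat; lra).
assert (H8 : 0 < 8 / delta) by (apply Rdiv_lt_0_compat; lra).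
assert (Hc2 : 0 < c ^ 2) by (apply pow_lt; unfold c; lra).
assert (H8c : 0 < 8 / delta * c ^ 2) by (apply Rmult_lt_0_compat; assumption).
exists ((M + / 2) * M + (M + / 2) + 2 * c ^ 2 + 8 / delta * c ^ 2).
split; [nra |].
intros A m s HA Hm Hs Hw; assert (Hm0 : 0 < m) by lra.
assert (Him : 0 < / m) by (apply Rinv_0_lt_compat; lra).
(* The parameters are ordered because the Lipschitz bound for Gudermann's sum concerns shifts to the
   right; symmetry gives the general case. *)
assert (Lip : forall a a', Rabs a <= M -> Rabs a' <= M -> a' <= a -> a - a' <= 1 ->
     Cmod (stirling_err A a s - stirling_err A a' s)%C <= ((M + / 2) + 8 / delta * c ^ 2) / m * (a - a')).
{ intros a a' Ha Ha' Hle H1.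
  rewrite !stirling_err_split by assumption.
  set (w := (RtoC A * s)%C) in *.
  replace (log_shift_err w a + gud_sum (w + RtoC a) - (log_shift_err w a' + gud_sum (w + RtoC a')))%C
   with ((log_shift_err w a - log_shift_err w a') + (gud_sum (w + RtoC a) - gud_sum (w + RtoC a')))%C by ring.
  apply Rle_trans with (1 := Cmod_triangle _ _).
  assert (I1 := log_shift_err_lipschitz m M a a' w Hm0 Hw Ha Ha').
  rewrite Rabs_pos_eq in I1 by lra.
  replace (w + RtoC a)%C with (w + RtoC a' + RtoC (a - a'))%C by (rewrite RtoC_minus; ring).
  apply Rabs_le_between in Ha'.
  assert (I2 := gud_sum_lipschitz delta m (a - a') (w + RtoC a')).
  fold c in I2.
  eapply Rle_trans; [apply Rplus_le_compat; [exact I1 | apply I2] |].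
  - lra.
  - apply far_interval with M; [assumption | lra].
  - lra.
  - right; unfold Rdiv; ring. }
split.
- intros a Ha; rewrite stirling_err_split by assumption.
  set (w := (RtoC A * s)%C) in *.
  assert (I1 : Cmod (log_shift_err w a) <= (M + / 2) / m * M).
  { assert (I := log_shift_err_lipschitz m M a 0 w Hm0 Hw Ha).
    rewrite log_shift_err_0, Rminus_0_r in I.
    replace (log_shift_err w a - 0)%C with (log_shift_err w a) in I by ring.
    apply Rle_trans with ((M + / 2) / m * Rabs a).
    - apply I; rewrite Rabs_R0; assumption.
    - apply Rmult_le_compat_l; [| assumption]. apply Rdiv_le_0_compat; lra. }
  assert (I2 : Cmod (gud_sum (w + RtoC a)) <= 2 * c ^ 2 / m).
  { apply gud_sum_bound; [lra |]; apply Rabs_le_between in Ha; apply far_interval with M; [assumption | lra]. }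
  apply Rle_trans with (1 := Cmod_triangle _ _).
  unfold Rdiv in *; nra.
- intros a a' Ha Ha' Hd1.
  assert (K : ((M + / 2) + 8 / delta * c ^ 2) / m <= ((M + / 2) * M + (M + / 2) + 2 * c ^ 2 + 8 / delta * c ^ 2) / m).
  { unfold Rdiv at 1 3; apply Rmult_le_compat_r; [lra | nra]. }
  destruct (Rle_dec a' a) as [H | H].
  + rewrite Rabs_pos_eq in * by lra.
    apply Rle_trans with (1 := Lip a a' Ha Ha' H Hd1); apply Rmult_le_compat_r; lra.
  + rewrite Cmod_minus_sym; rewrite Rabs_left in * by lra.
    replace (- (a - a')) with (a' - a) in * by ring.
    apply Rle_trans with (1 := Lip a' a Ha' Ha ltac:(lra) Hd1); apply Rmult_le_compat_r; lra.
Qed.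

Definition hkernel (p q : nat) (A a B b : nat -> R) (s : C) : C :=
  (prodC p (fun k => Cgamma (RtoC (A k) * s + RtoC (a k))) *
   prodC q (fun j => rgamma (RtoC (B j) * s + RtoC (b j))))%C.

Definition log_rho (p q : nat) (A B : nat -> R) : R :=
  sumR p (fun k => A k * ln (A k)) - sumR q (fun j => B j * ln (B j)).

Definition log_nu (p q : nat) (A B a b : nat -> R) : R :=
  (INR p - INR q) * (ln (2 * PI) / 2)
  + sumR p (fun k => (a k - / 2) * ln (A k)) - sumR q (fun j => (b j - / 2) * ln (B j)).

Definition theta (p q : nat) (A a B b : nat -> R) (s : C) : C :=
  (sumC p (fun k => stirling_err (A k) (a k) s) - sumC q (fun j => stirling_err (B j) (b j) s))%C.

Lemma prodR_exp n (f g : nat -> R) : (forall k, (k < n)%nat -> f k = exp (g k)) -> prodR n f = exp (sumR n g).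
Proof.
induction n as [| n IH]; intros H; simpl; [symmetry; apply exp_0 |].
rewrite IH, H, exp_plus by auto with arith; reflexivity.
Qed.

Lemma sumR_opp n f : sumR n (fun k => - f k) = - sumR n f.
Proof. induction n as [| n IH]; simpl; [ring |]; rewrite IH; ring. Qed.

Lemma rho_exp p q A B : rho p q A B = exp (log_rho p q A B).
Proof.
unfold rho, log_rho, Rminus; rewrite exp_plus, <- sumR_opp.
f_equal; apply prodR_exp; intros; unfold Rpower; f_equal; ring.
Qed.

Lemma nu_star_exp p q A B a b : nu_star p q A B a b = exp (log_nu p q A B a b).
Proof.
unfold nu_star, log_nu, Rminus; rewrite !exp_plus, <- sumR_opp.
f_equal; [f_equal |].
- unfold Rpower; f_equal; field.
- apply prodR_exp; intros; unfold Rpower; f_equal; field.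
- apply prodR_exp; intros; unfold Rpower; f_equal; field.
Qed.

Lemma prodC_Cexp n (f g : nat -> C) : (forall k, (k < n)%nat -> f k = Cexp (g k)) -> prodC n f = Cexp (sumC n g).
Proof.
induction n as [| n IH]; intros H; simpl; [symmetry; apply Cexp_0 |].
rewrite IH, H, Cexp_plus by auto with arith; reflexivity.
Qed.

Lemma sumC_opp n (f : nat -> C) : sumC n (fun k => - f k)%C = (- sumC n f)%C.
Proof. induction n as [| n IH]; simpl; [ring |]; rewrite IH; ring. Qed.

Lemma sum_LogGamma n (A a : nat -> R) (s : C) :
  sumC n (fun k => LogGamma (RtoC (A k) * s + RtoC (a k))) =
  (s * Clog s * RtoC (sumR n A) + Clog s * RtoC (sumR n a - INR n / 2)
   + s * RtoC (sumR n (fun k => A k * ln (A k))%R)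
   + RtoC (sumR n (fun k => (a k - / 2) * ln (A k))%R) - s * RtoC (sumR n A)
   + RtoC (INR n * (ln (2 * PI) / 2)) + sumC n (fun k => stirling_err (A k) (a k) s))%C.
Proof.
induction n as [| n IH].
- simpl; replace (0 - 0 / 2) with 0 by field; rewrite Rmult_0_l; ring.
- change (sumC (S n) (fun k => LogGamma (RtoC (A k) * s + RtoC (a k)))) with
   (sumC n (fun k => LogGamma (RtoC (A k) * s + RtoC (a k))) + LogGamma (RtoC (A n) * s + RtoC (a n)))%C.
  change (sumC (S n) (fun k => stirling_err (A k) (a k) s)) with
   (sumC n (fun k => stirling_err (A k) (a k) s) + stirling_err (A n) (a n) s)%C.
  rewrite IH, S_INR; simpl sumR.
  unfold stirling_err at 3.
  set (c0 := ln (2 * PI) / 2).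
  replace (sumR n a + a n - (INR n + 1) / 2) with ((sumR n a - INR n / 2) + (a n - / 2)) by field.
  replace ((INR n + 1) * c0) with (INR n * c0 + c0) by ring.
  rewrite !RtoC_plus, !RtoC_mult, !RtoC_minus; ring.
Qed.

(** In the sum of the logarithms, [s log s] and [-s] carry the coefficient [sum A - sum B], which is
    zero by balance. The surviving terms regroup into [nu], [rho^s], [s^(-mu)] and the error
    [theta]. *)
Lemma hkernel_asymptotic p q A a B b (s : C) (m : R) :
  sumR q B - sumR p A = 0 -> 0 < m ->
  (forall k, (k < p)%nat -> far m (RtoC (A k) * s + RtoC (a k))%C) ->
  (forall j, (j < q)%nat -> far m (RtoC (B j) * s + RtoC (b j))%C) ->
  hkernel p q A a B b s =
  Cexp (RtoC (log_nu p q A B a b) + RtoC (log_rho p q A B) * s - RtoC (mu p q a b) * Clog s + theta p q A a B b s)%C.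
Proof.
intros Hbal Hm HA HB; unfold hkernel.
rewrite (prodC_Cexp p _ (fun k => LogGamma (RtoC (A k) * s + RtoC (a k)))).
2: { intros k Hk; apply Cgamma_LogGamma with m; auto. }
rewrite (prodC_Cexp q _ (fun k => - LogGamma (RtoC (B k) * s + RtoC (b k)))%C).
2: { intros k Hk; apply rgamma_LogGamma with m; auto. }
rewrite <- Cexp_plus, sumC_opp, !sum_LogGamma; f_equal.
unfold log_nu, log_rho, mu, theta.
replace (sumR q B) with (sumR p A) by lra.
replace (sumR q b - sumR p a + (INR p - INR q) / 2) with ((sumR q b - INR q / 2) - (sumR p a - INR p / 2)) by field.
replace ((INR p - INR q) * (ln (2 * PI) / 2)) with (INR p * (ln (2 * PI) / 2) - INR q * (ln (2 * PI) / 2)) by ring.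
rewrite !RtoC_minus, !RtoC_plus, !RtoC_minus; ring.
Qed.

Lemma sumC_Cmod_le n (f : nat -> C) (M : R) : (forall k, (k < n)%nat -> Cmod (f k) <= M) -> Cmod (sumC n f) <= INR n * M.
Proof.
induction n as [| n IH]; intros H; [simpl; rewrite Cmod_0; lra |].
rewrite S_INR; simpl sumC; apply Rle_trans with (1 := Cmod_triangle _ _).
assert (H1 := H n (Nat.lt_succ_diag_r n)); assert (H2 : Cmod (sumC n f) <= INR n * M) by (apply IH; auto with arith).
lra.
Qed.

(** The conditions on [s] refer to [A s - M], the leftmost shift allowed: a single condition then
    serves for all parameters bounded by [M]. *)
Lemma theta_estimates (p q : nat) (A B : nat -> R) (delta M : R) :
  (forall k, (k < p)%nat -> 0 < A k) -> (forall j, (j < q)%nat -> 0 < B j) ->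
  0 < delta -> 0 <= M -> exists T, 0 < T /\
  forall m s, delta <= m -> slit s ->
  (forall k, (k < p)%nat -> far m (RtoC (A k) * s - RtoC M)%C) ->
  (forall j, (j < q)%nat -> far m (RtoC (B j) * s - RtoC M)%C) ->
  forall a b, (forall k, (k < p)%nat -> Rabs (a k) <= M) -> (forall j, (j < q)%nat -> Rabs (b j) <= M) ->
  Cmod (theta p q A a B b s) <= T / m /\
  forall a' b' d, (forall k, (k < p)%nat -> Rabs (a' k) <= M) -> (forall j, (j < q)%nat -> Rabs (b' j) <= M) ->
  0 <= d <= 1 -> (forall k, (k < p)%nat -> Rabs (a k - a' k) <= d) -> (forall j, (j < q)%nat -> Rabs (b j - b' j) <= d) ->
  Cmod (theta p q A a B b s - theta p q A a' B b' s)%C <= T / m * d.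
Proof.
intros HA HB Hd HM; destruct (stirling_err_estimates delta M Hd HM) as [T [HT H]].
assert (Hp := pos_INR p); assert (Hq := pos_INR q).
exists ((INR p + INR q + 1) * T); split; [nra |].
intros m s Hm Hs FA FB a b Ha Hb.
assert (Hm0 : 0 < / m) by (apply Rinv_0_lt_compat; lra).
assert (HTm : 0 < T / m) by (unfold Rdiv; nra).
replace ((INR p + INR q + 1) * T / m) with ((INR p + INR q + 1) * (T / m)) by (unfold Rdiv; ring).
split.
- unfold theta; apply Rle_trans with (1 := Cmod_minus_le _ _).
  assert (H1 : Cmod (sumC p (fun k => stirling_err (A k) (a k) s)) <= INR p * (T / m)).
  { apply sumC_Cmod_le; intros k Hk; destruct (H (A k) m s) as [H0 _]; auto. }
  assert (H2 : Cmod (sumC q (fun k => stirling_err (B k) (b k) s)) <= INR q * (T / m)).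
  { apply sumC_Cmod_le; intros k Hk; destruct (H (B k) m s) as [H0 _]; auto. }
  lra.
- intros a' b' d Ha' Hb' Hd1 Da Db; unfold theta.
  replace (sumC p (fun k => stirling_err (A k) (a k) s) - sumC q (fun j => stirling_err (B j) (b j) s) -
    (sumC p (fun k => stirling_err (A k) (a' k) s) - sumC q (fun j => stirling_err (B j) (b' j) s)))%C with
   ((sumC p (fun k => stirling_err (A k) (a k) s) - sumC p (fun k => stirling_err (A k) (a' k) s)) -
    (sumC q (fun k => stirling_err (B k) (b k) s) - sumC q (fun k => stirling_err (B k) (b' k) s)))%C by ring.
  rewrite !sumC_minus; apply Rle_trans with (1 := Cmod_minus_le _ _).
  assert (H1 : Cmod (sumC p (fun k => stirling_err (A k) (a k) s - stirling_err (A k) (a' k) s)%C) <= INR p * (T / m * d)).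
  { apply sumC_Cmod_le; intros k Hk; destruct (H (A k) m s) as [_ H0]; auto.
    apply Rle_trans with (T / m * Rabs (a k - a' k)).
    - apply H0; auto; apply Rle_trans with d; auto; lra.
    - apply Rmult_le_compat_l; [lra | auto]. }
  assert (H2 : Cmod (sumC q (fun k => stirling_err (B k) (b k) s - stirling_err (B k) (b' k) s)%C) <= INR q * (T / m * d)).
  { apply sumC_Cmod_le; intros k Hk; destruct (H (B k) m s) as [_ H0]; auto.
    apply Rle_trans with (T / m * Rabs (b k - b' k)).
    - apply H0; auto; apply Rle_trans with d; auto; lra.
    - apply Rmult_le_compat_l; [lra | auto]. }
  assert (0 <= T / m * d) by nra; nra.
Qed.

(** * Cauchy's theorem on rectangles *)

Definition cont2 (f : C -> C) (s : C) : Prop :=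
  continuity_2d_pt (fun x y => Re (f (x, y))) (Re s) (Im s) /\
  continuity_2d_pt (fun x y => Im (f (x, y))) (Re s) (Im s).

Lemma cont2_const c s : cont2 (fun _ => c) s.
Proof. split; apply continuity_2d_pt_const. Qed.

Lemma cont2_id s : cont2 (fun s => s) s.
Proof. split; [apply continuity_2d_pt_id1 | apply continuity_2d_pt_id2]. Qed.

Lemma cont2_plus f g s : cont2 f s -> cont2 g s -> cont2 (fun s => f s + g s)%C s.
Proof.
intros [F1 F2] [G1 G2]; split; simpl.
- apply (continuity_2d_pt_plus (fun x y => Re (f (x, y))) (fun x y => Re (g (x, y)))); assumption.
- apply (continuity_2d_pt_plus (fun x y => Im (f (x, y))) (fun x y => Im (g (x, y)))); assumption.
Qed.

Lemma cont2_mult f g s : cont2 f s -> cont2 g s -> cont2 (fun s => f s * g s)%C s.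
Proof.
intros [F1 F2] [G1 G2]; split; simpl.
- apply (continuity_2d_pt_minus (fun x y => Re (f (x, y)) * Re (g (x, y))) (fun x y => Im (f (x, y)) * Im (g (x, y))));
   apply continuity_2d_pt_mult; assumption.
- apply (continuity_2d_pt_plus (fun x y => Re (f (x, y)) * Im (g (x, y))) (fun x y => Im (f (x, y)) * Re (g (x, y))));
   apply continuity_2d_pt_mult; assumption.
Qed.

Lemma cont2_opp f s : cont2 f s -> cont2 (fun s => - f s)%C s.
Proof.
intros [F1 F2]; split; simpl; apply continuity_2d_pt_opp; assumption.
Qed.

Lemma cont2_inv (f : C -> C) s : f s <> 0%C -> cont2 f s -> cont2 (fun s => / f s)%C s.
Proof.
intros H [F1 F2].
assert (Hn := Cnorm2_pos _ H); rewrite (surjective_pairing s) in Hn.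
assert (N : continuity_2d_pt (fun x y => / (Re (f (x, y)) ^ 2 + Im (f (x, y)) ^ 2)) (Re s) (Im s)).
{ apply continuity_2d_pt_inv; [| unfold Re, Im in *; lra].
  apply (continuity_2d_pt_ext (fun x y => Re (f (x, y)) * Re (f (x, y)) + Im (f (x, y)) * Im (f (x, y)))).
  - intros; ring.
  - apply continuity_2d_pt_plus; apply continuity_2d_pt_mult; assumption. }
split; simpl.
- apply (continuity_2d_pt_mult (fun x y => Re (f (x, y)))); assumption.
- apply (continuity_2d_pt_mult (fun x y => - Im (f (x, y)))); [apply continuity_2d_pt_opp |]; assumption.
Qed.

Lemma cont2_Cexp f s : cont2 f s -> cont2 (fun s => Cexp (f s)) s.
Proof.
intros [F1 F2].
assert (E : continuity_2d_pt (fun x y => exp (Re (f (x, y)))) (Re s) (Im s)).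
{ apply continuity_1d_2d_pt_comp; [apply derivable_continuous_pt, derivable_pt_exp | assumption]. }
assert (CO : continuity_2d_pt (fun x y => cos (Im (f (x, y)))) (Re s) (Im s)).
{ apply continuity_1d_2d_pt_comp; [apply continuity_cos | assumption]. }
assert (SI : continuity_2d_pt (fun x y => sin (Im (f (x, y)))) (Re s) (Im s)).
{ apply continuity_1d_2d_pt_comp; [apply continuity_sin | assumption]. }
split; apply continuity_2d_pt_mult; assumption.
Qed.

(** The Cauchy-Riemann equations are encoded by a common [f'] for both directions. Joint continuity
    of [f] and [f'] gives what differentiation under the integral sign requires. *)
Definition holo_at (f f' : C -> C) (s : C) : Prop :=
  Cderiv (fun t => f (t, Im s)) (Re s) (f' s) /\
  Cderiv (fun t => f (Re s, t)) (Im s) (Ci * f' s)%C /\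
  cont2 f s /\ cont2 f' s.

Definition holo (D : C -> Prop) (f : C -> C) : Prop :=
  exists f', forall s, D s -> holo_at f f' s.

Lemma C_eta (s : C) : (Re s, Im s) = s.
Proof. destruct s; reflexivity. Qed.

Lemma holo_const D c : holo D (fun _ => c).
Proof.
exists (fun _ => RtoC 0); intros s _; split; [| split; [| split]].
- apply Cderiv_const.
- apply Cderiv_eq with (RtoC 0); [apply Cderiv_const | ring].
- apply cont2_const.
- apply cont2_const.
Qed.

Lemma holo_id D : holo D (fun s => s).
Proof.
exists (fun _ => RtoC 1); intros s _; split; [| split; [| split]].
- split; simpl; [apply (is_derive_id (K := R_AbsRing)) | apply (is_derive_const (V := R_NormedModule))].
- split; simpl.
  + evar_last; [apply (is_derive_const (V := R_NormedModule)) | unfold zero; simpl; ring].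
  + evar_last; [apply (is_derive_id (K := R_AbsRing)) | unfold one; simpl; ring].
- apply cont2_id.
- apply cont2_const.
Qed.

Lemma holo_plus D f g : holo D f -> holo D g -> holo D (fun s => f s + g s)%C.
Proof.
intros [f' Hf] [g' Hg]; exists (fun s => f' s + g' s)%C; intros s Hs.
destruct (Hf s Hs) as [F1 [F2 [F3 F4]]]; destruct (Hg s Hs) as [G1 [G2 [G3 G4]]].
split; [| split; [| split]].
- apply Cderiv_plus; assumption.
- eapply Cderiv_eq; [apply Cderiv_plus; eassumption | ring].
- apply cont2_plus; assumption.
- apply cont2_plus; assumption.
Qed.

Lemma holo_mult D f g : holo D f -> holo D g -> holo D (fun s => f s * g s)%C.
Proof.
intros [f' Hf] [g' Hg]; exists (fun s => f' s * g s + f s * g' s)%C; intros s Hs.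
destruct (Hf s Hs) as [F1 [F2 [F3 F4]]]; destruct (Hg s Hs) as [G1 [G2 [G3 G4]]].
split; [| split; [| split]].
- eapply Cderiv_eq; [apply Cderiv_mult; eassumption |]; cbv beta; rewrite C_eta; reflexivity.
- eapply Cderiv_eq; [apply Cderiv_mult; eassumption |]; cbv beta; rewrite C_eta; ring.
- apply cont2_mult; assumption.
- apply cont2_plus; apply cont2_mult; assumption.
Qed.

Lemma holo_inv D (f : C -> C) : (forall s, D s -> f s <> 0%C) -> holo D f -> holo D (fun s => / f s)%C.
Proof.
intros H0 [f' Hf]; exists (fun s => - (f' s * / (f s * f s)))%C; intros s Hs.
destruct (Hf s Hs) as [F1 [F2 [F3 F4]]]; specialize (H0 s Hs).
split; [| split; [| split]].
- eapply Cderiv_eq; [apply Cderiv_inv; [rewrite C_eta; assumption | eassumption] |].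
  cbv beta; rewrite C_eta; reflexivity.
- eapply Cderiv_eq; [apply Cderiv_inv; [rewrite C_eta; assumption | eassumption] |].
  cbv beta; rewrite C_eta; field; assumption.
- apply cont2_inv; assumption.
- apply cont2_opp, cont2_mult; [assumption |]; apply (cont2_inv (fun s => f s * f s)%C).
  + intros E; apply Cmod_gt_0 in H0; assert (E2 := f_equal Cmod E); rewrite Cmod_mult, Cmod_0 in E2; nra.
  + apply cont2_mult; assumption.
Qed.

Lemma holo_Cexp D f : holo D f -> holo D (fun s => Cexp (f s)).
Proof.
intros [f' Hf]; exists (fun s => f' s * Cexp (f s))%C; intros s Hs.
destruct (Hf s Hs) as [F1 [F2 [F3 F4]]].
split; [| split; [| split]].
- eapply Cderiv_eq; [apply Cderiv_Cexp; eassumption |]; cbv beta; rewrite C_eta; reflexivity.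
- eapply Cderiv_eq; [apply Cderiv_Cexp; eassumption |]; cbv beta; rewrite C_eta; ring.
- apply cont2_Cexp; assumption.
- apply cont2_mult; [assumption | apply cont2_Cexp; assumption].
Qed.

Lemma holo_ext D f g : (forall s, f s = g s) -> holo D f -> holo D g.
Proof.
intros E [f' Hf]; exists f'; intros s Hs.
destruct (Hf s Hs) as [F1 [F2 [[F3 F3'] F4]]].
split; [| split; [| split]]; try assumption.
- apply Cderiv_ext with (2 := F1); intros; apply E.
- apply Cderiv_ext with (2 := F2); intros; apply E.
- split; [eapply continuity_2d_pt_ext; [| exact F3] | eapply continuity_2d_pt_ext; [| exact F3']];
  intros; cbv beta; rewrite E; reflexivity.
Qed.

Lemma holo_prodC D n (f : nat -> C -> C) : (forall k, (k < n)%nat -> holo D (f k)) ->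
  holo D (fun s => prodC n (fun k => f k s)).
Proof.
induction n as [| n IH]; intros H; [exact (holo_const D (RtoC 1)) |].
apply (holo_mult D (fun s => prodC n (fun k => f k s)) (f n)).
- apply IH; intros k Hk; apply H; lia.
- apply H; lia.
Qed.

(** The imaginary part of Cauchy's theorem for a rectangle: horizontal sides contribute [Im f] and
    vertical ones, where [ds = i dy], contribute [Re f]. The real part is the same identity for
    [i f]. As it involves integrals of [f] only, it passes to uniform limits. *)
Definition rect_identity (f : C -> C) (x1 x2 y1 y2 : R) : Prop :=
  exists l1 l2 l3 l4,
  is_RInt (fun t => Im (f (t, y1))) x1 x2 l1 /\ is_RInt (fun y => Re (f (x2, y))) y1 y2 l2 /\
  is_RInt (fun y => Re (f (x1, y))) y1 y2 l3 /\ is_RInt (fun t => Im (f (t, y2))) x1 x2 l4 /\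
  l1 + l2 = l3 + l4.

Lemma Cderiv_ex_RInt (f f' : R -> C) a b : (forall t, Rmin a b <= t <= Rmax a b -> Cderiv f t (f' t)) ->
  ex_RInt (fun t => Re (f t)) a b /\ ex_RInt (fun t => Im (f t)) a b.
Proof.
intros H; split; apply (ex_RInt_continuous (V := R_CompleteNormedModule)); intros t Ht;
  destruct (H t Ht) as [H1 H2];
  apply (ex_derive_continuous (K := R_AbsRing) (V := R_NormedModule)); eexists; eassumption.
Qed.

Lemma continuity_2d_continuous_1 (f : R -> R -> R) x y : continuity_2d_pt f x y -> continuous (fun t => f t y) x.
Proof.
intros H; apply continuity_pt_filterlim, continuity_pt_locally; intros eps.
destruct (H eps) as [d Hd]; exists d; intros u Hu.
apply Hd; [exact Hu | rewrite Rminus_diag, Rabs_R0; apply cond_pos].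
Qed.

Lemma continuity_2d_continuous_2 (f : R -> R -> R) x y : continuity_2d_pt f x y -> continuous (fun t => f x t) y.
Proof.
intros H; apply continuity_pt_filterlim, continuity_pt_locally; intros eps.
destruct (H eps) as [d Hd]; exists d; intros u Hu.
apply Hd; [rewrite Rminus_diag, Rabs_R0; apply cond_pos | exact Hu].
Qed.

(* Differentiating in y the integral of Im f along a horizontal segment, the
   Cauchy-Riemann equation turns the derivative into an increment of Re f. *)
Lemma holo_rect (f : C -> C) (x1 x2 y1 y2 e : R) : x1 <= x2 -> y1 <= y2 -> 0 < e ->
  holo (fun s => x1 - e <= Re s <= x2 + e /\ y1 - e <= Im s <= y2 + e) f ->
  rect_identity f x1 x2 y1 y2.
Proof.
intros Hx Hy He [f' Hf].
assert (Hf1 : forall x y, x1 - e <= x <= x2 + e -> y1 - e <= y <= y2 + e -> holo_at f f' (x, y)).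
{ intros x y H1 H2; apply Hf; simpl; auto. }
set (J := fun y => RInt (fun t => Im (f (t, y))) x1 x2).
assert (XR : forall x, x1 - e <= x <= x2 + e -> ex_RInt (fun y => Re (f (x, y))) y1 y2).
{ intros x Hx0; apply (Cderiv_ex_RInt (fun y => f (x, y)) (fun y => Ci * f' (x, y))%C).
  rewrite Rmin_left, Rmax_right by lra; intros t Ht; apply (Hf1 x t); lra. }
assert (XI : forall y, y1 - e <= y <= y2 + e -> ex_RInt (fun t => Im (f (t, y))) x1 x2).
{ intros y Hy0; apply (Cderiv_ex_RInt (fun t => f (t, y)) (fun t => f' (t, y))).
  rewrite Rmin_left, Rmax_right by lra; intros t Ht; apply (Hf1 t y); lra. }
assert (DJ : forall y, y1 <= y <= y2 -> is_derive J y (Re (f (x2, y)) - Re (f (x1, y)))).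
{ intros y Hy0.
  assert (LOC : forall (P : R -> Prop), (forall u, y1 - e <= u <= y2 + e -> P u) -> locally y P).
  { intros P HP; exists (mkposreal e He); intros u Hu.
    unfold ball in Hu; simpl in Hu; unfold AbsRing_ball, abs, minus, plus, opp in Hu; simpl in Hu.
    apply Rabs_lt_between in Hu; apply HP; lra. }
  evar_last.
  - apply (is_derive_RInt_param (fun u t => Im (f (t, u))) x1 x2 y).
    + apply LOC; intros u Hu t; rewrite Rmin_left, Rmax_right by lra; intros Ht.
      destruct (Hf1 t u) as [_ [[_ H] _]]; [lra | lra |]; eexists; exact H.
    + rewrite Rmin_left, Rmax_right by lra; intros t Ht.
      apply continuity_2d_pt_ext_loc with (fun u v => Re (f' (v, u))).
      * exists (mkposreal e He); simpl; intros u v Hu Hv.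
        apply Rabs_lt_between in Hu; apply Rabs_lt_between in Hv.
        destruct (Hf1 v u) as [_ [[_ H] _]]; [lra | lra |].
        apply is_derive_unique in H; simpl in H.
        change (Derive (fun z : R => Im (f (v, z))) u = 0 * Im (f' (v, u)) + 1 * Re (f' (v, u))) in H.
        rewrite H; ring.
      * destruct (Hf1 t y) as [_ [_ [_ [H _]]]]; [lra | lra |].
        intros eps; destruct (H eps) as [d Hd]; exists d; intros u v Hu Hv; apply Hd; assumption.
    + apply LOC; intros u Hu; apply XI; assumption.
  - apply (is_RInt_unique (V := R_CompleteNormedModule)).
    apply (is_RInt_ext (fun t => Re (f' (t, y)))).
    + rewrite Rmin_left, Rmax_right by lra; intros t Ht.
      destruct (Hf1 t y) as [_ [[_ H] _]]; [lra | lra |].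
      apply is_derive_unique in H; simpl in H.
      change (Derive (fun z : R => Im (f (t, z))) y = 0 * Im (f' (t, y)) + 1 * Re (f' (t, y))) in H.
      etransitivity; [| symmetry; exact H].
      change (Re (f' (t, y)) = 0 * Im (f' (t, y)) + 1 * Re (f' (t, y))); ring.
    + apply (is_RInt_derive (V := R_CompleteNormedModule) (fun t => Re (f (t, y)))).
      * rewrite Rmin_left, Rmax_right by lra; intros t Ht.
        destruct (Hf1 t y) as [[H _] _]; [lra | lra |]; exact H.
      * rewrite Rmin_left, Rmax_right by lra; intros t Ht.
        destruct (Hf1 t y) as [_ [_ [_ [H _]]]]; [lra | lra |].
        apply (continuity_2d_continuous_1 (fun x y => Re (f' (x, y)))); exact H. }
assert (HJ : is_RInt (fun y => Re (f (x2, y)) - Re (f (x1, y))) y1 y2 (J y2 - J y1)).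
{ apply (is_RInt_derive (V := R_CompleteNormedModule) J).
  - rewrite Rmin_left, Rmax_right by lra; exact DJ.
  - rewrite Rmin_left, Rmax_right by lra; intros y Hy0.
    apply (continuous_minus (V := R_NormedModule) (fun y => Re (f (x2, y))) (fun y => Re (f (x1, y)))).
    + destruct (Hf1 x2 y) as [_ [_ [[H _] _]]]; [lra | lra |].
      apply (continuity_2d_continuous_2 (fun x y => Re (f (x, y)))); exact H.
    + destruct (Hf1 x1 y) as [_ [_ [[H _] _]]]; [lra | lra |].
      apply (continuity_2d_continuous_2 (fun x y => Re (f (x, y)))); exact H. }
assert (R1 := RInt_correct (V := R_CompleteNormedModule) _ _ _ (XR x1 ltac:(lra))).
assert (R2 := RInt_correct (V := R_CompleteNormedModule) _ _ _ (XR x2 ltac:(lra))).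
assert (HJ2 := is_RInt_minus (V := R_NormedModule) _ _ _ _ _ _ R2 R1).
apply (is_RInt_unique (V := R_CompleteNormedModule)) in HJ.
apply (is_RInt_unique (V := R_CompleteNormedModule)) in HJ2.
exists (J y1), (RInt (fun y => Re (f (x2, y))) y1 y2), (RInt (fun y => Re (f (x1, y))) y1 y2), (J y2).
split; [apply (RInt_correct (V := R_CompleteNormedModule)), XI; lra |].
split; [exact R2 |]; split; [exact R1 |].
split; [apply (RInt_correct (V := R_CompleteNormedModule)), XI; lra |].
assert (E : RInt (fun y => Re (f (x2, y)) - Re (f (x1, y))) y1 y2 =
   RInt (fun y => Re (f (x2, y))) y1 y2 - RInt (fun y => Re (f (x1, y))) y1 y2) by exact HJ2.
change (RInt (fun y => Re (f (x2, y)) - Re (f (x1, y))) y1 y2 = J y2 - J y1) in HJ.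
lra.
Qed.

Lemma is_RInt_uniform_limit (f : nat -> R -> R) (g : R -> R) (a b : R) (h : nat -> R) : a <= b ->
  (forall n, is_RInt (f n) a b (h n)) ->
  (forall eps, 0 < eps -> exists N, forall n, (N <= n)%nat -> forall t, a <= t <= b -> Rabs (f n t - g t) < eps) ->
  exists l : R, is_lim_seq h l /\ is_RInt g a b l.
Proof.
intros Hab Hf Hu.
(* Uniform convergence on [a, b] becomes global after precomposing with the projection onto [a, b]. *)
set (cl := fun t => Rmax a (Rmin b t)).
assert (Hcl : forall t, a <= cl t <= b).
{ intros t; unfold cl; split; [apply Rmax_l |]; apply Rmax_lub; [assumption | apply Rmin_l]. }
assert (Hid : forall t, a < t < b -> cl t = t).
{ intros t Ht; unfold cl; rewrite Rmin_right, Rmax_right by lra; reflexivity. }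
destruct (filterlim_RInt (V := R_CompleteNormedModule) (fun n t => f n (cl t)) a b eventually _ (fun t => g (cl t)) h) as [l [H1 H2]].
- intros n; apply is_RInt_ext with (f n); [| apply Hf].
  rewrite Rmin_left, Rmax_right by lra; intros t Ht; rewrite Hid by assumption; reflexivity.
- intros P [eps HP].
  destruct (Hu eps (cond_pos eps)) as [N HN]; exists N; intros n Hn; apply HP; intros t.
  apply (HN n Hn (cl t) (Hcl t)).
- exists l; split; [exact H1 |].
  apply is_RInt_ext with (2 := H2).
  rewrite Rmin_left, Rmax_right by lra; intros t Ht; rewrite Hid by assumption; reflexivity.
Qed.

Definition unif_conv (K : C -> Prop) (f : nat -> C -> C) (g : C -> C) : Prop :=
  forall eps, 0 < eps -> exists N, forall n, (N <= n)%nat -> forall s, K s -> Cmod (f n s - g s)%C < eps.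

(** This is how Cauchy's theorem goes from Gauss' products, which are elementary functions, to the
    integrand built from their limits. *)
Lemma rect_identity_limit (f : nat -> C -> C) (g : C -> C) (x1 x2 y1 y2 : R) : x1 <= x2 -> y1 <= y2 ->
  (forall n, rect_identity (f n) x1 x2 y1 y2) ->
  unif_conv (fun s => x1 <= Re s <= x2 /\ y1 <= Im s <= y2) f g ->
  rect_identity g x1 x2 y1 y2.
Proof.
intros Hx Hy Hf Hu.
assert (URe : forall x, x1 <= x <= x2 -> forall eps, 0 < eps -> exists N, forall n, (N <= n)%nat ->
   forall y, y1 <= y <= y2 -> Rabs (Re (f n (x, y)) - Re (g (x, y))) < eps).
{ intros x Hx0 eps He; destruct (Hu eps He) as [N HN]; exists N; intros n Hn y Hy0.
  apply Rle_lt_trans with (2 := HN n Hn (x, y) (conj Hx0 Hy0)).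
  exact (re_le_Cmod (f n (x, y) - g (x, y))). }
assert (UIm : forall y, y1 <= y <= y2 -> forall eps, 0 < eps -> exists N, forall n, (N <= n)%nat ->
   forall x, x1 <= x <= x2 -> Rabs (Im (f n (x, y)) - Im (g (x, y))) < eps).
{ intros y Hy0 eps He; destruct (Hu eps He) as [N HN]; exists N; intros n Hn x Hx0.
  apply Rle_lt_trans with (2 := HN n Hn (x, y) (conj Hx0 Hy0)).
  exact (Rabs_Im_le_Cmod (f n (x, y) - g (x, y))). }
set (h1 := fun n => RInt (fun t => Im (f n (t, y1))) x1 x2).
set (h2 := fun n => RInt (fun y => Re (f n (x2, y))) y1 y2).
set (h3 := fun n => RInt (fun y => Re (f n (x1, y))) y1 y2).
set (h4 := fun n => RInt (fun t => Im (f n (t, y2))) x1 x2).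
assert (H : forall n, is_RInt (fun t => Im (f n (t, y1))) x1 x2 (h1 n) /\ is_RInt (fun y => Re (f n (x2, y))) y1 y2 (h2 n) /\
  is_RInt (fun y => Re (f n (x1, y))) y1 y2 (h3 n) /\ is_RInt (fun t => Im (f n (t, y2))) x1 x2 (h4 n) /\
  h1 n + h2 n = h3 n + h4 n).
{ intros n; destruct (Hf n) as [l1 [l2 [l3 [l4 [P1 [P2 [P3 [P4 E]]]]]]]].
  unfold h1, h2, h3, h4.
  rewrite (is_RInt_unique (V := R_CompleteNormedModule) _ _ _ _ P1), (is_RInt_unique (V := R_CompleteNormedModule) _ _ _ _ P2),
    (is_RInt_unique (V := R_CompleteNormedModule) _ _ _ _ P3), (is_RInt_unique (V := R_CompleteNormedModule) _ _ _ _ P4).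
  auto. }
destruct (is_RInt_uniform_limit (fun n t => Im (f n (t, y1))) (fun t => Im (g (t, y1))) x1 x2 h1 Hx) as [l1 [L1 I1]].
{ intros n; exact (proj1 (H n)). } { apply UIm; lra. }
destruct (is_RInt_uniform_limit (fun n t => Re (f n (x2, t))) (fun t => Re (g (x2, t))) y1 y2 h2 Hy) as [l2 [L2 I2]].
{ intros n; exact (proj1 (proj2 (H n))). } { apply URe; lra. }
destruct (is_RInt_uniform_limit (fun n t => Re (f n (x1, t))) (fun t => Re (g (x1, t))) y1 y2 h3 Hy) as [l3 [L3 I3]].
{ intros n; exact (proj1 (proj2 (proj2 (H n)))). } { apply URe; lra. }
destruct (is_RInt_uniform_limit (fun n t => Im (f n (t, y2))) (fun t => Im (g (t, y2))) x1 x2 h4 Hx) as [l4 [L4 I4]].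
{ intros n; exact (proj1 (proj2 (proj2 (proj2 (H n))))). } { apply UIm; lra. }
exists l1, l2, l3, l4; repeat split; try assumption.
assert (M1 := is_lim_seq_plus' _ _ _ _ L1 L2); assert (M2 := is_lim_seq_plus' _ _ _ _ L3 L4).
apply is_lim_seq_unique in M2.
apply (is_lim_seq_ext _ (fun n => h3 n + h4 n)) in M1; [| intros n; exact (proj2 (proj2 (proj2 (proj2 (H n)))))].
apply is_lim_seq_unique in M1; rewrite M1 in M2; injection M2; auto.
Qed.

(** * Cauchy's theorem for the integrand *)

Lemma poch_neq_0 (z : C) n : 0 < Im z \/ 0 < Re z -> poch z n <> 0%C.
Proof.
intros H; induction n as [| n IH].
- simpl; intros ->; simpl in H; lra.
- change (poch z (S n)) with (poch z n * (z + RtoC (INR (S n))))%C.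
  apply Cmult_neq_0; [assumption |]; intros E.
  assert (E1 := f_equal Re E); assert (E2 := f_equal Im E).
  cbn [Re Im Cplus RtoC fst snd] in E1, E2; unfold Re, Im in *.
  assert (P := pos_INR (S n)); lra.
Qed.

Lemma gauss_neq_0 (z : C) n : 0 < Im z \/ 0 < Re z -> gauss n z <> 0%C.
Proof.
intros H; unfold gauss; apply Cmult_neq_0; [apply poch_neq_0; assumption |].
apply Cmod_gt_0; rewrite Cmod_inv.
- apply Rinv_0_lt_compat, Cmod_gt_0, Cmult_neq_0; [apply RtoC_neq_0, INR_fact_neq_0 |].
  rewrite cpowR_Cexp; apply Cexp_neq_0.
- apply Cmult_neq_0; [apply RtoC_neq_0, INR_fact_neq_0 |].
  rewrite cpowR_Cexp; apply Cexp_neq_0.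
Qed.

Lemma holo_gauss D (f : C -> C) n : holo D f -> holo D (fun s => gauss n (f s)).
Proof.
intros Hf; unfold gauss, Cdiv.
apply (holo_mult D (fun s => poch (f s) n) (fun s => / (RtoC (INR (fact n)) * cpowR (INR n) (f s)))%C).
- induction n as [| n IH]; [exact Hf |].
  apply (holo_mult D (fun s => poch (f s) n) (fun s => f s + RtoC (INR (S n)))%C); [exact IH |].
  apply holo_plus; [exact Hf | apply holo_const].
- apply (holo_inv D (fun s => RtoC (INR (fact n)) * cpowR (INR n) (f s))%C).
  + intros s _; apply Cmult_neq_0; [apply RtoC_neq_0, INR_fact_neq_0 |].
    rewrite cpowR_Cexp; apply Cexp_neq_0.
  + apply holo_mult; [apply holo_const |].
    apply (holo_ext D (fun s => Cexp (RtoC (ln (INR n)) * f s))).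
    * intros s; symmetry; apply cpowR_Cexp.
    * apply holo_Cexp, holo_mult; [apply holo_const | exact Hf].
Qed.

Lemma holo_affine D (A a : R) : holo D (fun s => RtoC A * s + RtoC a)%C.
Proof.
apply holo_plus; [| apply holo_const]; apply holo_mult; [apply holo_const | apply holo_id].
Qed.

Lemma unif_conv_const K (g : C -> C) : unif_conv K (fun _ => g) g.
Proof.
intros eps He; exists 0%nat; intros n _ s _.
replace (g s - g s)%C with (RtoC 0) by ring; rewrite Cmod_0; assumption.
Qed.

Lemma unif_conv_mult K f f0 g g0 (M : R) : 0 <= M ->
  (forall s, K s -> Cmod (f0 s) <= M) -> (forall s, K s -> Cmod (g0 s) <= M) ->
  unif_conv K f f0 -> unif_conv K g g0 ->
  unif_conv K (fun n s => f n s * g n s)%C (fun s => f0 s * g0 s)%C.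
Proof.
intros HM Bf Bg Uf Ug eps He.
set (e := Rmin 1 (eps / (2 * M + 2))).
assert (Hq : 0 < eps / (2 * M + 2)) by (apply Rdiv_lt_0_compat; lra).
assert (He' : 0 < e) by (apply Rmin_pos; lra).
destruct (Uf e He') as [N1 H1]; destruct (Ug e He') as [N2 H2].
exists (max N1 N2); intros n Hn s Hs.
specialize (H1 n ltac:(lia) s Hs); specialize (H2 n ltac:(lia) s Hs).
specialize (Bf s Hs); specialize (Bg s Hs).
assert (e1 : e <= 1) by apply Rmin_l; assert (e2 : e <= eps / (2 * M + 2)) by apply Rmin_r.
replace (f n s * g n s - f0 s * g0 s)%C with
  ((f n s - f0 s) * (g n s - g0 s) + (f n s - f0 s) * g0 s + f0 s * (g n s - g0 s))%C by ring.
assert (T1 := Cmod_triangle ((f n s - f0 s) * (g n s - g0 s) + (f n s - f0 s) * g0 s) (f0 s * (g n s - g0 s))).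
assert (T2 := Cmod_triangle ((f n s - f0 s) * (g n s - g0 s)) ((f n s - f0 s) * g0 s)).
rewrite (Cmod_mult (f0 s)) in T1; rewrite !(Cmod_mult (f n s - f0 s)) in T2.
set (u := Cmod (f n s - f0 s)) in *; set (v := Cmod (g n s - g0 s)) in *.
assert (0 <= u) by apply Cmod_ge_0; assert (0 <= v) by apply Cmod_ge_0.
assert (0 <= Cmod (f0 s)) by apply Cmod_ge_0; assert (0 <= Cmod (g0 s)) by apply Cmod_ge_0.
assert (u * v <= e * 1) by (apply Rmult_le_compat; lra).
assert (u * Cmod (g0 s) <= e * M) by (apply Rmult_le_compat; lra).
assert (Cmod (f0 s) * v <= M * e) by (apply Rmult_le_compat; lra).
assert (e * (2 * M + 2) <= eps).
{ apply Rle_trans with (eps / (2 * M + 2) * (2 * M + 2)); [apply Rmult_le_compat_r; lra | right; field; lra]. }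
assert (0 < e * 1) by lra.
lra.
Qed.

Lemma unif_conv_inv K f f0 (c : R) : 0 < c -> (forall s, K s -> c <= Cmod (f0 s)) ->
  unif_conv K f f0 -> unif_conv K (fun n s => / f n s)%C (fun s => / f0 s)%C.
Proof.
intros Hc Bf Uf eps He.
set (e := Rmin (c / 2) (eps * (c * c) / 4)).
assert (Hq : 0 < eps * (c * c) / 4) by (assert (0 < c * c) by nra; apply Rdiv_lt_0_compat; [nra | lra]).
assert (He' : 0 < e) by (apply Rmin_pos; lra).
destruct (Uf e He') as [N1 H1].
exists N1; intros n Hn s Hs; specialize (H1 n Hn s Hs); specialize (Bf s Hs).
assert (e1 : e <= c / 2) by apply Rmin_l; assert (e2 : e <= eps * (c * c) / 4) by apply Rmin_r.
assert (T := Cmod_minus_ge (f0 s) (f0 s - f n s)).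
replace (f0 s - (f0 s - f n s))%C with (f n s) in T by ring.
rewrite Cmod_minus_sym in H1.
assert (N0 : f0 s <> 0%C) by (apply Cmod_gt_0; lra).
assert (Nn : f n s <> 0%C) by (apply Cmod_gt_0; lra).
replace (/ f n s - / f0 s)%C with ((f0 s - f n s) * (/ f n s * / f0 s))%C by (field; auto).
rewrite !Cmod_mult, !Cmod_inv by assumption.
assert (I1 : / Cmod (f n s) <= 2 / c).
{ replace (2 / c) with (/ (c / 2)) by (field; lra); apply Rinv_le_contravar; lra. }
assert (I2 : / Cmod (f0 s) <= / c) by (apply Rinv_le_contravar; lra).
assert (P1 : 0 < / Cmod (f n s)) by (apply Rinv_0_lt_compat; lra).
assert (P2 : 0 < / Cmod (f0 s)) by (apply Rinv_0_lt_compat; lra).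
apply Rle_lt_trans with (eps * (c * c) / 4 * (2 / c * / c)).
- apply Rmult_le_compat; [apply Cmod_ge_0 | nra | lra |].
  apply Rmult_le_compat; lra.
- replace (eps * (c * c) / 4 * (2 / c * / c)) with (eps / 2) by (field; lra); lra.
Qed.

(** The bound on the limit product belongs to the induction: multiplying by one more factor
    preserves uniform convergence when both limits are bounded. *)
Lemma unif_conv_prodC K p (f : nat -> nat -> C -> C) (f0 : nat -> C -> C) (M : R) : 0 <= M ->
  (forall k, (k < p)%nat -> (forall s, K s -> Cmod (f0 k s) <= M) /\ unif_conv K (f k) (f0 k)) ->
  (exists M', 0 <= M' /\ forall s, K s -> Cmod (prodC p (fun k => f0 k s)) <= M') /\
  unif_conv K (fun n s => prodC p (fun k => f k n s)) (fun s => prodC p (fun k => f0 k s)).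
Proof.
intros HM; induction p as [| p IH]; intros H.
- split.
  + exists 1; split; [lra |]; intros s _; simpl; rewrite Cmod_1; lra.
  + exact (unif_conv_const K (fun _ => RtoC 1)).
- destruct IH as [[M' [HM' B']] U']; [intros; apply H; lia |].
  destruct (H p ltac:(lia)) as [B U].
  split.
  + exists (M' * M); split; [nra |]; intros s Hs; simpl; rewrite Cmod_mult.
    apply Rmult_le_compat; try apply Cmod_ge_0; auto.
  + apply (unif_conv_mult K (fun n s => prodC p (fun k => f k n s)) (fun s => prodC p (fun k => f0 k s))
      (f p) (f0 p) (M' + M)); auto; [lra | |]; intros s Hs.
    * apply Rle_trans with M'; [auto | lra].
    * apply Rle_trans with M; [auto | lra].
Qed.

Lemma LogGamma_bound (m M : R) : 0 < m -> 0 <= M -> exists K, forall z, far m z -> Cmod z <= M -> Cmod (LogGamma z) <= K.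
Proof.
intros Hm HM.
set (Lg := Rabs (ln m) + Rabs (ln (M + m)) + PI).
assert (H0 : 0 <= Lg).
{ unfold Lg; assert (P := PI_RGT_0); assert (H1 := Rabs_pos (ln m)); assert (H2 := Rabs_pos (ln (M + m))); lra. }
exists ((M + / 2) * Lg + M + Rabs (ln (2 * PI) / 2) + 2 * (1 + 2 / m) ^ 2 / m).
intros z Fz Hz; assert (Hz0 := far_Cmod_ge m z Hm Fz).
assert (HL : Cmod (Clog z) <= Lg).
{ apply Rle_trans with (1 := Cmod_Clog_le z); unfold Lg.
  assert (L1 : ln m <= ln (Cmod z)) by (apply ln_le; lra).
  assert (L2 : ln (Cmod z) <= ln (M + m)) by (apply ln_le; lra).
  assert (Rabs (ln (Cmod z)) <= Rabs (ln m) + Rabs (ln (M + m))); [| lra].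
  assert (H1 := Rle_abs (- ln m)); rewrite Rabs_Ropp in H1; assert (H2 := Rle_abs (ln (M + m))).
  assert (H3 := Rabs_pos (ln m)); assert (H4 := Rabs_pos (ln (M + m))).
  apply Rabs_le; lra. }
unfold LogGamma, stirling_main.
apply Rle_trans with (1 := Cmod_triangle _ _); apply Rplus_le_compat.
2: { apply gud_sum_bound; [lra | assumption]. }
apply Rle_trans with (1 := Cmod_triangle _ _); apply Rplus_le_compat; [| rewrite Cmod_R; lra].
apply Rle_trans with (1 := Cmod_minus_le _ _); apply Rplus_le_compat; [| assumption].
rewrite Cmod_mult; apply Rmult_le_compat; try apply Cmod_ge_0; [| assumption].
apply Rle_trans with (1 := Cmod_minus_le _ _); rewrite Cmod_R, Rabs_pos_eq by lra; lra.
Qed.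

Lemma far_affine (A a m : R) (s : C) : 0 < A -> 0 <= a -> far m s -> far (A * m) (RtoC A * s + RtoC a)%C.
Proof.
intros HA Ha; unfold far.
replace (Re (RtoC A * s + RtoC a)%C) with (A * Re s + a) by (unfold Re; simpl; ring).
replace (Im (RtoC A * s + RtoC a)%C) with (A * Im s) by (unfold Im; simpl; ring).
intros [H | [H1 H2]]; [left | right]; nra.
Qed.

Lemma Cmod_affine_le (A a X : R) (s : C) : Cmod s <= X -> Cmod (RtoC A * s + RtoC a)%C <= Rabs A * X + Rabs a.
Proof.
intros H; apply Rle_trans with (1 := Cmod_triangle _ _); rewrite Cmod_mult, !Cmod_R.
apply Rplus_le_compat_r, Rmult_le_compat_l; [apply Rabs_pos | assumption].
Qed.

Lemma finite_bound (n : nat) (P : nat -> R -> Prop) :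
  (forall k M M', P k M -> M <= M' -> P k M') -> (forall k, (k < n)%nat -> exists M, P k M) ->
  exists M, 0 <= M /\ forall k, (k < n)%nat -> P k M.
Proof.
intros Hmon; induction n as [| n IH]; intros H.
- exists 0; split; [lra |]; intros; lia.
- destruct IH as [M [HM HP]]; [intros; apply H; lia |].
  destruct (H n ltac:(lia)) as [M' HM'].
  exists (Rmax M M'); split; [apply Rle_trans with (1 := HM), Rmax_l |].
  intros k Hk; destruct (Nat.eq_dec k n) as [-> | Hne].
  + apply Hmon with M'; [assumption | apply Rmax_r].
  + apply Hmon with M; [apply HP; lia | apply Rmax_l].
Qed.

Lemma gauss_affine_unif (K : C -> Prop) (X A a : R) : (forall s, K s -> Cmod s <= X) -> 0 <= X ->
  exists M, forall s, K s -> Cmod (rgamma (RtoC A * s + RtoC a)%C) <= M /\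
  unif_conv K (fun n s => gauss n (RtoC A * s + RtoC a)%C) (fun s => rgamma (RtoC A * s + RtoC a)%C).
Proof.
intros HK HX.
assert (HY : 0 <= Rabs A * X + Rabs a) by (assert (H1 := Rabs_pos A); assert (H2 := Rabs_pos a); nra).
destruct (gauss_rgamma _ HY) as [Kb [HKb HB]].
exists Kb; intros s Hs; split; [apply HB, Cmod_affine_le, HK, Hs |].
intros eps He; destruct (nfloor_ex (Kb / eps)) as [N HN]; [apply Rdiv_le_0_compat; lra |].
exists (S N); intros n Hn s' Hs'.
destruct (HB (RtoC A * s' + RtoC a)%C) as [_ [H _]]; [apply Cmod_affine_le, HK, Hs' |].
apply Rle_lt_trans with (1 := H n ltac:(lia)).
apply le_INR in Hn; rewrite S_INR in Hn; assert (0 <= INR N) by apply pos_INR.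
apply Rmult_lt_reg_r with (INR n); [lra |].
rewrite Rmult_assoc, Rinv_l by lra.
replace (Kb * 1) with (Kb / eps * eps) by (field; lra); nra.
Qed.

(** By Stirling's formula both [Gamma] and [1/Gamma] are exponentials of a bounded quantity. The
    lower bound on [1/Gamma] is what permits inverting Gauss' products uniformly. *)
Lemma Cgamma_affine_bound (K : C -> Prop) (X A a m : R) : (forall s, K s -> Cmod s <= X /\ far m s) -> 0 <= X ->
  0 < A -> 0 <= a -> 0 < m ->
  exists M, 0 < M /\ forall s, K s -> Cmod (Cgamma (RtoC A * s + RtoC a)%C) <= M /\ / M <= Cmod (rgamma (RtoC A * s + RtoC a)%C).
Proof.
intros HK HX HA Ha Hm.
assert (HY : 0 <= Rabs A * X + Rabs a) by (assert (H1 := Rabs_pos A); assert (H2 := Rabs_pos a); nra).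
assert (HAm : 0 < A * m) by nra.
destruct (LogGamma_bound (A * m) _ HAm HY) as [L HL].
exists (exp L); split; [apply exp_pos |]; intros s Hs; destruct (HK s Hs) as [H1 H2].
assert (F := far_affine A a m s HA Ha H2).
assert (B := HL _ F (Cmod_affine_le A a X s H1)).
rewrite (Cgamma_LogGamma (A * m)), (rgamma_LogGamma (A * m)), !Cmod_Cexp by assumption.
split; [apply exp_le, Rle_trans with (1 := Re_le_Cmod _), B |].
rewrite <- exp_Ropp; apply exp_le.
assert (R1 := Re_le_Cmod (LogGamma (RtoC A * s + RtoC a))).
change (- L <= - Re (LogGamma (RtoC A * s + RtoC a))); lra.
Qed.

Lemma hintegrand_eq p q A a B b x s :
  hintegrand p q A a B b x s = (hkernel p q A a B b s * Cexp (RtoC (- ln x) * s))%C.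
Proof.
unfold hintegrand, hkernel; rewrite cpowR_Cexp; f_equal; f_equal; rewrite RtoC_opp; ring.
Qed.

(** The hypothesis on [x1] and [y1] keeps the rectangle away from the poles, which for [a >= 0] lie
    on the closed negative axis. The factor [w] is there to be 1 or [i], giving the imaginary or the
    real part of Cauchy's theorem. *)
Lemma hintegrand_rect p q A a B b x (w : C) x1 x2 y1 y2 :
  (forall k, (k < p)%nat -> 0 < A k) -> (forall k, (k < p)%nat -> 0 <= a k) ->
  x1 <= x2 -> y1 <= y2 -> 0 < y1 \/ (0 < x1 /\ 0 <= y1) ->
  rect_identity (fun s => w * hintegrand p q A a B b x s)%C x1 x2 y1 y2.
Proof.
intros HA Ha Hx Hy Hpos.
set (K := fun s : C => x1 <= Re s <= x2 /\ y1 <= Im s <= y2).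
set (fn := fun n s => (prodC p (fun k => / gauss n (RtoC (A k) * s + RtoC (a k))) *
   prodC q (fun j => gauss n (RtoC (B j) * s + RtoC (b j))) * Cexp (RtoC (- ln x) * s))%C).
apply rect_identity_limit with (fun n s => w * fn n s)%C; [assumption | assumption | |].
(* The margin is chosen so that on the enlarged rectangle, too, the real part or the imaginary part
   stays positive and no Gauss product in a denominator vanishes. *)
- assert (He : exists e, 0 < e /\ (0 < y1 - e \/ 0 < x1 - e)).
  { destruct Hpos as [H | [H _]]; [exists (y1 / 2) | exists (x1 / 2)]; lra. }
  destruct He as [e [He He2]].
  intros n; apply holo_rect with e; [assumption | assumption | assumption |].
  apply holo_mult; [apply holo_const |]; apply holo_mult; [apply holo_mult |].
  + apply (holo_prodC _ p (fun k s => / gauss n (RtoC (A k) * s + RtoC (a k)))%C); intros k Hk.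
    apply (holo_inv _ (fun s => gauss n (RtoC (A k) * s + RtoC (a k)))%C).
    * intros s [Hs1 Hs2]; apply gauss_neq_0.
      replace (Re (RtoC (A k) * s + RtoC (a k))%C) with (A k * Re s + a k) by (unfold Re; simpl; ring).
      replace (Im (RtoC (A k) * s + RtoC (a k))%C) with (A k * Im s) by (unfold Im; simpl; ring).
      specialize (HA k Hk); specialize (Ha k Hk).
      destruct He2; [left | right]; nra.
    * apply (holo_gauss _ (fun s => RtoC (A k) * s + RtoC (a k))%C), holo_affine.
  + apply (holo_prodC _ q (fun k s => gauss n (RtoC (B k) * s + RtoC (b k)))); intros k Hk.
    apply (holo_gauss _ (fun s => RtoC (B k) * s + RtoC (b k))%C), holo_affine.
  + apply holo_Cexp, holo_mult; [apply holo_const | apply holo_id].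
- assert (Hm : exists m, 0 < m /\ forall s, K s -> far m s).
  { destruct Hpos as [H | [H1 H2]].
    - exists y1; split; [assumption |]; intros s [H0 H1]; left; lra.
    - exists x1; split; [assumption |]; intros s [H0 H3]; right; lra. }
  destruct Hm as [m [Hm Hfar]].
  set (X := Rabs x1 + Rabs x2 + (Rabs y1 + Rabs y2)).
  assert (HX : 0 <= X).
  { unfold X; assert (Q1 := Rabs_pos x1); assert (Q2 := Rabs_pos x2); assert (Q3 := Rabs_pos y1); assert (Q4 := Rabs_pos y2); lra. }
  assert (HKX : forall s, K s -> Cmod s <= X).
  { intros s [H1 H2]; apply Rle_trans with (1 := Cmod_le_abs s); unfold X.
    assert (Q : forall u v r, u <= r <= v -> Rabs r <= Rabs u + Rabs v).
    { intros u v r Hr; assert (Q1 := Rle_abs v); assert (Q2 := Rle_abs (- u)); rewrite Rabs_Ropp in Q2.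
      assert (Q3 := Rabs_pos u); assert (Q4 := Rabs_pos v); apply Rabs_le; lra. }
    apply Rplus_le_compat; apply Q; assumption. }
  assert (HK0 : exists s0, K s0) by (exists (x1, y1); split; simpl; lra).
  destruct HK0 as [s0 Hs0].
  destruct (finite_bound p (fun k M => 0 < M /\ forall s, K s -> Cmod (Cgamma (RtoC (A k) * s + RtoC (a k))%C) <= M
     /\ / M <= Cmod (rgamma (RtoC (A k) * s + RtoC (a k))%C))) as [M1 [HM1 B1]].
  { intros k M M' [P0 P1] Hle; split; [lra |]; intros s Hs; destruct (P1 s Hs) as [P2 P3]; split; [lra |].
    apply Rle_trans with (2 := P3), Rinv_le_contravar; lra. }
  { intros k Hk; apply Cgamma_affine_bound with X m; auto. }
  destruct (finite_bound q (fun k M => forall s, K s -> Cmod (rgamma (RtoC (B k) * s + RtoC (b k))%C) <= M)) as [M2 [HM2 B2]].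
  { intros k M M' P1 Hle s Hs; apply Rle_trans with M; auto. }
  { intros k Hk; destruct (gauss_affine_unif K X (B k) (b k) HKX HX) as [M HM].
    exists M; intros s Hs; apply (HM s Hs). }
  assert (U1 := unif_conv_prodC K p (fun k n s => / gauss n (RtoC (A k) * s + RtoC (a k)))%C
    (fun k s => Cgamma (RtoC (A k) * s + RtoC (a k))) M1 HM1).
  destruct U1 as [[M1' [HM1' B1']] U1].
  { intros k Hk; destruct (B1 k Hk) as [Mpos Bk]; split; [intros s Hs; apply (Bk s Hs) |].
    apply (unif_conv_inv K (fun n s => gauss n (RtoC (A k) * s + RtoC (a k))) (fun s => rgamma (RtoC (A k) * s + RtoC (a k))) (/ M1)).
    - apply Rinv_0_lt_compat; assumption.
    - intros s Hs; apply (Bk s Hs).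
    - destruct (gauss_affine_unif K X (A k) (a k) HKX HX) as [M HM]; apply (HM s0 Hs0). }
  assert (U2 := unif_conv_prodC K q (fun k n s => gauss n (RtoC (B k) * s + RtoC (b k)))
    (fun k s => rgamma (RtoC (B k) * s + RtoC (b k))) M2 HM2).
  destruct U2 as [[M2' [HM2' B2']] U2].
  { intros k Hk; split; [intros s Hs; apply (B2 k Hk s Hs) |].
    destruct (gauss_affine_unif K X (B k) (b k) HKX HX) as [M HM]; apply (HM s0 Hs0). }
  assert (HS : 0 <= M1' + M2') by lra.
  assert (B1'' : forall s, K s -> Cmod (prodC p (fun k => Cgamma (RtoC (A k) * s + RtoC (a k)))) <= M1' + M2').
  { intros s Hs; specialize (B1' s Hs); lra. }
  assert (B2'' : forall s, K s -> Cmod (prodC q (fun k => rgamma (RtoC (B k) * s + RtoC (b k)))) <= M1' + M2').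
  { intros s Hs; specialize (B2' s Hs); lra. }
  assert (U3 := unif_conv_mult K _ _ _ _ (M1' + M2') HS B1'' B2'' U1 U2).
  intros eps He.
  set (E := exp (Rabs (- ln x) * X)).
  assert (HE : 0 < E) by apply exp_pos.
  assert (H12 : 0 <= M1' * M2') by (apply Rmult_le_pos; assumption).
  assert (U4 : unif_conv K fn (fun s => hkernel p q A a B b s * Cexp (RtoC (- ln x) * s))%C).
  { apply (unif_conv_mult K _ _ (fun _ s => Cexp (RtoC (- ln x) * s)) (fun s => Cexp (RtoC (- ln x) * s)) (M1' * M2' + E)).
    - lra.
    - intros s Hs; unfold hkernel; rewrite Cmod_mult; apply Rle_trans with (M1' * M2'); [| lra].
      apply Rmult_le_compat; try apply Cmod_ge_0; auto.
    - intros s Hs; rewrite Cmod_Cexp; apply Rle_trans with E; [| lra].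
      apply exp_le, Rle_trans with (1 := Re_le_Cmod _); rewrite Cmod_mult, Cmod_R.
      apply Rmult_le_compat_l; [apply Rabs_pos | auto].
    - exact U3.
    - apply unif_conv_const. }
  assert (Hw := Cmod_ge_0 w).
  destruct (U4 (eps / (Cmod w + 1))) as [N HN]; [apply Rdiv_lt_0_compat; lra |].
  exists N; intros n Hn s Hs; rewrite hintegrand_eq.
  specialize (HN n Hn s Hs).
  match goal with |- Cmod (w * ?a - w * ?b)%C < _ => replace (w * a - w * b)%C with (w * (a - b))%C by ring end.
  rewrite Cmod_mult.
  apply Rle_lt_trans with (Cmod w * (eps / (Cmod w + 1))); [apply Rmult_le_compat_l; lra |].
  apply Rmult_lt_reg_r with (Cmod w + 1); [lra |].
  replace (Cmod w * (eps / (Cmod w + 1)) * (Cmod w + 1)) with (Cmod w * eps) by (field; lra); nra.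
Qed.

(** * Contour integrals *)

Notation is_RIntR := (is_RInt (V := R_NormedModule)).
Notation ex_RIntR := (ex_RInt (V := R_NormedModule)).
Notation RIntR := (RInt (V := R_CompleteNormedModule)).

(** The improper integral from minus infinity to [c], with an explicit rate variable; it is turned
    into [RInt_gen] only when the definition of [foxH] is met. *)
Definition tail_int (g : R -> R) (c l : R) : Prop :=
  (forall T, T <= c -> ex_RIntR g T c) /\
  forall eps, 0 < eps -> exists T0, T0 <= c /\ forall T, T <= T0 -> Rabs (RIntR g T c - l) < eps.

Lemma tail_int_ext g h c l : (forall t, t <= c -> g t = h t) -> tail_int g c l -> tail_int h c l.
Proof.
intros E [H1 H2]; split.
- intros T HT; apply ex_RInt_ext with g; [| apply H1; assumption].
  rewrite Rmin_left, Rmax_right by lra; intros t Ht; apply E; lra.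
- intros eps He; destruct (H2 eps He) as [T0 [HT0 HT]]; exists T0; split; [assumption |].
  intros T HTT; rewrite <- (RInt_ext g); [apply HT; assumption |].
  rewrite Rmin_left, Rmax_right by lra; intros t Ht; apply E; lra.
Qed.

Lemma tail_int_lim g c l l' : tail_int g c l ->
  (forall eps, 0 < eps -> exists T0, T0 <= c /\ forall T, T <= T0 -> Rabs (RIntR g T c - l') < eps) -> l = l'.
Proof.
intros [_ H1] H2; apply Rminus_diag_uniq.
destruct (Req_dec (l - l') 0) as [E | E]; [assumption | exfalso].
assert (P : 0 < Rabs (l - l') / 2) by (assert (H := Rabs_pos_lt _ E); lra).
destruct (H1 _ P) as [T1 [_ Q1]]; destruct (H2 _ P) as [T2 [_ Q2]].
specialize (Q1 (Rmin T1 T2) (Rmin_l _ _)); specialize (Q2 (Rmin T1 T2) (Rmin_r _ _)).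
set (I := RIntR g (Rmin T1 T2) c) in *.
assert (T := Rabs_triang (l - I) (I - l')); replace (l - I + (I - l')) with (l - l') in T by ring.
rewrite (Rabs_minus_sym l I) in T; lra.
Qed.

Lemma tail_int_unique g c l l' : tail_int g c l -> tail_int g c l' -> l = l'.
Proof. intros H1 H2; apply (tail_int_lim g c l l' H1), H2. Qed.

Lemma tail_int_minus g h c l l' : tail_int g c l -> tail_int h c l' -> tail_int (fun t => g t - h t) c (l - l').
Proof.
intros [G1 G2] [H1 H2]; split.
- intros T HT; apply (ex_RInt_minus (V := R_NormedModule) g h); auto.
- intros eps He; destruct (G2 (eps / 2)) as [T1 [HT1 Q1]]; [lra |]; destruct (H2 (eps / 2)) as [T2 [HT2 Q2]]; [lra |].
  exists (Rmin T1 T2); split; [apply Rle_trans with (1 := Rmin_l T1 T2); assumption |].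
  intros T HT.
  assert (E1 := Rle_trans _ _ _ HT (Rmin_l T1 T2)); assert (E2 := Rle_trans _ _ _ HT (Rmin_r T1 T2)).
  assert (E : RIntR (fun t => g t - h t) T c = RIntR g T c - RIntR h T c).
  { apply (RInt_minus (V := R_CompleteNormedModule) g h); [apply G1 | apply H1]; lra. }
  rewrite E; specialize (Q1 T E1); specialize (Q2 T E2).
  replace (RIntR g T c - RIntR h T c - (l - l')) with ((RIntR g T c - l) - (RIntR h T c - l')) by ring.
  apply Rle_lt_trans with (1 := Rabs_triang _ _); rewrite Rabs_Ropp; lra.
Qed.

Lemma tail_int_scal k g c l : tail_int g c l -> tail_int (fun t => k * g t) c (k * l).
Proof.
intros [G1 G2]; split.
- intros T HT; apply (ex_RInt_scal (V := R_NormedModule) g); auto.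
- intros eps He; assert (Hk := Rabs_pos k).
  destruct (G2 (eps / (Rabs k + 1))) as [T1 [HT1 Q1]]; [apply Rdiv_lt_0_compat; lra |].
  exists T1; split; [assumption |]; intros T HT; specialize (Q1 T HT).
  assert (E : RIntR (fun t => k * g t) T c = k * RIntR g T c).
  { apply (RInt_scal (V := R_CompleteNormedModule) g); apply G1; lra. }
  rewrite E, <- Rmult_minus_distr_l, Rabs_mult.
  apply Rle_lt_trans with (Rabs k * (eps / (Rabs k + 1))); [apply Rmult_le_compat_l; lra |].
  apply Rmult_lt_reg_r with (Rabs k + 1); [lra |].
  replace (Rabs k * (eps / (Rabs k + 1)) * (Rabs k + 1)) with (Rabs k * eps) by (field; lra); nra.
Qed.

Lemma RInt_exp_dominated (g : R -> R) (M k T c : R) : 0 < k -> T <= c -> ex_RIntR g T c ->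
  (forall t, T <= t <= c -> Rabs (g t) <= M * exp (k * t)) ->
  Rabs (RIntR g T c) <= M * (exp (k * c) / k - exp (k * T) / k).
Proof.
intros Hk HT Hex Hb.
assert (HI : is_RIntR (fun t => M * exp (k * t)) T c (M * (exp (k * c) / k) - M * (exp (k * T) / k))).
{ apply (is_RInt_derive (V := R_CompleteNormedModule) (fun t => M * (exp (k * t) / k))).
  - intros t _; auto_derive; [trivial | field; lra].
  - intros t _; apply (ex_derive_continuous (K := R_AbsRing) (V := R_NormedModule)); auto_derive; trivial. }
rewrite Rmult_minus_distr_l.
apply (norm_RInt_le (V := R_NormedModule) g (fun t => M * exp (k * t)) T c); auto.
apply (RInt_correct (V := R_CompleteNormedModule)); assumption.
Qed.

Lemma tail_int_exists g c M k : 0 < k -> 0 <= M -> (forall T, T <= c -> ex_RIntR g T c) ->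
  (forall t, t <= c -> Rabs (g t) <= M * exp (k * t)) ->
  exists l, tail_int g c l.
Proof.
intros Hk HM Hex Hb.
assert (D : forall T T', T <= T' <= c -> Rabs (RIntR g T c - RIntR g T' c) <= M / k * exp (k * T')).
{ intros T T' HT.
  assert (E : RIntR g T c = RIntR g T T' + RIntR g T' c).
  { symmetry; apply (RInt_Chasles (V := R_CompleteNormedModule)).
    - apply (ex_RInt_Chasles_1 (V := R_CompleteNormedModule)) with c; [lra | apply Hex; lra].
    - apply Hex; lra. }
  rewrite E; unfold Rminus; rewrite Rplus_assoc, Rplus_opp_r, Rplus_0_r.
  eapply Rle_trans; [apply (RInt_exp_dominated g M k); try lra |].
  - apply (ex_RInt_Chasles_1 (V := R_CompleteNormedModule)) with c; [lra | apply Hex; lra].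
  - intros t Ht; apply Hb; lra.
  - assert (P := exp_pos (k * T)); assert (P1 : 0 <= M * (exp (k * T) / k)).
    { apply Rmult_le_pos; [assumption |]; apply Rdiv_le_0_compat; lra. }
    unfold Rdiv in *; lra. }
assert (S0 : forall eps, 0 < eps -> exists T0, T0 <= c /\ M / k * exp (k * T0) < eps).
{ intros eps He; set (w := eps / (M / k + 1)).
  assert (HMk : 0 <= M / k) by (apply Rdiv_le_0_compat; lra).
  assert (Hw : 0 < w) by (apply Rdiv_lt_0_compat; lra).
  exists (Rmin c (ln w / k)); split; [apply Rmin_l |].
  apply Rle_lt_trans with (M / k * w).
  - apply Rmult_le_compat_l; [assumption |].
    rewrite <- (exp_ln w Hw) at 2; apply exp_le.
    apply Rle_trans with (k * (ln w / k)); [apply Rmult_le_compat_l; [lra | apply Rmin_r] | right; field; lra].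
  - apply Rmult_lt_reg_r with (M / k + 1); [lra |].
    replace (M / k * w * (M / k + 1)) with (M / k * eps) by (unfold w; field; split; lra); nra. }
destruct (proj1 (filterlim_locally_cauchy (U := R_CompleteSpace) (F := Rbar_locally m_infty) (fun T => RIntR g T c))) as [l Hl].
{ intros eps; destruct (S0 (eps / 2)) as [T0 [HT0 Q]]; [assert (H := cond_pos eps); lra |].
  exists (fun T => T < T0); split; [exists T0; auto |].
  intros u v Hu Hv.
  assert (Du := D u T0 ltac:(lra)); assert (Dv := D v T0 ltac:(lra)).
  change (Rabs (RIntR g v c - RIntR g u c) < eps).
  replace (RIntR g v c - RIntR g u c) with ((RIntR g v c - RIntR g T0 c) - (RIntR g u c - RIntR g T0 c)) by ring.
  apply Rle_lt_trans with (1 := Rabs_triang _ _); rewrite Rabs_Ropp; lra. }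
exists l; split; [assumption |].
intros eps He; destruct (Hl (fun y => Rabs (y - l) < eps)) as [T0 HT0].
{ exists (mkposreal eps He); intros y Hy; exact Hy. }
exists (Rmin c (T0 - 1)); split; [apply Rmin_l |]; intros T HT; apply HT0.
assert (Q := Rmin_r c (T0 - 1)); lra.
Qed.

Lemma tail_int_bound g c M k l : 0 < k -> 0 <= M -> tail_int g c l ->
  (forall t, t <= c -> Rabs (g t) <= M * exp (k * t)) -> Rabs l <= M * exp (k * c) / k.
Proof.
intros Hk HM [H1 H2] Hb; apply le_epsilon; intros eps He; destruct (H2 eps He) as [T0 [HT0 Q]].
specialize (Q T0 (Rle_refl _)).
assert (B : Rabs (RIntR g T0 c) <= M * (exp (k * c) / k - exp (k * T0) / k)).
{ apply RInt_exp_dominated; auto; intros t Ht; apply Hb; lra. }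
assert (P := exp_pos (k * T0)); assert (P1 : 0 <= M * (exp (k * T0) / k)).
{ apply Rmult_le_pos; [assumption |]; apply Rdiv_le_0_compat; lra. }
assert (T := Rabs_triang (RIntR g T0 c) (l - RIntR g T0 c)); rewrite (Rabs_minus_sym l) in T.
replace (RIntR g T0 c + (l - RIntR g T0 c)) with l in T by ring.
unfold Rdiv in *; lra.
Qed.

(* [l] is the imaginary part of the integral of [F] along the path going up from
   [c] to [c + iY] and then left to [-oo + iY]. *)
Definition cint (F : C -> C) (c Y l : R) : Prop :=
  ex_RIntR (fun y => Re (F (c, y))) 0 Y /\
  exists l2, tail_int (fun t => Im (F (t, Y))) c l2 /\ l = RIntR (fun y => Re (F (c, y))) 0 Y - l2.

Lemma cint_unique F c Y l l' : cint F c Y l -> cint F c Y l' -> l = l'.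
Proof.
intros [_ [l2 [H ->]]] [_ [l2' [H' ->]]]; rewrite (tail_int_unique _ _ _ _ H H'); reflexivity.
Qed.

Lemma cint_minus F G c Y l l' : cint F c Y l -> cint G c Y l' -> cint (fun s => F s - G s)%C c Y (l - l').
Proof.
intros [H1 [l2 [H2 ->]]] [G1 [m2 [G2 ->]]]; split.
- apply (ex_RInt_minus (V := R_NormedModule) (fun y => Re (F (c, y))) (fun y => Re (G (c, y)))); assumption.
- exists (l2 - m2); split.
  + exact (tail_int_minus _ _ _ _ _ H2 G2).
  + assert (E : RIntR (fun y => Re (F (c, y) - G (c, y))%C) 0 Y = RIntR (fun y => Re (F (c, y))) 0 Y - RIntR (fun y => Re (G (c, y))) 0 Y).
    { apply (RInt_minus (V := R_CompleteNormedModule) (fun y => Re (F (c, y))) (fun y => Re (G (c, y)))); assumption. }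
    rewrite E; ring.
Qed.

Lemma cint_scal (k : R) F c Y l : cint F c Y l -> cint (fun s => RtoC k * F s)%C c Y (k * l).
Proof.
intros [H1 [l2 [H2 ->]]].
assert (E1 : forall z, Re (RtoC k * z)%C = k * Re z) by (intros; unfold Re; simpl; ring).
assert (E2 : forall z, Im (RtoC k * z)%C = k * Im z) by (intros; unfold Im; simpl; ring).
split.
- apply ex_RInt_ext with (fun y => k * Re (F (c, y))); [intros; symmetry; apply E1 |].
  apply (ex_RInt_scal (V := R_NormedModule) (fun y => Re (F (c, y)))); assumption.
- exists (k * l2); split.
  + apply tail_int_ext with (fun t => k * Im (F (t, Y))); [intros; symmetry; apply E2 |].
    apply tail_int_scal; assumption.
  + assert (E : RIntR (fun y => Re (RtoC k * F (c, y))%C) 0 Y = k * RIntR (fun y => Re (F (c, y))) 0 Y).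
    { rewrite <- (RInt_scal (V := R_CompleteNormedModule) (fun y => Re (F (c, y)))) by assumption.
      apply RInt_ext; intros; apply E1. }
    rewrite E; ring.
Qed.

Lemma cint_bound F c Y l M1 M2 k : 0 <= Y -> 0 < k -> 0 <= M2 ->
  (forall y, 0 <= y <= Y -> Cmod (F (c, y)) <= M1) ->
  (forall t, t <= c -> Cmod (F (t, Y)) <= M2 * exp (k * t)) ->
  cint F c Y l -> Rabs l <= M1 * Y + M2 * exp (k * c) / k.
Proof.
intros HY Hk HM2 B1 B2 [H1 [l2 [H2 ->]]].
apply Rle_trans with (1 := Rabs_triang _ _); rewrite Rabs_Ropp; apply Rplus_le_compat.
- replace (M1 * Y) with ((Y - 0) * M1) by ring.
  apply (norm_RInt_le_const (V := R_NormedModule) (fun y => Re (F (c, y)))); [assumption | |].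
  + intros y Hy; apply Rle_trans with (2 := B1 y Hy), re_le_Cmod.
  + apply (RInt_correct (V := R_CompleteNormedModule)); assumption.
- apply tail_int_bound with (fun t => Im (F (t, Y))); try assumption.
  intros t Ht; apply Rle_trans with (2 := B2 t Ht), Rabs_Im_le_Cmod.
Qed.

Lemma cint_exists F c Y M k : 0 < k -> 0 <= M ->
  ex_RIntR (fun y => Re (F (c, y))) 0 Y -> (forall T, T <= c -> ex_RIntR (fun t => Im (F (t, Y))) T c) ->
  (forall t, t <= c -> Cmod (F (t, Y)) <= M * exp (k * t)) ->
  exists l, cint F c Y l.
Proof.
intros Hk HM H1 H2 B.
destruct (tail_int_exists (fun t => Im (F (t, Y))) c M k Hk HM H2) as [l2 Hl2].
{ intros t Ht; apply Rle_trans with (2 := B t Ht), Rabs_Im_le_Cmod. }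
eexists; split; [assumption |]; exists l2; split; [assumption | reflexivity].
Qed.

(** The substitution [s = kz] carries the path with corner [c + iY] to the one with corner
    [kc + ikY]. With [k = 1/u] it brings the moving corner [(1 + i)/u] back to [1 + i]. *)
Lemma cint_scale F k c Y l : 0 < k -> cint F (k * c) (k * Y) l -> cint (fun z => RtoC k * F (RtoC k * z))%C c Y l.
Proof.
intros Hk [H1 [l2 [[H2 H3] ->]]].
assert (E0 : forall x y, (RtoC k * (x, y))%C = (k * x, k * y)).
{ intros x y; apply injective_projections; simpl; ring. }
assert (E1 : forall z, Re (RtoC k * z)%C = k * Re z) by (intros; unfold Re; simpl; ring).
assert (E2 : forall z, Im (RtoC k * z)%C = k * Im z) by (intros; unfold Im; simpl; ring).
assert (I1 : is_RIntR (fun y => Re (RtoC k * F (RtoC k * (c, y)))%C) 0 Y (RIntR (fun y => Re (F (k * c, y))) 0 (k * Y))).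
{ apply is_RInt_ext with (fun y => k * Re (F (k * c, k * y + 0))).
  - intros y _; rewrite E1, E0, Rplus_0_r; reflexivity.
  - apply (is_RInt_comp_lin (V := R_NormedModule) (fun y => Re (F (k * c, y))) k 0 0 Y).
    rewrite Rmult_0_r, !Rplus_0_r; apply (RInt_correct (V := R_CompleteNormedModule)); assumption. }
assert (I2 : forall T, T <= c -> is_RIntR (fun t => Im (RtoC k * F (RtoC k * (t, Y)))%C) T c (RIntR (fun t => Im (F (t, k * Y))) (k * T) (k * c))).
{ intros T HT; apply is_RInt_ext with (fun t => k * Im (F (k * t + 0, k * Y))).
  - intros t _; rewrite E2, E0, Rplus_0_r; reflexivity.
  - apply (is_RInt_comp_lin (V := R_NormedModule) (fun t => Im (F (t, k * Y))) k 0 T c).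
    rewrite !Rplus_0_r; apply (RInt_correct (V := R_CompleteNormedModule)), H2; nra. }
split; [eexists; exact I1 |].
exists l2; split; [split |].
- intros T HT; eexists; apply I2; assumption.
- intros eps He; destruct (H3 eps He) as [T0 [HT0 Q]]; exists (T0 / k); split.
  + apply Rmult_le_reg_l with k; [assumption |]; replace (k * (T0 / k)) with T0 by (field; lra); assumption.
  + intros T HT.
    assert (HT' : k * T <= T0).
    { apply Rle_trans with (k * (T0 / k)); [apply Rmult_le_compat_l; lra | right; field; lra]. }
    rewrite (is_RInt_unique (V := R_CompleteNormedModule) _ _ _ _ (I2 T ltac:(nra))).
    apply Q; assumption.
- rewrite (is_RInt_unique (V := R_CompleteNormedModule) _ _ _ _ I1); reflexivity.
Qed.

(** Cauchy's theorem on rectangles, in each direction separately. Since each path starts on the real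
    axis, reality of [F] there is as essential as its decay to the left. *)
Lemma cint_independent F k : 0 < k ->
  (forall x1 x2 y1 y2, x1 <= x2 -> y1 <= y2 -> 0 < y1 \/ (0 < x1 /\ 0 <= y1) -> rect_identity F x1 x2 y1 y2) ->
  (forall t, 0 < t -> Im (F (t, 0)) = 0) ->
  (forall y1 y2 c, 0 < y1 <= y2 -> exists M, 0 <= M /\ forall t y, t <= c -> y1 <= y <= y2 -> Cmod (F (t, y)) <= M * exp (k * t)) ->
  exists l, forall c Y, 0 < c -> 0 < Y -> cint F c Y l.
Proof.
intros Hk HR HZ HD.
assert (XQ : forall T c Y, T <= c -> 0 < Y -> ex_RIntR (fun t => Im (F (t, Y))) T c).
{ intros T c Y HT HY; destruct (HR T c Y Y HT (Rle_refl _) (or_introl HY)) as [l1 [_ [_ [_ [H _]]]]]; eexists; exact H. }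
assert (XP : forall c Y, 0 < c -> 0 < Y -> ex_RIntR (fun y => Re (F (c, y))) 0 Y).
{ intros c Y Hc HY; destruct (HR c c 0 Y (Rle_refl _) ltac:(lra) (or_intror (conj Hc (Rle_refl 0)))) as [_ [l2 [_ [_ [_ [H _]]]]]]; eexists; exact H. }
assert (EX : forall c Y, 0 < c -> 0 < Y -> exists l, cint F c Y l).
{ intros c Y Hc HY; destruct (HD Y Y c) as [M [HM B]]; [lra |].
  apply (cint_exists F c Y M k); auto.
  intros t Ht; apply B; lra. }
(* Between the heights [Y] and [Y'], the left side of the rectangle at abscissa [T] contributes at
   most [(Y' - Y) M e^(kT)], which vanishes as [T] goes to minus infinity. *)
assert (IY : forall c Y Y' l l', 0 < c -> 0 < Y < Y' -> cint F c Y l -> cint F c Y' l' -> l = l').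
{ intros c Y Y' l l' Hc HY [H1 [l2 [H2 ->]]] [G1 [m2 [G2 ->]]].
  destruct (HD Y Y' c) as [M [HM B]]; [lra |].
  destruct (HR c c Y Y' (Rle_refl _) ltac:(lra) ltac:(lra)) as [_ [v [_ [_ [_ [Hv _]]]]]].
  assert (EP : RIntR (fun y => Re (F (c, y))) 0 Y' = RIntR (fun y => Re (F (c, y))) 0 Y + v).
  { apply (is_RInt_unique (V := R_CompleteNormedModule)), (is_RInt_Chasles (V := R_NormedModule)) with Y; [| exact Hv].
    apply (RInt_correct (V := R_CompleteNormedModule)); assumption. }
  assert (TL := tail_int_minus _ _ _ _ _ G2 H2).
  assert (Ev : m2 - l2 = v); [| lra].
  apply (tail_int_lim _ _ _ _ TL).
  intros eps He.
  set (w := eps / (M * (Y' - Y) + 1)).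
  assert (HMY : 0 <= M * (Y' - Y)) by (apply Rmult_le_pos; lra).
  assert (Hw : 0 < w) by (apply Rdiv_lt_0_compat; lra).
  exists (Rmin c (ln w / k)); split; [apply Rmin_l |]; intros T HT.
  assert (HTc := Rle_trans _ _ _ HT (Rmin_l _ _)); assert (HTw := Rle_trans _ _ _ HT (Rmin_r _ _)).
  destruct (HR T c Y Y' HTc ltac:(lra) ltac:(lra)) as [q1 [p2 [p1 [q2 [I1 [I2 [I3 [I4 E]]]]]]]].
  assert (Ep : p2 = v).
  { apply (is_RInt_unique (V := R_CompleteNormedModule)) in I2; apply (is_RInt_unique (V := R_CompleteNormedModule)) in Hv.
    rewrite <- I2; exact Hv. }
  assert (EI : RIntR (fun t => Im (F (t, Y')) - Im (F (t, Y))) T c = q2 - q1).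
  { apply (is_RInt_unique (V := R_CompleteNormedModule)), (is_RInt_minus (V := R_NormedModule) (fun t => Im (F (t, Y'))) (fun t => Im (F (t, Y)))); assumption. }
  rewrite EI.
  replace (q2 - q1 - v) with (- p1) by lra; rewrite Rabs_Ropp.
  assert (B1 : Rabs p1 <= (Y' - Y) * (M * w)).
  { apply (norm_RInt_le_const (V := R_NormedModule) (fun y => Re (F (T, y))) Y Y' p1); [lra | | assumption].
    intros y Hy; apply Rle_trans with (1 := re_le_Cmod _), Rle_trans with (1 := B T y HTc Hy).
    apply Rmult_le_compat_l; [assumption |].
    rewrite <- (exp_ln w Hw); apply exp_le.
    apply Rle_trans with (k * (ln w / k)); [apply Rmult_le_compat_l; lra | right; field; lra]. }
  apply Rle_lt_trans with (1 := B1).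
  apply Rmult_lt_reg_r with (M * (Y' - Y) + 1); [lra |].
  replace ((Y' - Y) * (M * w) * (M * (Y' - Y) + 1)) with (M * (Y' - Y) * eps) by (unfold w; field; lra).
  nra. }
(* The bottom side lies on the positive axis, where [F] is real, so it does not contribute to the
   imaginary part. *)
assert (IC : forall c c' Y l l', 0 < c < c' -> 0 < Y -> cint F c Y l -> cint F c' Y l' -> l = l').
{ intros c c' Y l l' Hc HY [H1 [l2 [H2 ->]]] [G1 [m2 [G2 ->]]].
  destruct (HR c c' 0 Y ltac:(lra) ltac:(lra) ltac:(lra)) as [q1 [p2 [p1 [q2 [I1 [I2 [I3 [I4 E]]]]]]]].
  rewrite (is_RInt_unique (V := R_CompleteNormedModule) _ _ _ _ I2), (is_RInt_unique (V := R_CompleteNormedModule) _ _ _ _ I3).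
  assert (Q1 : q1 = 0).
  { apply (is_RInt_unique (V := R_CompleteNormedModule)) in I1; rewrite <- I1.
    rewrite (RInt_ext _ (fun _ => 0)), RInt_const.
    - unfold scal; simpl; unfold mult; simpl; ring.
    - rewrite Rmin_left, Rmax_right by lra; intros t Ht; apply HZ; lra. }
  assert (m2 = l2 + q2); [| lra].
  apply (tail_int_lim _ _ _ _ G2).
  intros eps He; destruct H2 as [X2 H2]; destruct (H2 eps He) as [T0 [HT0 Q]]; exists T0; split; [lra |].
  intros T HT; specialize (Q T HT).
  assert (EI : RIntR (fun t => Im (F (t, Y))) T c' = RIntR (fun t => Im (F (t, Y))) T c + q2).
  { apply (is_RInt_unique (V := R_CompleteNormedModule)), (is_RInt_Chasles (V := R_NormedModule)) with c; [| exact I4].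
    apply (RInt_correct (V := R_CompleteNormedModule)), X2; lra. }
  rewrite EI; match goal with |- Rabs ?e < _ => replace e with (RIntR (fun t => Im (F (t, Y))) T c - l2) by ring end; assumption. }
destruct (EX 1 1) as [l Hl]; [lra | lra |].
exists l; intros c Y Hc HY.
destruct (EX c 1 Hc ltac:(lra)) as [l' Hl']; destruct (EX c Y Hc HY) as [l'' Hl''].
assert (E1 : l = l').
{ destruct (Rtotal_order c 1) as [H | [-> | H]].
  - symmetry; apply (IC c 1 1); lra || assumption.
  - apply (cint_unique _ _ _ _ _ Hl Hl').
  - apply (IC 1 c 1); lra || assumption. }
assert (E2 : l' = l'').
{ destruct (Rtotal_order Y 1) as [H | [-> | H]].
  - symmetry; apply (IY c Y 1); lra || assumption.
  - apply (cint_unique _ _ _ _ _ Hl' Hl'').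
  - apply (IY c 1 Y); lra || assumption. }
rewrite E1, E2; assumption.
Qed.

(** * Fox's function as a contour integral *)

Lemma prodC_conj n (f g : nat -> C) : (forall k, (k < n)%nat -> f k = Cconj (g k)) -> prodC n f = Cconj (prodC n g).
Proof.
induction n as [| n IH]; intros H; simpl; [symmetry; apply Cconj_RtoC |].
rewrite IH, H, Cmult_conj by auto with arith; reflexivity.
Qed.

Lemma hintegrand_conj p q A a B b x s : hintegrand p q A a B b x (Cconj s) = Cconj (hintegrand p q A a B b x s).
Proof.
assert (E : forall c d, (RtoC c * Cconj s + RtoC d)%C = Cconj (RtoC c * s + RtoC d)).
{ intros c d; rewrite Cplus_conj, Cmult_conj, !Cconj_RtoC; reflexivity. }
rewrite !hintegrand_eq; unfold hkernel; rewrite !Cmult_conj.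
f_equal; [f_equal |].
- apply prodC_conj; intros k _; unfold Cgamma; rewrite E, rgamma_conj, Cconj_inv; reflexivity.
- apply prodC_conj; intros k _; rewrite E; apply rgamma_conj.
- rewrite <- Cexp_conj, Cmult_conj, Cconj_RtoC; reflexivity.
Qed.

Lemma hintegrand_real p q A a B b x t : Im (hintegrand p q A a B b x (t, 0)) = 0.
Proof.
assert (H := hintegrand_conj p q A a B b x (t, 0)).
replace (Cconj (t, 0)) with ((t, 0) : C) in H by (unfold Cconj; simpl; rewrite Ropp_0; reflexivity).
apply (f_equal Im) in H; change (Im (hintegrand p q A a B b x (t, 0)) = - Im (hintegrand p q A a B b x (t, 0))) in H; lra.
Qed.

Lemma positive_lower_bound n (f : nat -> R) : (forall k, (k < n)%nat -> 0 < f k) ->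
  exists c, 0 < c /\ forall k, (k < n)%nat -> c <= f k.
Proof.
induction n as [| n IH]; intros H.
- exists 1; split; [lra |]; intros; lia.
- destruct IH as [c [Hc Hk]]; [intros; apply H; lia |].
  exists (Rmin c (f n)); split; [apply Rmin_pos; auto |].
  intros k Hkn; destruct (Nat.eq_dec k n) as [-> | Hne]; [apply Rmin_r |].
  apply Rle_trans with (1 := Rmin_l _ _); apply Hk; lia.
Qed.

Lemma Rabs_upper_bound n (f : nat -> R) : exists M, 0 <= M /\ forall k, (k < n)%nat -> Rabs (f k) <= M.
Proof.
apply (finite_bound n (fun k M => Rabs (f k) <= M)).
- intros; lra.
- intros k _; exists (Rabs (f k)); lra.
Qed.

Lemma far_scaled_Im (A m M : R) (s : C) : m <= A * Im s -> far m (RtoC A * s - RtoC M)%C.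
Proof.
intros H; left; replace (Im (RtoC A * s - RtoC M)%C) with (A * Im s) by (unfold Im; simpl; ring); assumption.
Qed.

Lemma far_of_margin (m M a : R) (w : C) : far m (w - RtoC M)%C -> Rabs a <= M -> far m (w + RtoC a)%C.
Proof.
intros H Ha; apply Rabs_le_between in Ha; apply far_interval with M; [assumption | lra].
Qed.

Lemma hintegrand_asymptotic p q A a B b x (s : C) (m : R) :
  sumR q B - sumR p A = 0 -> 0 < m ->
  (forall k, (k < p)%nat -> far m (RtoC (A k) * s + RtoC (a k))%C) ->
  (forall j, (j < q)%nat -> far m (RtoC (B j) * s + RtoC (b j))%C) ->
  hintegrand p q A a B b x s =
  Cexp (RtoC (log_rho p q A B - ln x) * s + (RtoC (log_nu p q A B a b) - RtoC (mu p q a b) * Clog s + theta p q A a B b s))%C.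
Proof.
intros Hbal Hm H1 H2; rewrite hintegrand_eq, (hkernel_asymptotic p q A a B b s m) by assumption.
rewrite <- Cexp_plus; f_equal; rewrite RtoC_minus, RtoC_opp; ring.
Qed.

(** At height at least [y1] one has [|s| >= y1], so [|s|^(-mu)] is bounded because [mu >= 0], and so
    is [theta]. Only [e^(ut)] remains, with a constant independent of [x]. *)
Lemma hintegrand_strip p q A a B b y1 :
  (forall k, (k < p)%nat -> 0 < A k) -> (forall j, (j < q)%nat -> 0 < B j) ->
  sumR q B - sumR p A = 0 -> 0 <= mu p q a b -> 0 < y1 ->
  exists M, 0 <= M /\ forall x t y, y1 <= y ->
    Cmod (hintegrand p q A a B b x (t, y)) <= M * exp ((log_rho p q A B - ln x) * t).
Proof.
intros HA HB Hbal Hmu Hy1.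
destruct (positive_lower_bound p A HA) as [k1 [Hk1 L1]]; destruct (positive_lower_bound q B HB) as [k2 [Hk2 L2]].
destruct (Rabs_upper_bound p a) as [Ma [HMa Ba]]; destruct (Rabs_upper_bound q b) as [Mb [HMb Bb]].
set (k0 := Rmin k1 k2); assert (Hk0 : 0 < k0) by (apply Rmin_pos; assumption).
set (M := Ma + Mb); set (m := k0 * y1); assert (Hm : 0 < m) by (unfold m; nra).
destruct (theta_estimates p q A B m M HA HB Hm ltac:(unfold M; lra)) as [T [HT TE]].
exists (exp (log_nu p q A B a b - mu p q a b * ln y1 + T / m)); split; [left; apply exp_pos |].
intros x t y Hy.
assert (FA : forall k, (k < p)%nat -> far m (RtoC (A k) * (t, y) - RtoC M)%C).
{ intros k Hk; apply far_scaled_Im; simpl; unfold m.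
  assert (k0 <= A k) by (apply Rle_trans with (1 := Rmin_l k1 k2); auto).
  apply Rmult_le_compat; lra. }
assert (FB : forall k, (k < q)%nat -> far m (RtoC (B k) * (t, y) - RtoC M)%C).
{ intros k Hk; apply far_scaled_Im; simpl; unfold m.
  assert (k0 <= B k) by (apply Rle_trans with (1 := Rmin_r k1 k2); auto).
  apply Rmult_le_compat; lra. }
assert (Ba' : forall k, (k < p)%nat -> Rabs (a k) <= M) by (intros k Hk; specialize (Ba k Hk); unfold M; lra).
assert (Bb' : forall k, (k < q)%nat -> Rabs (b k) <= M) by (intros k Hk; specialize (Bb k Hk); unfold M; lra).
assert (SL : slit (t, y)) by (apply slit_Im_pos; simpl; lra).
destruct (TE m (t, y) (Rle_refl _) SL FA FB a b Ba' Bb') as [Tb _].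
rewrite (hintegrand_asymptotic p q A a B b x (t, y) m); auto;
  [| intros; apply far_of_margin with M; auto | intros; apply far_of_margin with M; auto].
rewrite Cmod_Cexp, <- exp_plus; apply exp_le.
assert (R1 := Re_le_Cmod (theta p q A a B b (t, y))).
assert (LN : ln y1 <= ln (Cmod (t, y))).
{ apply ln_le; [assumption |]; apply Rle_trans with (2 := Rabs_Im_le_Cmod (t, y)); simpl.
  rewrite Rabs_pos_eq; lra. }
set (th := theta p q A a B b (t, y)) in *.
replace (Re (RtoC (log_rho p q A B - ln x) * (t, y) + (RtoC (log_nu p q A B a b) - RtoC (mu p q a b) * Clog (t, y) + th))%C)
  with ((log_rho p q A B - ln x) * t + (log_nu p q A B a b - mu p q a b * ln (Cmod (t, y)) + Re th))
  by (unfold Re; simpl; ring).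
assert (mu p q a b * ln y1 <= mu p q a b * ln (Cmod (t, y))) by (apply Rmult_le_compat_l; assumption).
lra.
Qed.

Lemma hintegrand_cint p q A a B b x :
  (forall k, (k < p)%nat -> 0 < A k) -> (forall j, (j < q)%nat -> 0 < B j) ->
  sumR q B - sumR p A = 0 -> (forall k, (k < p)%nat -> 0 <= a k) -> 0 <= mu p q a b ->
  0 < x < rho p q A B ->
  exists l, forall c Y, 0 < c -> 0 < Y -> cint (hintegrand p q A a B b x) c Y l.
Proof.
intros HA HB Hbal Ha Hmu Hx.
assert (Hu : 0 < log_rho p q A B - ln x).
{ rewrite rho_exp in Hx; assert (L := ln_increasing x _ (proj1 Hx) (proj2 Hx)); rewrite ln_exp in L; lra. }
apply cint_independent with (log_rho p q A B - ln x); [assumption | | |].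
- intros x1 x2 y1 y2 H1 H2 H3.
  destruct (hintegrand_rect p q A a B b x 1 x1 x2 y1 y2 HA Ha H1 H2 H3) as [l1 [l2 [l3 [l4 [I1 [I2 [I3 [I4 E]]]]]]]].
  assert (E0 : forall s, (1 * hintegrand p q A a B b x s)%C = hintegrand p q A a B b x s) by (intros; ring).
  exists l1, l2, l3, l4; split; [| split; [| split; [| split]]]; [| | | | exact E].
  + apply is_RInt_ext with (2 := I1); intros; rewrite E0; reflexivity.
  + apply is_RInt_ext with (2 := I2); intros; rewrite E0; reflexivity.
  + apply is_RInt_ext with (2 := I3); intros; rewrite E0; reflexivity.
  + apply is_RInt_ext with (2 := I4); intros; rewrite E0; reflexivity.
- intros t _; apply hintegrand_real.
- intros y1 y2 c Hy; destruct (hintegrand_strip p q A a B b y1 HA HB Hbal Hmu) as [M [HM B0]]; [lra |].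
  exists M; split; [assumption |]; intros t y _ Hy2; apply B0; lra.
Qed.

Lemma is_RIntR_ext (f g : R -> R) a b l : (forall x, f x = g x) -> is_RIntR f a b l -> is_RIntR g a b l.
Proof. intros E; apply is_RInt_ext; intros x _; apply E. Qed.

Lemma is_RInt_C (f : R -> C) a b l1 l2 : is_RIntR (fun t => Re (f t)) a b l1 -> is_RIntR (fun t => Im (f t)) a b l2 ->
  is_RInt (V := C_R_NormedModule) f a b (l1, l2).
Proof. intros H1 H2; exact (is_RInt_fct_extend_pair f a b l1 l2 H1 H2). Qed.

Lemma tail_int_RInt_gen_C (f : R -> C) c l1 l2 :
  tail_int (fun t => Re (f t)) c l1 -> tail_int (fun t => Im (f t)) c l2 ->
  RInt_gen (V := C_R_CompleteNormedModule) f (Rbar_locally m_infty) (at_point c) = (l1, l2).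
Proof.
intros [H1 H2] [G1 G2].
apply (is_RInt_gen_unique (V := C_R_CompleteNormedModule)).
intros P [eps HP].
destruct (H2 eps (cond_pos eps)) as [T0 [HT0 Q]]; destruct (G2 eps (cond_pos eps)) as [T1 [HT1 Q']].
exists (fun T => T < Rmin T0 T1) (fun y => y = c).
- exists (Rmin T0 T1); auto.
- reflexivity.
- intros x y Hx ->; exists (RIntR (fun t => Re (f t)) x c, RIntR (fun t => Im (f t)) x c).
  assert (Hx0 := Rlt_le_trans _ _ _ Hx (Rmin_l T0 T1)); assert (Hx1 := Rlt_le_trans _ _ _ Hx (Rmin_r T0 T1)).
  split.
  + apply is_RInt_C; apply (RInt_correct (V := R_CompleteNormedModule)); [apply H1 | apply G1]; lra.
  + apply HP; split; [apply Q | apply Q']; lra.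
Qed.

Lemma maxR_zero n f : (forall k, (k < n)%nat -> f k <= 0) -> maxR n f = 0.
Proof.
induction n as [| n IH]; intros H; simpl; [reflexivity |].
rewrite IH by auto with arith; apply Rmax_left; auto with arith.
Qed.

(** The lower half of the loop is the conjugate of the upper half, run backwards. The loop integral
    is thus [2i l], and division by [2 pi i] leaves the real number [l / PI]. *)
Lemma foxH_cint p q A a B b x l :
  (forall k, (k < p)%nat -> 0 < A k) -> (forall j, (j < q)%nat -> 0 < B j) ->
  sumR q B - sumR p A = 0 -> (forall k, (k < p)%nat -> 0 <= a k) -> 0 <= mu p q a b ->
  0 < x < rho p q A B ->
  cint (hintegrand p q A a B b x) 1 1 l -> foxH p q A a B b x = RtoC (l / PI).
Proof.
intros HA HB Hbal Ha Hmu Hx [X1 [l2 [T2 El]]].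
set (F := hintegrand p q A a B b x) in *.
assert (Hu : 0 < log_rho p q A B - ln x).
{ rewrite rho_exp in Hx; assert (L := ln_increasing x _ (proj1 Hx) (proj2 Hx)); rewrite ln_exp in L; lra. }
(* [maxR] starts from 0 and every [- a k / A k] is at most 0, so the abscissa of the loop does not
   depend on the parameters. *)
assert (Hc : loop_c p A a = 1).
{ unfold loop_c; rewrite maxR_zero; [ring |]; intros k Hk.
  specialize (HA k Hk); specialize (Ha k Hk).
  assert (0 <= a k / A k) by (apply Rdiv_le_0_compat; assumption).
  unfold Rdiv in *; lra. }
assert (Conj : forall t y, F (t, - y) = Cconj (F (t, y))).
{ intros t y; exact (hintegrand_conj p q A a B b x (t, y)). }
assert (Conj1 : forall t, F (t, -1) = Cconj (F (t, 1))).
{ intros t; rewrite <- Conj; reflexivity. }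
destruct (hintegrand_strip p q A a B b 1 HA HB Hbal Hmu ltac:(lra)) as [M [HM B0]].
(* Integrability of the real part comes from Cauchy's theorem for [i F]. *)
assert (XT : forall T, T <= 1 -> ex_RIntR (fun t => Re (F (t, 1))) T 1).
{ intros T HT; destruct (hintegrand_rect p q A a B b x Ci T 1 1 1 HA Ha HT (Rle_refl _) ltac:(lra)) as [l1 [_ [_ [_ [H _]]]]].
  exists l1; apply is_RInt_ext with (2 := H); intros t _; fold F; unfold Im, Re; simpl; ring. }
assert (XV : ex_RIntR (fun y => Im (F (1, y))) 0 1).
{ destruct (hintegrand_rect p q A a B b x Ci 1 1 0 1 HA Ha (Rle_refl _) ltac:(lra) ltac:(lra)) as [_ [l3 [_ [_ [_ [H _]]]]]].
  exists (-1 * l3); apply is_RInt_ext with (fun y => -1 * Re (Ci * F (1, y))%C).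
  - intros t _; unfold Im, Re; simpl; ring.
  - apply (is_RInt_scal (V := R_NormedModule) (fun y => Re (Ci * F (1, y))%C)); exact H. }
destruct (tail_int_exists (fun t => Re (F (t, 1))) 1 M _ Hu HM XT) as [l1 T1].
{ intros t Ht; apply Rle_trans with (1 := re_le_Cmod _); apply B0; lra. }
assert (I1 : RInt_gen (V := C_R_CompleteNormedModule) (fun t => F (t, 1)) (Rbar_locally m_infty) (at_point 1) = (l1, l2)).
{ apply tail_int_RInt_gen_C; assumption. }
assert (I2 : RInt_gen (V := C_R_CompleteNormedModule) (fun t => F (t, -1)) (Rbar_locally m_infty) (at_point 1) = (l1, -1 * l2)).
{ apply tail_int_RInt_gen_C.
  - apply tail_int_ext with (2 := T1); intros t _; rewrite Conj1; reflexivity.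
  - apply tail_int_ext with (fun t => -1 * Im (F (t, 1))); [intros t _; rewrite Conj1; unfold Im; simpl; ring |].
    apply tail_int_scal; assumption. }
set (P := RIntR (fun y => Re (F (1, y))) 0 1) in *.
assert (IP : is_RIntR (fun y => Re (F (1, y))) 0 1 P) by (apply (RInt_correct (V := R_CompleteNormedModule)); assumption).
destruct XV as [V IV].
(* On the vertical side, conjugation makes the real part even in [y] and the imaginary part odd: the
   first integral doubles and the second cancels. *)
assert (IP' : is_RIntR (fun y => Re (F (1, y))) (-1) 0 P).
{ replace P with (-1 * (- P)) by ring.
  apply is_RIntR_ext with (fun y => -1 * (-1 * Re (F (1, -1 * y + 0)))).
  { intros y; replace (-1 * y + 0) with (- y) by ring; rewrite Conj; unfold Re; simpl; ring. }
  apply (is_RInt_scal (V := R_NormedModule) (fun y => -1 * Re (F (1, -1 * y + 0)))).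
  apply (is_RInt_comp_lin (V := R_NormedModule) (fun y => Re (F (1, y))) (-1) 0 (-1) 0).
  replace (-1 * 0 + 0) with 0 by ring; replace (-1 * -1 + 0) with 1 by ring.
  apply (is_RInt_swap (V := R_NormedModule)); exact IP. }
assert (IV' : is_RIntR (fun y => Im (F (1, y))) (-1) 0 (- V)).
{ apply is_RIntR_ext with (fun y => -1 * Im (F (1, -1 * y + 0))).
  { intros y; replace (-1 * y + 0) with (- y) by ring; rewrite Conj; unfold Im; simpl; ring. }
  apply (is_RInt_comp_lin (V := R_NormedModule) (fun y => Im (F (1, y))) (-1) 0 (-1) 0).
  replace (-1 * 0 + 0) with 0 by ring; replace (-1 * -1 + 0) with 1 by ring.
  apply (is_RInt_swap (V := R_NormedModule)); exact IV. }
assert (I3 : RInt (V := C_R_CompleteNormedModule) (fun y => F (1, y)) (-1) 1 = (P + P, - V + V)).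
{ apply (is_RInt_unique (V := C_R_CompleteNormedModule)), is_RInt_C.
  - apply (is_RInt_Chasles (V := R_NormedModule)) with 0; assumption.
  - apply (is_RInt_Chasles (V := R_NormedModule)) with 0; assumption. }
unfold foxH; rewrite Hc; fold F; rewrite I1, I2, I3, El.
assert (HPI := PI_RGT_0).
apply injective_projections; simpl; field; lra.
Qed.

(** * Hankel's integral *)

Definition hankel (v : R) (z : C) : C := Cexp (z - RtoC v * Clog z)%C.

Lemma Cderiv_horizontal y t : Cderiv (fun t => (t, y)) t 1%C.
Proof. split; simpl; [apply (is_derive_id (K := R_AbsRing)) | apply (is_derive_const (V := R_NormedModule))]. Qed.

Lemma Cderiv_vertical x t : Cderiv (fun t => (x, t)) t Ci.
Proof. split; simpl; [apply (is_derive_const (V := R_NormedModule)) | apply (is_derive_id (K := R_AbsRing))]. Qed.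

Lemma hankel_S v z : slit z -> hankel (1 + v) z = (hankel v z / z)%C.
Proof.
intros Hz; unfold hankel.
replace (z - RtoC (1 + v) * Clog z)%C with ((z - RtoC v * Clog z) - Clog z)%C by (rewrite RtoC_plus; ring).
rewrite Cexp_minus, Cexp_Clog by assumption; reflexivity.
Qed.

Lemma Cderiv_hankel v (f : R -> C) t l : slit (f t) -> Cderiv f t l ->
  Cderiv (fun t => hankel v (f t)) t (l * (hankel v (f t) - RtoC v * hankel (1 + v) (f t)))%C.
Proof.
intros Hs Hf; rewrite hankel_S by assumption; unfold hankel; eapply Cderiv_eq.
- apply Cderiv_Cexp, Cderiv_minus; [exact Hf |].
  apply Cderiv_scal, Cderiv_Clog; [exact Hs | exact Hf].
- unfold Cdiv; ring.
Qed.

Lemma slit_right y : slit (1, y).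
Proof. apply slit_Re_pos; simpl; lra. Qed.

Lemma slit_top t : slit (t, 1).
Proof. apply slit_Im_pos; simpl; lra. Qed.

Lemma Cmod_right_ge_1 y : 1 <= Cmod (1, y).
Proof. apply Rle_trans with (2 := Re_le_Cmod (1, y)); simpl; lra. Qed.

Lemma Cmod_top_ge_1 t : 1 <= Cmod (t, 1).
Proof.
apply Rle_trans with (2 := Rabs_Im_le_Cmod (t, 1)); simpl; rewrite Rabs_R1; lra.
Qed.

Lemma ln_nonneg x : 1 <= x -> 0 <= ln x.
Proof. intros H; rewrite <- ln_1; apply ln_le; lra. Qed.

Lemma Cmod_hankel v z : Cmod (hankel v z) = exp (Re z - v * ln (Cmod z)).
Proof. unfold hankel; rewrite Cmod_Cexp; f_equal; unfold Re; simpl; ring. Qed.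

Lemma Cmod_hankel_le v z : 0 <= v -> 1 <= Cmod z -> Cmod (hankel v z) <= exp (Re z).
Proof.
intros Hv Hz; rewrite Cmod_hankel; apply exp_le; assert (H := ln_nonneg _ Hz); nra.
Qed.

Lemma hankel_cint v : 0 <= v -> exists l, cint (hankel v) 1 1 l.
Proof.
intros Hv; apply cint_exists with 1 1; [lra | lra | | |].
- apply (Cderiv_ex_RInt (fun y => hankel v (1, y)) (fun y => Ci * (hankel v (1, y) - RtoC v * hankel (1 + v) (1, y)))%C).
  intros y _; apply (Cderiv_hankel v (fun y => (1, y))); [apply slit_right | apply Cderiv_vertical].
- intros T HT; apply (Cderiv_ex_RInt (fun t => hankel v (t, 1)) (fun t => 1 * (hankel v (t, 1) - RtoC v * hankel (1 + v) (t, 1)))%C).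
  intros y _; apply (Cderiv_hankel v (fun t => (t, 1))); [apply slit_top | apply Cderiv_horizontal].
- intros t _; rewrite !Rmult_1_l; apply (Cmod_hankel_le v (t, 1)); [assumption | apply Cmod_top_ge_1].
Qed.

Lemma Cderiv_FTC (f g g' : R -> C) a b : a <= b ->
  (forall t, Cderiv f t (g t)) -> (forall t, Cderiv g t (g' t)) ->
  is_RIntR (fun t => Re (g t)) a b (Re (f b) - Re (f a)) /\ is_RIntR (fun t => Im (g t)) a b (Im (f b) - Im (f a)).
Proof.
intros Hab Hf Hg; split.
- apply (is_RInt_derive (V := R_CompleteNormedModule) (fun t => Re (f t))); intros t _; [exact (proj1 (Hf t)) |].
  apply (ex_derive_continuous (K := R_AbsRing) (V := R_NormedModule)); eexists; exact (proj1 (Hg t)).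
- apply (is_RInt_derive (V := R_CompleteNormedModule) (fun t => Im (f t))); intros t _; [exact (proj2 (Hf t)) |].
  apply (ex_derive_continuous (K := R_AbsRing) (V := R_NormedModule)); eexists; exact (proj2 (Hg t)).
Qed.

Lemma Cderiv_hankel_S v (f : R -> C) t l : slit (f t) -> Cderiv f t l ->
  exists l', Cderiv (fun t => l * (hankel v (f t) - RtoC v * hankel (1 + v) (f t)))%C t l'.
Proof.
intros Hs Hf; eexists; apply Cderiv_scal, Cderiv_minus; [| apply Cderiv_scal]; apply Cderiv_hankel; eassumption.
Qed.

(** The derivative of [e^z z^(-v)] is [e^z z^(-v) - v e^z z^(-1-v)]. Its integral along the path has
    zero imaginary part, the primitive being real at 1 and vanishing at the far end. This is the
    recurrence of [1/Gamma], and the source of the factor [mu]. *)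
Lemma hankel_parts v l l1 : 0 <= v -> cint (hankel v) 1 1 l -> cint (hankel (1 + v)) 1 1 l1 -> l = v * l1.
Proof.
intros Hv Hl Hl1.
set (g := fun z => (hankel v z - RtoC v * hankel (1 + v) z)%C).
assert (H : cint g 1 1 (l - v * l1)) by exact (cint_minus _ _ _ _ _ _ Hl (cint_scal v _ _ _ _ Hl1)).
destruct H as [X1 [l2 [T2 El]]].
assert (Z0 : Im (hankel v (1, 0)) = 0).
{ unfold hankel; change ((1, 0) : C) with (RtoC 1); rewrite Clog_RtoC, ln_1 by lra.
  replace (RtoC 1 - RtoC v * RtoC 0)%C with (RtoC 1) by ring; rewrite Cexp_RtoC; reflexivity. }
assert (DV : forall y, exists g', Cderiv (fun y => Ci * g (1, y))%C y g').
{ intros y; apply (Cderiv_hankel_S v (fun y => (1, y)) y Ci); [apply slit_right | apply Cderiv_vertical]. }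
assert (DH : forall t, exists g', Cderiv (fun t => 1 * g (t, 1))%C t g').
{ intros t; apply (Cderiv_hankel_S v (fun t => (t, 1)) t 1); [apply slit_top | apply Cderiv_horizontal]. }
assert (V : RIntR (fun y => Re (g (1, y))) 0 1 = Im (hankel v (1, 1)) - Im (hankel v (1, 0))).
{ apply (is_RInt_unique (V := R_CompleteNormedModule)).
  apply is_RIntR_ext with (fun y => Im (Ci * g (1, y))%C); [intros; unfold Im, Re; simpl; ring |].
  destruct (Cderiv_FTC (fun y => hankel v (1, y)) (fun y => Ci * g (1, y))%C
    (fun y => (Derive (fun y => Re (Ci * g (1, y))%C) y, Derive (fun y => Im (Ci * g (1, y))%C) y)) 0 1) as [_ I]; [lra | | | exact I].
  - intros y; apply (Cderiv_hankel v (fun y => (1, y))); [apply slit_right | apply Cderiv_vertical].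
  - intros y; destruct (DV y) as [g' [H1 H2]]; split; apply Derive_correct; eexists; eassumption. }
assert (HH : forall T, T <= 1 -> RIntR (fun t => Im (g (t, 1))) T 1 = Im (hankel v (1, 1)) - Im (hankel v (T, 1))).
{ intros T HT; apply (is_RInt_unique (V := R_CompleteNormedModule)).
  apply is_RIntR_ext with (fun t => Im (1 * g (t, 1))%C); [intros; unfold Im, Re; simpl; ring |].
  destruct (Cderiv_FTC (fun t => hankel v (t, 1)) (fun t => 1 * g (t, 1))%C
    (fun t => (Derive (fun t => Re (1 * g (t, 1))%C) t, Derive (fun t => Im (1 * g (t, 1))%C) t)) T 1) as [_ I]; [lra | | | exact I].
  - intros y; apply (Cderiv_hankel v (fun t => (t, 1))); [apply slit_top | apply Cderiv_horizontal].
  - intros y; destruct (DH y) as [g' [H1 H2]]; split; apply Derive_correct; eexists; eassumption. }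
assert (E2 : l2 = Im (hankel v (1, 1))).
{ apply (tail_int_lim _ _ _ _ T2); intros eps He; exists (Rmin 1 (ln eps - 1)); split; [apply Rmin_l |].
  intros T HT; assert (HT1 := Rle_trans _ _ _ HT (Rmin_l _ _)); assert (HT2 := Rle_trans _ _ _ HT (Rmin_r _ _)).
  rewrite HH by assumption.
  replace (Im (hankel v (1, 1)) - Im (hankel v (T, 1)) - Im (hankel v (1, 1))) with (- Im (hankel v (T, 1))) by ring.
  rewrite Rabs_Ropp; apply Rle_lt_trans with (1 := Rabs_Im_le_Cmod _).
  apply Rle_lt_trans with (1 := Cmod_hankel_le v (T, 1) Hv (Cmod_top_ge_1 T)); simpl.
  rewrite <- (exp_ln eps He); apply exp_increasing; lra. }
rewrite V, E2, Z0 in El; lra.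
Qed.

Lemma hankel_1_eq z : slit z -> hankel 1 z = (Cexp z * / z)%C.
Proof.
intros Hz; replace 1 with (1 + 0) at 1 by ring; rewrite hankel_S by assumption.
unfold hankel; replace (z - RtoC 0 * Clog z)%C with z by ring; reflexivity.
Qed.

Lemma Cderiv_exp_ray (z : C) : z <> 0%C ->
  forall r, Cderiv (fun r => Cexp (RtoC r * z) * / z)%C r (Cexp (RtoC r * z)).
Proof.
intros Hz r; eapply Cderiv_eq.
- apply Cderiv_mult; [| apply Cderiv_const].
  apply Cderiv_Cexp, Cderiv_mult; [apply Cderiv_id | apply Cderiv_const].
- cbv beta; field; assumption.
Qed.

(* [(e^z - 1)/z] is an average of [e^{rz}], [0 <= r <= 1], whose imaginary part is O(Im z). *)
Lemma Im_exp_div_near (t h : R) : t <= 1 -> 0 < h ->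
  Rabs (Im (Cexp (t, h) * / (t, h))%C - Im (/ (t, h))%C) <= exp 1 * h.
Proof.
intros Ht Hh; set (z := (t, h) : C).
assert (Hz : z <> 0%C) by (apply slit_neq_0, slit_Im_pos; simpl; lra).
assert (D := Cderiv_exp_ray z Hz).
destruct (MVT_gen (fun r => Im (Cexp (RtoC r * z) * / z)%C) 0 1 (fun r => Im (Cexp (RtoC r * z)))) as [r [Hr E]].
- intros r _; exact (proj2 (D r)).
- intros r _; apply continuity_pt_filterlim, (ex_derive_continuous (K := R_AbsRing) (V := R_NormedModule)).
  eexists; exact (proj2 (D r)).
- rewrite Rmin_left, Rmax_right in Hr by lra.
  replace (RtoC 1 * z)%C with z in E by ring; replace (RtoC 0 * z)%C with (RtoC 0) in E by ring.
  rewrite Cexp_0 in E; replace (1 * / z)%C with (/ z)%C in E by ring.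
  rewrite E, Rminus_0_r, Rmult_1_r.
  replace (Im (Cexp (RtoC r * z))) with (exp (r * t) * sin (r * h)).
  2: { unfold Cexp; simpl; f_equal; f_equal; ring. }
  rewrite Rabs_mult, Rabs_pos_eq by (left; apply exp_pos).
  apply Rmult_le_compat; [left; apply exp_pos | apply Rabs_pos | apply exp_le; nra |].
  apply Rle_trans with (r * h); [| nra].
  destruct Hr as [[Hr0 | <-] Hr1].
  + assert (0 < r * h) by nra.
    assert (B1 := sin_lt_x (r * h) H); assert (B2 := SIN_bound (r * h)).
    apply Rabs_le; split; [| lra].
    destruct (Rle_dec (r * h) 1) as [Hle | Hgt]; [| lra].
    assert (0 <= sin (r * h)) by (apply sin_ge_0; [lra |]; assert (P := PI2_1); lra). lra.
  + rewrite Rmult_0_l, sin_0, Rabs_R0; lra.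
Qed.

Lemma atan_le_id x : 0 <= x -> 0 <= atan x <= x.
Proof.
intros [Hx | <-]; [| rewrite atan_0; lra].
split; [rewrite <- atan_0; left; apply atan_increasing; assumption |].
destruct (MVT_gen atan 0 x (fun x => / (1 + x²))) as [c [Hc E]].
- intros y _; apply is_derive_atan.
- intros y _; apply continuity_pt_filterlim, (ex_derive_continuous (K := R_AbsRing) (V := R_NormedModule)).
  eexists; apply is_derive_atan.
- rewrite atan_0, !Rminus_0_r in E; rewrite E.
  assert (H := Rle_0_sqr c).
  assert (/ (1 + c²) <= 1) by (rewrite <- Rinv_1; apply Rinv_le_contravar; lra); nra.
Qed.

(** Hankel's integral for [1/Gamma(1)]. The horizontal side is lowered to height [h], where the
    imaginary parts of [e^z/z] and [1/z] differ by [O(h)]; that of [1/z] integrates to arctangents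
    whose difference tends to [PI]. *)
Lemma hankel_1_cint l : cint (hankel 1) 1 1 l -> l = PI.
Proof.
intros [X1 [l2 [T2 El]]].
set (f := fun z => (Cexp z * / z)%C).
assert (Ef : forall z, slit z -> hankel 1 z = f z) by (intros; apply hankel_1_eq; assumption).
assert (Main : forall T, 1 <= T -> Rabs (RIntR (fun y => Re (hankel 1 (1, y))) 0 1 - RIntR (fun t => Im (hankel 1 (t, 1))) (- T) 1 - PI) <= exp (- T)).
{ intros T HT.
  (* The path is cut at [-T], where the vertical side contributes at most [e^(-T)]; the rest of the
     error is linear in [h], which then goes to 0 with [T] fixed. *)
  assert (Step : forall h, 0 < h < 1 ->
    Rabs (RIntR (fun y => Re (hankel 1 (1, y))) 0 1 - RIntR (fun t => Im (hankel 1 (t, 1))) (- T) 1 - PI)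
      <= exp (- T) + h * (exp 1 + exp 1 * (T + 1) + 2)).
  { intros h Hh.
    assert (RI : rect_identity f (- T) 1 h 1).
    { apply holo_rect with (h / 2); [lra | lra | lra |].
      apply holo_mult; [apply holo_Cexp, holo_id |].
      apply (holo_inv _ (fun s => s)); [| apply holo_id].
      intros s [_ Hs]; apply slit_neq_0, slit_Im_pos; lra. }
    destruct RI as [q1 [p2 [p1 [q2 [I1 [I2 [I3 [I4 E]]]]]]]].
    set (P := RIntR (fun y => Re (hankel 1 (1, y))) 0 1).
    assert (I4' : RIntR (fun t => Im (hankel 1 (t, 1))) (- T) 1 = q2).
    { apply (is_RInt_unique (V := R_CompleteNormedModule)).
      apply is_RIntR_ext with (2 := I4); intros t; rewrite Ef by apply slit_top; reflexivity. }
    assert (I2' : is_RIntR (fun y => Re (hankel 1 (1, y))) h 1 p2).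
    { apply is_RIntR_ext with (2 := I2); intros t; rewrite Ef by apply slit_right; reflexivity. }
    assert (X0 : ex_RIntR (fun y => Re (hankel 1 (1, y))) 0 h).
    { apply (ex_RInt_Chasles_1 (V := R_CompleteNormedModule)) with 1; [lra | assumption]. }
    destruct X0 as [p0 I0].
    assert (EP : P = p0 + p2).
    { apply (is_RInt_unique (V := R_CompleteNormedModule)), (is_RInt_Chasles (V := R_NormedModule)) with h; assumption. }
    assert (B0 : Rabs p0 <= (h - 0) * exp 1).
    { apply (norm_RInt_le_const (V := R_NormedModule) (fun y => Re (hankel 1 (1, y))) 0 h p0); [lra | | assumption].
      intros y Hy; apply Rle_trans with (1 := re_le_Cmod _).
      apply (Cmod_hankel_le 1 (1, y)); [lra | apply Cmod_right_ge_1]. }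
    assert (B1 : Rabs p1 <= (1 - h) * exp (- T)).
    { apply (norm_RInt_le_const (V := R_NormedModule) (fun y => Re (f (- T, y))) h 1 p1); [lra | | assumption].
      intros y Hy; apply Rle_trans with (1 := re_le_Cmod _).
      rewrite <- Ef by (apply slit_Im_pos; simpl; lra).
      apply (Cmod_hankel_le 1 (- T, y)); [lra |].
      apply Rle_trans with (2 := re_le_Cmod (- T, y)); simpl; rewrite Rabs_Ropp, Rabs_pos_eq; lra. }
    (* The imaginary part of [1/(t + ih)] is [-h/(t^2 + h^2)], the derivative of [- atan (t/h)]. *)
    assert (IA : is_RIntR (fun t => Im (/ (t, h))%C) (- T) 1 (- atan (1 / h) - - atan (- T / h))).
    { apply (is_RInt_derive (V := R_CompleteNormedModule) (fun t => - atan (t / h))).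
      - intros t _; auto_derive; [trivial |].
        unfold Im; simpl; field; repeat split; nra.
      - intros t _; unfold Im; simpl.
        apply (ex_derive_continuous (K := R_AbsRing) (V := R_NormedModule)); auto_derive; nra. }
    assert (ID := is_RInt_minus (V := R_NormedModule) _ _ _ _ _ _ I1 IA).
    assert (BD := norm_RInt_le_const (V := R_NormedModule) _ (- T) 1 _ (exp 1 * h) ltac:(lra) (fun t Ht => Im_exp_div_near t h (proj2 Ht) (proj1 Hh)) ID).
    change (Rabs (q1 - (- atan (1 / h) - - atan (- T / h))) <= (1 - - T) * (exp 1 * h)) in BD.
    replace (1 / h) with (/ h) in BD by (field; lra).
    replace (- T / h) with (- / (h / T)) in BD by (field; lra).
    assert (HhT : 0 < h / T) by (apply Rdiv_lt_0_compat; lra).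
    rewrite atan_opp, !atan_inv in BD by lra.
    assert (A1 := atan_le_id h ltac:(lra)); assert (A2 := atan_le_id (h / T) ltac:(lra)).
    assert (HhT1 : h / T <= h).
    { apply Rmult_le_reg_r with T; [lra |]; replace (h / T * T) with h by (field; lra); nra. }
    assert (Ep := exp_pos (- T)).
    fold P; rewrite I4', EP.
    apply Rabs_le_between in B0; apply Rabs_le_between in B1; apply Rabs_le_between in BD.
    apply Rabs_le; nra. }
  apply le_epsilon; intros eps He.
  set (W := exp 1 + exp 1 * (T + 1) + 2) in *.
  assert (HW : 0 < W) by (unfold W; assert (E1 := exp_pos 1); nra).
  assert (Hh : 0 < Rmin (1 / 2) (eps / W)) by (apply Rmin_pos; [lra | apply Rdiv_lt_0_compat; lra]).
  assert (Hh1 : Rmin (1 / 2) (eps / W) < 1) by (apply Rle_lt_trans with (1 := Rmin_l _ _); lra).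
  apply Rle_trans with (1 := Step (Rmin (1 / 2) (eps / W)) (conj Hh Hh1)).
  apply Rplus_le_compat_l; apply Rle_trans with (eps / W * W); [apply Rmult_le_compat_r; [lra | apply Rmin_r] | right; field; lra]. }
assert (E : l2 = RIntR (fun y => Re (hankel 1 (1, y))) 0 1 - PI); [| lra].
apply (tail_int_lim _ _ _ _ T2); intros eps He; exists (Rmin (-1) (ln eps - 1)); split.
{ apply Rle_trans with (1 := Rmin_l _ _); lra. }
intros T HT; assert (HT1 := Rle_trans _ _ _ HT (Rmin_l _ _)); assert (HT2 := Rle_trans _ _ _ HT (Rmin_r _ _)).
specialize (Main (- T) ltac:(lra)); rewrite Ropp_involutive in Main.
rewrite <- Rabs_Ropp.
match goal with |- Rabs ?e < _ => replace e with (RIntR (fun y => Re (hankel 1 (1, y))) 0 1 - RIntR (fun t => Im (hankel 1 (t, 1))) T 1 - PI) by ring end.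
apply Rle_lt_trans with (1 := Main).
rewrite <- (exp_ln eps He); apply exp_increasing; lra.
Qed.

Lemma ln_le_minus_1 x : 0 < x -> 1 + ln x <= x.
Proof. intros Hx; assert (H := exp_ineq1_le (ln x)); rewrite exp_ln in H by assumption; lra. Qed.

Lemma Cexp_log_power_near (v : R) (z : C) : 0 <= v -> 1 <= Cmod z ->
  Cmod (Cexp (- (RtoC v * Clog z)) - 1)%C <= v * Cmod (Clog z).
Proof.
intros Hv Hz; assert (L := ln_nonneg _ Hz).
rewrite <- Cexp_0.
eapply Rle_trans; [apply Cexp_minus_le with (M := 0) |].
- replace (Re (- (RtoC v * Clog z))%C) with (- (v * ln (Cmod z))) by (unfold Re; simpl; ring); nra.
- simpl; lra.
- replace (- (RtoC v * Clog z) - 0)%C with (- (RtoC v * Clog z))%C by ring.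
  rewrite exp_0, Rmult_1_r, Cmod_opp, Cmod_mult, Cmod_R, Rabs_pos_eq by assumption; lra.
Qed.

(** Integration by parts moves the exponent from [v] to [1 + v] and extracts the factor [v]. The
    remaining integral is Lipschitz in [v] and equals [PI] at [v = 0]. Here [k] is [1/Gamma(1 + v)]
    in disguise. *)
Lemma hankel_constant : exists Q, 0 <= Q /\ forall v, 0 <= v -> exists k,
  cint (hankel v) 1 1 (PI * (v * k)) /\ Rabs (k - 1) <= Q * v.
Proof.
assert (HPI := PI_RGT_0).
exists (2 * (1 + PI) * exp 1 / PI); split.
{ apply Rdiv_le_0_compat; [| lra]; assert (H := exp_pos 1); nra. }
intros v Hv.
destruct (hankel_cint v Hv) as [l Hl]; destruct (hankel_cint (1 + v)) as [l1 Hl1]; [lra |].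
destruct (hankel_cint 1) as [l0 Hl0]; [lra |].
assert (E0 := hankel_1_cint l0 Hl0); subst l0.
assert (El := hankel_parts v l l1 Hv Hl Hl1).
exists (l1 / PI); split.
{ replace (PI * (v * (l1 / PI))) with l by (rewrite El; field; lra); assumption. }
(* The factor [1/|z|] of [hankel 1] compensates [|log z|], which is at most [(1 + PI)|z|]. *)
assert (Bd : forall z, 1 <= Cmod z -> Cmod (hankel (1 + v) z - hankel 1 z)%C <= v * (1 + PI) * exp (Re z)).
{ intros z Hz; assert (L := ln_nonneg _ Hz).
  replace (hankel (1 + v) z) with (hankel 1 z * Cexp (- (RtoC v * Clog z)))%C.
  2: { unfold hankel; rewrite <- Cexp_plus; f_equal; rewrite RtoC_plus; ring. }
  replace (hankel 1 z * Cexp (- (RtoC v * Clog z)) - hankel 1 z)%C with (hankel 1 z * (Cexp (- (RtoC v * Clog z)) - 1))%C by ring.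
  rewrite Cmod_mult.
  assert (B1 := Cexp_log_power_near v z Hv Hz).
  assert (B2 := Cmod_Clog_le z); rewrite Rabs_pos_eq in B2 by assumption.
  assert (B3 := ln_le_minus_1 (Cmod z) ltac:(lra)).
  assert (B4 : Cmod (hankel 1 z) = exp (Re z) / Cmod z).
  { rewrite Cmod_hankel, Rmult_1_l; unfold Rminus; rewrite exp_plus, exp_Ropp, exp_ln by lra; reflexivity. }
  rewrite B4.
  apply Rle_trans with (exp (Re z) / Cmod z * (v * ((1 + PI) * Cmod z))).
  - apply Rmult_le_compat_l.
    + apply Rlt_le, Rdiv_lt_0_compat; [apply exp_pos | lra].
    + apply Rle_trans with (1 := B1), Rmult_le_compat_l; [assumption |]; nra.
  - right; field; lra. }
assert (B : Rabs (l1 - PI) <= v * (1 + PI) * exp 1 * 1 + v * (1 + PI) * exp (1 * 1) / 1).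
{ apply cint_bound with (6 := cint_minus _ _ _ _ _ _ Hl1 Hl0); [lra | lra | nra | |].
  - intros y _; exact (Bd (1, y) (Cmod_right_ge_1 y)).
  - intros t _; rewrite Rmult_1_l; exact (Bd (t, 1) (Cmod_top_ge_1 t)). }
replace (l1 / PI - 1) with ((l1 - PI) / PI) by (field; lra).
unfold Rdiv at 1; rewrite Rabs_mult, (Rabs_pos_eq (/ PI)) by (left; apply Rinv_0_lt_compat; lra).
apply Rle_trans with ((v * (1 + PI) * exp 1 * 1 + v * (1 + PI) * exp (1 * 1) / 1) * / PI).
- apply Rmult_le_compat_r; [left; apply Rinv_0_lt_compat; lra | assumption].
- right; rewrite Rmult_1_l; field; lra.
Qed.

(** * Perturbation of the parameters *)

Lemma prodC_bound n (f : nat -> C) M : 0 <= M -> (forall k, (k < n)%nat -> Cmod (f k) <= M) -> Cmod (prodC n f) <= M ^ n.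
Proof.
intros HM; induction n as [| n IH]; intros H; simpl; [rewrite Cmod_1; lra |].
rewrite Cmod_mult, Rmult_comm; apply Rmult_le_compat; try apply Cmod_ge_0; auto with arith.
Qed.

Lemma prodC_lipschitz n (f g : nat -> C) M d : 1 <= M ->
  (forall k, (k < n)%nat -> Cmod (f k) <= M) -> (forall k, (k < n)%nat -> Cmod (g k) <= M) ->
  (forall k, (k < n)%nat -> Cmod (f k - g k)%C <= d) ->
  Cmod (prodC n f - prodC n g)%C <= INR n * M ^ n * d.
Proof.
intros HM; induction n as [| n IH]; intros Hf Hg Hd.
- simpl; replace (1 - 1)%C with (RtoC 0) by ring; rewrite Cmod_0; lra.
- rewrite S_INR; simpl prodC; simpl pow.
  replace (prodC n f * f n - prodC n g * g n)%C with ((prodC n f - prodC n g) * f n + prodC n g * (f n - g n))%C by ring.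
  apply Rle_trans with (1 := Cmod_triangle _ _); rewrite !Cmod_mult.
  assert (I1 : Cmod (prodC n f - prodC n g)%C <= INR n * M ^ n * d) by (apply IH; auto with arith).
  assert (I2 : Cmod (prodC n g) <= M ^ n) by (apply prodC_bound; [lra | auto with arith]).
  assert (I3 := Hf n ltac:(lia)); assert (I4 := Hd n ltac:(lia)).
  assert (P0 := Cmod_ge_0 (prodC n f - prodC n g)); assert (P1 := Cmod_ge_0 (f n)).
  assert (P2 := Cmod_ge_0 (prodC n g)); assert (P3 := Cmod_ge_0 (f n - g n)).
  assert (Hp : 0 < M ^ n) by (apply pow_lt; lra).
  assert (J1 : Cmod (prodC n f - prodC n g) * Cmod (f n) <= INR n * M ^ n * d * M) by (apply Rmult_le_compat; assumption).
  assert (J2 : Cmod (prodC n g) * Cmod (f n - g n) <= M ^ n * d) by (apply Rmult_le_compat; assumption).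
  assert (M ^ n * d <= M ^ n * d * M) by (assert (0 <= M ^ n * d) by (apply Rmult_le_pos; lra); nra).
  nra.
Qed.

Lemma sumR_lipschitz n (f g : nat -> R) M : (forall k, (k < n)%nat -> Rabs (f k - g k) <= M) ->
  Rabs (sumR n f - sumR n g) <= INR n * M.
Proof.
induction n as [| n IH]; intros H; [simpl; rewrite Rminus_diag, Rabs_R0; lra |].
rewrite S_INR; simpl sumR.
replace (sumR n f + f n - (sumR n g + g n)) with ((sumR n f - sumR n g) + (f n - g n)) by ring.
apply Rle_trans with (1 := Rabs_triang _ _).
assert (H1 := H n ltac:(lia)); assert (H2 : Rabs (sumR n f - sumR n g) <= INR n * M) by (apply IH; auto with arith); lra.
Qed.

Lemma mu_lipschitz p q a b a' b' d : (forall k, (k < p)%nat -> Rabs (a k - a' k) <= d) ->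
  (forall j, (j < q)%nat -> Rabs (b j - b' j) <= d) -> Rabs (mu p q a b - mu p q a' b') <= (INR p + INR q) * d.
Proof.
intros Ha Hb; unfold mu.
replace (sumR q b - sumR p a + (INR p - INR q) / 2 - (sumR q b' - sumR p a' + (INR p - INR q) / 2))
  with ((sumR q b - sumR q b') - (sumR p a - sumR p a')) by ring.
apply Rle_trans with (1 := Rabs_triang _ _); rewrite Rabs_Ropp.
assert (H1 := sumR_lipschitz p a a' d Ha); assert (H2 := sumR_lipschitz q b b' d Hb); lra.
Qed.

Lemma log_nu_lipschitz p q A B : exists Q, 0 <= Q /\ forall a b a' b' d, 0 <= d ->
  (forall k, (k < p)%nat -> Rabs (a k - a' k) <= d) -> (forall j, (j < q)%nat -> Rabs (b j - b' j) <= d) ->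
  Rabs (log_nu p q A B a b - log_nu p q A B a' b') <= Q * d.
Proof.
destruct (Rabs_upper_bound p (fun k => ln (A k))) as [M1 [HM1 B1]].
destruct (Rabs_upper_bound q (fun k => ln (B k))) as [M2 [HM2 B2]].
assert (Hp := pos_INR p); assert (Hq := pos_INR q).
exists (INR p * M1 + INR q * M2); split; [nra |].
intros a b a' b' d Hd Ha Hb; unfold log_nu.
match goal with |- Rabs (?c + ?s1 - ?s2 - (?c + ?t1 - ?t2)) <= _ =>
  replace (c + s1 - s2 - (c + t1 - t2)) with ((s1 - t1) - (s2 - t2)) by ring end.
apply Rle_trans with (1 := Rabs_triang _ _); rewrite Rabs_Ropp.
rewrite Rmult_plus_distr_r, !Rmult_assoc; apply Rplus_le_compat; apply sumR_lipschitz; intros k Hk.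
- replace ((a k - / 2) * ln (A k) - (a' k - / 2) * ln (A k)) with (ln (A k) * (a k - a' k)) by ring.
  rewrite Rabs_mult; apply Rmult_le_compat; try apply Rabs_pos; auto.
- replace ((b k - / 2) * ln (B k) - (b' k - / 2) * ln (B k)) with (ln (B k) * (b k - b' k)) by ring.
  rewrite Rabs_mult; apply Rmult_le_compat; try apply Rabs_pos; auto.
Qed.

Definition near_params (p q : nat) (a b a' b' : nat -> R) (d : R) : Prop :=
  (forall k, (k < p)%nat -> Rabs (a k - a' k) <= d) /\ (forall j, (j < q)%nat -> Rabs (b j - b' j) <= d).

Lemma rgamma_family_lipschitz (M : R) : 0 <= M -> exists K, 1 <= K /\
  forall A b b' s, Cmod (RtoC A * s + RtoC b)%C <= M -> Cmod (RtoC A * s + RtoC b')%C <= M ->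
  Cmod (rgamma (RtoC A * s + RtoC b)%C) <= K /\
  Cmod (rgamma (RtoC A * s + RtoC b)%C - rgamma (RtoC A * s + RtoC b')%C)%C <= K * Rabs (b - b').
Proof.
intros HM; destruct (gauss_rgamma M HM) as [K [HK H]]; exists (K + 1); split; [lra |].
intros A b b' s Hb Hb'; destruct (H _ Hb) as [H1 [_ H2]]; split; [lra |].
apply Rle_trans with (1 := H2 _ Hb').
replace (RtoC A * s + RtoC b - (RtoC A * s + RtoC b'))%C with (RtoC (b - b')) by (rewrite RtoC_minus; ring).
rewrite Cmod_R; assert (P := Rabs_pos (b - b')); nra.
Qed.

(** On this fixed segment [A s - M] may approach the negative axis, outside the reach of the uniform
    Stirling estimates. Boundedness replaces them: [1/Gamma] is locally Lipschitz, and [Gamma] is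
    bounded at [A s + a] because [a >= 0] and [Re s = 1/2]. *)
Lemma hkernel_segment_lipschitz p q A B (M : R) :
  (forall k, (k < p)%nat -> 0 < A k) -> 0 <= M -> exists K, 0 <= K /\
  forall y, 0 <= y <= 1 -> forall a b, (forall k, (k < p)%nat -> 0 <= a k <= M) -> (forall j, (j < q)%nat -> Rabs (b j) <= M) ->
  Cmod (hkernel p q A a B b ((/ 2)%R, y)) <= K /\
  forall a' b' d, (forall k, (k < p)%nat -> 0 <= a' k <= M) -> (forall j, (j < q)%nat -> Rabs (b' j) <= M) ->
  0 <= d -> near_params p q a b a' b' d ->
  Cmod (hkernel p q A a B b ((/ 2)%R, y) - hkernel p q A a' B b' ((/ 2)%R, y))%C <= K * d.
Proof.
intros HA HM.
destruct (positive_lower_bound p A HA) as [k0 [Hk0 L0]].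
destruct (Rabs_upper_bound p A) as [MA [HMA BA]]; destruct (Rabs_upper_bound q B) as [MB [HMB BB]].
set (X := (MA + MB) * 2 + M).
assert (HX : 0 <= X) by (unfold X; lra).
destruct (rgamma_family_lipschitz X HX) as [K [HK HR]].
destruct (LogGamma_bound (k0 * / 2) X ltac:(nra) HX) as [L HL].
set (E := exp L); assert (HE : 0 < E) by apply exp_pos.
assert (Hs : forall y, 0 <= y <= 1 -> Cmod ((/ 2)%R, y) <= 2).
{ intros y Hy; apply Rle_trans with (1 := Cmod_le_abs _); simpl; rewrite !Rabs_pos_eq; lra. }
assert (AX : forall y k r, 0 <= y <= 1 -> (k < p)%nat -> Rabs r <= M -> Cmod (RtoC (A k) * ((/ 2)%R, y) + RtoC r)%C <= X).
{ intros y k r Hy Hk Hr; apply Rle_trans with (1 := Cmod_affine_le (A k) r 2 _ (Hs y Hy)).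
  specialize (BA k Hk); unfold X; lra. }
assert (BX : forall y k r, 0 <= y <= 1 -> (k < q)%nat -> Rabs r <= M -> Cmod (RtoC (B k) * ((/ 2)%R, y) + RtoC r)%C <= X).
{ intros y k r Hy Hk Hr; apply Rle_trans with (1 := Cmod_affine_le (B k) r 2 _ (Hs y Hy)).
  specialize (BB k Hk); unfold X; lra. }
assert (FA : forall y k r, 0 <= y <= 1 -> (k < p)%nat -> 0 <= r -> far (k0 * / 2) (RtoC (A k) * ((/ 2)%R, y) + RtoC r)%C).
{ intros y k r Hy Hk Hr; assert (F := far_affine (A k) r (/ 2) ((/ 2)%R, y) (HA k Hk) Hr ltac:(right; simpl; lra)).
  specialize (L0 k Hk); destruct F as [F | [F1 F2]]; [left | right]; nra. }
assert (GB : forall y k r, 0 <= y <= 1 -> (k < p)%nat -> 0 <= r <= M -> Cmod (Cgamma (RtoC (A k) * ((/ 2)%R, y) + RtoC r)%C) <= E).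
{ intros y k r Hy Hk Hr; assert (F := FA y k r Hy Hk (proj1 Hr)).
  rewrite (Cgamma_LogGamma (k0 * / 2)) by (nra || assumption); rewrite Cmod_Cexp; apply exp_le.
  apply Rle_trans with (1 := Re_le_Cmod _), HL; [assumption |].
  apply AX; try assumption; rewrite Rabs_pos_eq; lra. }
set (N := E + 1 + K).
(* From [1/g - 1/g' = -(g - g')/(g g')]: [K] is a Lipschitz constant of [rgamma] and [E] bounds each
   inverse. *)
set (KD := K * E * E).
assert (HKD : 0 <= KD) by (unfold KD; apply Rmult_le_pos; [apply Rmult_le_pos |]; lra).
assert (GD : forall y k r r', 0 <= y <= 1 -> (k < p)%nat -> 0 <= r <= M -> 0 <= r' <= M ->
   Cmod (Cgamma (RtoC (A k) * ((/ 2)%R, y) + RtoC r)%C - Cgamma (RtoC (A k) * ((/ 2)%R, y) + RtoC r')%C)%C <= KD * Rabs (r - r')).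
{ intros y k r r' Hy Hk Hr Hr'.
  assert (G1 := GB y k r Hy Hk Hr); assert (G2 := GB y k r' Hy Hk Hr').
  destruct (HR (A k) r r' ((/ 2)%R, y)) as [_ H2].
  { apply AX; try assumption; rewrite Rabs_pos_eq; lra. }
  { apply AX; try assumption; rewrite Rabs_pos_eq; lra. }
  assert (N1 : rgamma (RtoC (A k) * ((/ 2)%R, y) + RtoC r)%C <> 0%C).
  { rewrite (rgamma_LogGamma (k0 * / 2)); [apply Cexp_neq_0 | nra | apply FA; lra || assumption]. }
  assert (N2 : rgamma (RtoC (A k) * ((/ 2)%R, y) + RtoC r')%C <> 0%C).
  { rewrite (rgamma_LogGamma (k0 * / 2)); [apply Cexp_neq_0 | nra | apply FA; lra || assumption]. }
  unfold Cgamma in *.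
  set (g := rgamma (RtoC (A k) * ((/ 2)%R, y) + RtoC r)%C) in *; set (g' := rgamma (RtoC (A k) * ((/ 2)%R, y) + RtoC r')%C) in *.
  replace (/ g - / g')%C with (- ((g - g') * / g * / g'))%C by (field; auto).
  rewrite Cmod_opp, !Cmod_mult; unfold KD.
  replace (K * E * E * Rabs (r - r')) with (K * Rabs (r - r') * E * E) by ring.
  apply Rmult_le_compat; try apply Cmod_ge_0; [apply Rmult_le_pos; apply Cmod_ge_0 | | assumption].
  apply Rmult_le_compat; try apply Cmod_ge_0; assumption. }
assert (Hp := pos_INR p); assert (Hq := pos_INR q).
assert (HN : 1 <= N) by (unfold N; lra).
assert (HNp : 0 < N ^ p) by (apply pow_lt; lra); assert (HNq : 0 < N ^ q) by (apply pow_lt; lra).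
set (Z1 := INR p * N ^ p * KD * N ^ q); set (Z2 := N ^ p * (INR q * N ^ q * K)).
assert (HZ1 : 0 <= Z1) by (unfold Z1; repeat apply Rmult_le_pos; lra).
assert (HZ2 : 0 <= Z2) by (unfold Z2; repeat apply Rmult_le_pos; lra).
assert (HZ3 : 0 < N ^ p * N ^ q) by (apply Rmult_lt_0_compat; assumption).
exists (N ^ p * N ^ q + Z1 + Z2); split; [lra |].
intros y Hy a b Ha Hb.
assert (PA : forall a, (forall k, (k < p)%nat -> 0 <= a k <= M) -> forall k, (k < p)%nat -> Cmod (Cgamma (RtoC (A k) * ((/ 2)%R, y) + RtoC (a k))%C) <= N).
{ intros a0 Ha0 k Hk; apply Rle_trans with (1 := GB y k (a0 k) Hy Hk (Ha0 k Hk)); unfold N; lra. }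
assert (PB : forall b, (forall k, (k < q)%nat -> Rabs (b k) <= M) -> forall k, (k < q)%nat -> Cmod (rgamma (RtoC (B k) * ((/ 2)%R, y) + RtoC (b k))%C) <= N).
{ intros b0 Hb0 k Hk; destruct (HR (B k) (b0 k) (b0 k) ((/ 2)%R, y)) as [H1 _]; [apply BX; auto | apply BX; auto |].
  unfold N; lra. }
split.
- unfold hkernel; rewrite Cmod_mult; apply Rle_trans with (N ^ p * N ^ q); [| lra].
  apply Rmult_le_compat; try apply Cmod_ge_0; apply prodC_bound; try lra; [apply PA | apply PB]; assumption.
- intros a' b' d Ha' Hb' Hd [Da Db]; unfold hkernel.
  set (P1 := prodC p (fun k => Cgamma (RtoC (A k) * ((/ 2)%R, y) + RtoC (a k))%C)).
  set (P1' := prodC p (fun k => Cgamma (RtoC (A k) * ((/ 2)%R, y) + RtoC (a' k))%C)).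
  set (P2 := prodC q (fun k => rgamma (RtoC (B k) * ((/ 2)%R, y) + RtoC (b k))%C)).
  set (P2' := prodC q (fun k => rgamma (RtoC (B k) * ((/ 2)%R, y) + RtoC (b' k))%C)).
  replace (P1 * P2 - P1' * P2')%C with ((P1 - P1') * P2 + P1' * (P2 - P2'))%C by ring.
  apply Rle_trans with (1 := Cmod_triangle _ _); rewrite !Cmod_mult.
  assert (I1 : Cmod (P1 - P1')%C <= INR p * N ^ p * (KD * d)).
  { apply prodC_lipschitz; [assumption | apply PA; assumption | apply PA; assumption |].
    intros k Hk; apply Rle_trans with (1 := GD y k (a k) (a' k) Hy Hk (Ha k Hk) (Ha' k Hk)).
    apply Rmult_le_compat_l; auto. }
  assert (I2 : Cmod (P2 - P2')%C <= INR q * N ^ q * (K * d)).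
  { apply prodC_lipschitz; [assumption | apply PB; assumption | apply PB; assumption |].
    intros k Hk; destruct (HR (B k) (b k) (b' k) ((/ 2)%R, y)) as [_ H2]; [apply BX; auto | apply BX; auto |].
    apply Rle_trans with (1 := H2), Rmult_le_compat_l; [lra | auto]. }
  assert (I3 : Cmod P2 <= N ^ q) by (apply prodC_bound; [lra | apply PB; assumption]).
  assert (I4 : Cmod P1' <= N ^ p) by (apply prodC_bound; [lra | apply PA; assumption]).
  assert (J1 : Cmod (P1 - P1') * Cmod P2 <= INR p * N ^ p * (KD * d) * N ^ q) by (apply Rmult_le_compat; try apply Cmod_ge_0; assumption).
  assert (J2 : Cmod P1' * Cmod (P2 - P2') <= N ^ p * (INR q * N ^ q * (K * d))) by (apply Rmult_le_compat; try apply Cmod_ge_0; assumption).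
  replace (INR p * N ^ p * (KD * d) * N ^ q) with (Z1 * d) in J1 by (unfold Z1; ring).
  replace (N ^ p * (INR q * N ^ q * (K * d))) with (Z2 * d) in J2 by (unfold Z2; ring).
  assert (0 <= N ^ p * N ^ q * d) by (apply Rmult_le_pos; lra).
  lra.
Qed.

Lemma Cexp_minus_1_le (w : C) (h : R) : Cmod w <= h -> Cmod (Cexp w - 1)%C <= Cmod w * exp h.
Proof.
intros H; rewrite <- Cexp_0.
replace (Cmod w) with (Cmod (w - 0)%C) at 1 by (f_equal; ring).
assert (H0 := Cmod_ge_0 w); assert (H1 := Re_le_Cmod w).
apply Cexp_minus_le; simpl; lra.
Qed.

(** Writing the difference as [(E - E')(F - 1) + E'(F - F')], with [E], [F] the exponentials of
    [al], [th], leaves the small factor [h] in both terms. It compensates the factor [Y] of the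
    rescaling. *)
Lemma perturb_remainder (al al' th th' : C) (V h h0 g d : R) :
  Re al <= V -> Re al' <= V -> Cmod th <= h -> Cmod th' <= h -> h <= h0 ->
  Cmod (al - al')%C <= g -> Cmod (th - th')%C <= h * d ->
  Cmod (Cexp al * (Cexp th - 1) - Cexp al' * (Cexp th' - 1))%C <= exp (V + h0) * (h * (g + d)).
Proof.
intros Hal Hal' Hth Hth' Hh Hg Hd.
replace (Cexp al * (Cexp th - 1) - Cexp al' * (Cexp th' - 1))%C with
  ((Cexp al - Cexp al') * (Cexp th - 1) + Cexp al' * (Cexp th - Cexp th'))%C by ring.
apply Rle_trans with (1 := Cmod_triangle _ _); rewrite !Cmod_mult, exp_plus.
assert (E0 : 0 < exp V) by apply exp_pos; assert (E1 : 0 < exp h0) by apply exp_pos.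
assert (P1 := Cmod_ge_0 th); assert (P2 := Cmod_ge_0 (al - al')); assert (P3 := Cmod_ge_0 (th - th')).
assert (I1 := Cexp_minus_le al al' V Hal Hal').
assert (I2 := Cexp_minus_1_le th h0 ltac:(lra)).
assert (I3 : Cmod (Cexp al') <= exp V) by (rewrite Cmod_Cexp; apply exp_le; assumption).
assert (I4 : Cmod (Cexp th - Cexp th')%C <= Cmod (th - th')%C * exp h0).
{ apply Cexp_minus_le; [apply Rle_trans with (1 := Re_le_Cmod th) | apply Rle_trans with (1 := Re_le_Cmod th')]; lra. }
assert (J1 : Cmod (Cexp al - Cexp al') * Cmod (Cexp th - 1) <= (g * exp V) * (h * exp h0)).
{ apply Rmult_le_compat; try apply Cmod_ge_0.
  - apply Rle_trans with (1 := I1), Rmult_le_compat_r; lra.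
  - apply Rle_trans with (1 := I2), Rmult_le_compat_r; lra. }
assert (J2 : Cmod (Cexp al') * Cmod (Cexp th - Cexp th') <= exp V * (h * d * exp h0)).
{ apply Rmult_le_compat; try apply Cmod_ge_0; [assumption |].
  apply Rle_trans with (1 := I4), Rmult_le_compat_r; lra. }
apply Rle_trans with (g * exp V * (h * exp h0) + exp V * (h * d * exp h0)); [lra | right; ring].
Qed.

(** The counterpart for the fixed contour, where [theta] is bounded but not small. *)
Lemma perturb_product (al al' th th' : C) (V h0 g e : R) :
  Re al <= V -> Re al' <= V -> Cmod th <= h0 -> Cmod th' <= h0 ->
  Cmod (al - al')%C <= g -> Cmod (th - th')%C <= e ->
  Cmod (Cexp (al + th) - Cexp (al' + th'))%C <= exp (V + h0) * (g + e).
Proof.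
intros Hal Hal' Hth Hth' Hg Hd.
assert (R1 := Re_le_Cmod th); assert (R2 := Re_le_Cmod th').
eapply Rle_trans; [apply Cexp_minus_le with (M := V + h0) |].
- change (Re al + Re th <= V + h0); lra.
- change (Re al' + Re th' <= V + h0); lra.
- rewrite Rmult_comm; apply Rmult_le_compat_l; [left; apply exp_pos |].
  replace (al + th - (al' + th'))%C with ((al - al') + (th - th'))%C by ring.
  apply Rle_trans with (1 := Cmod_triangle _ _); lra.
Qed.

(** * The loop integral near [rho] and away from it *)

Definition main_exponent (p q : nat) (A B a b : nat -> R) (s : C) : C :=
  (RtoC (log_nu p q A B a b) - RtoC (mu p q a b) * Clog s)%C.

Lemma Re_main_exponent p q A B a b s : 0 <= mu p q a b -> 1 <= Cmod s ->
  Re (main_exponent p q A B a b s) <= log_nu p q A B a b.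
Proof.
intros Hmu Hs; assert (L := ln_nonneg _ Hs).
replace (Re (main_exponent p q A B a b s)) with (log_nu p q A B a b - mu p q a b * ln (Cmod s))
  by (unfold main_exponent, Re; simpl; ring); nra.
Qed.

(** As [mu] vanishes at the limit parameters, it is itself [O(d)]. The factor [1 + ln |s|] stems
    from [mu log s] and has to be absorbed on each contour. *)
Lemma main_exponent_lipschitz p q A B (a' b' : nat -> R) : mu p q a' b' = 0 ->
  exists V Q, 0 <= Q /\ log_nu p q A B a' b' <= V /\ forall a b d, 0 <= d <= 1 -> near_params p q a b a' b' d ->
  log_nu p q A B a b <= V /\ Rabs (mu p q a b) <= Q * d /\
  Rabs (log_nu p q A B a b - log_nu p q A B a' b') <= Q * d /\
  forall s, 1 <= Cmod s ->
  Cmod (main_exponent p q A B a b s - main_exponent p q A B a' b' s)%C <= Q * d * (1 + ln (Cmod s)).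
Proof.
intros Hmu; destruct (log_nu_lipschitz p q A B) as [Q0 [HQ0 H]].
assert (Hp := pos_INR p); assert (Hq := pos_INR q); assert (HPI := PI_RGT_0).
assert (HQ1 : 0 <= (INR p + INR q) * (1 + PI)) by nra.
exists (log_nu p q A B a' b' + Q0), (Q0 + (INR p + INR q) * (1 + PI)).
split; [lra |]; split; [lra |].
intros a b d Hd [Ha Hb].
assert (H1 := H a b a' b' d (proj1 Hd) Ha Hb).
assert (H2 := mu_lipschitz p q a b a' b' d Ha Hb); rewrite Hmu, Rminus_0_r in H2.
assert (H1' := H1); apply Rabs_le_between in H1'.
assert (F1 : 0 <= (INR p + INR q) * PI * d) by (apply Rmult_le_pos; [apply Rmult_le_pos |]; lra).
assert (F2 : 0 <= Q0 * d) by (apply Rmult_le_pos; lra).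
assert (F3 : 0 <= (INR p + INR q) * d) by (apply Rmult_le_pos; lra).
assert (F4 : Q0 * d <= Q0) by nra.
split; [lra |]; split; [lra |]; split; [lra |].
intros s Hs; assert (L := ln_nonneg _ Hs).
unfold main_exponent; rewrite Hmu.
replace (RtoC (log_nu p q A B a b) - RtoC (mu p q a b) * Clog s - (RtoC (log_nu p q A B a' b') - RtoC 0 * Clog s))%C
  with (RtoC (log_nu p q A B a b - log_nu p q A B a' b') - RtoC (mu p q a b) * Clog s)%C by (rewrite RtoC_minus; ring).
apply Rle_trans with (1 := Cmod_minus_le _ _); rewrite Cmod_mult, !Cmod_R.
assert (CL := Cmod_Clog_le s); rewrite Rabs_pos_eq in CL by assumption.
assert (J : Rabs (mu p q a b) * Cmod (Clog s) <= ((INR p + INR q) * d) * ((1 + PI) * (1 + ln (Cmod s)))).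
{ apply Rmult_le_compat; [apply Rabs_pos | apply Cmod_ge_0 | assumption | nra]. }
assert (0 <= Q0 * d * ln (Cmod s)) by (apply Rmult_le_pos; nra).
nra.
Qed.

(** Half of the decay of [e^t] pays for the linear growth of [|z|] along the horizontal side. *)
Lemma exp_linear_le t : t <= 1 -> (1 + Rabs t) * exp t <= 4 * exp (t / 2).
Proof.
intros Ht.
assert (E : exp t = exp (t / 2) * exp (t / 2)) by (rewrite <- exp_plus; f_equal; field).
rewrite E, <- Rmult_assoc; apply Rmult_le_compat_r; [left; apply exp_pos |].
destruct (Rle_dec 0 t) as [H0 | H0].
- rewrite Rabs_pos_eq by assumption.
  assert (exp (t / 2) <= 2).
  { assert (I := exp_ineq1_le (- (t / 2))); rewrite exp_Ropp in I.
    assert (P := exp_pos (t / 2)).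
    apply Rmult_le_reg_r with (/ exp (t / 2)); [apply Rinv_0_lt_compat; assumption |].
    rewrite Rinv_r by lra; lra. }
  assert (P := exp_pos (t / 2)); nra.
- rewrite Rabs_left by lra.
  assert (I := exp_ineq1_le (- (t / 2))); rewrite exp_Ropp in I.
  assert (P := exp_pos (t / 2)).
  apply Rle_trans with (2 * / exp (t / 2) * exp (t / 2)); [apply Rmult_le_compat_r; lra |].
  rewrite Rmult_assoc, Rinv_l by lra; lra.
Qed.

Lemma Cmod_top_le t : Cmod (t, 1) <= 1 + Rabs t.
Proof. apply Rle_trans with (1 := Cmod_le_abs _); simpl; rewrite Rabs_R1; lra. Qed.

Definition contour_pt (z : C) : Prop := (Re z = 1 /\ 0 <= Im z <= 1) \/ (Im z = 1 /\ Re z <= 1).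

Lemma contour_pt_slit z : contour_pt z -> slit z /\ 1 <= Cmod z.
Proof.
intros [[H1 H2] | [H1 H2]]; split.
- apply slit_Re_pos; lra.
- apply Rle_trans with (2 := Re_le_Cmod z); lra.
- apply slit_Im_pos; lra.
- apply Rle_trans with (2 := Rabs_Im_le_Cmod z); rewrite H1, Rabs_R1; lra.
Qed.

(* With [Y = 1/u] the rescaled integrand is [e^z] times a quantity depending on
   [Y z] only; subtracting the leading term leaves the factor [e^theta - 1 = O(1/Y)]. *)
Lemma rescaled_remainder p q A B a b x Y l k (K0 : R) :
  sumR q B - sumR p A = 0 ->
  0 < x < rho p q A B -> Y = / (log_rho p q A B - ln x) ->
  cint (hintegrand p q A a B b x) Y Y l ->
  cint (hankel (mu p q a b)) 1 1 K0 ->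
  0 < k ->
  (forall z, contour_pt z -> (forall i, (i < p)%nat -> far k (RtoC (A i) * (RtoC Y * z) + RtoC (a i))%C) /\
     (forall j, (j < q)%nat -> far k (RtoC (B j) * (RtoC Y * z) + RtoC (b j))%C)) ->
  exists D, cint D 1 1 (l - exp (log_nu p q A B a b) * Rpower Y (1 - mu p q a b) * K0) /\
  forall z, contour_pt z -> D z = (Cexp z * (RtoC Y * (Cexp (main_exponent p q A B a b (RtoC Y * z)) * (Cexp (theta p q A a B b (RtoC Y * z)) - 1))))%C.
Proof.
intros hbal Hx HY Hl HK Hk Hfar.
assert (Hu : 0 < log_rho p q A B - ln x).
{ rewrite rho_exp in Hx; assert (L := ln_increasing x _ (proj1 Hx) (proj2 Hx)); rewrite ln_exp in L; lra. }
assert (HY0 : 0 < Y) by (rewrite HY; apply Rinv_0_lt_compat; assumption).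
replace (cint (hintegrand p q A a B b x) Y Y l) with (cint (hintegrand p q A a B b x) (Y * 1) (Y * 1) l) in Hl by (rewrite Rmult_1_r; reflexivity).
apply cint_scale in Hl; [| assumption].
exists (fun z => RtoC Y * hintegrand p q A a B b x (RtoC Y * z) - RtoC (exp (log_nu p q A B a b) * Rpower Y (1 - mu p q a b)) * hankel (mu p q a b) z)%C.
split; [apply cint_minus; [exact Hl | apply cint_scal; exact HK] |].
intros z Hz; destruct (contour_pt_slit z Hz) as [Sz _]; destruct (Hfar z Hz) as [F1 F2].
rewrite (hintegrand_asymptotic p q A a B b x _ k); try assumption.
fold (main_exponent p q A B a b (RtoC Y * z)).
replace (RtoC (log_rho p q A B - ln x) * (RtoC Y * z))%C with z.
2: { replace (RtoC (log_rho p q A B - ln x) * (RtoC Y * z))%C with (RtoC ((log_rho p q A B - ln x) * Y) * z)%C by (rewrite RtoC_mult; ring).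
     rewrite HY, Rinv_r by lra; ring. }
rewrite !Cexp_plus.
assert (EH : (RtoC (exp (log_nu p q A B a b) * Rpower Y (1 - mu p q a b)) * hankel (mu p q a b) z)%C =
   (RtoC Y * (Cexp z * Cexp (main_exponent p q A B a b (RtoC Y * z))))%C).
{ unfold main_exponent, hankel, Rpower; rewrite (Clog_scal Y z) by assumption.
  replace (RtoC Y) with (Cexp (RtoC (ln Y))) at 1 by (rewrite Cexp_RtoC, exp_ln by assumption; reflexivity).
  rewrite <- exp_plus, <- Cexp_RtoC, <- !Cexp_plus; f_equal.
  rewrite RtoC_plus, RtoC_mult, RtoC_minus; ring. }
rewrite EH; ring.
Qed.

(** On the loop enlarged by [Y = 1/u] every argument of Gamma is at distance at least [delta Y] from
    the negative axis, so [theta = O(1/Y)], which compensates the Jacobian [Y]. Varying the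
    parameters costs a factor [ln(Y|z|)], bounded by a multiple of [sqrt Y |z|]. The resulting
    weight [sqrt (1/u)] is integrable at [rho]. *)
Lemma regime_near_rho p q A B (a' b' : nat -> R) :
  (forall k, (k < p)%nat -> 0 < A k) -> (forall j, (j < q)%nat -> 0 < B j) -> sumR q B - sumR p A = 0 ->
  (forall k, (k < p)%nat -> 0 <= a' k) -> mu p q a' b' = 0 ->
  exists Y0 K, 1 <= Y0 /\ 0 <= K /\
  forall a b d, 0 <= d <= 1 -> near_params p q a b a' b' d -> (forall k, (k < p)%nat -> 0 <= a k) -> 0 <= mu p q a b ->
  forall x, 0 < x < rho p q A B -> Y0 <= / (log_rho p q A B - ln x) ->
  forall l l' K0, (forall c Y, 0 < c -> 0 < Y -> cint (hintegrand p q A a B b x) c Y l) ->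
  (forall c Y, 0 < c -> 0 < Y -> cint (hintegrand p q A a' B b' x) c Y l') ->
  cint (hankel (mu p q a b)) 1 1 K0 ->
  Rabs l' <= K /\
  Rabs (l - l' - exp (log_nu p q A B a b) * Rpower (/ (log_rho p q A B - ln x)) (1 - mu p q a b) * K0) <= K * d * sqrt (/ (log_rho p q A B - ln x)).
Proof.
intros hA hB hbal Ha' Hmu'.
destruct (positive_lower_bound p A hA) as [k1 [Hk1 L1]]; destruct (positive_lower_bound q B hB) as [k2 [Hk2 L2]].
destruct (Rabs_upper_bound p a') as [Ma [HMa Ba]]; destruct (Rabs_upper_bound q b') as [Mb [HMb Bb]].
set (k0 := Rmin k1 k2); assert (Hk0 : 0 < k0) by (apply Rmin_pos; assumption).
assert (LA : forall k, (k < p)%nat -> k0 <= A k) by (intros k Hk; apply Rle_trans with (1 := Rmin_l k1 k2); auto).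
assert (LB : forall k, (k < q)%nat -> k0 <= B k) by (intros k Hk; apply Rle_trans with (1 := Rmin_r k1 k2); auto).
(* The extra 1 is room for parameters at distance [d <= 1] from the limit ones. *)
set (M := Ma + Mb + 1); assert (HM : 0 <= M) by (unfold M; lra).
(* One half of the distance [k0 Y] pays for the shift by [M]; the other half is the distance
   [delta Y] that is kept. *)
set (delta := k0 / 2); assert (Hdelta : 0 < delta) by (unfold delta; lra).
destruct (theta_estimates p q A B delta M hA hB Hdelta HM) as [T [HT TE]].
destruct (main_exponent_lipschitz p q A B a' b' Hmu') as [V [Q [HQ [HV ME]]]].
(* From this value of [Y] on, [M <= delta Y]. *)
set (Y0 := 1 + 2 * M / k0).
assert (HY0 : 1 <= Y0) by (unfold Y0; assert (0 <= 2 * M / k0) by (apply Rdiv_le_0_compat; lra); lra).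
set (h0 := T / delta); assert (Hh0 : 0 < h0) by (apply Rdiv_lt_0_compat; assumption).
set (W := exp (V + h0) * h0); assert (HW : 0 < W) by (apply Rmult_lt_0_compat; [apply exp_pos | assumption]).
set (K1 := W * (2 * (Q + 1))); assert (HK1 : 0 < K1) by (apply Rmult_lt_0_compat; lra).
assert (E1 := exp_pos 1); assert (E2 := exp_pos (/ 2 * 1)).
exists Y0, (W * (2 * exp 1) + K1 * (2 * exp 1 + 4 * exp (/ 2 * 1) / / 2)).
split; [assumption |]; split; [nra |].
intros a b d Hd Hnear Ha Hmu x Hx HYx l l' K0 Hl Hl' HK.
set (u := log_rho p q A B - ln x) in *.
assert (Hu : 0 < u).
{ unfold u; rewrite rho_exp in Hx; assert (L := ln_increasing x _ (proj1 Hx) (proj2 Hx)); rewrite ln_exp in L; lra. }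
set (Y := / u) in *; assert (HY : 0 < Y) by (apply Rinv_0_lt_compat; assumption).
set (m := delta * Y).
assert (Hm : delta <= m) by (unfold m; nra).
assert (BA' : forall k, (k < p)%nat -> Rabs (a' k) <= M) by (intros k Hk; specialize (Ba k Hk); unfold M; lra).
assert (BB' : forall k, (k < q)%nat -> Rabs (b' k) <= M) by (intros k Hk; specialize (Bb k Hk); unfold M; lra).
assert (BA : forall k, (k < p)%nat -> Rabs (a k) <= M).
{ intros k Hk; specialize (Ba k Hk); assert (N1 := proj1 Hnear k Hk).
  assert (TR := Rabs_triang (a k - a' k) (a' k)); replace (a k - a' k + a' k) with (a k) in TR by ring; unfold M; lra. }
assert (BB : forall k, (k < q)%nat -> Rabs (b k) <= M).
{ intros k Hk; specialize (Bb k Hk); assert (N1 := proj2 Hnear k Hk).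
  assert (TR := Rabs_triang (b k - b' k) (b' k)); replace (b k - b' k + b' k) with (b k) in TR by ring; unfold M; lra. }
assert (HMY : M <= delta * Y).
{ unfold delta; apply Rle_trans with (k0 / 2 * (2 * M / k0)); [right; field; lra |].
  apply Rmult_le_compat_l; [lra |]; unfold Y0 in HYx; lra. }
assert (FAR : forall c z, k0 <= c -> contour_pt z -> far m (RtoC c * (RtoC Y * z) - RtoC M)%C).
{ intros c z Hc Hz; unfold far.
  replace (Re (RtoC c * (RtoC Y * z) - RtoC M)%C) with (c * Y * Re z - M) by (unfold Re; simpl; ring).
  replace (Im (RtoC c * (RtoC Y * z) - RtoC M)%C) with (c * Y * Im z) by (unfold Im; simpl; ring).
  assert (CY : k0 * Y <= c * Y) by (apply Rmult_le_compat_r; lra).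
  assert (DY : k0 * Y = delta * Y + delta * Y) by (unfold delta; field).
  destruct Hz as [[-> [Z1 Z2]] | [-> Z]].
  - right; split; [unfold m; lra |]. apply Rmult_le_pos; [nra | assumption].
  - left; unfold m; assert (0 < delta * Y) by nra; lra. }
assert (FZ : forall (a0 b0 : nat -> R), (forall k, (k < p)%nat -> Rabs (a0 k) <= M) -> (forall k, (k < q)%nat -> Rabs (b0 k) <= M) ->
   forall z, contour_pt z -> (forall i, (i < p)%nat -> far m (RtoC (A i) * (RtoC Y * z) + RtoC (a0 i))%C) /\
     (forall j, (j < q)%nat -> far m (RtoC (B j) * (RtoC Y * z) + RtoC (b0 j))%C)).
{ intros a0 b0 H1 H2 z Hz; split; intros i Hi; apply far_of_margin with M; auto. }
(* At the limit parameters [mu = 0] and Hankel's integral is 0: the limit function has no singular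
   term, and subtracting the leading part does not change [l']. *)
destruct hankel_constant as [Q0 [_ HC]]; destruct (HC 0 (Rle_refl 0)) as [kk [HK0 _]].
rewrite Rmult_0_l, Rmult_0_r, <- Hmu' in HK0.
assert (Hm0 : 0 < m) by lra.
destruct (rescaled_remainder p q A B a b x Y l m K0 hbal Hx eq_refl (Hl Y Y HY HY) HK Hm0 (FZ a b BA BB)) as [D [CD ED]].
destruct (rescaled_remainder p q A B a' b' x Y l' m _ hbal Hx eq_refl (Hl' Y Y HY HY) HK0 Hm0 (FZ a' b' BA' BB')) as [D' [CD' ED']].
rewrite Hmu', Rmult_0_r, Rminus_0_r in CD'.
(* The Jacobian [Y] and the decay of [theta] in [m = delta Y] cancel exactly. *)
assert (HYm : Y * (T / m) = h0) by (unfold m, h0; field; lra).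
assert (Hhm : T / m <= h0).
{ unfold h0, Rdiv; apply Rmult_le_compat_l; [lra | apply Rinv_le_contravar; lra]. }
assert (CZ : forall z, contour_pt z -> 1 <= Cmod (RtoC Y * z)%C /\ Cmod (RtoC Y * z)%C = Y * Cmod z /\ slit (RtoC Y * z)%C).
{ intros z Hz; destruct (contour_pt_slit z Hz) as [S1 S2].
  rewrite Cmod_mult, Cmod_R, Rabs_pos_eq by lra; split; [nra |]; split; [reflexivity | apply slit_scal; assumption]. }
destruct (ME a b d Hd Hnear) as [HV1 [_ [_ ML]]].
assert (BD' : forall z, contour_pt z -> Cmod (D' z) <= W * exp (Re z)).
{ intros z Hz; destruct (CZ z Hz) as [C1 [C2 C3]].
  rewrite ED' by assumption; rewrite !Cmod_mult, Cmod_Cexp, Cmod_R, (Rabs_pos_eq Y), Rmult_comm by lra.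
  apply Rmult_le_compat_r; [left; apply exp_pos |].
  destruct (TE m (RtoC Y * z)%C Hm C3) with (a := a') (b := b') as [T1 _]; auto.
  assert (I1 := Cexp_minus_1_le _ h0 (Rle_trans _ _ _ T1 Hhm)).
  assert (I2 : Cmod (Cexp (main_exponent p q A B a' b' (RtoC Y * z))) <= exp V).
  { rewrite Cmod_Cexp; apply exp_le; apply Rle_trans with (2 := HV); apply Re_main_exponent; [lra | assumption]. }
  unfold W; rewrite exp_plus, <- HYm.
  apply Rle_trans with (Y * (exp V * (T / m * exp h0))); [| rewrite <- HYm; right; ring].
  apply Rmult_le_compat_l; [lra |].
  apply Rmult_le_compat; try apply Cmod_ge_0; [assumption |].
  apply Rle_trans with (1 := I1), Rmult_le_compat_r; [left; apply exp_pos | assumption]. }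
assert (S0 : sqrt Y * sqrt Y = Y) by (apply sqrt_sqrt; lra).
assert (S1 : 1 <= sqrt Y) by (rewrite <- sqrt_1; apply sqrt_le_1; lra).
assert (BDD : forall z, contour_pt z -> Cmod (D z - D' z)%C <= K1 * d * sqrt Y * (Cmod z * exp (Re z))).
{ intros z Hz; destruct (CZ z Hz) as [C1 [C2 C3]]; destruct (contour_pt_slit z Hz) as [_ Z1].
  rewrite ED, ED' by assumption.
  set (al := main_exponent p q A B a b (RtoC Y * z)); set (al' := main_exponent p q A B a' b' (RtoC Y * z)).
  set (th := theta p q A a B b (RtoC Y * z)); set (th' := theta p q A a' B b' (RtoC Y * z)).
  replace (Cexp z * (RtoC Y * (Cexp al * (Cexp th - 1))) - Cexp z * (RtoC Y * (Cexp al' * (Cexp th' - 1))))%C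
    with (Cexp z * (RtoC Y * (Cexp al * (Cexp th - 1) - Cexp al' * (Cexp th' - 1))))%C by ring.
  rewrite !Cmod_mult, Cmod_Cexp, Cmod_R, (Rabs_pos_eq Y), (Rmult_comm (exp (Re z))), <- !Rmult_assoc by lra.
  apply Rmult_le_compat_r; [left; apply exp_pos |].
  destruct (TE m (RtoC Y * z)%C Hm C3) with (a := a) (b := b) as [T1 T2]; auto.
  destruct (TE m (RtoC Y * z)%C Hm C3) with (a := a') (b := b') as [T1' _]; auto.
  specialize (T2 a' b' d BA' BB' Hd (proj1 Hnear) (proj2 Hnear)).
  assert (PR := perturb_remainder al al' th th' V (T / m) h0 (Q * d * (1 + ln (Cmod (RtoC Y * z)))) d
    (Rle_trans _ _ _ (Re_main_exponent p q A B a b _ Hmu C1) HV1)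
    (Rle_trans _ _ _ (Re_main_exponent p q A B a' b' _ (Req_le_sym _ _ Hmu') C1) HV)
    T1 T1' Hhm (ML _ C1) T2).
  assert (LZ := ln_le_minus_1 (Cmod z) ltac:(lra)).
  assert (LY := ln_le_minus_1 (sqrt Y) ltac:(lra)).
  assert (LYY : ln Y = ln (sqrt Y) + ln (sqrt Y)) by (rewrite <- ln_mult, S0 by lra; reflexivity).
  (* With [ln Y = 2 ln (sqrt Y)] and [ln t <= t - 1], the left side is at most [2 sqrt Y + |z| - 2];
     the product of [sqrt Y - 1] and [|z| - 1] being nonnegative does the rest. *)
  assert (LL : 1 + ln (Cmod (RtoC Y * z)) <= 2 * sqrt Y * Cmod z).
  { rewrite C2, ln_mult by lra.
    assert (0 <= (sqrt Y - 1) * (Cmod z - 1)) by (apply Rmult_le_pos; lra).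
    lra. }
  assert (L1' : Q * d * (1 + ln (Cmod (RtoC Y * z))) + d <= (Q + 1) * d * (2 * sqrt Y * Cmod z)).
  { assert (1 <= 2 * sqrt Y * Cmod z) by nra.
    assert (Q * d * (1 + ln (Cmod (RtoC Y * z))) <= Q * d * (2 * sqrt Y * Cmod z)).
    { apply Rmult_le_compat_l; [apply Rmult_le_pos; lra | assumption]. }
    assert (d * 1 <= d * (2 * sqrt Y * Cmod z)) by (apply Rmult_le_compat_l; lra). lra. }
  apply Rle_trans with (Y * (exp (V + h0) * (T / m * ((Q + 1) * d * (2 * sqrt Y * Cmod z))))).
  - apply Rmult_le_compat_l; [lra |]; apply Rle_trans with (1 := PR).
    apply Rmult_le_compat_l; [left; apply exp_pos |]; apply Rmult_le_compat_l; [| assumption].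
    apply Rlt_le, Rdiv_lt_0_compat; lra.
  - right; unfold K1, W; rewrite <- HYm; ring. }
assert (PV : forall y, 0 <= y <= 1 -> contour_pt (1, y)) by (intros y Hy; left; simpl; lra).
assert (PH : forall t, t <= 1 -> contour_pt (t, 1)) by (intros t Ht; right; simpl; lra).
assert (S2 : 0 <= K1 * d * sqrt Y) by (apply Rmult_le_pos; [apply Rmult_le_pos |]; lra).
assert (HKb : 0 <= K1 * (2 * exp 1 + 4 * exp (/ 2 * 1) / / 2)) by (apply Rmult_le_pos; [lra |]; unfold Rdiv; rewrite Rinv_inv; lra).
split.
- apply Rle_trans with (W * (2 * exp 1)); [| lra].
  replace (W * (2 * exp 1)) with (W * exp 1 * 1 + W * exp (1 * 1) / 1) by (rewrite Rmult_1_l; field).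
  apply cint_bound with (6 := CD'); [lra | lra | lra | |].
  + intros y Hy; exact (BD' (1, y) (PV y Hy)).
  + intros t Ht; rewrite Rmult_1_l; exact (BD' (t, 1) (PH t Ht)).
- assert (CM := cint_minus _ _ _ _ _ _ CD CD').
  match type of CM with cint _ _ _ ?e => replace (l - l' - exp (log_nu p q A B a b) * Rpower Y (1 - mu p q a b) * K0) with e by ring end.
  apply Rle_trans with (K1 * d * sqrt Y * (2 * exp 1) * 1 + K1 * d * sqrt Y * 4 * exp (/ 2 * 1) / / 2).
  + apply cint_bound with (6 := CM); [lra | lra | lra | |].
    * intros y Hy; apply Rle_trans with (1 := BDD (1, y) (PV y Hy)).
      apply Rmult_le_compat_l; [assumption |]; apply Rmult_le_compat_r; [left; apply exp_pos |].
      apply Rle_trans with (1 := Cmod_le_abs _); simpl; rewrite !Rabs_pos_eq; lra.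
    * intros t Ht; apply Rle_trans with (1 := BDD (t, 1) (PH t Ht)); rewrite (Rmult_assoc _ 4).
      apply Rmult_le_compat_l; [assumption |].
      replace (/ 2 * t) with (t / 2) by field.
      apply Rle_trans with (2 := exp_linear_le t Ht).
      apply Rmult_le_compat_r; [left; apply exp_pos | apply Cmod_top_le].
  + assert (0 <= W * (2 * exp 1) * d * sqrt Y) 
      by (apply Rmult_le_pos; [apply Rmult_le_pos; [apply Rmult_le_pos |] |]; lra).
    apply Rle_trans with (K1 * (2 * exp 1 + 4 * exp (/ 2 * 1) / / 2) * d * sqrt Y); [right; field |].
    nra.
Qed.

(** Trades the factor [1 + |t|] for half of the minimal decay rate [u0]. *)
Lemma linear_le_exp (u0 t : R) : 0 < u0 <= 1 -> t <= / 2 -> 1 + Rabs t <= 2 / u0 * exp (- (u0 / 2 * t)).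
Proof.
intros Hu Ht; assert (I := exp_ineq1_le (- (u0 / 2 * t))).
assert (H2 : 2 <= 2 / u0).
{ apply Rmult_le_reg_r with u0; [lra |]; replace (2 / u0 * u0) with 2 by (field; lra); lra. }
destruct (Rle_dec 0 t) as [H0 | H0].
- rewrite Rabs_pos_eq by assumption.
  apply Rle_trans with (2 * (3 / 4)); [lra |].
  apply Rmult_le_compat; [lra | lra | lra |]; nra.
- rewrite Rabs_left by lra.
  apply Rle_trans with (2 / u0 * (1 + - (u0 / 2 * t))); [| apply Rmult_le_compat_l; lra].
  replace (2 / u0 * (1 + - (u0 / 2 * t))) with (2 / u0 - t) by (field; lra); lra.
Qed.

(** For [u >= u0] the decay [e^(ut)] to the left has a rate bounded below, so a fixed contour
    suffices: compactness handles its vertical side and Stirling's formula its horizontal one. *)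
Lemma regime_far p q A B (a' b' : nat -> R) (u0 : R) :
  (forall k, (k < p)%nat -> 0 < A k) -> (forall j, (j < q)%nat -> 0 < B j) -> sumR q B - sumR p A = 0 ->
  (forall k, (k < p)%nat -> 0 <= a' k) -> mu p q a' b' = 0 -> 0 < u0 <= 1 ->
  exists K, 0 <= K /\
  forall a b d, 0 <= d <= 1 -> near_params p q a b a' b' d -> (forall k, (k < p)%nat -> 0 <= a k) -> 0 <= mu p q a b ->
  forall x, 0 < x < rho p q A B -> u0 <= log_rho p q A B - ln x ->
  forall l l', (forall c Y, 0 < c -> 0 < Y -> cint (hintegrand p q A a B b x) c Y l) ->
  (forall c Y, 0 < c -> 0 < Y -> cint (hintegrand p q A a' B b' x) c Y l') ->
  Rabs l' <= K * exp (- (ln x / 2)) /\ Rabs (l - l') <= K * d * exp (- (ln x / 2)).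
Proof.
intros hA hB hbal Ha' Hmu' Hu0.
destruct (positive_lower_bound p A hA) as [k1 [Hk1 L1]]; destruct (positive_lower_bound q B hB) as [k2 [Hk2 L2]].
destruct (Rabs_upper_bound p a') as [Ma [HMa Ba]]; destruct (Rabs_upper_bound q b') as [Mb [HMb Bb]].
set (k0 := Rmin k1 k2); assert (Hk0 : 0 < k0) by (apply Rmin_pos; assumption).
assert (LA : forall k, (k < p)%nat -> k0 <= A k) by (intros k Hk; apply Rle_trans with (1 := Rmin_l k1 k2); auto).
assert (LB : forall k, (k < q)%nat -> k0 <= B k) by (intros k Hk; apply Rle_trans with (1 := Rmin_r k1 k2); auto).
set (M := Ma + Mb + 1); assert (HM : 0 <= M) by (unfold M; lra).
destruct (theta_estimates p q A B k0 M hA hB Hk0 HM) as [T [HT TE]].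
destruct (main_exponent_lipschitz p q A B a' b' Hmu') as [V [Q [HQ [HV ME]]]].
destruct (hkernel_segment_lipschitz p q A B M hA HM) as [S [HS HSeg]].
destruct (hintegrand_strip p q A a' B b' 1 hA hB hbal ltac:(lra) ltac:(lra)) as [N [HN Strip]].
set (h0 := T / k0); assert (Hh0 : 0 < h0) by (apply Rdiv_lt_0_compat; assumption).
set (W := exp (V + h0) * (Q + h0)); assert (HW : 0 < W) by (apply Rmult_lt_0_compat; [apply exp_pos | lra]).
assert (Hiu : 0 < 2 / u0) by (apply Rdiv_lt_0_compat; lra).
set (er := exp (log_rho p q A B / 2)); assert (Her : 0 < er) by apply exp_pos.
assert (HWu : 0 <= W * (2 / u0) * (2 / u0) * er) by (apply Rmult_le_pos; [apply Rmult_le_pos; [apply Rmult_le_pos |] |]; lra).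
assert (HNu : 0 <= N * (2 / u0) * er) by (apply Rmult_le_pos; [apply Rmult_le_pos |]; lra).
exists (S + N * (2 / u0) * er + W * (2 / u0) * (2 / u0) * er).
split; [lra |].
intros a b d Hd Hnear Ha Hmu x Hx Hux l l' Hl Hl'.
set (u := log_rho p q A B - ln x) in *.
set (rx := exp (- (ln x / 2))); assert (Hrx : 0 < rx) by apply exp_pos.
assert (Erx : exp (u / 2) = er * rx) by (unfold er, rx; rewrite <- exp_plus; f_equal; unfold u; field).
assert (BA' : forall k, (k < p)%nat -> Rabs (a' k) <= M) by (intros k Hk; specialize (Ba k Hk); unfold M; lra).
assert (BB' : forall k, (k < q)%nat -> Rabs (b' k) <= M) by (intros k Hk; specialize (Bb k Hk); unfold M; lra).
assert (BA : forall k, (k < p)%nat -> Rabs (a k) <= M).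
{ intros k Hk; specialize (Ba k Hk); assert (N1 := proj1 Hnear k Hk).
  assert (TR := Rabs_triang (a k - a' k) (a' k)); replace (a k - a' k + a' k) with (a k) in TR by ring; unfold M; lra. }
assert (BB : forall k, (k < q)%nat -> Rabs (b k) <= M).
{ intros k Hk; specialize (Bb k Hk); assert (N1 := proj2 Hnear k Hk).
  assert (TR := Rabs_triang (b k - b' k) (b' k)); replace (b k - b' k + b' k) with (b k) in TR by ring; unfold M; lra. }
assert (IA' : forall k, (k < p)%nat -> 0 <= a' k <= M).
{ intros k Hk; specialize (BA' k Hk); rewrite Rabs_pos_eq in BA' by auto; auto. }
assert (IA : forall k, (k < p)%nat -> 0 <= a k <= M).
{ intros k Hk; specialize (BA k Hk); rewrite Rabs_pos_eq in BA by auto; auto. }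
assert (Ev : forall y, Cmod (Cexp (RtoC (- ln x) * ((/ 2)%R, y))) = rx).
{ intros y; rewrite Cmod_Cexp; unfold rx; f_equal; unfold Re; simpl; field. }
(* On the vertical side [|x^(-s)| = x^(-1/2)], which is integrable at 0; the abscissa 1 of the
   original loop would give [1/x]. *)
assert (Hl1 := Hl (/ 2) 1 ltac:(lra) ltac:(lra)); assert (Hl1' := Hl' (/ 2) 1 ltac:(lra) ltac:(lra)).
assert (Hiu2 : / u <= / u0) by (apply Rinv_le_contravar; lra).
split.
- apply Rle_trans with (S * rx * 1 + N * exp (u * / 2) / u).
  + apply cint_bound with (6 := Hl1'); [lra | lra | assumption | |].
    * intros y Hy; rewrite hintegrand_eq, Cmod_mult, Ev; apply Rmult_le_compat_r; [lra |].
      apply (HSeg y Hy a' b' IA' BB').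
    * intros t Ht; apply Strip; lra.
  + replace (u * / 2) with (u / 2) by (unfold Rdiv; ring); rewrite Erx.
    assert (N * (er * rx) / u <= N * (2 / u0) * er * rx).
    { replace (N * (2 / u0) * er * rx) with (N * (er * rx) * (2 / u0)) by ring.
      unfold Rdiv at 1; apply Rmult_le_compat_l; [apply Rmult_le_pos; [lra | nra] |].
      unfold Rdiv; assert (0 < / u0) by (apply Rinv_0_lt_compat; lra); lra. }
    assert (0 <= W * (2 / u0) * (2 / u0) * er * rx) by (apply Rmult_le_pos; lra).
    lra.
- destruct (ME a b d Hd Hnear) as [HV1 [_ [_ ML]]].
  (* The decay rate left after [u0/2] has been spent on the factor [1 + ln |s|]. *)
  set (kk := u - u0 / 2).
  assert (Hkk : 0 < kk) by (unfold kk; lra).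
  apply Rle_trans with (S * d * rx * 1 + W * d * (2 / u0) * exp (kk * / 2) / kk).
  + apply cint_bound with (6 := cint_minus _ _ _ _ _ _ Hl1 Hl1'); [lra | assumption | | |].
    * apply Rmult_le_pos; [apply Rmult_le_pos |]; lra.
    * intros y Hy; rewrite !hintegrand_eq.
      match goal with |- Cmod (?h1 * ?e - ?h2 * ?e)%C <= _ => replace (h1 * e - h2 * e)%C with ((h1 - h2) * e)%C by ring end.
      rewrite Cmod_mult, Ev; apply Rmult_le_compat_r; [lra |].
      apply (proj2 (HSeg y Hy a b IA BB) a' b' d IA' BB'); [lra | assumption].
    * intros t Ht.
      assert (C1 := Cmod_top_ge_1 t); assert (C3 := slit_top t).
      assert (FA : forall k, (k < p)%nat -> far k0 (RtoC (A k) * (t, 1) - RtoC M)%C).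
      { intros k Hk; apply far_scaled_Im; simpl; rewrite Rmult_1_r; auto. }
      assert (FB : forall k, (k < q)%nat -> far k0 (RtoC (B k) * (t, 1) - RtoC M)%C).
      { intros k Hk; apply far_scaled_Im; simpl; rewrite Rmult_1_r; auto. }
      rewrite !(fun a0 b0 => hintegrand_asymptotic p q A a0 B b0 x (t, 1) k0); try assumption;
        try (intros; apply far_of_margin with M; auto).
      fold (main_exponent p q A B a b (t, 1)); fold (main_exponent p q A B a' b' (t, 1)).
      rewrite !(Cexp_plus (RtoC (log_rho p q A B - ln x) * (t, 1))).
      match goal with |- Cmod (?e * ?h1 - ?e * ?h2)%C <= _ => replace (e * h1 - e * h2)%C with (e * (h1 - h2))%C by ring end.
      rewrite Cmod_mult, Cmod_Cexp.
      replace (Re (RtoC (log_rho p q A B - ln x) * (t, 1))%C) with (u * t) by (unfold u, Re; simpl; ring).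
      destruct (TE k0 (t, 1) (Rle_refl _) C3 FA FB a b BA BB) as [T1 T2].
      destruct (TE k0 (t, 1) (Rle_refl _) C3 FA FB a' b' BA' BB') as [T1' _].
      specialize (T2 a' b' d BA' BB' Hd (proj1 Hnear) (proj2 Hnear)).
      assert (PP := perturb_product _ _ _ _ V h0 _ _
        (Rle_trans _ _ _ (Re_main_exponent p q A B a b _ Hmu C1) HV1)
        (Rle_trans _ _ _ (Re_main_exponent p q A B a' b' _ (Req_le_sym _ _ Hmu') C1) HV)
        T1 T1' (ML _ C1) T2).
      assert (LZ := ln_le_minus_1 (Cmod (t, 1)) ltac:(lra)); assert (LT := Cmod_top_le t).
      assert (LE := linear_le_exp u0 t Hu0 Ht).
      apply Rle_trans with (exp (u * t) * (W * d * (2 / u0 * exp (- (u0 / 2 * t))))).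
      -- apply Rmult_le_compat_l; [left; apply exp_pos |].
         apply Rle_trans with (1 := PP).
         unfold W; rewrite !Rmult_assoc; apply Rmult_le_compat_l; [left; apply exp_pos |].
         fold h0.
         assert (J1 : Q * (d * (1 + ln (Cmod (t, 1)))) <= Q * (d * (2 / u0 * exp (- (u0 / 2 * t))))).
         { apply Rmult_le_compat_l; [assumption |]; apply Rmult_le_compat_l; lra. }
         assert (J2 : h0 * d * 1 <= h0 * d * (2 / u0 * exp (- (u0 / 2 * t)))).
         { apply Rmult_le_compat_l; [nra |]; assert (R0 := Rabs_pos t); lra. }
         rewrite Rmult_plus_distr_r; lra.
      -- right; replace (kk * t) with (u * t + - (u0 / 2 * t)) by (unfold kk; ring); rewrite exp_plus; ring.
  + assert (E1 : exp (kk * / 2) <= er * rx).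
    { rewrite <- Erx; apply exp_le; unfold kk; lra. }
    assert (E2 : / kk <= 2 / u0).
    { replace (2 / u0) with (/ (u0 / 2)) by (field; lra); apply Rinv_le_contravar; unfold kk; lra. }
    assert (E3 : W * d * (2 / u0) * exp (kk * / 2) / kk <= W * (2 / u0) * (2 / u0) * er * d * rx).
    { apply Rle_trans with (W * d * (2 / u0) * (er * rx) * (2 / u0)); [| right; ring].
      unfold Rdiv at 1; apply Rmult_le_compat.
      - apply Rmult_le_pos; [| left; apply exp_pos]; apply Rmult_le_pos; [apply Rmult_le_pos |]; lra.
      - left; apply Rinv_0_lt_compat; assumption.
      - apply Rmult_le_compat_l; [| assumption]; apply Rmult_le_pos; [apply Rmult_le_pos |]; lra.
      - assumption. }
    assert (0 <= N * (2 / u0) * er * d * rx) by (apply Rmult_le_pos; [apply Rmult_le_pos |]; lra).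
    lra.
Qed.

(** * Joining the two regimes *)

Lemma Rpower_le_base_ge_1 (w e : R) : 1 <= w -> 0 <= e <= 1 -> 1 <= Rpower w e <= w.
Proof.
intros Hw He; assert (L := ln_nonneg w Hw); unfold Rpower; split.
- apply Rle_trans with (exp 0); [rewrite exp_0; lra | apply exp_le; nra].
- rewrite <- (exp_ln w) at 2 by lra; apply exp_le; nra.
Qed.

(* Near [rho] the two natural local variables [u = ln (rho/x)] and [v = 1 - x/rho] are
   interchangeable in the singular term, up to a bounded error. *)
Lemma singular_term_compare (u v e : R) : 0 < u -> v = 1 - exp (- u) -> 0 <= e <= 1 ->
  0 <= Rpower (/ v) e - Rpower (/ u) e <= 1.
Proof.
intros Hu Hv He.
assert (E1 := exp_ineq1_le (- u)); assert (E2 := exp_ineq1_le u).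
assert (Ep := exp_pos (- u)); assert (Ep2 := exp_pos u).
assert (Ei : exp (- u) * exp u = 1) by (rewrite <- exp_plus, Rplus_opp_l, exp_0; reflexivity).
assert (Hv0 : 0 < v) by (rewrite Hv, exp_Ropp; assert (/ exp u < 1) by (rewrite <- Rinv_1; apply Rinv_lt_contravar; [lra |]; assert (1 + u < exp u) by (apply exp_ineq1; lra); lra); lra).
assert (Hvu : v <= u) by lra.
assert (Hv1 : v < 1) by lra.
assert (Huv : u * (1 - v) <= v) by (rewrite Hv; nra).
assert (Hiv : 1 <= / v) by (rewrite <- Rinv_1; apply Rinv_le_contravar; lra).
assert (Eq : Rpower (/ v) e = Rpower (/ u) e * Rpower (u / v) e).
{ unfold Rpower; rewrite <- exp_plus; f_equal; unfold Rdiv; rewrite ln_mult, !ln_Rinv; try lra; apply Rinv_0_lt_compat; assumption. }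
assert (Huv1 : 1 <= u / v).
{ apply Rmult_le_reg_r with v; [assumption |]; replace (u / v * v) with u by (field; lra); lra. }
destruct (Rpower_le_base_ge_1 (u / v) e Huv1 He) as [P1 P2].
destruct (Rpower_le_base_ge_1 (/ v) e Hiv He) as [P3 P4].
assert (P5 : 0 < Rpower (/ u) e) by apply exp_pos.
split; [rewrite Eq; nra |].
set (a := Rpower (/ u) e) in *; set (b := Rpower (u / v) e) in *.
assert (Hb : b * v <= u).
{ apply Rle_trans with (u / v * v); [apply Rmult_le_compat_r; lra | right; field; lra]. }
apply Rle_trans with (a * b * v); [| rewrite <- Eq; apply Rle_trans with (/ v * v); [apply Rmult_le_compat_r; lra | right; field; lra]].
rewrite Eq; replace (a * b - a) with (a * (b - 1)) by ring; rewrite Rmult_assoc.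
apply Rmult_le_compat_l; [lra |].
assert (b * (1 - v) <= 1); [| lra].
apply Rmult_le_reg_r with v; [assumption |].
apply Rle_trans with (u * (1 - v)); [| lra].
replace (b * (1 - v) * v) with (b * v * (1 - v)) by ring; apply Rmult_le_compat_r; lra.
Qed.

Lemma log_gap_pos p q A B x : 0 < x < rho p q A B -> 0 < log_rho p q A B - ln x.
Proof.
intros Hx; rewrite rho_exp in Hx; assert (L := ln_increasing x _ (proj1 Hx) (proj2 Hx)); rewrite ln_exp in L; lra.
Qed.

Lemma exp_half_ln x : 0 < x -> exp (- (ln x / 2)) = / sqrt x.
Proof.
intros Hx; rewrite exp_Ropp; f_equal.
rewrite <- (Rpower_sqrt x) by assumption; unfold Rpower; f_equal; field.
Qed.

Lemma inv_sqrt_pos x : 0 < x -> 0 < / sqrt x.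
Proof. intros Hx; apply Rinv_0_lt_compat, sqrt_lt_R0; assumption. Qed.

(** The two contours are combined into one estimate on all of the interval. The singular term is
    expressed through [1 - x/rho], a power of which has an explicit primitive in [x]; both error
    weights are integrable. *)
Lemma foxH_cint_estimate p q A B (a' b' : nat -> R) :
  (forall k, (k < p)%nat -> 0 < A k) -> (forall j, (j < q)%nat -> 0 < B j) -> sumR q B - sumR p A = 0 ->
  (forall k, (k < p)%nat -> 0 <= a' k) -> mu p q a' b' = 0 ->
  exists K, 0 <= K /\
  forall a b d, 0 <= d <= 1 -> near_params p q a b a' b' d -> (forall k, (k < p)%nat -> 0 <= a k) -> 0 <= mu p q a b <= 1 ->
  exists k, Rabs (k - 1) <= K * mu p q a b /\
  forall x, 0 < x < rho p q A B ->
  forall l l', (forall c Y, 0 < c -> 0 < Y -> cint (hintegrand p q A a B b x) c Y l) ->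
  (forall c Y, 0 < c -> 0 < Y -> cint (hintegrand p q A a' B b' x) c Y l') ->
  Rabs l' <= K * (/ sqrt x + / sqrt (rho p q A B - x)) /\
  Rabs (l - l' - PI * (exp (log_nu p q A B a b) * (mu p q a b * k) * Rpower (/ ((rho p q A B - x) / rho p q A B)) (1 - mu p q a b)))
    <= K * d * (/ sqrt x + / sqrt (rho p q A B - x)).
Proof.
intros hA hB hbal Ha' Hmu'.
destruct (regime_near_rho p q A B a' b' hA hB hbal Ha' Hmu') as [Y0 [K1 [HY0 [HK1 R1]]]].
(* The far regime begins where the near one stops, so the two cover every [x]. *)
set (u0 := / Y0).
assert (Hu0 : 0 < u0 <= 1).
{ unfold u0; split; [apply Rinv_0_lt_compat; lra | rewrite <- Rinv_1; apply Rinv_le_contravar; lra]. }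
destruct (regime_far p q A B a' b' u0 hA hB hbal Ha' Hmu' Hu0) as [K2 [HK2 R2]].
destruct hankel_constant as [Q0 [HQ0 HC]].
destruct (main_exponent_lipschitz p q A B a' b' Hmu') as [V [Q [HQ [HV ME]]]].
set (r := rho p q A B); assert (Hr : 0 < r) by (unfold r; rewrite rho_exp; apply exp_pos).
assert (Hsr : 0 < sqrt r) by (apply sqrt_lt_R0; assumption).
assert (HPI := PI_RGT_0); assert (EV := exp_pos V).
(* The value of [1 - x/rho] at [u = u0]. Away from [rho] the singular power is at most [1/v0], and
   the whole singular term can be counted as an error. *)
set (v0 := 1 - exp (- u0)).
assert (Hv0 : 0 < v0).
{ unfold v0; assert (exp (- u0) < exp 0) by (apply exp_increasing; lra); rewrite exp_0 in *; lra. }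
set (Z := exp V * (PI * (Q * (1 + Q0)))).
assert (HZ : 0 <= Z) by (unfold Z; apply Rmult_le_pos; [lra |]; apply Rmult_le_pos; [lra |]; apply Rmult_le_pos; lra).
assert (Hiv0 : 0 < / v0) by (apply Rinv_0_lt_compat; assumption).
(* In order: the deviation of [k] from 1, the near and far estimates, the change of variable from
   [u] to [v], and the singular term in the far regime. Each [sqrt r] comes from comparing with
   [1/sqrt x] or [1/sqrt (r - x)]. *)
exists (Q0 + (K1 * sqrt r + K2 + Z * sqrt r + Z * / v0 * sqrt r)).
assert (P1 : 0 <= K1 * sqrt r) by nra; assert (P2 : 0 <= Z * sqrt r) by nra.
assert (P3 : 0 <= Z * / v0 * sqrt r) by (apply Rmult_le_pos; [apply Rmult_le_pos |]; lra).
split; [lra |].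
intros a b d Hd Hnear Ha Hmu.
destruct (HC (mu p q a b) (proj1 Hmu)) as [k [Hk1 Hk2]].
destruct (ME a b d Hd Hnear) as [HV1 [Hmud _]].
rewrite Rabs_pos_eq in Hmud by lra.
exists k; split; [nra |].
intros x Hx l l' Hl Hl'.
set (u := log_rho p q A B - ln x).
assert (Hu : 0 < u) by (apply log_gap_pos; assumption).
fold r in Hx; set (v := (r - x) / r).
assert (Ex : x = r * exp (- u)).
{ unfold r, u; rewrite rho_exp, <- exp_plus; rewrite <- (exp_ln x) at 1 by lra; f_equal; ring. }
assert (Hv : v = 1 - exp (- u)) by (unfold v; rewrite Ex; field; lra).
assert (Hiu := exp_ineq1_le (- u)).
assert (Hvu : v <= u) by lra.
assert (Hvpos : 0 < v) by (unfold v; apply Rdiv_lt_0_compat; lra).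
assert (Sx : 0 < / sqrt x) by (apply inv_sqrt_pos; lra); assert (Srx : 0 < / sqrt (r - x)) by (apply inv_sqrt_pos; lra).
assert (Sle : 1 <= sqrt r * / sqrt x).
{ rewrite <- (Rinv_r (sqrt x)) by (apply Rgt_not_eq, sqrt_lt_R0; lra).
  apply Rmult_le_compat_r; [lra |]; apply sqrt_le_1; lra. }
assert (Ske : sqrt (/ u) <= sqrt r * / sqrt (r - x)).
{ apply Rle_trans with (sqrt (/ v)).
  - apply sqrt_le_1; [left; apply Rinv_0_lt_compat; lra | left; apply Rinv_0_lt_compat; lra | apply Rinv_le_contravar; lra].
  - replace (/ v) with (r / (r - x)) by (unfold v; field; lra).
    rewrite sqrt_div_alt by lra; unfold Rdiv; lra. }
(* The coefficient of the singular power contains [mu], hence is [O(d)]: errors multiplied by it are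
   admissible. *)
assert (Bk : Rabs (exp (log_nu p q A B a b) * (mu p q a b * k) * PI) <= Z * d).
{ rewrite !Rabs_mult, (Rabs_pos_eq PI), (Rabs_pos_eq (exp _)), (Rabs_pos_eq (mu p q a b)) by (lra || (left; apply exp_pos)).
  assert (Hka : Rabs k <= 1 + Q0).
  { assert (TR := Rabs_triang (k - 1) 1); rewrite Rabs_R1 in TR; replace (k - 1 + 1) with k in TR by ring; nra. }
  apply Rle_trans with (exp V * (Q * d * (1 + Q0)) * PI); [| unfold Z; right; ring].
  apply Rmult_le_compat_r; [lra |].
  apply Rmult_le_compat; [left; apply exp_pos | apply Rmult_le_pos; [lra | apply Rabs_pos] | apply exp_le; assumption |].
  apply Rmult_le_compat; try apply Rabs_pos; lra. }
assert (He : 0 <= 1 - mu p q a b <= 1) by lra.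
set (sing := Rpower (/ v) (1 - mu p q a b)).
assert (SC := singular_term_compare u v (1 - mu p q a b) Hu Hv He); fold sing in SC.
assert (Zd : 0 <= Z * d) by nra.
destruct (Rle_dec Y0 (/ u)) as [Hnr | Hfr].
- destruct (R1 a b d Hd Hnear Ha (proj1 Hmu) x Hx Hnr l l' _ Hl Hl' Hk1) as [B1 B2].
  fold u in B2; split.
  + apply Rle_trans with (1 := B1).
    assert (K1 * 1 <= K1 * (sqrt r * / sqrt x)) by (apply Rmult_le_compat_l; assumption).
    assert (0 <= K1 * sqrt r * / sqrt (r - x)) by (apply Rmult_le_pos; lra).
    assert (0 <= (Q0 + K2 + Z * sqrt r + Z * / v0 * sqrt r) * (/ sqrt x + / sqrt (r - x))) by (apply Rmult_le_pos; lra).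
    lra.
  + set (G := exp (log_nu p q A B a b) * (mu p q a b * k)) in *.
    replace (l - l' - PI * (G * sing)) with
      ((l - l' - exp (log_nu p q A B a b) * Rpower (/ u) (1 - mu p q a b) * (PI * (mu p q a b * k))) - G * PI * (sing - Rpower (/ u) (1 - mu p q a b)))
      by (unfold G; ring).
    apply Rle_trans with (1 := Rabs_triang _ _); rewrite Rabs_Ropp, (Rabs_mult (G * PI)), (Rabs_pos_eq (sing - _)) by lra.
    assert (I1 : Rabs (G * PI) * (sing - Rpower (/ u) (1 - mu p q a b)) <= Z * d * 1).
    { apply Rmult_le_compat; [apply Rabs_pos | lra | assumption | lra]. }
    assert (I2 : Z * d * 1 <= Z * d * (sqrt r * / sqrt x)) by (apply Rmult_le_compat_l; assumption).
    assert (I3 : K1 * d * sqrt (/ u) <= K1 * d * (sqrt r * / sqrt (r - x))) by (apply Rmult_le_compat_l; [nra | assumption]).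
    assert (0 <= K1 * sqrt r * d * / sqrt x) by (apply Rmult_le_pos; [apply Rmult_le_pos |]; lra).
    assert (0 <= Z * sqrt r * d * / sqrt (r - x)) by (apply Rmult_le_pos; [apply Rmult_le_pos |]; lra).
    assert (0 <= (Q0 + K2 + Z * / v0 * sqrt r) * d * (/ sqrt x + / sqrt (r - x))) by (apply Rmult_le_pos; [apply Rmult_le_pos |]; lra).
    lra.
- assert (Hux : u0 <= u).
  { unfold u0; rewrite <- (Rinv_inv u); apply Rinv_le_contravar; [apply Rinv_0_lt_compat; assumption | lra]. }
  destruct (R2 a b d Hd Hnear Ha (proj1 Hmu) x Hx Hux l l' Hl Hl') as [B1 B2].
  rewrite exp_half_ln in B1, B2 by lra; split.
  + apply Rle_trans with (1 := B1).
    assert (0 <= K2 * / sqrt (r - x)) by (apply Rmult_le_pos; lra).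
    assert (0 <= (Q0 + K1 * sqrt r + Z * sqrt r + Z * / v0 * sqrt r) * (/ sqrt x + / sqrt (r - x))) by (apply Rmult_le_pos; lra).
    lra.
  + set (G := exp (log_nu p q A B a b) * (mu p q a b * k)) in *.
    replace (l - l' - PI * (G * sing)) with ((l - l') - G * PI * sing) by ring.
    apply Rle_trans with (1 := Rabs_triang _ _); rewrite Rabs_Ropp, Rabs_mult.
    assert (Hvv0 : v0 <= v).
    { rewrite Hv; unfold v0; assert (exp (- u) <= exp (- u0)) by (apply exp_le; lra); lra. }
    assert (Hiv : 1 <= / v).
    { rewrite <- Rinv_1; apply Rinv_le_contravar; [assumption |]; assert (E := exp_pos (- u)); lra. }
    assert (Hs : Rabs sing <= / v0).
    { rewrite Rabs_pos_eq by (left; apply exp_pos).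
      destruct (Rpower_le_base_ge_1 (/ v) _ Hiv He) as [_ S2]; apply Rle_trans with (1 := S2), Rinv_le_contravar; lra. }
    assert (I1 : Rabs (G * PI) * Rabs sing <= Z * d * / v0) by (apply Rmult_le_compat; try apply Rabs_pos; assumption).
    assert (I2 : Z * d * / v0 * 1 <= Z * d * / v0 * (sqrt r * / sqrt x)) by (apply Rmult_le_compat_l; [nra | assumption]).
    assert (0 <= K2 * d * / sqrt (r - x)) by (apply Rmult_le_pos; [apply Rmult_le_pos |]; lra).
    assert (0 <= Z * / v0 * sqrt r * d * / sqrt (r - x)) by (apply Rmult_le_pos; [apply Rmult_le_pos |]; lra).
    assert (0 <= (Q0 + K1 * sqrt r + Z * sqrt r) * d * (/ sqrt x + / sqrt (r - x))) by (apply Rmult_le_pos; [apply Rmult_le_pos |]; lra).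
    lra.
Qed.

(** Local Lipschitz dependence on [ln x], which makes the density continuous and thus integrable on
    compact subintervals. The factor [|s|] produced by differentiating [x^(-s)] is absorbed by part
    of the exponential decay. *)
Lemma cint_continuous_in_x p q A B a b x0 :
  (forall k, (k < p)%nat -> 0 < A k) -> (forall j, (j < q)%nat -> 0 < B j) -> sumR q B - sumR p A = 0 ->
  (forall k, (k < p)%nat -> 0 <= a k) -> 0 <= mu p q a b -> 0 < x0 < rho p q A B ->
  exists K e, 0 <= K /\ 0 < e /\ forall x, 0 < x < rho p q A B -> Rabs (ln x - ln x0) <= e ->
  forall l l0, (forall c Y, 0 < c -> 0 < Y -> cint (hintegrand p q A a B b x) c Y l) ->
  (forall c Y, 0 < c -> 0 < Y -> cint (hintegrand p q A a B b x0) c Y l0) ->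
  Rabs (l - l0) <= K * Rabs (ln x - ln x0).
Proof.
intros hA hB hbal Ha Hmu Hx0.
destruct (Rabs_upper_bound p a) as [Ma [HMa Ba]]; destruct (Rabs_upper_bound q b) as [Mb [HMb Bb]].
destruct (hintegrand_strip p q A a B b 1 hA hB hbal Hmu ltac:(lra)) as [N [HN Strip]].
destruct (hkernel_segment_lipschitz p q A B (Ma + Mb) hA ltac:(lra)) as [S [HS HSeg]].
set (w := log_rho p q A B - ln x0); assert (Hw : 0 < w) by (apply log_gap_pos; assumption).
(* If [ln x] is within [u1 <= w/2] of [ln x0], then [log rho - ln x] is still at least [u1]: this
   reserve of decay is common to all nearby [x]. *)
set (u1 := Rmin (w / 2) 1).
assert (Hu1 : 0 < u1 <= 1) by (unfold u1; split; [apply Rmin_pos; lra | apply Rmin_r]).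
assert (Hu1w : u1 <= w / 2) by apply Rmin_l.
set (E := exp w); assert (HE : 0 < E) by apply exp_pos.
set (L := log_rho p q A B - u1).
assert (Ep := exp_pos (- (L * / 2) + w)).
assert (Eq := exp_pos (u1 / 2 * / 2)).
assert (H2u : 0 < 2 / u1) by (apply Rdiv_lt_0_compat; lra).
assert (Q1 : 0 <= S * (2 * exp (- (L * / 2) + w))) by nra.
assert (Q2 : 0 <= N * E * (2 / u1) * exp (u1 / 2 * / 2) / (u1 / 2)).
{ apply Rdiv_le_0_compat; [| lra]; apply Rmult_le_pos; [| lra]; apply Rmult_le_pos; [nra | lra]. }
exists (S * (2 * exp (- (L * / 2) + w)) + N * E * (2 / u1) * exp (u1 / 2 * / 2) / (u1 / 2)), u1.
split; [lra |]; split; [lra |].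
intros x Hx Hxx0 l l0 Hl Hl0.
set (D := Rabs (ln x - ln x0)) in *; assert (HD : 0 <= D) by apply Rabs_pos.
assert (Hxx := Hxx0); unfold D in Hxx; apply Rabs_le_between in Hxx.
(* Both [ln x] and [ln x0] lie between [L - w] and [L]. So [e^(-Lt + w)] dominates both powers,
   whatever the sign of [t]. *)
assert (EB : forall t y, t <= / 2 -> Cmod (Cexp (RtoC (- ln x) * (t, y)) - Cexp (RtoC (- ln x0) * (t, y)))%C
   <= D * Cmod (t, y) * exp (- (L * t) + w)).
{ intros t y Ht; eapply Rle_trans; [apply Cexp_minus_le with (M := - (L * t) + w) |].
  - replace (Re (RtoC (- ln x) * (t, y))%C) with (- ln x * t) by (unfold Re; simpl; ring).
    assert (0 <= L - ln x <= w) by (unfold L, w in *; lra).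
    destruct (Rle_dec 0 t); nra.
  - replace (Re (RtoC (- ln x0) * (t, y))%C) with (- ln x0 * t) by (unfold Re; simpl; ring).
    assert (0 <= L - ln x0 <= w) by (unfold L, w in *; lra).
    destruct (Rle_dec 0 t); nra.
  - replace (RtoC (- ln x) * (t, y) - RtoC (- ln x0) * (t, y))%C with (RtoC (- (ln x - ln x0)) * (t, y))%C
      by (rewrite !RtoC_opp, RtoC_minus; ring).
    rewrite Cmod_mult, Cmod_R, Rabs_Ropp; unfold D; lra. }
assert (CM := cint_minus _ _ _ _ _ _ (Hl (/ 2) 1 ltac:(lra) ltac:(lra)) (Hl0 (/ 2) 1 ltac:(lra) ltac:(lra))).
apply Rle_trans with (S * (2 * exp (- (L * / 2) + w)) * D * 1 + N * E * (2 / u1) * D * exp (u1 / 2 * / 2) / (u1 / 2)).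
2: { right; field; lra. }
assert (DF : forall s, (hintegrand p q A a B b x s - hintegrand p q A a B b x0 s)%C =
   (hkernel p q A a B b s * (Cexp (RtoC (- ln x) * s) - Cexp (RtoC (- ln x0) * s)))%C).
{ intros s; rewrite !hintegrand_eq; ring. }
apply cint_bound with (6 := CM); [lra | lra | | |].
- apply Rmult_le_pos; [apply Rmult_le_pos; [nra | lra] | lra].
- intros y Hy; rewrite DF, Cmod_mult.
  rewrite (Rmult_assoc S); apply Rmult_le_compat; try apply Cmod_ge_0.
  + apply (HSeg y Hy a b).
    * intros k Hk; split; [auto |]; assert (B1 := Ba k Hk); assert (B2 := Rle_abs (a k)); lra.
    * intros k Hk; specialize (Bb k Hk); lra.
  + apply Rle_trans with (1 := EB (/ 2) y (Rle_refl _)).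
    assert (Cmod ((/ 2)%R, y) <= 2).
    { apply Rle_trans with (1 := Cmod_le_abs _); simpl; rewrite !Rabs_pos_eq; lra. }
    apply Rle_trans with (D * 2 * exp (- (L * / 2) + w)); [| right; ring].
    apply Rmult_le_compat_r; [lra |]; apply Rmult_le_compat_l; assumption.
- intros t Ht; rewrite DF, Cmod_mult.
  assert (HK : Cmod (hkernel p q A a B b (t, 1)) <= N * exp (log_rho p q A B * t)).
  { assert (ST := Strip 1 t 1 (Rle_refl _)); rewrite hintegrand_eq, ln_1, Ropp_0, Rminus_0_r in ST.
    replace (RtoC 0 * (t, 1))%C with (RtoC 0) in ST by ring; rewrite Cexp_0 in ST.
    replace (hkernel p q A a B b (t, 1) * 1)%C with (hkernel p q A a B b (t, 1)) in ST by ring; exact ST. }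
  assert (LE := linear_le_exp u1 t Hu1 Ht); assert (LT := Cmod_top_le t).
  apply Rle_trans with (N * exp (log_rho p q A B * t) * (D * (2 / u1 * exp (- (u1 / 2 * t))) * exp (- (L * t) + w))).
  + apply Rmult_le_compat; try apply Cmod_ge_0; [assumption |].
    apply Rle_trans with (1 := EB t 1 Ht); apply Rmult_le_compat_r; [left; apply exp_pos |].
    apply Rmult_le_compat_l; [assumption | lra].
  + right.
    transitivity (N * (2 / u1) * D * (exp (log_rho p q A B * t) * exp (- (u1 / 2 * t)) * exp (- (L * t) + w))); [ring |].
    transitivity (N * (2 / u1) * D * (E * exp (u1 / 2 * t))); [| ring].
    f_equal; unfold E; rewrite <- !exp_plus; f_equal; unfold L; field.
Qed.

(** * Improper integrals on open intervals *)

Lemma at_right_point (a : R) (P : R -> Prop) : at_right a P -> exists e, 0 < e /\ forall x, a < x < a + e -> P x.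
Proof.
intros [e He]; exists e; split; [apply cond_pos |]; intros x Hx; apply He; [| lra].
unfold ball; simpl; unfold AbsRing_ball, abs, minus, plus, opp; simpl; rewrite Rabs_pos_eq; lra.
Qed.

Lemma at_left_point (a : R) (P : R -> Prop) : at_left a P -> exists e, 0 < e /\ forall x, a - e < x < a -> P x.
Proof.
intros [e He]; exists e; split; [apply cond_pos |]; intros x Hx; apply He; [| lra].
unfold ball; simpl; unfold AbsRing_ball, abs, minus, plus, opp; simpl; rewrite Rabs_left; lra.
Qed.

Lemma at_right_interval (a e : R) (P : R -> Prop) : 0 < e -> (forall x, a < x < a + e -> P x) -> at_right a P.
Proof.
intros He H; exists (mkposreal e He); intros x Hx Hax; apply H.
unfold ball in Hx; simpl in Hx; unfold AbsRing_ball, abs, minus, plus, opp in Hx; simpl in Hx.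
apply Rabs_lt_between in Hx; lra.
Qed.

Lemma at_left_interval (a e : R) (P : R -> Prop) : 0 < e -> (forall x, a - e < x < a -> P x) -> at_left a P.
Proof.
intros He H; exists (mkposreal e He); intros x Hx Hax; apply H.
unfold ball in Hx; simpl in Hx; unfold AbsRing_ball, abs, minus, plus, opp in Hx; simpl in Hx.
apply Rabs_lt_between in Hx; lra.
Qed.

Definition has_end_limits (G : R -> R) (a b l1 l2 : R) : Prop :=
  forall eps, 0 < eps -> exists e, 0 < e /\ a + e < b - e /\
  (forall x, a < x < a + e -> Rabs (G x - l1) < eps) /\ (forall x, b - e < x < b -> Rabs (G x - l2) < eps).

Definition is_int_open (phi : R -> R) (a b l : R) : Prop :=
  is_RInt_gen (V := R_NormedModule) phi (at_right a) (at_left b) l.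

Lemma is_int_open_intro (phi : R -> R) (a b l : R) :
  (forall eps, 0 < eps -> exists e, 0 < e /\ forall x y, a < x < a + e -> b - e < y < b ->
     exists I, is_RIntR phi x y I /\ Rabs (I - l) < eps) -> is_int_open phi a b l.
Proof.
intros H P [eps HP]; destruct (H eps (cond_pos eps)) as [e [He HI]].
exists (fun x => a < x < a + e) (fun y => b - e < y < b).
- apply at_right_interval with e; auto.
- apply at_left_interval with e; auto.
- intros x y Hx Hy; destruct (HI x y Hx Hy) as [I [I1 I2]]; exists I; split; [exact I1 | apply HP, I2].
Qed.

Lemma is_int_open_FTC (psi Psi : R -> R) (a b l1 l2 : R) : a < b ->
  (forall x, a < x < b -> is_derive Psi x (psi x)) -> (forall x, a < x < b -> continuous psi x) ->
  has_end_limits Psi a b l1 l2 -> is_int_open psi a b (l2 - l1).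
Proof.
intros Hab HD HC HL; apply is_int_open_intro; intros eps He.
destruct (HL (eps / 2)) as [e [He0 [Hm [H1 H2]]]]; [lra |].
exists e; split; [assumption |]; intros x y Hx Hy; exists (Psi y - Psi x); split.
- apply (is_RInt_derive (V := R_CompleteNormedModule) Psi); rewrite Rmin_left, Rmax_right by lra; intros t Ht; [apply HD | apply HC]; lra.
- specialize (H1 x Hx); specialize (H2 y Hy).
  replace (Psi y - Psi x - (l2 - l1)) with ((Psi y - l2) - (Psi x - l1)) by ring.
  apply Rle_lt_trans with (1 := Rabs_triang _ _); rewrite Rabs_Ropp; lra.
Qed.

(** Comparison test at both ends at once. The increments of the primitive [Psi] give the Cauchy
    criterion along the product of the two one-sided filters, and its end limits give the bound. *)
Lemma is_int_open_dominated (phi psi Psi : R -> R) (a b l1 l2 : R) : a < b ->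
  (forall x, a < x < b -> continuous phi x) -> (forall x, a < x < b -> Rabs (phi x) <= psi x) ->
  (forall x, a < x < b -> is_derive Psi x (psi x)) -> (forall x, a < x < b -> continuous psi x) ->
  has_end_limits Psi a b l1 l2 -> exists l, is_int_open phi a b l /\ Rabs l <= l2 - l1.
Proof.
intros Hab Hphi Hle HD HC HL.
assert (X : forall x y, a < x < b -> a < y < b -> ex_RIntR phi x y).
{ intros x y Hx Hy; apply (ex_RInt_continuous (V := R_CompleteNormedModule)); intros t Ht; apply Hphi.
  assert (T1 := Rmin_glb_lt _ _ _ (proj1 Hx) (proj1 Hy)); assert (T2 := Rmax_lub_lt _ _ _ (proj2 Hx) (proj2 Hy)); lra. }
assert (B0 : forall x y, a < x -> x <= y -> y < b -> Rabs (RIntR phi x y) <= Psi y - Psi x).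
{ intros x y Hx Hxy Hy.
  apply (norm_RInt_le (V := R_NormedModule) phi psi x y); [assumption | intros t Ht; apply Hle; lra | |].
  - apply (RInt_correct (V := R_CompleteNormedModule)), X; lra.
  - apply (is_RInt_derive (V := R_CompleteNormedModule) Psi); rewrite Rmin_left, Rmax_right by lra; intros t Ht; [apply HD | apply HC]; lra. }
assert (B : forall x y, a < x < b -> a < y < b -> Rabs (RIntR phi x y) <= Rabs (Psi y - Psi x)).
{ intros x y Hx Hy; destruct (Rle_dec x y) as [H | H].
  - apply Rle_trans with (2 := Rle_abs _), B0; lra.
  - assert (S0 := opp_RInt_swap (V := R_CompleteNormedModule) phi x y (X x y Hx Hy)).
    change (- RIntR phi x y = RIntR phi y x) in S0.
    rewrite <- Rabs_Ropp, S0, Rabs_minus_sym; apply Rle_trans with (2 := Rle_abs _), B0; lra. }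
assert (HL0 : exists l : R, filterlim (fun xy : R * R => RIntR phi (fst xy) (snd xy)) (filter_prod (at_right a) (at_left b)) (locally l)).
{ apply (proj1 (filterlim_locally_cauchy (U := R_CompleteSpace) (F := filter_prod (at_right a) (at_left b))
  (fun xy => RIntR phi (fst xy) (snd xy)))); intros eps; destruct (HL (eps / 8)) as [e [He0 [Hm [H1 H2]]]]; [assert (Q := cond_pos eps); lra |].
  exists (fun xy => a < fst xy < a + e /\ b - e < snd xy < b); split.
  - exists (fun x => a < x < a + e) (fun y => b - e < y < b); [apply at_right_interval with e; auto | apply at_left_interval with e; auto | auto].
  - intros [x y] [x' y'] [Hx Hy] [Hx' Hy']; simpl in *.
    change (Rabs (RIntR phi x' y' - RIntR phi x y) < eps).
    assert (E : RIntR phi x y = RIntR phi x x' + (RIntR phi x' y' + RIntR phi y' y)).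
    { assert (C1 := RInt_Chasles (V := R_CompleteNormedModule) phi x' y' y (X x' y' ltac:(lra) ltac:(lra)) (X y' y ltac:(lra) ltac:(lra))).
      assert (C2 := RInt_Chasles (V := R_CompleteNormedModule) phi x x' y (X x x' ltac:(lra) ltac:(lra)) (X x' y ltac:(lra) ltac:(lra))).
      change (RIntR phi x' y' + RIntR phi y' y = RIntR phi x' y) in C1.
      change (RIntR phi x x' + RIntR phi x' y = RIntR phi x y) in C2; lra. }
    rewrite E.
    assert (D1 := B x x' ltac:(lra) ltac:(lra)); assert (D2 := B y' y ltac:(lra) ltac:(lra)).
    assert (F1 := H1 x Hx); assert (F2 := H1 x' Hx'); assert (F3 := H2 y Hy); assert (F4 := H2 y' Hy').
    assert (T1 := Rabs_triang (Psi x' - l1) (- (Psi x - l1))); rewrite Rabs_Ropp in T1.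
    replace (Psi x' - l1 + - (Psi x - l1)) with (Psi x' - Psi x) in T1 by ring.
    assert (T2 := Rabs_triang (Psi y - l2) (- (Psi y' - l2))); rewrite Rabs_Ropp in T2.
    replace (Psi y - l2 + - (Psi y' - l2)) with (Psi y - Psi y') in T2 by ring.
    replace (RIntR phi x' y' - (RIntR phi x x' + (RIntR phi x' y' + RIntR phi y' y))) with (- (RIntR phi x x' + RIntR phi y' y)) by ring.
    rewrite Rabs_Ropp; apply Rle_lt_trans with (1 := Rabs_triang _ _); assert (Q := cond_pos eps); lra. }
destruct HL0 as [l Hl].
assert (HI : forall eps, 0 < eps -> exists e, 0 < e /\ a + e < b - e /\ forall x y, a < x < a + e -> b - e < y < b ->
   Rabs (RIntR phi x y - l) < eps).
{ intros eps He; destruct (Hl (fun z => Rabs (z - l) < eps)) as [P1 P2 HP1 HP2 HP].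
  { exists (mkposreal eps He); intros z Hz; exact Hz. }
  destruct (at_right_point _ _ HP1) as [e1 [He1 Q1]]; destruct (at_left_point _ _ HP2) as [e2 [He2 Q2]].
  exists (Rmin (Rmin e1 e2) ((b - a) / 3)).
  assert (M1 := Rmin_l (Rmin e1 e2) ((b - a) / 3)); assert (M2 := Rmin_r (Rmin e1 e2) ((b - a) / 3)).
  assert (M3 := Rmin_l e1 e2); assert (M4 := Rmin_r e1 e2).
  split; [apply Rmin_pos; [apply Rmin_pos; assumption | lra] |]; split; [lra |].
  intros x y Hx Hy; apply (HP x y); [apply Q1 | apply Q2]; lra. }
exists l; split.
- apply is_int_open_intro; intros eps He; destruct (HI eps He) as [e [He0 [Hm Q]]].
  exists e; split; [assumption |]; intros x y Hx Hy; exists (RIntR phi x y); split; [| apply Q; assumption].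
  apply (RInt_correct (V := R_CompleteNormedModule)), X; lra.
- apply le_epsilon; intros eps He.
  destruct (HI (eps / 4)) as [e [He0 [Hm Q]]]; [lra |].
  destruct (HL (eps / 4)) as [e' [He0' [Hm' [H1 H2]]]]; [lra |].
  set (x := a + Rmin e e' / 2); set (y := b - Rmin e e' / 2).
  assert (N0 : 0 < Rmin e e') by (apply Rmin_pos; assumption); assert (N1 := Rmin_l e e'); assert (N2 := Rmin_r e e').
  specialize (Q x y ltac:(unfold x; lra) ltac:(unfold y; lra)).
  specialize (H1 x ltac:(unfold x; lra)); specialize (H2 y ltac:(unfold y; lra)).
  assert (D := B0 x y ltac:(unfold x; lra) ltac:(unfold x, y; lra) ltac:(unfold y; lra)).
  apply Rabs_lt_between in H1; apply Rabs_lt_between in H2.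
  assert (T := Rabs_triang (RIntR phi x y) (l - RIntR phi x y)); rewrite (Rabs_minus_sym l) in T.
  replace (RIntR phi x y + (l - RIntR phi x y)) with l in T by ring; lra.
Qed.

Lemma is_int_open_plus f g a b l l' : is_int_open f a b l -> is_int_open g a b l' -> is_int_open (fun x => f x + g x) a b (l + l').
Proof. intros H1 H2; exact (is_RInt_gen_plus f g l l' H1 H2). Qed.

Lemma is_int_open_scal k f a b l : is_int_open f a b l -> is_int_open (fun x => k * f x) a b (k * l).
Proof. intros H; exact (is_RInt_gen_scal f k l H). Qed.

Lemma is_int_open_ext f g a b l : a < b -> (forall x, a < x < b -> f x = g x) -> is_int_open f a b l -> is_int_open g a b l.
Proof.
intros Hab E H; refine (is_RInt_gen_ext f g l _ H).
exists (fun x => a < x < a + (b - a) / 2) (fun y => b - (b - a) / 2 < y < b).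
- apply at_right_interval with ((b - a) / 2); [lra | auto].
- apply at_left_interval with ((b - a) / 2); [lra | auto].
- intros x y Hx Hy t; simpl; rewrite Rmin_left, Rmax_right by lra; intros Ht; apply E; lra.
Qed.

Lemma is_int_open_C (f : R -> C) (phi : R -> R) a b l : a < b -> (forall x, a < x < b -> f x = RtoC (phi x)) ->
  is_int_open phi a b l -> RInt_gen (V := C_R_CompleteNormedModule) f (at_right a) (at_left b) = RtoC l.
Proof.
intros Hab E H; apply (is_RInt_gen_unique (V := C_R_CompleteNormedModule)).
intros P [eps HP].
destruct (H (fun z => Rabs (z - l) < eps)) as [P1 P2 HP1 HP2 HQ].
{ exists eps; intros z Hz; exact Hz. }
destruct (at_right_point _ _ HP1) as [e1 [He1 Q1]]; destruct (at_left_point _ _ HP2) as [e2 [He2 Q2]].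
set (e := Rmin (Rmin e1 e2) ((b - a) / 3)).
assert (M1 := Rmin_l (Rmin e1 e2) ((b - a) / 3)); assert (M2 := Rmin_r (Rmin e1 e2) ((b - a) / 3)).
assert (M3 := Rmin_l e1 e2); assert (M4 := Rmin_r e1 e2); fold e in M1, M2.
assert (He : 0 < e) by (apply Rmin_pos; [apply Rmin_pos; assumption | lra]).
exists (fun x => a < x < a + e) (fun y => b - e < y < b).
- apply at_right_interval with e; auto.
- apply at_left_interval with e; auto.
- intros x y Hx Hy; destruct (HQ x y (Q1 x ltac:(lra)) (Q2 y ltac:(lra))) as [I [I1 I2]].
  exists (RtoC I); split.
  + apply (is_RInt_ext (V := C_R_NormedModule) (fun x => RtoC (phi x))).
    * simpl; rewrite Rmin_left, Rmax_right by lra; intros t Ht; symmetry; apply E; lra.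
    * apply is_RInt_C; [exact I1 |].
      assert (Z := is_RInt_const (V := R_NormedModule) x y 0).
      change (is_RIntR (fun _ => 0) x y ((y - x) * 0)) in Z; rewrite Rmult_0_r in Z; exact Z.
  + apply HP; split; [exact I2 |].
    change (Rabs (0 - 0) < eps); rewrite Rminus_0_r, Rabs_R0; apply cond_pos.
Qed.

Lemma has_end_limits_continuous G a b : a < b ->
  (forall eps, 0 < eps -> exists e, 0 < e /\ forall x, a <= x <= b -> Rabs (x - a) < e -> Rabs (G x - G a) < eps) ->
  (forall eps, 0 < eps -> exists e, 0 < e /\ forall x, a <= x <= b -> Rabs (x - b) < e -> Rabs (G x - G b) < eps) ->
  has_end_limits G a b (G a) (G b).
Proof.
intros Hab H1 H2 eps He; destruct (H1 eps He) as [e1 [He1 Q1]]; destruct (H2 eps He) as [e2 [He2 Q2]].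
exists (Rmin (Rmin e1 e2) ((b - a) / 3)).
assert (M1 := Rmin_l (Rmin e1 e2) ((b - a) / 3)); assert (M2 := Rmin_r (Rmin e1 e2) ((b - a) / 3)).
assert (M3 := Rmin_l e1 e2); assert (M4 := Rmin_r e1 e2).
split; [apply Rmin_pos; [apply Rmin_pos; assumption | lra] |]; split; [lra |]; split.
- intros x Hx; apply Q1; [lra |]; rewrite Rabs_pos_eq; lra.
- intros x Hx; apply Q2; [lra |]; rewrite Rabs_left; lra.
Qed.

Lemma continuity_pt_eps G x : continuity_pt G x -> forall eps, 0 < eps -> exists e, 0 < e /\ forall y, Rabs (y - x) < e -> Rabs (G y - G x) < eps.
Proof.
intros H eps He; destruct (proj1 (continuity_pt_locally G x) H (mkposreal eps He)) as [e Q].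
exists e; split; [apply cond_pos |]; intros y Hy; apply Q; exact Hy.
Qed.

Lemma has_end_limits_cont_pt G a b : a < b -> continuity_pt G a -> continuity_pt G b -> has_end_limits G a b (G a) (G b).
Proof.
intros Hab Ha Hb; apply has_end_limits_continuous; [assumption | |]; intros eps He.
- destruct (continuity_pt_eps G a Ha eps He) as [e [He0 Q]]; exists e; split; auto.
- destruct (continuity_pt_eps G b Hb eps He) as [e [He0 Q]]; exists e; split; auto.
Qed.

Lemma continuity_pt_of_derive G x l : is_derive G x l -> continuity_pt G x.
Proof.
intros H; apply continuity_pt_filterlim, (ex_derive_continuous (K := R_AbsRing) (V := R_NormedModule)); eexists; exact H.
Qed.

(** * Weak convergence *)

Definition foxHr (p q : nat) (A a B b : nat -> R) (x : R) : R := Re (foxH p q A a B b x).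

Lemma foxH_real p q A a B b x :
  (forall k, (k < p)%nat -> 0 < A k) -> (forall j, (j < q)%nat -> 0 < B j) -> sumR q B - sumR p A = 0 ->
  (forall k, (k < p)%nat -> 0 <= a k) -> 0 <= mu p q a b -> 0 < x < rho p q A B ->
  foxH p q A a B b x = RtoC (foxHr p q A a B b x) /\
  forall c Y, 0 < c -> 0 < Y -> cint (hintegrand p q A a B b x) c Y (PI * foxHr p q A a B b x).
Proof.
intros hA hB hbal Ha Hmu Hx; assert (HPI := PI_RGT_0).
destruct (hintegrand_cint p q A a B b x hA hB hbal Ha Hmu Hx) as [l Hl].
assert (E := foxH_cint p q A a B b x l hA hB hbal Ha Hmu Hx (Hl 1 1 ltac:(lra) ltac:(lra))).
unfold foxHr; rewrite E; split; [reflexivity |].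
intros c Y Hc HY; simpl; replace (PI * (l / PI)) with l by (field; lra); auto.
Qed.

Lemma foxHr_continuous p q A a B b x0 :
  (forall k, (k < p)%nat -> 0 < A k) -> (forall j, (j < q)%nat -> 0 < B j) -> sumR q B - sumR p A = 0 ->
  (forall k, (k < p)%nat -> 0 <= a k) -> 0 <= mu p q a b -> 0 < x0 < rho p q A B ->
  continuous (foxHr p q A a B b) x0.
Proof.
intros hA hB hbal Ha Hmu Hx0; assert (HPI := PI_RGT_0).
destruct (cint_continuous_in_x p q A B a b x0 hA hB hbal Ha Hmu Hx0) as [K [e [HK [He Q]]]].
apply continuity_pt_filterlim, continuity_pt_locally; intros eps; assert (Heps := cond_pos eps).
assert (Hm : 0 < Rmin e (eps / (K + 1))) by (apply Rmin_pos; [assumption | apply Rdiv_lt_0_compat; lra]).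
assert (CL : continuity_pt ln x0).
{ apply continuity_pt_of_derive with (/ x0); auto_derive; [lra | field; lra]. }
destruct (continuity_pt_eps ln x0 CL _ Hm) as [d [Hd D]].
assert (Hd' : 0 < Rmin d (Rmin x0 (rho p q A B - x0))) by (repeat apply Rmin_pos; lra).
exists (mkposreal _ Hd'); intros x Hx; change (Rabs (x - x0) < Rmin d (Rmin x0 (rho p q A B - x0))) in Hx.
assert (H1 := Rlt_le_trans _ _ _ Hx (Rmin_l _ _)); assert (H2 := Rlt_le_trans _ _ _ Hx (Rmin_r _ _)).
assert (H3 := Rlt_le_trans _ _ _ H2 (Rmin_l _ _)); assert (H4 := Rlt_le_trans _ _ _ H2 (Rmin_r _ _)).
apply Rabs_lt_between in H3; apply Rabs_lt_between in H4.
assert (Hx' : 0 < x < rho p q A B) by lra.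
specialize (D x H1).
assert (D1 := Rlt_le_trans _ _ _ D (Rmin_l _ _)); assert (D2 := Rlt_le_trans _ _ _ D (Rmin_r _ _)).
destruct (foxH_real p q A a B b x hA hB hbal Ha Hmu Hx') as [_ C1].
destruct (foxH_real p q A a B b x0 hA hB hbal Ha Hmu Hx0) as [_ C0].
assert (B0 := Q x Hx' ltac:(lra) _ _ C1 C0).
rewrite <- Rmult_minus_distr_l, Rabs_mult, (Rabs_pos_eq PI) in B0 by lra.
set (z := Rabs (foxHr p q A a B b x - foxHr p q A a B b x0)) in *.
assert (Hz : 0 <= z) by apply Rabs_pos.
assert (P1 : 1 <= PI) by (assert (P := PI2_1); lra).
apply Rle_lt_trans with (K * Rabs (ln x - ln x0)); [nra |].
apply Rle_lt_trans with (K * (eps / (K + 1))); [apply Rmult_le_compat_l; lra |].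
apply Rmult_lt_reg_r with (K + 1); [lra |].
replace (K * (eps / (K + 1)) * (K + 1)) with (K * eps) by (field; lra); nra.
Qed.

(** The weight has the primitive [2 sqrt x - 2 sqrt (r - x)], continuous up to both ends of
    [[0, r]]; its increment is at most [4 sqrt r]. *)
Lemma int_weight_dominated (phi : R -> R) (eta r c : R) : 0 <= eta < r -> 0 <= c ->
  (forall x, eta < x < r -> continuous phi x) ->
  (forall x, eta < x < r -> Rabs (phi x) <= c * (/ sqrt x + / sqrt (r - x))) ->
  exists l, is_int_open phi eta r l /\ Rabs l <= c * (4 * sqrt r).
Proof.
intros He Hc Hphi Hb.
set (Psi := fun x => c * (2 * sqrt x - 2 * sqrt (r - x))).
destruct (is_int_open_dominated phi (fun x => c * (/ sqrt x + / sqrt (r - x))) Psi eta r (Psi eta) (Psi r)) as [l [Hl Bl]];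
  try assumption; try lra.
- intros x Hx; unfold Psi; auto_derive; [repeat split; lra |].
  assert (0 < sqrt x) by (apply sqrt_lt_R0; lra).
  replace (r + - x) with (r - x) by ring; assert (0 < sqrt (r - x)) by (apply sqrt_lt_R0; lra).
  field; lra.
- intros x Hx; apply (ex_derive_continuous (K := R_AbsRing) (V := R_NormedModule)); auto_derive.
  assert (0 < sqrt x) by (apply sqrt_lt_R0; lra).
  assert (0 < sqrt (r + - x)) by (apply sqrt_lt_R0; lra).
  repeat split; lra.
- assert (CP : forall x, 0 <= x <= r -> continuity_pt Psi x).
  { intros x Hx; unfold Psi; apply continuity_pt_mult; [apply continuity_pt_const; intros ? ?; reflexivity |].
    apply continuity_pt_minus; apply continuity_pt_mult; try (apply continuity_pt_const; intros ? ?; reflexivity).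
    - apply continuity_pt_sqrt; lra.
    - apply (continuity_pt_comp (fun x => r - x) sqrt).
      + apply continuity_pt_minus; [apply continuity_pt_const; intros ? ?; reflexivity | apply continuity_pt_id].
      + apply continuity_pt_sqrt; lra. }
  apply has_end_limits_cont_pt; [lra | apply CP; lra | apply CP; lra].
- exists l; split; [assumption |]; apply Rle_trans with (1 := Bl); unfold Psi.
  rewrite Rminus_diag, sqrt_0, <- Rmult_minus_distr_l.
  assert (S1 := sqrt_pos eta); assert (S2 : sqrt (r - eta) <= sqrt r) by (apply sqrt_le_1; lra).
  apply Rmult_le_compat_l; lra.
Qed.

(** The function [v (1 - x/r)^(v-1)], an approximation of [r] times the unit mass at [r] as [v]
    decreases to 0. *)
Definition sing_density (r v x : R) : R := v * Rpower (/ ((r - x) / r)) (1 - v).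

Definition sing_primitive (r v x : R) : R := - (r * Rpower ((r - x) / r) v).

Lemma sing_density_eq r v x : 0 < r -> x < r -> sing_density r v x = v * exp ((v - 1) * ln ((r - x) / r)).
Proof.
intros Hr Hx; assert (0 < (r - x) / r) by (apply Rdiv_lt_0_compat; lra).
unfold sing_density, Rpower; rewrite ln_Rinv by assumption; f_equal; f_equal; ring.
Qed.

Lemma is_derive_sing_primitive r v x : 0 < r -> x < r -> is_derive (sing_primitive r v) x (sing_density r v x).
Proof.
intros Hr Hx; assert (Hd : 0 < (r - x) / r) by (apply Rdiv_lt_0_compat; lra).
rewrite sing_density_eq by assumption.
replace ((v - 1) * ln ((r - x) / r)) with (v * ln ((r - x) / r) + - ln ((r - x) / r)) by ring.
rewrite exp_plus, exp_Ropp, exp_ln by assumption.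
unfold sing_primitive, Rpower; auto_derive.
- repeat split; unfold Rdiv, Rminus in *; lra.
- unfold Rdiv, Rminus in *; field; lra.
Qed.

Lemma continuous_sing_density r v x : 0 < r -> x < r -> continuous (sing_density r v) x.
Proof.
intros Hr Hx; assert (Hd : 0 < (r - x) / r) by (apply Rdiv_lt_0_compat; lra).
assert (Hi : 0 < / ((r - x) / r)) by (apply Rinv_0_lt_compat; assumption).
apply (ex_derive_continuous (K := R_AbsRing) (V := R_NormedModule)); unfold sing_density, Rpower; auto_derive.
unfold Rdiv, Rminus in *; repeat split; lra.
Qed.

Lemma sing_primitive_limits r v eta : 0 <= eta < r -> 0 < v ->
  has_end_limits (sing_primitive r v) eta r (sing_primitive r v eta) 0.
Proof.
intros He Hv eps Heps.
assert (CP := continuity_pt_of_derive _ _ _ (is_derive_sing_primitive r v eta ltac:(lra) ltac:(lra))).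
destruct (continuity_pt_eps _ _ CP eps Heps) as [e1 [He1 Q1]].
(* Chosen so that [w^v = eps/r]; a relative distance below [w] from the end makes the primitive
   smaller than [eps]. *)
set (w := exp (ln (eps / r) / v)); assert (Hw : 0 < w) by apply exp_pos.
assert (Her : 0 < eps / r) by (apply Rdiv_lt_0_compat; lra).
exists (Rmin (Rmin e1 (w * r)) ((r - eta) / 3)).
assert (M1 := Rmin_l (Rmin e1 (w * r)) ((r - eta) / 3)); assert (M2 := Rmin_r (Rmin e1 (w * r)) ((r - eta) / 3)).
assert (M3 := Rmin_l e1 (w * r)); assert (M4 := Rmin_r e1 (w * r)).
split; [apply Rmin_pos; [apply Rmin_pos; nra | lra] |]; split; [lra |]; split.
- intros x Hx; apply Q1; rewrite Rabs_pos_eq; lra.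
- intros x Hx; rewrite Rminus_0_r; unfold sing_primitive; rewrite Rabs_Ropp.
  assert (P : 0 < Rpower ((r - x) / r) v) by apply exp_pos.
  rewrite Rabs_pos_eq by nra.
  assert (Hd : 0 < (r - x) / r) by (apply Rdiv_lt_0_compat; lra).
  apply Rlt_le_trans with (r * (eps / r)); [| right; field; lra].
  apply Rmult_lt_compat_l; [lra |].
  rewrite <- (exp_ln (eps / r)) by assumption; apply exp_increasing.
  assert (L : ln ((r - x) / r) < ln (eps / r) / v).
  { rewrite <- (ln_exp (ln (eps / r) / v)); apply ln_increasing; [assumption |]; fold w.
    apply Rmult_lt_reg_r with r; [lra |]; replace ((r - x) / r * r) with (r - x) by (field; lra); lra. }
  apply Rlt_le_trans with (v * (ln (eps / r) / v)); [apply Rmult_lt_compat_l; assumption | right; field; lra].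
Qed.

Lemma int_sing_density r v eta : 0 <= eta < r -> 0 < v ->
  is_int_open (sing_density r v) eta r (r * Rpower ((r - eta) / r) v).
Proof.
intros He Hv; replace (r * Rpower ((r - eta) / r) v) with (0 - sing_primitive r v eta) by (unfold sing_primitive; ring).
apply is_int_open_FTC with (sing_primitive r v); [lra | | |].
- intros x Hx; apply is_derive_sing_primitive; lra.
- intros x Hx; apply continuous_sing_density; lra.
- apply sing_primitive_limits; assumption.
Qed.

Lemma sing_mass_le r v eta : 0 <= eta < r -> 0 < v -> 0 < Rpower ((r - eta) / r) v <= 1.
Proof.
intros He Hv; split; [apply exp_pos |]; unfold Rpower; rewrite <- exp_0; apply exp_le.
assert (ln ((r - eta) / r) <= 0); [| nra].
rewrite <- ln_1; apply ln_le; [apply Rdiv_lt_0_compat; lra |].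
apply Rmult_le_reg_r with r; [lra |]; replace ((r - eta) / r * r) with (r - eta) by (field; lra); lra.
Qed.

(** The total mass of [sing_density] is at most [r], uniformly in [v]. The constant [c] takes care
    of the part on which the density has been compensated. *)
Lemma int_sing_dominated (phi : R -> R) r v eta e1 c : 0 <= eta < r -> 0 < v -> 0 <= e1 -> 0 <= c ->
  (forall x, eta < x < r -> continuous phi x) ->
  (forall x, eta < x < r -> Rabs (phi x) <= e1 * sing_density r v x + c) ->
  exists l, is_int_open phi eta r l /\ Rabs l <= e1 * r + c * r.
Proof.
intros He Hv He1 Hc Hphi Hb.
destruct (is_int_open_dominated phi (fun x => e1 * sing_density r v x + c) (fun x => e1 * sing_primitive r v x + c * x) eta r
  (e1 * sing_primitive r v eta + c * eta) (e1 * 0 + c * r)) as [l [Hl Bl]]; try assumption; try lra.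
- intros x Hx.
  apply (is_derive_plus (V := R_NormedModule) (fun x => e1 * sing_primitive r v x) (fun x => c * x)).
  + apply (is_derive_scal (fun x => sing_primitive r v x)), is_derive_sing_primitive; lra.
  + auto_derive; [trivial | ring].
- intros x Hx; apply (continuous_plus (V := R_NormedModule) (fun x => e1 * sing_density r v x) (fun _ => c)).
  + apply (continuous_scal_r (V := R_NormedModule) e1 (sing_density r v)), continuous_sing_density; lra.
  + apply continuous_const.
- intros eps Heps.
  destruct (sing_primitive_limits r v eta He Hv (eps / (2 * (e1 + 1)))) as [e [Hpe [Hm [H1 H2]]]].
  { apply Rdiv_lt_0_compat; lra. }
  set (e2 := eps / (2 * (c + 1))); assert (He2 : 0 < e2) by (apply Rdiv_lt_0_compat; lra).
  assert (S1 : e1 * (eps / (2 * (e1 + 1))) <= eps / 2).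
  { apply Rmult_le_reg_r with (2 * (e1 + 1)); [lra |]; replace (e1 * (eps / (2 * (e1 + 1))) * (2 * (e1 + 1))) with (e1 * eps) by (field; lra); nra. }
  assert (S2 : c * e2 < eps / 2).
  { unfold e2; apply Rmult_lt_reg_r with (2 * (c + 1)); [lra |]; replace (c * (eps / (2 * (c + 1))) * (2 * (c + 1))) with (c * eps) by (field; lra); nra. }
  exists (Rmin e e2); assert (M1 := Rmin_l e e2); assert (M2 := Rmin_r e e2).
  split; [apply Rmin_pos; assumption |]; split; [lra |]; split; intros x Hx.
  + replace (e1 * sing_primitive r v x + c * x - (e1 * sing_primitive r v eta + c * eta)) with
      (e1 * (sing_primitive r v x - sing_primitive r v eta) + c * (x - eta)) by ring.
    apply Rle_lt_trans with (1 := Rabs_triang _ _); rewrite !Rabs_mult, (Rabs_pos_eq e1), (Rabs_pos_eq c), (Rabs_pos_eq (x - eta)) by lra.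
    specialize (H1 x ltac:(lra)).
    assert (e1 * Rabs (sing_primitive r v x - sing_primitive r v eta) <= e1 * (eps / (2 * (e1 + 1)))) by (apply Rmult_le_compat_l; lra).
    assert (c * (x - eta) <= c * e2) by (apply Rmult_le_compat_l; lra). lra.
  + replace (e1 * sing_primitive r v x + c * x - (e1 * 0 + c * r)) with
      (e1 * (sing_primitive r v x - 0) + c * (x - r)) by ring.
    apply Rle_lt_trans with (1 := Rabs_triang _ _); rewrite !Rabs_mult, (Rabs_pos_eq e1), (Rabs_pos_eq c), (Rabs_left (x - r)) by lra.
    specialize (H2 x ltac:(lra)).
    assert (e1 * Rabs (sing_primitive r v x - 0) <= e1 * (eps / (2 * (e1 + 1)))) by (apply Rmult_le_compat_l; lra).
    assert (c * - (x - r) <= c * e2) by (apply Rmult_le_compat_l; lra). lra.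
- exists l; split; [assumption |]; apply Rle_trans with (1 := Bl).
  destruct (sing_mass_le r v eta He Hv) as [S1 S2]; unfold sing_primitive.
  assert (e1 * (r * Rpower ((r - eta) / r) v) <= e1 * r) by (apply Rmult_le_compat_l; nra).
  nra.
Qed.

Lemma continuous_on_interval_facts (f : R -> R) (eta r : R) : eta < r ->
  continuous_on (fun x => eta <= x <= r) f ->
  (forall x, eta < x < r -> continuous f x) /\
  (exists M, 0 <= M /\ forall x, eta <= x <= r -> Rabs (f x) <= M) /\
  (forall eps, 0 < eps -> exists d, 0 < d /\ forall x, eta <= x <= r -> r - x < d -> Rabs (f x - f r) < eps).
Proof.
intros He Hf; split; [| split].
- intros x Hx P HP; destruct (Hf x ltac:(lra) P HP) as [d Hd].
  assert (Hm : 0 < Rmin d (Rmin (x - eta) (r - x))) by (repeat apply Rmin_pos; try lra; apply cond_pos).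
  exists (mkposreal _ Hm); intros y Hy.
  change (Rabs (y - x) < Rmin d (Rmin (x - eta) (r - x))) in Hy.
  assert (H1 := Rlt_le_trans _ _ _ Hy (Rmin_l _ _)); assert (H2 := Rlt_le_trans _ _ _ Hy (Rmin_r _ _)).
  assert (H3 := Rlt_le_trans _ _ _ H2 (Rmin_l _ _)); assert (H4 := Rlt_le_trans _ _ _ H2 (Rmin_r _ _)).
  apply Rabs_lt_between in H3; apply Rabs_lt_between in H4.
  apply Hd; [exact H1 | lra].
(* Composing with the projection onto [[eta, r]], a contraction, turns relative continuity into
   continuity on the line, as the boundedness theorem expects. *)
- set (cl := fun x => Rmax eta (Rmin r x)).
  assert (Hcl : forall x, eta <= cl x <= r).
  { intros x; unfold cl; split; [apply Rmax_l | apply Rmax_lub; [lra | apply Rmin_l]]. }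
  assert (Hid : forall x, eta <= x <= r -> cl x = x).
  { intros x Hx; unfold cl; rewrite Rmin_right, Rmax_right; lra. }
  assert (Lip : forall x y, Rabs (cl x - cl y) <= Rabs (x - y)).
  { intros x y; unfold cl, Rmax, Rmin, Rabs.
    destruct (Rle_dec r x); destruct (Rle_dec r y);
    repeat match goal with |- context [Rle_dec ?a ?b] => destruct (Rle_dec a b) | |- context [Rcase_abs ?a] => destruct (Rcase_abs a) end; lra. }
  destruct (bounded_continuity (V := R_NormedModule) (fun x => f (cl x)) eta r) as [M HM].
  { intros x Hx P HP; destruct (Hf (cl x) (Hcl x) P HP) as [d Hd]; exists d; intros y Hy.
    apply Hd; [| apply Hcl]; apply Rle_lt_trans with (1 := Lip y x); exact Hy. }
  exists (Rmax M 0); split; [apply Rmax_r |]; intros x Hx; specialize (HM x Hx); rewrite Hid in HM by assumption.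
  apply Rle_trans with M; [left; exact HM | apply Rmax_l].
- intros eps Heps; destruct (Hf r ltac:(lra) (fun y => Rabs (y - f r) < eps)) as [d Hd].
  { exists (mkposreal eps Heps); intros y Hy; exact Hy. }
  exists d; split; [apply cond_pos |]; intros x Hx Hxd; apply Hd; [| assumption].
  change (Rabs (x - r) < d); rewrite Rabs_minus_sym, Rabs_pos_eq; lra.
Qed.

(** Closer than [d] to [r] continuity gives [eps]; farther away the trivial bound [2M] is at most
    [2M (r - x)/d]. The linear term is shaped to cancel the singularity [1/(1 - x/r)] of the
    density. *)
Lemma modulus_at_end (f : R -> R) (eta r M : R) : 0 <= eta < r ->
  (forall x, eta <= x <= r -> Rabs (f x) <= M) ->
  (forall eps, 0 < eps -> exists d, 0 < d /\ forall x, eta <= x <= r -> r - x < d -> Rabs (f x - f r) < eps) ->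
  forall eps, 0 < eps -> exists c, 0 <= c /\ forall x, eta <= x <= r -> Rabs (f x - f r) <= eps + c * ((r - x) / r).
Proof.
intros He HM Hc eps Heps; destruct (Hc eps Heps) as [d [Hd Q]].
assert (HM0 : 0 <= M) by (apply Rle_trans with (2 := HM r ltac:(lra)), Rabs_pos).
exists (2 * M * r / d); split; [apply Rdiv_le_0_compat; nra |].
intros x Hx; assert (Hv : 0 <= (r - x) / r) by (apply Rdiv_le_0_compat; lra).
destruct (Rlt_le_dec (r - x) d) as [H | H].
- specialize (Q x Hx H); assert (0 <= 2 * M * r / d * ((r - x) / r)) by (apply Rmult_le_pos; [apply Rdiv_le_0_compat; nra | assumption]); lra.
- assert (B1 := HM x Hx); assert (B2 := HM r ltac:(lra)).
  assert (T := Rabs_triang (f x) (- f r)); rewrite Rabs_Ropp in T.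
  replace (2 * M * r / d * ((r - x) / r)) with (2 * M * ((r - x) / d)) by (field; lra).
  assert (1 <= (r - x) / d).
  { apply Rmult_le_reg_r with d; [assumption |]; replace ((r - x) / d * d) with (r - x) by (field; lra); lra. }
  unfold Rminus; nra.
Qed.

Lemma maxR_ge n f k : (k < n)%nat -> f k <= maxR n f.
Proof.
induction n as [| n IH]; intros Hk; [lia |]; simpl.
destruct (Nat.eq_dec k n) as [-> | Hne]; [apply Rmax_r |].
apply Rle_trans with (2 := Rmax_l _ _), IH; lia.
Qed.

Lemma distpq_near p q a b a' b' : near_params p q a b a' b' (distpq p q a b a' b').
Proof.
split; intros k Hk; unfold distpq.
- apply Rle_trans with (2 := Rmax_l _ _), (maxR_ge p (fun k => Rabs (a k - a' k))); assumption.
- apply Rle_trans with (2 := Rmax_r _ _), (maxR_ge q (fun k => Rabs (b k - b' k))); assumption.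
Qed.

(** A negative coordinate would keep every point of the set at distance at least its absolute value;
    so the limit parameters, too, have their poles on the closed negative axis. *)
Lemma limit_point_nonneg p q (a' b' : nat -> R) :
  (forall d, 0 < d -> exists a b, inS p q a b /\ 0 < distpq p q a b a' b' < d) ->
  forall k, (k < p)%nat -> 0 <= a' k.
Proof.
intros H k Hk; destruct (Rle_dec 0 (a' k)) as [H0 | H0]; [assumption | exfalso].
destruct (H (- a' k)) as [a [b [[Ha _] Hd]]]; [lra |].
assert (N := proj1 (distpq_near p q a b a' b') k Hk); specialize (Ha k Hk).
apply Rabs_le_between in N; lra.
Qed.

Lemma int_fH_value p q A a B b eta f l :
  (forall k, (k < p)%nat -> 0 < A k) -> (forall j, (j < q)%nat -> 0 < B j) -> sumR q B - sumR p A = 0 ->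
  (forall k, (k < p)%nat -> 0 <= a k) -> 0 <= mu p q a b -> 0 <= eta < rho p q A B ->
  is_int_open (fun x => f x * foxHr p q A a B b x) eta (rho p q A B) l ->
  int_fH p q A a B b eta f = RtoC l.
Proof.
intros hA hB hbal Ha Hmu He Hl; unfold int_fH.
apply is_int_open_C with (fun x => f x * foxHr p q A a B b x); [lra | | assumption].
intros x Hx; destruct (foxH_real p q A a B b x hA hB hbal Ha Hmu ltac:(lra)) as [-> _].
apply injective_projections; simpl; [reflexivity |]; unfold scal; simpl; unfold mult; simpl; ring.
Qed.

(** [f] is compared with its value at [r]. The part [e] of the deviation meets a mass of at most
    [r]; the linear part cancels the singularity and leaves an integrand of size [c v], which
    disappears with [v]. *)
Lemma int_sing_concentration (f : R -> R) (eta r e c v : R) : 0 <= eta < r -> 0 < v -> 0 <= e -> 0 <= c ->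
  (forall x, eta < x < r -> continuous f x) ->
  (forall x, eta <= x <= r -> Rabs (f x - f r) <= e + c * ((r - x) / r)) ->
  exists l, is_int_open (fun x => f x * sing_density r v x) eta r l /\
    Rabs (l - f r * (r * Rpower ((r - eta) / r) v)) <= e * r + c * v * r.
Proof.
intros He Hv Hee Hc Hf Hm.
destruct (int_sing_dominated (fun x => (f x - f r) * sing_density r v x) r v eta e (c * v)) as [l [Hl Bl]]; try assumption.
- apply Rmult_le_pos; lra.
- intros x Hx; apply (continuous_mult (K := R_AbsRing) (fun x => f x - f r) (sing_density r v)).
  + apply (continuous_minus (V := R_NormedModule) f (fun _ => f r)); [apply Hf; assumption | apply continuous_const].
  + apply continuous_sing_density; lra.
- intros x Hx; assert (Hd : 0 < (r - x) / r) by (apply Rdiv_lt_0_compat; lra).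
  assert (Ew := sing_density_eq r v x ltac:(lra) ltac:(lra)).
  assert (Pw : 0 < sing_density r v x) by (rewrite Ew; apply Rmult_lt_0_compat; [assumption | apply exp_pos]).
  rewrite Rabs_mult, (Rabs_pos_eq (sing_density r v x)) by lra.
  apply Rle_trans with ((e + c * ((r - x) / r)) * sing_density r v x).
  { apply Rmult_le_compat_r; [lra |]; apply Hm; lra. }
  (* The product equals [v (1 - x/r)^v], a power of a number at most 1. *)
  assert (Vw : (r - x) / r * sing_density r v x <= v).
  { rewrite Ew, <- Rmult_assoc, (Rmult_comm _ v), Rmult_assoc.
    rewrite <- (Rmult_1_r v) at 3; apply Rmult_le_compat_l; [lra |].
    rewrite <- (exp_ln ((r - x) / r)) at 1 by assumption; rewrite <- exp_plus; apply Rle_trans with (exp 0); [apply exp_le | rewrite exp_0; lra].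
    assert (ln ((r - x) / r) <= 0); [| nra].
    rewrite <- ln_1; apply ln_le; [assumption |].
    apply Rmult_le_reg_r with r; [lra |]; replace ((r - x) / r * r) with (r - x) by (field; lra); lra. }
  assert (c * ((r - x) / r * sing_density r v x) <= c * v) by (apply Rmult_le_compat_l; assumption).
  lra.
- exists (l + f r * (r * Rpower ((r - eta) / r) v)); split.
  + apply is_int_open_ext with (fun x => (f x - f r) * sing_density r v x + f r * sing_density r v x); [lra | intros; ring |].
    apply is_int_open_plus; [assumption |]; apply is_int_open_scal, int_sing_density; assumption.
  + replace (l + f r * (r * Rpower ((r - eta) / r) v) - f r * (r * Rpower ((r - eta) / r) v)) with l by ring; assumption.
Qed.

Theorem theorem3 (p q : nat) (A B : nat -> R)
  (hA : forall k, (k < p)%nat -> 0 < A k)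
  (hB : forall j, (j < q)%nat -> 0 < B j)
  (hbal : sumR q B - sumR p A = 0)
  (astar bstar : nat -> R)
  (hlimpt : forall d, 0 < d -> exists a b, inS p q a b /\
              0 < distpq p q a b astar bstar < d)
  (hmu : mu p q astar bstar = 0)
  (eta : R) (heta0 : 0 <= eta) (heta1 : eta < rho p q A B)
  (f : R -> R)
  (hf : continuous_on (fun x => eta <= x <= rho p q A B) f) :
  forall eps, 0 < eps -> exists d, 0 < d /\
    forall a b, inS p q a b -> 0 < distpq p q a b astar bstar < d ->
      Cmod (Cminus (int_fH p q A a B b eta f)
              (Cplus (RtoC (nu_star p q A B astar bstar * rho p q A B * f (rho p q A B)))
                     (int_fH p q A astar B bstar eta f))) < eps.
Proof.
intros eps Heps.
assert (Hastar := limit_point_nonneg p q astar bstar hlimpt).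
destruct (foxH_cint_estimate p q A B astar bstar hA hB hbal Hastar hmu) as [K [HK Est]].
destruct (main_exponent_lipschitz p q A B astar bstar hmu) as [V [Q [HQ [HV ME]]]].
set (r := rho p q A B) in *.
assert (He : 0 <= eta < r) by lra; assert (HPI := PI_RGT_0); assert (EV := exp_pos V).
destruct (continuous_on_interval_facts f eta r heta1 hf) as [Fc [[M [HM FM]] Fr]].
assert (HKP : 0 <= K / PI) by (apply Rdiv_le_0_compat; lra).
(* The oscillation of [f] near [rho] allowed by the bound [exp V (1 + K)] on the coefficient [nu k]
   and the bound [r] on the mass, for a total error of [eps/4]. *)
set (e1 := eps / (4 * (exp V * (1 + K) * r + 1))).
assert (P1 : 0 < exp V * (1 + K) * r) by (apply Rmult_lt_0_compat; [apply Rmult_lt_0_compat |]; lra).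
assert (He1 : 0 < e1) by (apply Rdiv_lt_0_compat; lra).
assert (He1b : exp V * (1 + K) * r * e1 <= eps / 4).
{ apply Rmult_le_reg_r with (4 * (exp V * (1 + K) * r + 1)); [lra |].
  replace (exp V * (1 + K) * r * e1 * (4 * (exp V * (1 + K) * r + 1))) with (exp V * (1 + K) * r * eps) by (unfold e1; field; lra).
  nra. }
destruct (modulus_at_end f eta r M He FM Fr e1 He1) as [c [Hc Fmod]].
(* The mass on the interval is [r] times [(1 - eta/r)^v], and this power differs from 1 by at most
   [v Le]. *)
set (Le := Rabs (ln ((r - eta) / r))); assert (HLe : 0 <= Le) by apply Rabs_pos.
(* Coefficients of [d] in the three errors: the nonsingular remainder, the singular term where [f]
   has moved away from its end value, and the deviation of the singular mass from its limit. *)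
set (C1 := M * (K / PI) * (4 * sqrt r)); set (C2 := exp V * (1 + K) * (c * Q * r)); set (C3 := r * M * (exp V * (K * Q + Q * Le + Q))).
assert (Hsr := sqrt_pos r).
assert (HC1 : 0 <= C1) by (unfold C1; apply Rmult_le_pos; [apply Rmult_le_pos |]; lra).
assert (HC2 : 0 <= C2) by (unfold C2; apply Rmult_le_pos; [| apply Rmult_le_pos; [apply Rmult_le_pos |]]; nra).
assert (HC3 : 0 <= C3).
{ unfold C3; apply Rmult_le_pos; [nra |]; apply Rmult_le_pos; [lra |].
  assert (0 <= K * Q) by nra; assert (0 <= Q * Le) by nra; lra. }
(* The bound 1 is required by the Lipschitz estimates, [1/(Q + 1)] forces [mu <= 1], and the last
   one makes the terms linear in [d] at most [eps/4]. *)
set (d0 := Rmin (Rmin 1 (/ (Q + 1))) (eps / (4 * (C1 + C2 + C3 + 1)))).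
assert (Hd0 : 0 < d0).
{ apply Rmin_pos; [apply Rmin_pos; [lra | apply Rinv_0_lt_compat; lra] | apply Rdiv_lt_0_compat; lra]. }
exists d0; split; [assumption |].
intros a b [Ha Hmu] Hdist.
assert (Hnear := distpq_near p q a b astar bstar).
set (d := distpq p q a b astar bstar) in *.
assert (D1 := Rmin_l (Rmin 1 (/ (Q + 1))) (eps / (4 * (C1 + C2 + C3 + 1)))).
assert (D2 := Rmin_r (Rmin 1 (/ (Q + 1))) (eps / (4 * (C1 + C2 + C3 + 1)))).
assert (D3 := Rmin_l 1 (/ (Q + 1))); assert (D4 := Rmin_r 1 (/ (Q + 1))); fold d0 in D1, D2.
assert (Hd : 0 <= d <= 1) by lra.
destruct (ME a b d Hd Hnear) as [HV1 [Hmud [Hnud _]]].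
rewrite Rabs_pos_eq in Hmud by lra.
set (v := mu p q a b) in *.
(* The exponent [1 - v] of the singular power must lie in [[0, 1]]. *)
assert (Hv1 : v <= 1).
{ apply Rle_trans with (1 := Hmud); apply Rle_trans with (Q * / (Q + 1)); [apply Rmult_le_compat_l; lra |].
  apply Rmult_le_reg_r with (Q + 1); [lra |]; rewrite Rmult_assoc, Rinv_l; lra. }
destruct (Est a b d Hd Hnear Ha ltac:(fold v; lra)) as [k [Hk EstX]]; fold v in Hk, EstX.
set (nu := exp (log_nu p q A B a b)) in *.
assert (Hnu : 0 < nu <= exp V) by (unfold nu; split; [apply exp_pos | apply exp_le; assumption]).
set (h := foxHr p q A a B b); set (hs := foxHr p q A astar B bstar).
assert (Ch : forall x, eta < x < r -> continuous h x).
{ intros x Hx; apply foxHr_continuous; try assumption; [fold v; lra | fold r; lra]. }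
assert (Chs : forall x, eta < x < r -> continuous hs x).
{ intros x Hx; apply foxHr_continuous; try assumption; [lra | fold r; lra]. }
assert (Bnd : forall x, eta < x < r ->
   Rabs (hs x) <= K / PI * (/ sqrt x + / sqrt (r - x)) /\
   Rabs (h x - hs x - nu * k * sing_density r v x) <= K / PI * d * (/ sqrt x + / sqrt (r - x))).
{ intros x Hx.
  destruct (foxH_real p q A a B b x hA hB hbal Ha ltac:(fold v; lra) ltac:(fold r; lra)) as [_ Cl].
  destruct (foxH_real p q A astar B bstar x hA hB hbal Hastar ltac:(lra) ltac:(fold r; lra)) as [_ Cs].
  destruct (EstX x ltac:(lra) _ _ Cl Cs) as [B1 B2]; fold h in B2; fold hs in B1, B2.
  assert (SD : nu * (v * k) * Rpower (/ ((r - x) / r)) (1 - v) = nu * k * sing_density r v x) by (unfold sing_density; ring).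
  rewrite SD in B2.
  replace (PI * h x - PI * hs x - PI * (nu * k * sing_density r v x)) with (PI * (h x - hs x - nu * k * sing_density r v x)) in B2 by ring.
  rewrite Rabs_mult, (Rabs_pos_eq PI) in B1, B2 by lra.
  split; apply Rmult_le_reg_l with PI; try assumption.
  - apply Rle_trans with (1 := B1); right; field; repeat split; lra || (apply Rgt_not_eq, sqrt_lt_R0; lra).
  - apply Rle_trans with (1 := B2); right; field; repeat split; lra || (apply Rgt_not_eq, sqrt_lt_R0; lra). }
assert (Cw : forall x, eta < x < r -> continuous (sing_density r v) x) by (intros x Hx; apply continuous_sing_density; lra).
destruct (int_weight_dominated (fun x => f x * (h x - hs x - nu * k * sing_density r v x)) eta r (M * (K / PI) * d) He) as [I0 [HI0 BI0]].
{ apply Rmult_le_pos; [apply Rmult_le_pos |]; lra. }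
{ intros x Hx; apply (continuous_mult (K := R_AbsRing) f (fun x => h x - hs x - nu * k * sing_density r v x)); [auto |].
  apply (continuous_minus (V := R_NormedModule) (fun x => h x - hs x) (fun x => nu * k * sing_density r v x)).
  - apply (continuous_minus (V := R_NormedModule) h hs); auto.
  - apply (continuous_scal_r (V := R_NormedModule) (nu * k) (sing_density r v)); auto. }
{ intros x Hx; rewrite Rabs_mult.
  apply Rle_trans with (M * (K / PI * d * (/ sqrt x + / sqrt (r - x)))); [| right; ring].
  apply Rmult_le_compat; try apply Rabs_pos; [apply FM; lra | exact (proj2 (Bnd x Hx))]. }
destruct (int_weight_dominated (fun x => f x * hs x) eta r (M * (K / PI)) He) as [I1 [HI1 _]].
{ apply Rmult_le_pos; lra. }
{ intros x Hx; apply (continuous_mult (K := R_AbsRing) f hs); auto. }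
{ intros x Hx; rewrite Rabs_mult, Rmult_assoc.
  apply Rmult_le_compat; try apply Rabs_pos; [apply FM; lra | exact (proj1 (Bnd x Hx))]. }
destruct (int_sing_concentration f eta r e1 c v He Hmu ltac:(lra) Hc Fc Fmod) as [J [HJ BJ]].
(* The density splits into the remainder, the limit density and the singular term. The integral of
   the limit density recurs in the claimed limit, so it cancels exactly. *)
assert (HI : is_int_open (fun x => f x * h x) eta r (I0 + (I1 + nu * k * J))).
{ apply is_int_open_ext with (fun x => f x * (h x - hs x - nu * k * sing_density r v x) + (f x * hs x + nu * k * (f x * sing_density r v x))).
  - lra.
  - intros; ring.
  - apply is_int_open_plus; [assumption |]; apply is_int_open_plus; [assumption |]; apply is_int_open_scal; assumption. }
rewrite (int_fH_value p q A a B b eta f _ hA hB hbal Ha ltac:(fold v; lra) He HI).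
rewrite (int_fH_value p q A astar B bstar eta f _ hA hB hbal Hastar ltac:(lra) He HI1).
rewrite <- RtoC_plus, <- RtoC_minus, Cmod_R, nu_star_exp.
set (nus := exp (log_nu p q A B astar bstar)).
set (Pv := Rpower ((r - eta) / r) v) in *.
destruct (sing_mass_le r v eta He Hmu) as [Pv0 Pv1]; fold Pv in Pv0, Pv1.
assert (Pv2 : Rabs (Pv - 1) <= v * Le).
{ rewrite Rabs_left1 by lra; unfold Pv, Rpower.
  assert (I := exp_ineq1_le (v * ln ((r - eta) / r))).
  assert (L := Rle_abs (- ln ((r - eta) / r))); rewrite Rabs_Ropp in L; fold Le in L; nra. }
assert (Hka : Rabs k <= 1 + K).
{ assert (T := Rabs_triang (k - 1) 1); rewrite Rabs_R1 in T; replace (k - 1 + 1) with k in T by ring; nra. }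
assert (Hnuk : Rabs (nu * k) <= exp V * (1 + K)).
{ rewrite Rabs_mult, (Rabs_pos_eq nu) by lra; apply Rmult_le_compat; try lra; apply Rabs_pos. }
assert (Hnus : Rabs (nu - nus) <= exp V * (Q * d)).
{ assert (T := Cexp_minus_le (RtoC (log_nu p q A B a b)) (RtoC (log_nu p q A B astar bstar)) V ltac:(simpl; lra) ltac:(simpl; lra)).
  rewrite !Cexp_RtoC, <- !RtoC_minus, !Cmod_R in T; fold nu nus in T.
  apply Rle_trans with (1 := T); rewrite Rmult_comm; apply Rmult_le_compat_l; lra. }
assert (Hlim : Rabs (nu * k * Pv - nus) <= exp V * (K * Q + Q * Le + Q) * d).
{ replace (nu * k * Pv - nus) with (nu * ((k - 1) * Pv + (Pv - 1)) + (nu - nus)) by ring.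
  apply Rle_trans with (1 := Rabs_triang _ _); rewrite Rabs_mult, (Rabs_pos_eq nu) by lra.
  assert (T1 : Rabs ((k - 1) * Pv + (Pv - 1)) <= (K * Q + Q * Le) * d).
  { apply Rle_trans with (1 := Rabs_triang _ _); rewrite Rabs_mult, (Rabs_pos_eq Pv) by lra.
    assert (T2 : Rabs (k - 1) * Pv <= K * v * 1) by (apply Rmult_le_compat; try lra; apply Rabs_pos).
    assert (T3 : K * v <= K * (Q * d)) by (apply Rmult_le_compat_l; lra).
    assert (T4 : v * Le <= Q * d * Le) by (apply Rmult_le_compat_r; lra).
    lra. }
  assert (T5 : nu * Rabs ((k - 1) * Pv + (Pv - 1)) <= exp V * ((K * Q + Q * Le) * d)) by (apply Rmult_le_compat; try lra; apply Rabs_pos).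
  lra. }
(* What remains is the integral of the remainder, the concentration error of the singular term, and
   the convergence of its mass [nu k Pv] to [nus]. *)
replace (I0 + (I1 + nu * k * J) - (nus * r * f r + I1)) with
  (I0 + (nu * k * (J - f r * (r * Pv)) + r * f r * (nu * k * Pv - nus))) by ring.
assert (T1 := Rabs_triang I0 (nu * k * (J - f r * (r * Pv)) + r * f r * (nu * k * Pv - nus))).
assert (T2 := Rabs_triang (nu * k * (J - f r * (r * Pv))) (r * f r * (nu * k * Pv - nus))).
rewrite (Rabs_mult (nu * k)), (Rabs_mult (r * f r)), (Rabs_mult r (f r)), (Rabs_pos_eq r) in T2 by lra.
assert (S1 : Rabs (nu * k) * Rabs (J - f r * (r * Pv)) <= exp V * (1 + K) * (e1 * r + c * (Q * d) * r)).
{ apply Rmult_le_compat; try apply Rabs_pos; [assumption |].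
  apply Rle_trans with (1 := BJ), Rplus_le_compat_l, Rmult_le_compat_r; [lra |].
  apply Rmult_le_compat_l; lra. }
assert (S2 : r * Rabs (f r) * Rabs (nu * k * Pv - nus) <= r * M * (exp V * (K * Q + Q * Le + Q) * d)).
{ apply Rmult_le_compat; try apply Rabs_pos; [apply Rmult_le_pos; [lra | apply Rabs_pos] | | assumption].
  apply Rmult_le_compat_l; [lra | apply FM; lra]. }
replace (M * (K / PI) * d * (4 * sqrt r)) with (C1 * d) in BI0 by (unfold C1; ring).
replace (exp V * (1 + K) * (e1 * r + c * (Q * d) * r)) with (exp V * (1 + K) * r * e1 + C2 * d) in S1 by (unfold C2; ring).
replace (r * M * (exp V * (K * Q + Q * Le + Q) * d)) with (C3 * d) in S2 by (unfold C3; ring).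
assert (S3 : (C1 + C2 + C3) * d <= eps / 4).
{ apply Rle_trans with ((C1 + C2 + C3 + 1) * (eps / (4 * (C1 + C2 + C3 + 1)))); [apply Rmult_le_compat; lra | right; field; lra]. }
lra.
Qed.
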